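(* Let $r\ge 1$ and let $F$ be an $r$-regular graph. Then for all $\varepsilon > 0$ there exist an $n_0 = n_0(\varepsilon,F)$ and an $\eta = \eta(\varepsilon, F)>0$ such that every $F$-divisible graph $G$ on $n\geq n_0$ vertices with minimum degree $\delta(G) \geq (\delta+\varepsilon)n$, where \[ \delta := \begin{cases} \max \{ \delta^{\eta}_F ,\; 1-\frac1{d_F},\; 1 - \frac1{r+1} \} & \text{if $F$ is a vertex-disjoint union of copies of $K_{r+1}$,}\\ \max \{ \delta^{\eta}_F ,\; 1-\frac1{d_F},\; 1 - \frac1{r} \} & \text{otherwise,} \end{cases} \] has an $F$-decomposition. (If $d_F=0$, the term $1-\frac{1}{d_F}$ is omitted from the maximum.)
   Context: All graphs are finite and simple; $e(G)$ is the number of edges of $G$. A graph $G$ has an $F$-decomposition if $E(G)$ can be partitioned into edge sets of copies of $F$ in $G$. $\gcd(G)$ is the largest integer dividing the degree of every vertex of $G$. $G$ is $F$-divisible if $e(F)$ divides $e(G)$ and $\gcd(F)$ divides $\gcd(G)$. For $\eta > 0$, an $\eta$-approximate $F$-decomposition of a graph $G$ on $n$ vertices is a set of edge-disjoint copies of $F$ in $G$ covering all but at most $\eta n^2$ edges of $G$. For $n\in\mathbb{N}$, $\delta^{\eta}_F(n)$ is the infimum over all $\delta$ such that every graph $G$ on $n$ vertices with $\delta(G)\ge \delta n$ has an $\eta$-approximate $F$-decomposition, and $\delta^\eta_F := \limsup_{n\to\infty}\delta^\eta_F(n)$. Definition of $d_F$ for an $r$-regular graph $F$: Given vertex-disjoint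 graphs $H$ and $H'$, an $(H,H')_F$-transformer is a graph $T$ such that $V(H\cup H')\subseteq V(T)$, $T[V(H\cup H')]$ has no edges, and $T\cup H$ and $T\cup H'$ each have $F$-decompositions. Given a graph $T$ and $U\subseteq V(T)$ with $e(T[U])=0$, the degeneracy of $T$ rooted at $U$ is the least $d$ for which there is an ordering $v_1,\dots,v_b$ of $V(T)$ such that $U=\{v_1,\dots,v_a\}$ for some $a$ and, for each $a<j\le b$, $v_j$ is adjacent to at most $d$ of the $v_i$ with $i<j$. A graph $H'$ is obtained from a graph $H$ by identifying vertices if there are graphs $H_0=H,H_1,\dots,H_s=H'$ and vertices $x_i,y_i\in V(H_i)$ ($0\le i<s$) such that $(N_{H_i}(x_i)\cup\{x_i\})\cap(N_{H_i}(y_i)\cup\{y_i\})=\emptyset$ and $H_{i+1}$ is obtained from $H_i$ by identifying $x_i$ and $y_i$. $d_F$ is the smallest integer $d$ such that for every pair of vertex-disjoint graphs $H,H'$ where $H$ is $r$-regular and $H'$ can be obtained from a copy of $H$ by identifying vertices, there exists an $(H,H')_F$-transformer $T$ whose degeneracy rooted at $V(H\cup H')$ is at most $d$. (Such an integer exists for every $r$-regular $F$.) *)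

(* Defs.v *)
From HB Require Import structures.
From mathcomp Require Import all_boot all_order all_algebra.
From mathcomp Require Import boolp classical_sets reals ereal.
From mathcomp Require Import topology sequences.

Set Implicit Arguments.
Unset Strict Implicit.
Unset Printing Implicit Defensive.

Import Order.TTheory GRing.Theory Num.Theory.

Local Open Scope set_scope.

Record sgraph (V : finType) := SGraph {
  adj :> rel V;
  adj_sym : symmetric adj;
  adj_irr : irreflexive adj
}.

Definition nbhd (V : finType) (G : sgraph V) (x : V) : {set V} :=
  [set y | G x y].

Definition deg (V : finType) (G : sgraph V) (x : V) : nat := #|nbhd G x|.

Definition edges (V : finType) (G : sgraph V) : {set {set V}} :=
  [set e : {set V} | [exists x, exists y, G x y && (e == [set x; y])]].

(* Every degree is smaller than #|V|, so the default value #|V| of the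
   iterated minimum only matters when there are no vertices. *)
Definition mindeg (V : finType) (G : sgraph V) : nat :=
  \big[minn/#|V|]_(x : V) deg G x.

(* When all degrees are 0 this is 0, which every integer divides. *)
Definition gcd_graph (V : finType) (G : sgraph V) : nat :=
  \big[gcdn/0%N]_(x : V) deg G x.

Definition regular (V : finType) (r : nat) (G : sgraph V) : Prop :=
  forall x : V, deg G x = r.

Definition giso (V W : finType) (G : sgraph V) (H : sgraph W) : Prop :=
  exists f : V -> W, bijective f /\ forall x y, H (f x) (f y) = G x y.

Section Union.
Variables (V : finType) (G H : sgraph V).

Definition gunion_rel : rel V := [rel x y | G x y || H x y].

Fact gunion_sym : symmetric gunion_rel.
Proof. by move=> x y; rewrite /gunion_rel /= (adj_sym G) (adj_sym H). Qed.

Fact gunion_irr : irreflexive gunion_rel.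
Proof. by move=> x; rewrite /gunion_rel /= !adj_irr. Qed.

Definition gunion : sgraph V := SGraph gunion_sym gunion_irr.
End Union.

(* The graph on the vertex type W whose edges are the images of the edges of G;
   the test x != y is redundant when f is injective. *)
Section Image.
Variables (V W : finType) (f : V -> W) (G : sgraph V).

Definition gimage_rel : rel W :=
  [rel x y | (x != y) && [exists u, exists v, [&& f u == x, f v == y & G u v]]].

Fact gimage_sym : symmetric gimage_rel.
Proof.
move=> x y; rewrite /gimage_rel /= eq_sym; congr (_ && _).
by apply/existsP/existsP => -[u /existsP[v /and3P[fu fv Guv]]];
  exists v; apply/existsP; exists u; rewrite fu fv adj_sym.
Qed.

Fact gimage_irr : irreflexive gimage_rel.
Proof. by move=> x; rewrite /gimage_rel /= eqxx. Qed.

Definition gimage : sgraph W := SGraph gimage_sym gimage_irr.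
End Image.

Section Cliques.
Variables m k : nat.

Definition cliques_rel : rel ('I_m * 'I_k)%type :=
  [rel p q | (p.1 == q.1) && (p.2 != q.2)].

Fact cliques_sym : symmetric cliques_rel.
Proof. by move=> p q; rewrite /cliques_rel /= eq_sym; congr (_ && ~~ _); rewrite eq_sym. Qed.

Fact cliques_irr : irreflexive cliques_rel.
Proof. by move=> p; rewrite /cliques_rel /= !eqxx. Qed.

Definition cliques : sgraph ('I_m * 'I_k)%type := SGraph cliques_sym cliques_irr.
End Cliques.

Definition disjoint_cliques (V : finType) (k : nat) (F : sgraph V) : Prop :=
  exists m : nat, giso F (cliques m k).

(* A is the edge set of a (not necessarily induced) copy of F in G. *)
Definition is_copy (VF V : finType) (F : sgraph VF) (G : sgraph V)
    (A : {set {set V}}) : Prop :=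
  exists f : VF -> V,
    [/\ injective f,
        forall x y, F x y -> G (f x) (f y)
      & A = [set f @: (e : {set VF}) | e in edges F]].

Definition has_decomposition (VF V : finType) (F : sgraph VF) (G : sgraph V) :
    Prop :=
  exists P : {set {set {set V}}},
    finset.partition P (edges G) /\ forall A, A \in P -> is_copy F G A.

Definition divisible (VF V : finType) (F : sgraph VF) (G : sgraph V) : bool :=
  (#|edges F| %| #|edges G|)%N && (gcd_graph F %| gcd_graph G)%N.

Definition has_approx_decomposition (R : realType) (eta : R) (VF V : finType)
    (F : sgraph VF) (G : sgraph V) : Prop :=
  exists P : {set {set {set V}}},
    [/\ finset.trivIset P,
        forall A, A \in P -> is_copy F G A
      & (#|edges G :\: finset.cover P|%:R <= eta * #|V|%:R ^+ 2)%R].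

(* The infimum and the upper limit are taken in the extended reals: when eta is
   large every delta is admissible and the infimum is -oo. *)
Definition delta_approx_n (R : realType) (eta : R) (VF : finType)
    (F : sgraph VF) (n : nat) : \bar R :=
  ereal_inf [set delta%:E | delta in [set delta : R |
    forall (V : finType) (G : sgraph V), #|V| = n ->
      (delta * n%:R <= (mindeg G)%:R)%R ->
      has_approx_decomposition eta F G]]%classic.

Definition delta_approx (R : realType) (eta : R) (VF : finType)
    (F : sgraph VF) : \bar R :=
  limn_esup (delta_approx_n eta F).

(* s lists the vertices in an order that starts with U and in which each vertex
   outside U has at most d neighbours preceding it. *)
Definition rooted_order (V : finType) (T : sgraph V) (U : {set V}) (d : nat)
    (s : #|V|.-tuple V) : bool :=
  uniq s &&
  [exists a : 'I_#|V|.+1,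
     (U == [set x in take a s]) &&
     [forall j : 'I_#|V|,
        (a <= j)%N ==> (#|nbhd T (tnth s j) :&: [set x in take j s]| <= d)%N]].

Fact degeneracy_ex (V : finType) (T : sgraph V) (U : {set V}) :
  exists d, [exists s, rooted_order T U d s].
Proof.
have sz : size (enum U ++ enum (~: U)) == #|V|.
  by rewrite size_cat -!cardE cardsC.
exists #|V|; apply/existsP; exists (Tuple sz); apply/andP; split => /=.
  rewrite cat_uniq !enum_uniq andbT; apply/hasPn => x /=.
  by rewrite !mem_enum inE.
have ltU : (#|U| < #|V|.+1)%N by rewrite ltnS max_card.
apply/existsP; exists (Ordinal ltU); apply/andP; split.
  apply/eqP/setP => x.
  by rewrite inE /= take_size_cat ?mem_enum //= [in RHS]cardE.
by apply/forallP => j; apply/implyP => _; exact: max_card.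
Qed.

Definition degeneracy (V : finType) (T : sgraph V) (U : {set V}) : nat :=
  ex_minn (degeneracy_ex T U).

(* H and H' are placed in the vertex type of T by injections i and i' with
   disjoint images. *)
Definition is_transformer (VF V V' W : finType) (F : sgraph VF)
    (H : sgraph V) (H' : sgraph V') (T : sgraph W)
    (i : V -> W) (i' : V' -> W) : Prop :=
  [/\ injective i /\ injective i',
      forall u v, i u != i' v,
      forall x y, x \in codom i ++ codom i' -> y \in codom i ++ codom i' ->
        ~~ T x y,
      has_decomposition F (gunion T (gimage i H))
    & has_decomposition F (gunion T (gimage i' H'))].

(* p is the quotient map; the disjointness of the closed neighbourhoods forces
   x <> y. *)
Definition identify (V V' : finType) (H : sgraph V) (H' : sgraph V') : Prop :=
  exists (x y : V) (p : V -> V'),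
    [/\ [disjoint x |: nbhd H x & y |: nbhd H y],
        forall w, exists u, p u = w,
        forall u v, p u = p v <->
          [\/ u = v, u = x /\ v = y | u = y /\ v = x]
      & forall w w', H' w w' <-> exists u v, [/\ p u = w, p v = w' & H u v]].

Inductive identifications (V : finType) (H : sgraph V) :
    forall V' : finType, sgraph V' -> Prop :=
| identifications0 : identifications H H
| identificationsS (V1 V2 : finType) (H1 : sgraph V1) (H2 : sgraph V2) :
    identifications H H1 -> identify H1 H2 -> identifications H H2.

Definition dF_admissible (VF : finType) (r : nat) (F : sgraph VF) (d : nat) :
    Prop :=
  forall (V V' : finType) (H : sgraph V) (H' : sgraph V'),
    regular r H ->
    (exists (V0 : finType) (H0 : sgraph V0),
       giso H H0 /\ identifications H0 H') ->
    exists (W : finType) (T : sgraph W) (i : V -> W) (i' : V' -> W),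
      is_transformer F H H' T i i' /\
      (degeneracy T [set x in codom i ++ codom i'] <= d)%N.

(* The least admissible d; the default 0 would only be used if there were no
   admissible d. *)
Definition dF (VF : finType) (r : nat) (F : sgraph VF) : nat :=
  xget 0%N [set d | dF_admissible r F d /\
                    forall d', dF_admissible r F d' -> (d <= d')%N]%classic.

Definition threshold (R : realType) (eta : R) (VF : finType) (r : nat)
    (F : sgraph VF) : \bar R :=
  let k := if `[< disjoint_cliques r.+1 F >] then r.+1 else r in
  let m := Order.max (delta_approx eta F) (1 - k%:R^-1)%R%:E in
  if dF r F == 0%N then m else Order.max m (1 - (dF r F)%:R^-1)%R%:E.

(* Main.v *)
Require Import Defs.
From mathcomp Require Import all_boot all_order all_algebra.
From mathcomp Require Import boolp classical_sets reals ereal.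
From mathcomp Require Import topology sequences exp.
From mathcomp Require Import fingroup perm finfield.
From mathcomp Require Import eqtype ssrnat seq fintype bigop finset order.
From mathcomp Require Import zify ring lra.

(* Iterative absorption. Take nested random sets V = U_0, U_1, ..., U_l, where |U_(i+1)| is about |U_i| / N and
   |U_l| is bounded. Before anything else, reserve an absorber A outside U_1: for each of the boundedly many
   F-divisible graphs H on U_l, both A and A + H are decomposable. Then, for i = 0, 1, ..., the edges of U_i
   outside U_(i+1) are covered by copies of F that use few edges inside U_(i+1); the edges finally left over form
   an F-divisible graph H on U_l.

   One cover-down step first needs a packing that leaves few edges at every vertex. The packing given by
   delta^eta_F can be bad at a few vertices; one obtains K packings with disjoint sets of bad vertices by covering
   the edges at bad vertices with stars, which a factor of the neighbourhood by copies of F[N(v)] turns into copies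
   of F (Hajnal-Szemeredi, hence the terms 1 - 1/(r+1) and 1 - 1/r). Placing the vertices on an affine plane, each
   pair lies on one line, and choosing at random one of the K packings on each line spreads the bad vertices
   evenly. The remaining edges between U_i \ U_(i+1) and U_(i+1) are covered by stars again.

   An absorber for H is found by linking H, through transformers, to a graph that depends on the number of edges
   of H only, and that one to a disjoint union of copies of F. The link replaces each edge of H by a copy of F
   minus an edge, twice; identifying vertices of the result gives a canonical graph. The degeneracy of the
   transformers allows one to embed them greedily when the minimum degree exceeds (1 - 1/d_F) n. *)

Set Implicit Arguments.
Unset Strict Implicit.
Unset Printing Implicit Defensive.

Import Order.TTheory GRing.Theory Num.Theory.


(** * Edge sets and decompositions *)

(** The threshold depends on [eta], so [eta] must be fixed before the density [theta] is known, and
    the size [n1] from which approximate decompositions exist depends on both. Hence the packing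
    lemmas have the form: there is [eta], for each [n1] there is [n2], for each [theta] meeting
    [good_theta]. All other constants come from F, [eps] and auxiliary parameters.

    An approximate decomposition bounds the number of uncovered edges in total, while absorption
    needs a bound at every vertex. Bad vertices can be repaired only by stars, whose completion uses
    edges elsewhere, so only few of them can be repaired at a time; therefore several packings with
    disjoint bad sets are mixed instead of repairing one.

    An affine plane occurs a second time in the cover-down step. Two vertices outside U_(i+1) must
    have many common reserved neighbours, to cover an edge between them, but the sets reserved for
    different lines must share few pairs, so that the stars do not compete for the same edges. Lines
    do both: two of them meet, and in one point only. *)

Lemma card_bigcup_le (I : Type) (T : finType) (s : seq I) (P : pred I)
    (A : I -> {set T}) :
  #|\bigcup_(i <- s | P i) A i| <= \sum_(i <- s | P i) #|A i|.
Proof.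
elim/big_rec2: _ => [|i m B _ IH]; first by rewrite cards0.
by apply: leq_trans (leq_card_setU _ _) _; rewrite leq_add2l.
Qed.

Lemma double_count (S T : finType) (A : {set S}) (B : {set T}) (r : S -> T -> bool) :
  \sum_(x in A) #|[set y in B | r x y]| = \sum_(y in B) #|[set x in A | r x y]|.
Proof.
have H (U : finType) (C : {set U}) (q : pred U) : #|[set y in C | q y]| = \sum_(y in C) (q y : nat).
  by rewrite -sum1dep_card big_mkcondr; apply: eq_bigr => y _; case: ifP.
by under eq_bigr do rewrite H; rewrite exchange_big; apply: eq_bigr => y _; rewrite H.
Qed.

Lemma mem_bigcup_seq (T : finType) (I : eqType) (s : seq I) (A : I -> {set T}) x :
  reflect (exists2 i, i \in s & x \in A i) (x \in \bigcup_(i <- s) A i).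
Proof.
elim: s => [|i s IH]; first by rewrite big_nil inE; constructor => -[].
rewrite big_cons inE; apply: (iffP orP) => [[xi|/IH[j js xj]]|[j]].
- by exists i; rewrite ?mem_head.
- by exists j; rewrite // inE js orbT.
- by rewrite inE => /orP[/eqP->|js xj]; [left | right; apply/IH; exists j].
Qed.

Lemma sub_bigcup_seq (T : finType) (I : eqType) (s : seq I) (A : I -> {set T}) (B : {set T}) :
  {in s, forall i, A i \subset B} -> \bigcup_(i <- s) A i \subset B.
Proof.
by move=> sAB; apply/subsetP => x /mem_bigcup_seq[i is_ xi]; apply: (subsetP (sAB i is_)).
Qed.

Lemma disjoint_bigcup_seq (T : finType) (I : eqType) (s : seq I)
    (A : I -> {set T}) (B : {set T}) :
  {in s, forall i, [disjoint B & A i]} -> [disjoint B & \bigcup_(i <- s) A i].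
Proof.
elim: s => [|i s IH] dis; first by rewrite big_nil -setI_eq0 setI0.
rewrite big_cons -setI_eq0 setIUr setU_eq0 !setI_eq0 dis ?mem_head //=.
by apply: IH => j js; apply: dis; rewrite inE js orbT.
Qed.

Lemma card_sub2 (T : finType) (A B C : {set T}) : A \subset B :|: C -> #|A| <= #|B| + #|C|.
Proof. by move/subset_leq_card => /leq_trans; apply; apply: leq_card_setU. Qed.

Lemma card_sub3 (T : finType) (A B C D : {set T}) :
  A \subset B :|: C :|: D -> #|A| <= #|B| + #|C| + #|D|.
Proof.
by move/card_sub2 => /leq_trans; apply; rewrite leq_add2r; apply: leq_card_setU.
Qed.

Section EdgeSets.
Variable V : finType.
Implicit Types (E J : {set {set V}}) (x y z : V) (X Y S : {set V}).

(** Graphs are handled as sets of two-element vertex sets over an ambient type, so that removing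
    copies or restricting to some vertices requires no change of type; [within X] expresses a simple
    graph on X. The test [y != x] discards singletons that an arbitrary E might contain. *)
Definition enb E x : {set V} := [set y | (y != x) && ([set x; y] \in E)].
Definition within X E := forall e, e \in E -> #|e| = 2 /\ e \subset X.
Definition eind E X : {set {set V}} := [set e in E | e \subset X].
Definition star z S : {set {set V}} := [set [set z; y] | y in S].

Lemma in_enb E x y : (y \in enb E x) = (y != x) && ([set x; y] \in E).
Proof. by rewrite inE. Qed.

Lemma enb_sym E x y : (y \in enb E x) = (x \in enb E y).
Proof. by rewrite !in_enb eq_sym setUC. Qed.

Lemma enbxx E x : (x \in enb E x) = false.
Proof. by rewrite in_enb eqxx. Qed.

Lemma enbU E J x : enb (E :|: J) x = enb E x :|: enb J x.
Proof. by apply/setP => y; rewrite !inE andb_orr. Qed.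

Lemma enbD E J x : enb (E :\: J) x = enb E x :\: enb J x.
Proof. by apply/setP => y; rewrite !inE; case: (y != x). Qed.

Lemma enbI E J x : enb (E :&: J) x = enb E x :&: enb J x.
Proof. by apply/setP => y; rewrite !inE; case: (y != x). Qed.

Lemma enb0 x : enb set0 x = set0.
Proof. by apply/setP => y; rewrite !inE andbF. Qed.

Lemma enbS E J x : E \subset J -> enb E x \subset enb J x.
Proof.
by move=> sEJ; apply/subsetP => y; rewrite !in_enb => /andP[-> /(subsetP sEJ)].
Qed.

Lemma enb_bigcup (I : Type) (s : seq I) (P : pred I) (A : I -> {set {set V}}) x :
  enb (\bigcup_(i <- s | P i) A i) x = \bigcup_(i <- s | P i) enb (A i) x.
Proof.
by apply: (big_morph (fun E => enb E x)) => [E J|]; rewrite ?enbU ?enb0.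
Qed.

Lemma withinS X Y E : X \subset Y -> within X E -> within Y E.
Proof. by move=> sXY wE e /wE[-> /subset_trans->]. Qed.

Lemma within_sub X E J : J \subset E -> within X E -> within X J.
Proof. by move=> sJE wE e /(subsetP sJE)/wE. Qed.

Lemma withinU X E J : within X E -> within X J -> within X (E :|: J).
Proof. by move=> wE wJ e /setUP[/wE|/wJ]. Qed.

Lemma within0 X : within X set0. Proof. by move=> e; rewrite inE. Qed.

Lemma within_ind X Y E : within Y E -> within X (eind E X).
Proof. by move=> wE e; rewrite inE => /andP[/wE[-> _] ->]. Qed.

Lemma eind_sub E X : eind E X \subset E.
Proof. by apply/subsetP => e; rewrite inE => /andP[]. Qed.

Lemma edgeP X E e : within X E -> e \in E ->
  exists x y, [/\ x != y, e = [set x; y], x \in X, y \in X & y \in enb E x].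
Proof.
move=> wE eE; have [/eqP/cards2P[x [y [xy De]]] sX] := wE _ eE.
exists x, y; split=> //.
- by apply: (subsetP sX); rewrite De set21.
- by apply: (subsetP sX); rewrite De set22.
- by rewrite in_enb eq_sym xy -De.
Qed.

Lemma enb_within X E x : within X E -> enb E x \subset X.
Proof.
move=> wE; apply/subsetP => y; rewrite in_enb => /andP[_ /wE[_ /subsetP]].
by apply; rewrite set22.
Qed.

Lemma enb_out X E x : within X E -> x \notin X -> enb E x = set0.
Proof.
move=> wE xX; apply/setP => y; rewrite enb_sym [RHS]inE; apply/negP => /(subsetP (enb_within _ wE)).
by rewrite (negPf xX).
Qed.

Lemma enb_ind E X x : x \in X -> enb (eind E X) x = enb E x :&: X.
Proof.
by move=> xX; apply/setP => y; rewrite !inE subUset !sub1set xX /= andbA.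
Qed.

Lemma sum_enb X E : within X E -> \sum_x #|enb E x| = 2 * #|E|.
Proof.
move=> wE.
have -> : \sum_x #|enb E x| = \sum_x \sum_(e in E) (x \in e : nat).
  apply: eq_bigr => x _; rewrite -big_mkcondr sum1dep_card -(card_in_imset (f := fun y => [set x; y])).
    apply: eq_card => e; rewrite inE; apply/imsetP/andP => [[y]|[eE xe]].
      by rewrite in_enb => /andP[_ yE ->]; rewrite set21.
    have [a [b [ab De _ _ _]]] := edgeP wE eE.
    move: xe; rewrite De => /set2P[]->.
      by exists b; rewrite // in_enb eq_sym ab -De.
    by exists a; rewrite ?in_enb ?ab /= setUC // -De.
  move=> y y'; rewrite !in_enb => /andP[yx _] /andP[y'x _] /setP/(_ y).
  by rewrite !inE eqxx (negPf yx) /= => /esym/eqP.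
rewrite exchange_big /= mulnC -sum_nat_const; apply: eq_bigr => e /wE[<- _].
by rewrite -sum1_card [RHS]big_mkcond; apply: eq_bigr => x _; case: ifP.
Qed.

Lemma set2_inj (a b c : V) : b != a -> [set a; b] = [set a; c] -> b = c.
Proof. by move=> ba /setP/(_ b); rewrite !inE eqxx (negPf ba) orbT /= => /esym/eqP. Qed.

Lemma set2_eq (a b c d : V) : [set a; b] = [set c; d] ->
  (a = c /\ b = d) \/ (a = d /\ b = c).
Proof.
move=> eq2; have [ac|ac] := eqVneq a c; [left|right].
  subst c; split=> //; have [ba|ba] := eqVneq b a; last exact: set2_inj eq2.
  by move/setP/(_ d): eq2; rewrite ba !inE eqxx orbT orbb => /eqP.
have ad : a = d by move/setP/(_ a): eq2; rewrite !inE eqxx (negPf ac) => /esym/eqP.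
split=> //; subst d; move/setP/(_ c): eq2; rewrite !inE eqxx eq_sym (negPf ac).
by move=> /eqP.
Qed.

Lemma starE z S x y : x \in enb (star z S) y =
  (x != y) && ((y == z) && (x \in S) || (x == z) && (y \in S)).
Proof.
rewrite in_enb; have [//|xy /=] := eqVneq x y.
apply/imsetP/orP => [[w wS /set2_eq[][-> ->]]|[/andP[/eqP-> xS]|/andP[/eqP-> yS]]].
- by rewrite eqxx; left.
- by rewrite eqxx wS; right.
- by exists x.
- by exists y; rewrite // setUC.
Qed.

Lemma enb_star z S : z \notin S -> enb (star z S) z = S.
Proof.
move=> zS; apply/setP => x; rewrite starE eqxx (negPf zS) andbF orbF /=.
by have [->|//] := eqVneq x z; rewrite (negPf zS).
Qed.

Lemma starU z S S' : star z (S :|: S') = star z S :|: star z S'.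
Proof. exact: imsetU. Qed.

Lemma star_sub z S e : e \in star z S -> z \in e.
Proof. by case/imsetP=> x _ ->; rewrite set21. Qed.

End EdgeSets.

Section Copies.
Variables VF V : finType.
Implicit Types (f : VF -> V) (A B : {set {set VF}}).

Definition imE f A : {set {set V}} := [set f @: (e : {set VF}) | e in A].

Lemma imset_set2 f x y : f @: [set x; y] = [set f x; f y].
Proof. by rewrite imsetU1 imset_set1. Qed.

Lemma mem_imE f A x y : [set x; y] \in A -> [set f x; f y] \in imE f A.
Proof. by move=> xyA; rewrite -imset_set2 imset_f. Qed.

Lemma imEU f A B : imE f (A :|: B) = imE f A :|: imE f B.
Proof. exact: imsetU. Qed.

Lemma imES f A B : A \subset B -> imE f A \subset imE f B.
Proof. exact: imsetS. Qed.

Lemma imE_eq f g (X : {set VF}) A : (forall e, e \in A -> e \subset X) -> {in X, f =1 g} ->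
  imE f A = imE g A.
Proof.
move=> sA fg; apply: eq_in_imset => e eA; apply: eq_in_imset => x xe.
by apply: fg; apply: (subsetP (sA _ eA)).
Qed.

Lemma imE_inj f A : injective f -> #|imE f A| = #|A|.
Proof. by move=> /imset_inj finj; rewrite card_imset. Qed.

Lemma imE_within (X : {set VF}) f A : injective f -> within X A -> within (f @: X) (imE f A).
Proof.
by move=> finj wA _ /imsetP[e /wA[ce sX] ->]; rewrite card_imset ?imsetS.
Qed.

Lemma enb_imE f A x : injective f -> enb (imE f A) (f x) = f @: enb A x.
Proof.
move=> finj; apply/setP => y; apply/idP/imsetP => [|[w]]; last first.
  rewrite !in_enb => /andP[wx wA] ->; rewrite (inj_eq finj) wx /=.
  exact: mem_imE.
rewrite in_enb => /andP[yx /imsetP[e eA De]].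
have /imsetP[w we yw] : y \in f @: e by rewrite -De set22.
have : f x \in f @: e by rewrite -De set21.
rewrite mem_imset // => xe; exists w => //; rewrite in_enb.
have -> : w != x by apply: contraNneq yx => <-; rewrite yw.
suff -> : [set x; w] = e by [].
by apply: (imset_inj finj); rewrite imset_set2 -yw.
Qed.

Lemma enb_imE_out f A v : v \notin codom f -> enb (imE f A) v = set0.
Proof.
move=> vf; apply/setP => y; rewrite in_enb inE; apply: contraNF vf.
case/andP=> _ /imsetP[e _ De]; have : v \in f @: e by rewrite -De set21.
by case/imsetP=> w _ ->; apply: codom_f.
Qed.

Lemma enb_imE_sub f A (X : {set VF}) x y : within X A -> y \in enb (imE f A) x ->
  exists u v, [/\ u \in X, v \in X, x = f u, y = f v & v \in enb A u].
Proof.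
move=> wA; rewrite in_enb => /andP[yx /imsetP[e eA]].
have [u [v [uv De uX vX vu]]] := edgeP wA eA.
rewrite De imset_set2 => /set2_eq[][-> ->]; first by exists u, v.
by exists v, u; rewrite enb_sym.
Qed.

Lemma imE_star f v (S : {set VF}) : imE f (star v S) = star (f v) (f @: S).
Proof.
rewrite /imE /star -!imset_comp; apply: eq_imset => x /=; exact: imset_set2.
Qed.

End Copies.

Lemma imE_comp (U V W : finType) (f : U -> V) (g : V -> W) A :
  imE (g \o f) A = imE g (imE f A).
Proof.
rewrite /imE -imset_comp; apply: eq_imset => e /=; exact: imset_comp.
Qed.

Section Decompositions.
Variables (VF : finType) (EF : {set {set VF}}).

(** Adding one copy at a time makes the divisibility of sizes and degrees plain inductions and
    spares unions the bookkeeping of blocks. [dec_partition] and [trivIset_dec] translate to and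
    from partitions, the former for nonempty [EF], since the blocks of a partition are nonempty. *)
Inductive dec (V : finType) : {set {set V}} -> Prop :=
| dec0 : dec set0
| decS (f : VF -> V) (E : {set {set V}}) : injective f -> [disjoint imE f EF & E] -> dec E ->
    dec (imE f EF :|: E).

Section OneSet.
Variable V : finType.
Implicit Types E J : {set {set V}}.

Lemma dec_copy (f : VF -> V) : injective f -> dec (imE f EF).
Proof.
move=> finj; rewrite -[imE f EF]setU0; apply: decS => //; last exact: dec0.
by rewrite disjoints_subset setC0 subsetT.
Qed.

Lemma decU E J : [disjoint E & J] -> dec E -> dec J -> dec (E :|: J).
Proof.
move=> dEJ dE dJ; elim: dE dEJ => [|f E' finj dfE _ IH]; first by rewrite set0U.
rewrite -setUA => dEJ; apply: decS => //.
  rewrite -setI_eq0 setIUr setU_eq0 !setI_eq0 dfE /=.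
  by apply: disjointWl dEJ; apply: subsetUl.
by apply: IH; apply: disjointWl dEJ; apply: subsetUr.
Qed.

Lemma dec_bigcup (I : eqType) (s : seq I) (A : I -> {set {set V}}) :
    uniq s -> {in s, forall i, dec (A i)} ->
    {in s &, forall i j, i != j -> [disjoint A i & A j]} ->
  dec (\bigcup_(i <- s) A i).
Proof.
elim: s => [|i s IH] /=; first by rewrite big_nil => *; apply: dec0.
case/andP=> is_ us dA disA; rewrite big_cons; apply: decU.
- apply: disjoint_bigcup_seq => j js; apply: disA; rewrite ?inE ?eqxx ?js ?orbT //.
  by apply: contraNneq is_ => ->.
- by apply: dA; rewrite inE eqxx.
- apply: IH => // [j js|j k js ks]; first by apply: dA; rewrite inE js orbT.
  by apply: disA; rewrite inE ?js ?ks orbT.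
Qed.

Lemma dec_within X E : within X EF -> dec E -> within setT E.
Proof.
move=> wF; elim=> [|f E' finj _ _ IH]; first exact: within0.
apply: withinU => //; apply: withinS (subsetT _) _; exact: imE_within wF.
Qed.

Lemma dec_card E : dec E -> #|EF| %| #|E|.
Proof.
elim=> [|f E' finj dis _ IH]; first by rewrite cards0.
by rewrite cardsU disjoint_setI0 // cards0 subn0 dvdn_add // imE_inj.
Qed.

Lemma dec_deg r E x : (forall w, #|enb EF w| = r) -> dec E -> r %| #|enb E x|.
Proof.
move=> rF; elim=> [|f E' finj dis _ IH]; first by rewrite enb0 cards0.
rewrite enbU cardsU -enbI disjoint_setI0 // enb0 cards0 subn0 dvdn_add //.
have [/codomP[w ->]|xf] := boolP (x \in codom f).
  by rewrite enb_imE // card_imset // rF.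
by rewrite enb_imE_out // cards0.
Qed.

Lemma dec_partition E : EF != set0 -> dec E ->
  exists P, partition P E /\
    forall A, A \in P -> exists2 f : VF -> V, injective f & A = imE f EF.
Proof.
move=> F0; elim=> [|f E' finj dis _ [P [partP PF]]].
  by exists set0; split=> [|A]; rewrite ?inE // partition_set0.
exists (imE f EF |: P); split; last first.
  by move=> A /setU1P[->|/PF//]; exists f.
have cA : imE f EF != set0 by rewrite -card_gt0 imE_inj ?card_gt0.
have [/eqP covP tP P0] := and3P partP.
rewrite /partition !inE negb_or [_ == imE _ _]eq_sym cA P0 andbT /cover bigcup_setU big_set1.
rewrite -/(cover P) covP eqxx /=.
rewrite -covP disjoint_sym in dis.
have nAP : imE f EF \notin P.
  apply/negP => AP; case/negP: cA; rewrite -subset0 -(disjoint_setI0 dis) subsetI subxx andbT.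
  exact: bigcup_max AP _.
rewrite andbT; apply/trivIsetP => A B /setU1P[->|AP] /setU1P[->|BP]; first by rewrite eqxx.
- move=> _; rewrite disjoint_sym; apply: disjointWl dis; exact: bigcup_max BP _.
- move=> _; apply: disjointWl dis; exact: bigcup_max AP _.
- by move/trivIsetP: tP; apply.
Qed.

Lemma trivIset_dec P : trivIset P ->
    (forall A, A \in P -> exists2 f : VF -> V, injective f & A = imE f EF) ->
  dec (cover P).
Proof.
move=> /trivIsetP tP PF; rewrite /cover -big_enum.
apply: dec_bigcup => [|A|A B]; rewrite ?enum_uniq ?mem_enum //.
  by move=> /PF[f finj ->]; apply: dec_copy.
by move=> AP BP; apply: tP.
Qed.

End OneSet.

Lemma dec_imE (V W : finType) (g : V -> W) (E : {set {set V}}) : injective g -> dec E -> dec (imE g E).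
Proof.
move=> ginj; elim=> [|f E' finj dis _ IH]; first by rewrite /imE imset0; apply: dec0.
rewrite imEU -imE_comp; apply: decS => //; first exact: inj_comp.
rewrite imE_comp; rewrite -setI_eq0 -imsetI; last by move=> ? ? _ _; apply: imset_inj.
by rewrite (disjoint_setI0 dis) imset0.
Qed.

End Decompositions.

(** * Random maps *)

Local Open Scope ring_scope.

Section RandomMap.
Variables (R : realType) (I J : finType).

(** From e^(-y) >= 1 - y with y = x - x^2, because (1 - x + x^2)(1 + x) = 1 + x^3. This bound and
    the next let powers of 1 + th and 1 - th replace exponentials in [random_map]. *)
Lemma expR_le_1D (x : R) : 0 <= x -> expR (x - x ^+ 2) <= 1 + x.
Proof.
move=> x0; have H := expR_ge1Dx (- (x - x ^+ 2)).
have p : 0 < expR (- (x - x ^+ 2)) by apply: expR_gt0.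
rewrite -[x - x ^+ 2]opprK expRN -[leRHS]invrK lef_pV2 ?posrE ?invr_gt0 //; last by lra.
apply: le_trans H; rewrite -[leLHS]mul1r ler_pdivrMr; last by lra.
nra.
Qed.

Lemma expR_le_1B (x : R) : 0 <= x -> x <= 2^-1 -> expR (- (x + 2 * x ^+ 2)) <= 1 - x.
Proof.
move=> x0 x1; have H := expR_ge1Dx (x + 2 * x ^+ 2).
have p : 0 < expR (x + 2 * x ^+ 2) by apply: expR_gt0.
rewrite expRN -[leRHS]invrK lef_pV2 ?posrE ?invr_gt0 //; last by lra.
apply: le_trans H; rewrite -[leLHS]mul1r ler_pdivrMr; last by lra.
nra.
Qed.

(** The exponential moment of a binomial variable with success probability 1/|J|, as a sum over all
    maps instead of an average. *)
Lemma sum_prod_ffun (A : {set I}) (t : I -> J) (b : R) : (0 < #|J|)%N ->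
  \sum_(f : {ffun I -> J}) (1 + b) ^+ #|[set i in A | f i == t i]| =
  #|J|%:R ^+ #|I| * (1 + b / #|J|%:R) ^+ #|A| :> R.
Proof.
move=> J0; have Jn0 : #|J|%:R != 0 :> R by rewrite pnatr_eq0 -lt0n.
pose w i j : R := if (i \in A) && (j == t i) then 1 + b else 1.
have -> : \sum_(f : {ffun I -> J}) (1 + b) ^+ #|[set i in A | f i == t i]| =
    \sum_(f : {ffun I -> J}) \prod_i w i (f i).
  apply: eq_bigr => f _; rewrite -prodr_const big_mkcond; apply: eq_bigr => i _.
  by rewrite inE /w.
rewrite -bigA_distr_bigA /=.
rewrite (eq_bigr (fun i => #|J|%:R * (if i \in A then 1 + b / #|J|%:R else 1))); last first.
  move=> i _; rewrite /w; case: (i \in A) => /=; last by rewrite sumr_const mulr1 -mulr_natl mulr1.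
  rewrite (bigD1 (t i)) //= eqxx (eq_bigr (fun=> 1)) => [|j /negPf-> //].
  rewrite sumr_const (_ : #|_| = #|J|.-1); last first.
    by rewrite -(cardC1 (t i)); apply: eq_card => j; rewrite !inE.
  have -> : 1 *+ #|J|.-1 = #|J|%:R - 1 :> R.
    by rewrite -[in RHS](prednK J0) -[in RHS]natr1 addrK.
  by field.
by rewrite big_split /= prodr_const -big_mkcond /= prodr_const.
Qed.

(** Chernoff and union bounds by counting: a map that violates some condition has weight at least 1
    in the sum of the normalised moments over all c, whereas the total weight of all maps is less
    than their number. *)
Lemma random_map (C : finType) (A : C -> {set I}) (t : C -> I -> J) (n : nat) (alpha : R) :
    0 < alpha -> (0 < #|J|)%N -> (forall c, (#|A c| <= n)%N) ->
    2 * #|C|%:R * expR (- (alpha ^+ 2 * n%:R / 8)) < 1 ->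
  exists f : {ffun I -> J}, forall c,
    `| #|[set i in A c | f i == t c i]|%:R - #|A c|%:R / #|J|%:R | <= alpha * n%:R.
Proof.
move=> a0 J0 An small.
have X_le f c : (#|[set i in A c | f i == t c i]| <= #|A c|)%N.
  by apply: subset_leq_card; apply/subsetP => i; rewrite inE => /andP[].
have pJ : 0 < (#|J|%:R)^-1 :> R by rewrite invr_gt0 ltr0n.
have pJ1 : (#|J|%:R)^-1 <= 1 :> R by rewrite invf_le1 ?ltr0n // ler1n.
set p : R := (#|J|%:R)^-1 in pJ pJ1 *.
have [alpha1|alpha1] := lerP alpha 1; last first.
  have /card_gt0P[j0 _] := J0; exists [ffun=> j0] => c.
  set X := #|_|; have Xn : X%:R <= #|A c|%:R :> R by rewrite ler_nat X_le.
  have An' : #|A c|%:R <= n%:R :> R by rewrite ler_nat.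
  have X0 : 0 <= X%:R :> R by rewrite ler0n.
  have n0 : 0 <= n%:R :> R by rewrite ler0n.
  by rewrite ler_norml; apply/andP; split; nra.
(* With this value 2 th^2 n - th alpha n = - alpha^2 n / 8, the exponent in the hypothesis. *)
pose th := alpha / 4; pose N : R := #|J|%:R ^+ #|I|.
have N0 : 0 < N by rewrite exprn_gt0 // ltr0n.
have th0 : 0 < th by rewrite /th; lra.
have th1 : th <= 2^-1 by rewrite /th; lra.
pose X (f : {ffun I -> J}) c := #|[set i in A c | f i == t c i]|.
pose Wp f c : R := (1 + th) ^+ X f c; pose Wm f c : R := (1 + - th) ^+ X f c.
pose a c : R := #|A c|%:R.
pose Mp c := expR ((th - th ^+ 2) * (a c * p + alpha * n%:R)).
pose Mm c := expR (- (th + 2 * th ^+ 2) * (a c * p - alpha * n%:R)).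
have [/existsP[f /forallP good]|nogood] := boolP [exists f : {ffun I -> J}, [forall c,
    `| (X f c)%:R - a c * p | <= alpha * n%:R]].
  by exists f.
exfalso.
have n0 : 0 <= n%:R :> R by rewrite ler0n.
have ac c : 0 <= a c <= n%:R by rewrite ler0n ler_nat An.
have bad f : 1 <= \sum_c (Wp f c / Mp c + Wm f c / Mm c).
  move: nogood; rewrite negb_exists => /forallP/(_ f).
  rewrite negb_forall => /existsP[c]; rewrite -ltNge => far.
  have pos c' : 0 <= Wp f c' / Mp c' + Wm f c' / Mm c'.
    by rewrite addr_ge0 // divr_ge0 ?expR_ge0 // exprn_ge0 //; lra.
  rewrite (bigD1 c) //=; apply: ler_wpDr; first by apply: sumr_ge0.
  have /andP[ac0 acn] := ac c; have X0 : 0 <= (X f c)%:R :> R by rewrite ler0n.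
  have wp0 : 0 <= Wp f c / Mp c by rewrite divr_ge0 ?expR_ge0 // exprn_ge0 //; lra.
  have wm0 : 0 <= Wm f c / Mm c by rewrite divr_ge0 ?expR_ge0 // exprn_ge0 //; lra.
  have [Xbig|Xsmall] := lerP (a c * p + alpha * n%:R) (X f c)%:R.
    apply: ler_wpDr => //; rewrite ler_pdivlMr ?expR_gt0 // mul1r.
    apply: le_trans (_ : expR (th - th ^+ 2) ^+ X f c <= _).
      rewrite -expRM_natl ler_expR mulrC; apply: ler_wpM2r => //.
      by have : th ^+ 2 <= th * 1; rewrite ?expr2; nra.
    by apply: lerXn2r; rewrite ?nnegrE ?expR_ge0 ?expR_le_1D //; lra.
  have {}far : (X f c)%:R < a c * p - alpha * n%:R.
    move: far; case: (lerP 0 ((X f c)%:R - a c * p)) => [h|h].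
      by rewrite ger0_norm //; lra.
    by rewrite ltr0_norm //; lra.
  apply: ler_wpDl => //; rewrite ler_pdivlMr ?expR_gt0 // mul1r.
  apply: le_trans (_ : expR (- (th + 2 * th ^+ 2)) ^+ X f c <= _).
    rewrite -expRM_natl ler_expR.
    have : 0 <= th + 2 * th ^+ 2 by have := sqr_ge0 th; move: th0; lra.
    by move: (th + _) far; clear; move=> K; nra.
  by apply: lerXn2r; rewrite ?nnegrE ?expR_ge0 ?expR_le_1B //; lra.
have : \sum_(f : {ffun I -> J}) 1 <= \sum_(f : {ffun I -> J}) \sum_c (Wp f c / Mp c + Wm f c / Mm c).
  by apply: ler_sum => f _; apply: bad.
rewrite sumr_const card_ffun exchange_big /= leNgt => /negP; apply.
rewrite -(mulr_natr 1) mul1r natrX -/N.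
set E := expR _ in small; have E0 : 0 < E by apply: expR_gt0.
have lt1 : 2 * #|C|%:R * E * N < N by rewrite -[ltRHS]mul1r ltr_pM2r.
apply: le_lt_trans lt1; rewrite (_ : 2 * _ * _ * _ = \sum_(c : C) (E * N + E * N)); last first.
  by rewrite sumr_const -mulr_natr; ring.
apply: ler_sum => c _; have /andP[ac0 acn] := ac c.
have ap : a c * p <= n%:R by nra.
have ap0 : 0 <= a c * p by rewrite mulr_ge0 // ltW.
rewrite big_split /= -!mulr_suml !sum_prod_ffun // -/N -/p -/(a c).
have key : th ^+ 2 * (a c * p) * 2 - th * alpha * n%:R <= - (alpha ^+ 2 * n%:R / 8).
  have : th ^+ 2 * (a c * p) <= th ^+ 2 * n%:R by rewrite ler_wpM2l // sqr_ge0.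
  by rewrite /th; nra.
apply: lerD.
  rewrite ler_pdivrMr ?expR_gt0 // [E * N * _]mulrAC [leLHS]mulrC (ler_pM2r N0) /E -expRD.
  apply: le_trans (_ : expR (th * p) ^+ #|A c| <= _).
    apply: lerXn2r; rewrite ?nnegrE ?expR_ge0 ?expR_ge1Dx //.
    by rewrite addr_ge0 // mulr_ge0 // ltW.
  rewrite -expRM_natl ler_expR -/(a c).
  have : 0 <= th ^+ 2 * (alpha * n%:R) by rewrite mulr_ge0 ?sqr_ge0 // mulr_ge0 // ltW.
  have : th ^+ 2 * (alpha * n%:R) <= th ^+ 2 * n%:R.
    by rewrite ler_wpM2l ?sqr_ge0 // -[leRHS]mul1r ler_wpM2r.
  move: key; rewrite /th; nra.
rewrite ler_pdivrMr ?expR_gt0 // [E * N * _]mulrAC [leLHS]mulrC (ler_pM2r N0) /E -expRD.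
apply: le_trans (_ : expR (- th * p) ^+ #|A c| <= _).
  apply: lerXn2r; rewrite ?nnegrE ?expR_ge0 ?expR_ge1Dx //.
  by rewrite mulNr subr_ge0; nra.
rewrite -expRM_natl ler_expR -/(a c).
have : 0 <= th ^+ 2 * (alpha * n%:R) by rewrite mulr_ge0 ?sqr_ge0 // mulr_ge0 // ltW.
move: key; rewrite /th; nra.
Qed.
End RandomMap.

Lemma expRN_le (R : realType) (x : R) : 0 < x -> expR (- x) <= 4 / x ^+ 2.
Proof.
move=> x0; have H := expR_ge1Dx (x / 2).
have x2 : 0 < x ^+ 2 by rewrite exprn_gt0.
rewrite expRN -[leRHS]invrK lef_pV2 ?posrE ?expR_gt0 ?invr_gt0 ?divr_gt0 //.
rewrite invf_div (_ : x = x / 2 + x / 2); last by field.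
by rewrite expRD; nra.
Qed.

Lemma random_map_on (R : realType) (I J C0 : finType) (D : {set C0}) (A : C0 -> {set I})
    (t : C0 -> I -> J) (n : nat) (alpha : R) :
    0 < alpha -> (0 < #|J|)%N -> (forall c, c \in D -> (#|A c| <= n)%N) ->
    2 * #|D|%:R * expR (- (alpha ^+ 2 * n%:R / 8)) < 1 ->
  exists f : {ffun I -> J}, forall c, c \in D ->
    `| #|[set i in A c | f i == t c i]|%:R - #|A c|%:R / #|J|%:R | <= alpha * n%:R.
Proof.
move=> a0 J0 An; rewrite -card_sig => small.
have [i|f Hf] := @random_map R I J {c | c \in D} (fun c => A (val c)) (fun c => t (val c)) n alpha a0 J0 _ small.
  by apply: An; apply: valP.
by exists f => c cD; apply: (Hf (Sub c cD)).
Qed.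

(** For fixed alpha and linearly many conditions the bound e^(-x) <= 4 / x^2 is enough: the failure
    weight is at most 512 k / (alpha^4 n). *)
Lemma random_map_large (R : realType) (alpha : R) (k : nat) : 0 < alpha ->
  exists n0 : nat, forall (I J C : finType) (D : {set C}) (A : C -> {set I}) (t : C -> I -> J) (n : nat),
    (n0 <= n)%N -> (0 < #|J|)%N -> (#|D| <= k * n)%N -> (forall c, c \in D -> (#|A c| <= n)%N) ->
  exists f : {ffun I -> J}, forall c, c \in D ->
    `| #|[set i in A c | f i == t c i]|%:R - #|A c|%:R / #|J|%:R | <= alpha * n%:R.
Proof.
move=> a0; pose c : R := 512 * k%:R / alpha ^+ 4.
have a4 : 0 < alpha ^+ 4 by rewrite exprn_gt0.
have c0 : 0 <= c by rewrite divr_ge0 ?mulr_ge0 ?ler0n // ltW.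
exists (Num.bound c).+1 => I J C D A t n n0n J0 Dn An.
apply: random_map_on => //.
have cn : c < n%:R by apply: lt_le_trans (archi_boundP c0) _; rewrite ler_nat ltnW.
have n0 : 0 < n%:R :> R by rewrite ltr0n; apply: leq_ltn_trans n0n.
have x0 : 0 < alpha ^+ 2 * n%:R / 8 by rewrite !mulr_gt0 ?exprn_gt0 // invr_gt0.
apply: le_lt_trans (_ : 2 * (k%:R * n%:R) * (4 / (alpha ^+ 2 * n%:R / 8) ^+ 2) < 1).
  apply: ler_pM; rewrite ?mulr_ge0 ?expR_ge0 ?ler0n // ?expRN_le //.
  by rewrite ler_pM2l // -natrM ler_nat.
rewrite [ltLHS](_ : _ = c / n%:R); last by rewrite /c; field; rewrite !gt_eqF.
by rewrite ltr_pdivrMr // mul1r.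
Qed.

Lemma expR_half_le2 (R : realType) : expR (1 / 2) <= 2 :> R.
Proof.
have H := expR_ge1Dx (- (1 / 2) : R); have p : 0 < expR (1 / 2) :> R by apply: expR_gt0.
have : expR (1 / 2) * expR (- (1 / 2)) = 1 :> R by rewrite -expRD subrr expR0.
nra.
Qed.

Lemma expn2_ge_poly (R : realType) (c : R) (k : nat) :
  exists L0 : nat, forall L : nat, (L0 <= L)%N -> c * L%:R ^+ k <= 2 ^+ L.
Proof.
pose m : R := 2 * k.+1%:R; have m0 : 0 < m by rewrite mulr_gt0 // ltr0n.
pose c' : R := `|c| * m ^+ k.+1.
have c'0 : 0 <= c' by rewrite mulr_ge0 // exprn_ge0 // ltW.
exists (Num.bound c') => L LL.
have L0 : 0 <= L%:R :> R by rewrite ler0n.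
apply: le_trans (_ : `|c| * L%:R ^+ k <= _).
  by rewrite ler_wpM2r ?exprn_ge0 // ler_norm.
apply: le_trans (_ : (L%:R / m) ^+ k.+1 <= _).
  rewrite expr_div_n ler_pdivlMr ?exprn_gt0 // mulrAC [L%:R ^+ k.+1]exprS ler_wpM2r ?exprn_ge0 //.
  by apply: le_trans (ltW (archi_boundP c'0)) _; rewrite ler_nat.
apply: le_trans (_ : expR (L%:R / m) ^+ k.+1 <= _).
  apply: lerXn2r; rewrite ?nnegrE ?divr_ge0 ?expR_ge0 ?(ltW m0) //.
  by apply: le_trans (expR_ge1Dx _); rewrite lerDr.
rewrite -expRM_natl (_ : k.+1%:R * (L%:R / m) = L%:R * (1 / 2)); last first.
  rewrite /m; move: k.+1%:R (ltr0Sn R k) => K K0; field.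
  by rewrite gt_eqF.
rewrite expRM_natl; apply: lerXn2r; rewrite ?nnegrE ?expR_ge0 ?expR_half_le2 //.
Qed.

(* q = 2^m is of the order of (log n)^2. *)
Lemma field_size (R : realType) (c1 c2 : R) (n3 Q0 : nat) : 0 < c1 -> 0 < c2 ->
  exists n2 : nat, forall n : nat, (n2 <= n)%N -> exists m : nat,
    [/\ (0 < m)%N, 2 * n%:R * expR (- (c1 * (2 ^ m)%:R)) < 1,
      2 * ((n + 2 ^ m + 1) * (2 ^ m) ^ 2)%:R * expR (- (c2 / (2 ^ m)%:R ^+ 2 * n%:R)) < 1,
      (Q0 <= 2 ^ m)%N & (2 * 2 ^ m * n3 <= n)%N].
Proof.
move=> c10 c20.
have [L1 H1] := expn2_ge_poly (16 / c2) 5.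
have [L2 H2] := expn2_ge_poly (2 * n3%:R : R) 2.
have [L3 H3] := expn2_ge_poly (1 : R) 4.
pose B1 := Num.bound (8 / c1).
pose L0 := maxn (maxn L1 L2) (maxn (maxn L3 8) (maxn B1 (2 * Q0))).
exists (2 ^ L0)%N => n n_ge.
have n0 : (0 < n)%N by apply: leq_trans n_ge; rewrite expn_gt0.
pose L := trunc_log 2 n.
have LL : (L0 <= L)%N by apply: trunc_log_max.
have [LL1 LL2] : (L1 <= L)%N /\ (L2 <= L)%N by move: LL; rewrite /L0; lia.
have [LL3 LL8] : (L3 <= L)%N /\ (8 <= L)%N by move: LL; rewrite /L0; lia.
have [LLB LLQ] : (B1 <= L)%N /\ (2 * Q0 <= L)%N by move: LL; rewrite /L0; lia.
have /andP[Ln nL] : (2 ^ L <= n < 2 ^ L.+1)%N by apply: (@trunc_log_bounds 2).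
have L2gt : (0 < L ^ 2)%N by rewrite expn_gt0; lia.
(* So q = 2^m lies between L^2 / 2 and L^2, with L about log n: then c1 q outgrows log n, and n /
   q^2 still outgrows log n as well. *)
pose m := trunc_log 2 (L ^ 2).
have /andP[mL Lm] : (2 ^ m <= L ^ 2 < 2 ^ m.+1)%N by apply: (@trunc_log_bounds 2).
have L8 : 8 <= L%:R :> R by rewrite ler_nat.
have L0R : 0 < L%:R :> R by apply: lt_le_trans L8.
pose q : R := (2 ^ m)%:R.
have qL : q <= L%:R ^+ 2 by rewrite -natrX ler_nat.
have Lq : L%:R ^+ 2 <= 2 * q by rewrite -natrX -natrM -expnS ler_nat ltnW.
have nR : n%:R <= 2 ^+ L.+1 :> R by rewrite -natrX ler_nat ltnW.
have Rn : 2 ^+ L <= n%:R :> R by rewrite -natrX ler_nat.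
have q0 : 0 < q by rewrite /q ltr0n expn_gt0.
have e2 x : 2 ^+ x <= expR x%:R :> R.
  rewrite -[x%:R]mulr1 expRM_natl; apply: lerXn2r; rewrite ?nnegrE ?expR_ge0 //.
  by have := expR_ge1Dx (1 : R).
exists m; split.
- by rewrite /m trunc_log_gt0 //; nia.
- rewrite -/q; apply: le_lt_trans (_ : expR (L.+2)%:R * expR (- (c1 * q)) < 1).
    rewrite ler_wpM2r ?expR_ge0 //; apply: le_trans (e2 _).
    by rewrite exprS ler_pM2l.
  rewrite -expRD -[ltRHS]expR0 ltr_expR.
  have : 8 / c1 <= L%:R.
    by apply: le_trans (ltW (archi_boundP _)) _; rewrite ?ler_nat // divr_ge0 // ltW.
  rewrite ler_pdivrMr // => H.
  have : 4 * L%:R <= c1 * q.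
    have : c1 * (L%:R ^+ 2) <= c1 * (2 * q) by rewrite ler_pM2l.
    have : 8 * L%:R <= L%:R * c1 * L%:R by rewrite ler_pM2r.
    by rewrite expr2; nra.
  by rewrite -addn2 natrD; lra.
- have S3 : (L%:R ^+ 2) ^+ 2 <= 2 ^+ L :> R.
    by have := H3 L LL3; rewrite mul1r -exprM.
  have cnt : 2 * ((n + 2 ^ m + 1) * (2 ^ m) ^ 2)%:R <= expR (2 * L%:R + 4) :> R.
    apply: le_trans (_ : 2 ^+ (2 * L + 4) <= _); last by have := e2 (2 * L + 4)%N; rewrite natrD natrM.
    have q2 : q ^+ 2 <= 2 ^+ L :> R.
      by apply: le_trans S3; apply: lerXn2r; rewrite ?nnegrE ?exprn_ge0 // ltW.
    have q1 : q + 1 <= 2 ^+ L.+1 :> R.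
      have : 1 <= q by rewrite /q ler1n expn_gt0.
      by rewrite exprS; nra.
    rewrite natrM natrX !natrD -/q exprD [2 ^+ (2 * L)](_ : _ = 2 ^+ L * 2 ^+ L); last first.
      by rewrite mul2n -addnn exprD.
    have T0 : 0 < 2 ^+ L :> R by rewrite exprn_gt0.
    have : (n%:R + q + 1) * q ^+ 2 <= (2 * (2 ^+ L.+1)) * 2 ^+ L.
      by apply: ler_pM; [rewrite !addr_ge0 ?ler0n ?(ltW q0)|rewrite exprn_ge0 // ltW|lra|].
    rewrite [2 ^+ L.+1]exprS (_ : 2 ^+ 4 = 16); last by rewrite -natrX.
    move: (_ * q ^+ 2) (2 ^+ L) T0 => A T T0; have := mulr_gt0 T0 T0; lra.
  apply: le_lt_trans (_ : expR (2 * L%:R + 4) * expR (- (c2 / q ^+ 2 * n%:R)) < 1).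
    by rewrite ler_wpM2r ?expR_ge0.
  rewrite -expRD -[ltRHS]expR0 ltr_expR.
  suff : 3 * L%:R <= c2 / q ^+ 2 * n%:R by lra.
  have H := H1 L LL1.
  have q4 : q ^+ 2 <= L%:R ^+ 4.
    by rewrite (exprM _ 2 2); apply: lerXn2r; rewrite ?nnegrE ?exprn_ge0 // ltW.
  rewrite mulrAC ler_pdivlMr ?exprn_gt0 //.
  apply: le_trans (_ : 3 * L%:R * L%:R ^+ 4 <= _); first by rewrite ler_wpM2l // mulr_ge0 // ltW.
  apply: le_trans (_ : c2 * 2 ^+ L <= _); last by rewrite ler_pM2l.
  have : c2 * (16 / c2 * L%:R ^+ 5) <= c2 * 2 ^+ L by rewrite ler_pM2l.
  rewrite (_ : c2 * _ = 16 * L%:R ^+ 5); last by field; rewrite gt_eqF.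
  have : 0 <= L%:R ^+ 5 :> R by rewrite exprn_ge0 // ltW.
  by rewrite -mulrA -exprS; lra.
- move: Lm LLQ LL8; rewrite [(2 ^ m.+1)%N]expnS -mulnn; clear; move: (2 ^ m)%N => t; nia.
- have := H2 L LL2; rewrite -(ler_nat R) !natrM -/q => H.
  apply: le_trans Rn; apply: le_trans H.
  by rewrite mulrAC ler_wpM2l ?mulr_ge0 ?ler0n.
Qed.

Local Close Scope ring_scope.

(** * The Hajnal-Szemeredi theorem *)

Section EquitableColouring.
Variables V K : finType.
Implicit Types (X : {set V}) (C : {set K}) (f g : V -> K) (c d : K).

Definition cls X f c : {set V} := [set x in X | f x == c].

Definition colours (e : rel V) X C f :=
  (forall x, x \in X -> f x \in C) /\
  (forall x y, x \in X -> y \in X -> e x y -> f x != f y).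

Definition movable (e : rel V) X f x d := [forall y in X, (f y == d) ==> ~~ e x y].

Definition mv (e : rel V) X C f : rel K := fun c d =>
  [&& c \in C, d \in C, c != d & [exists x in X, (f x == c) && movable e X f x d]].

Definition upd f x c : V -> K := fun y => if y == x then c else f y.

Lemma cls_upd X f x c d : x \in X -> f x != c ->
  #|cls X (upd f x c) d| + (d == f x) = #|cls X f d| + (d == c).
Proof.
move=> xX fxc; rewrite (cardsD1 x (cls X f d)) (cardsD1 x (cls X (upd f x c) d)).
have -> : cls X (upd f x c) d :\ x = cls X f d :\ x.
  by apply/setP => y; rewrite !inE /upd; case: eqP.
by rewrite !inE /upd xX eqxx /= ![_ == d]eq_sym; lia.
Qed.

Lemma movableP (e : rel V) X f x d :
  reflect (forall y, y \in X -> f y = d -> ~~ e x y) (movable e X f x d).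
Proof.
apply: (iffP forall_inP) => H y yX; last by apply/implyP => /eqP; apply: H.
by move=> fy; have := H y yX; rewrite fy eqxx.
Qed.

Lemma sub_tail_path (T : eqType) (r r' : rel T) x p :
    (forall k l, k \in x :: p -> l \in p -> r k l -> r' k l) ->
  path r x p -> path r' x p.
Proof.
elim: p x => //= y p IH x H /andP[rxy pth]; rewrite H ?mem_head //=.
by apply: IH => // k l kp lp; apply: H; rewrite inE ?kp ?lp orbT.
Qed.

(** Move one witness along each arc. As no colour repeats on the path, no later arc ends in the
    class just enlarged or starts in the class just diminished, so the remaining witnesses stay
    valid. *)
Lemma shift_path (e : rel V) X C : symmetric e -> forall p f c,
    path (mv e X C f) c p -> uniq (c :: p) -> colours e X C f ->
  exists f', [/\ colours e X C f',
    forall x, x \in X -> f x \notin c :: p -> f' x = f x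
  & forall d, #|cls X f' d| + (d == c) = #|cls X f d| + (d == last c p)].
Proof.
move=> e_sym; elim=> [|d p IH] f c /=; first by move=> _ _ colf; exists f.
case/andP=> /and4P[cC dC cd /existsP[x /and3P[xX /eqP fx /movableP mx]]] pth.
case/andP=> cp /andP[dp up] [fC fe].
pose f1 := upd f x d.
have col1 : colours e X C f1.
  split=> [y yX|y z yX zX eyz]; first by rewrite /f1 /upd; case: ifP => // _; apply: fC.
  rewrite /f1 /upd; have [yx|_] := eqVneq y x; have [zx|_] := eqVneq z x; last exact: fe.
  - by have := fe _ _ yX zX eyz; rewrite yx zx eqxx.
  - by subst y; apply/eqP => dz; case/negP: (mx z zX (esym dz)).
  - by subst z; apply/eqP => yd; case/negP: (mx y yX yd); rewrite e_sym.
have pth1 : path (mv e X C f1) d p.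
  apply: sub_tail_path pth => k l kp lp.
  have kc : k != c by apply: contraNneq cp => <-.
  have ld : l != d by apply: contraNneq dp => <-.
  case/and4P=> kC lC kl /existsP[y /and3P[yX /eqP fy /movableP my]].
  rewrite /mv kC lC kl /=; apply/existsP; exists y; rewrite yX /=.
  have yx : y != x by apply: contraNneq kc => yx; rewrite -fy yx fx.
  rewrite {1}/f1 /upd (negPf yx) fy eqxx /=; apply/movableP => z zX.
  rewrite /f1 /upd; case: eqP => [_ dl|_]; last exact: my.
  by rewrite dl eqxx in ld.
have [f' [col' f'out f'c]] := IH f1 d pth1 (introT andP (conj dp up)) col1.
exists f'; split=> //.
- move=> y yX; rewrite inE negb_or => /andP[fyc yp].
  have yx : y != x by apply: contraNneq fyc => ->; rewrite fx.
  have f1y : f1 y = f y by rewrite /f1 /upd (negPf yx).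
  by rewrite f'out // f1y.
- move=> k; have := f'c k; have fxd : f x != d by rewrite fx.
  by have := cls_upd k xX fxd; rewrite -/f1 fx; clear; lia.
Qed.

Lemma card_cols X f (S : {set K}) (P : pred V) :
  #|[set x in X | (f x \in S) && P x]| = \sum_(c in S) #|[set x in X | (f x == c) && P x]|.
Proof.
rewrite -sum1dep_card (partition_big f [in S]) /=; last by move=> x /and3P[].
apply: eq_bigr => c cS; rewrite -sum1dep_card; apply: eq_bigl => x.
by have [->|] := eqVneq (f x) c; rewrite ?andbF ?andbT // cS.
Qed.

Definition equitable (e : rel V) X C s g :=
  colours e X C g /\ forall c, c \in C -> #|cls X g c| = s.

Section NearlyEquitable.
Variables (e : rel V) (X : {set V}) (C : {set K}) (s : nat).
Hypothesis e_sym : symmetric e.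
Hypothesis e_irr : irreflexive e.
Hypothesis degX : forall x, x \in X -> #|[set y in X | e x y]| < #|C|.
Hypothesis IHX : forall X' (C' : {set K}), X' \proper X -> #|X'| = #|C'| * s ->
  (forall x, x \in X' -> #|[set y in X' | e x y]| < #|C'|) ->
  exists g, equitable e X' C' s g.

(** One class is a vertex short and one has a vertex too many; the sizes are compared additively to
    avoid truncated subtraction. *)
Definition nearly f c0 c1 := [/\ colours e X C f, c0 \in C, c1 \in C, c0 != c1 &
  forall c, c \in C -> #|cls X f c| + (c == c0) = s + (c == c1)].

Definition acc f c0 : {set K} := [set c in C | connect (mv e X C f) c c0].

Lemma nearly_shift f c0 c1 : nearly f c0 c1 -> c1 \in acc f c0 ->
  exists g, equitable e X C s g.
Proof.
case=> colf c0C c1C c01 cf; rewrite inE => /andP[_ /connectP[p0 pth0 lp0]].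
move: pth0 lp0; case/shortenP => p pth up _ lp.
have [g [colg _ gc]] := shift_path e_sym pth up colf.
exists g; split=> // c cC; have := gc c; have := cf c cC; rewrite -lp; clear; lia.
Qed.

Section Fixed.
Variables (f : V -> K) (c0 c1 : K) (A : {set K}).
Hypothesis nf : nearly f c0 c1.
Hypothesis AE : forall c, (c \in A) = (c \in C) && connect (mv e X C f) c c0.
Hypothesis c1acc : c1 \notin A.

Let colf : colours e X C f. Proof. by case: nf. Qed.
Let fC x : x \in X -> f x \in C. Proof. by case: colf => + _; apply. Qed.
Let c0C : c0 \in C. Proof. by case: nf. Qed.
Let c1C : c1 \in C. Proof. by case: nf. Qed.
Let AC : A \subset C. Proof. by apply/subsetP => c; rewrite AE => /andP[]. Qed.
Let c0A : c0 \in A. Proof. by rewrite AE c0C connect0. Qed.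

Definition ncol y c := #|[set x in X | (f x == c) && e y x]|.
Definition nB y := #|[set x in X | (f x \in C :\: A) && e y x]|.

(** Otherwise y could move to d, and its colour would be accessible too. *)
Lemma ncol_acc y d : y \in X -> f y \in C :\: A -> d \in A -> 0 < ncol y d.
Proof.
move=> yX; rewrite inE => /andP[yA yC] dA; rewrite lt0n; apply: contraNneq (yA) => /eqP.
rewrite cards_eq0 => /eqP/setP n0; rewrite AE yC /=.
move: (dA); rewrite AE => /andP[dC]; apply: connect_trans; apply: connect1.
rewrite /mv yC dC /=; apply/andP; split.
  by apply: contraNneq yA => ->.
apply/existsP; exists y; rewrite yX eqxx /=; apply/movableP => x xX fx.
by have := n0 x; rewrite !inE xX fx eqxx /= => ->.
Qed.

Lemma sum_ncol y : y \in X -> \sum_(c in A) ncol y c + nB y < #|C|.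
Proof.
move=> yX; apply: leq_trans (degX yX); rewrite ltnS.
have -> : [set x in X | e y x] = [set x in X | (f x \in C) && e y x].
  by apply/setP => x; rewrite !inE; case xX: (x \in X); rewrite //= fC.
rewrite card_cols [leqRHS](big_setID A) /= (setIidPr AC) /nB card_cols.
exact: leqnn.
Qed.

(** Each accessible class takes at least one of the at most |C| - 1 neighbours of y. This is the
    degree condition under which the induction hypothesis recolours the inaccessible part, less one
    vertex, with the inaccessible colours. *)
Lemma nB_lt y : y \in X -> f y \in C :\: A -> nB y < #|C :\: A|.
Proof.
move=> yX fy; have := sum_ncol yX.
rewrite cardsD (setIidPr AC) => H; rewrite ltn_subRL; apply: leq_ltn_trans H.
rewrite leq_add2r -sum1_card; apply: leq_sum => c cA; exact: ncol_acc.
Qed.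

Definition Bs : {set V} := [set x in X | f x \in C :\: A].

Lemma cls_card c : c \in C -> #|cls X f c| + (c == c0) = s + (c == c1).
Proof. by case: nf => _ _ _ _; apply. Qed.

Lemma card_Bs : #|Bs| = #|C :\: A| * s + 1.
Proof.
have -> : Bs = [set x in X | (f x \in C :\: A) && true].
  by apply/setP => x; rewrite !inE andbT.
rewrite card_cols (bigD1 c1) ?inE ?c1acc //=.
rewrite (eq_bigr (fun=> s)); last first.
  move=> c; rewrite in_setD => /andP[/andP[cA cC] cc1].
  have := cls_card cC; rewrite (negPf cc1) addn0 => <-.
  have -> : (c == c0) = false by apply: contraNF cA => /eqP ->.
  by rewrite addn0; apply: eq_card => x; rewrite !inE andbT.
have := cls_card c1C; rewrite eqxx.
have -> : (c1 == c0) = false by apply: contraNF c1acc => /eqP ->.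
have -> : cls X f c1 = [set x in X | (f x == c1) && true].
  by apply/setP => x; rewrite !inE andbT.
rewrite addn0 => ->; rewrite sum_nat_const.
rewrite (cardsD1 c1 (C :\: A)) !inE c1C c1acc /= mulnDl mul1n.
have -> : #|[pred c | (c \in C :\: A) && (c != c1)]| = #|(C :\: A) :\ c1|.
  by apply: eq_card => c; rewrite !inE andbC.
by rewrite addnAC.
Qed.

Lemma cls_in_A c : c \in A -> #|cls X f c| + (c == c0) = s.
Proof.
move=> cA; have := cls_card (subsetP AC _ cA).
have -> : (c == c1) = false by apply: contraNF c1acc => /eqP <-.
by rewrite addn0.
Qed.

Lemma exchange_count (P Q : {set V}) :
  \sum_(y in P) #|[set x in Q | e y x]| = \sum_(x in Q) #|[set y in P | e x y]|.
Proof.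
have H (S : {set V}) y : #|[set x in S | e y x]| = \sum_(x in S) (e y x : nat).
  by rewrite -sum1dep_card big_mkcondr; apply: eq_bigr => x _; case: ifP.
under eq_bigr do rewrite H; rewrite exchange_big /=; apply: eq_bigr => x _.
by rewrite H; apply: eq_bigr => y _; rewrite e_sym.
Qed.

(** If c0 were alone, each of the (|C| - 1) s + 1 vertices of other colours would have a neighbour
    among the s - 1 vertices of class c0, each of which has at most |C| - 1 neighbours. *)
Lemma acc_gt1 : exists2 c, c \in A & c != c0.
Proof.
apply/exists_inP; rewrite -negb_forall_in; apply/negP => /forall_inP A1.
have DA : A = [set c0] by apply/setP => c; rewrite inE; apply/idP/eqP => [/A1/eqP//|->].
have cA := cls_in_A c0A; rewrite eqxx in cA.
have q1 : #|C :\: A|.+1 = #|C|.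
  by rewrite cardsD (setIidPr AC) DA cards1; have := subset_leq_card AC; rewrite DA cards1; lia.
have : #|Bs| <= #|cls X f c0| * #|C :\: A|.
  rewrite -sum1_card -sum_nat_const.
  apply: leq_trans (_ : \sum_(y in Bs) #|[set x in cls X f c0 | e y x]| <= _).
    apply: leq_sum => y; rewrite inE => /andP[yX fy].
    have := ncol_acc yX fy c0A; congr (_ < _); apply: eq_card => x.
    by rewrite !inE andbA.
  rewrite exchange_count; apply: leq_sum => x; rewrite inE => /andP[xX _].
  rewrite -ltnS q1; apply: leq_ltn_trans (degX xX); apply: subset_leq_card.
  by apply/subsetP => y; rewrite !inE => /andP[/andP[-> _] ->].
rewrite card_Bs; move: cA; case: (s) => [|s']; first by lia.
rewrite /= addn1 => -[->]; nia.
Qed.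

Lemma mv_ncol x d : x \in X -> d \in C -> d != f x -> ncol x d = 0 -> mv e X C f (f x) d.
Proof.
move=> xX dC dx /eqP; rewrite cards_eq0 => /eqP/setP n0.
rewrite /mv fC // dC eq_sym dx /=; apply/existsP; exists x; rewrite xX eqxx /=.
apply/movableP => y yX fy; have := n0 y.
by rewrite !inE yX fy eqxx /= => ->.
Qed.

Definition mvR U : rel K := fun c d => [&& mv e X C f c d, c != U & d != U].
Definition TT U : {set K} := [set c in A | (c != U) && ~~ connect (mvR U) c c0].

(** A path to c0 avoiding U cannot pass through W, since no such path starts from W. *)
Lemma avoidW U W c : W \in TT U -> connect (mvR U) c c0 -> connect (mvR W) c c0.
Proof.
rewrite inE => /and3P[_ _ nW] /connectP[p].
elim: p c => [|d p IH] c /=; first by move=> _ ->; apply: connect0.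
case/andP => /and3P[m cU dU] pth lst.
have cd : connect (mvR U) d c0 by apply/connectP; exists p.
have dW : d != W by apply: contraNneq nW => <-.
have cW : c != W.
  apply: contraNneq nW => <-; apply: connect_trans cd; apply: connect1.
  by rewrite /mvR m cU dU.
by apply: connect_trans (IH d pth lst); apply: connect1; rewrite /mvR m cW dW.
Qed.

Lemma mvR_first U : U \in A -> U != c0 ->
  exists d, [/\ mv e X C f U d, d != U & connect (mvR U) d c0].
Proof.
rewrite AE => /andP[_ /connectP[p0 pth0 lp0]]; move: pth0 lp0; case/shortenP.
case=> [|d p] /=; first by move=> _ _ _ -> /eqP.
case/andP=> m pth /andP[Up _] _ lst _; exists d; split=> //.
  by apply: contraNneq Up => ->; rewrite mem_head.
apply/connectP; exists p => //; apply: sub_tail_path pth => k l kp lp mkl.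
rewrite /mvR mkl /=; apply/andP; split; first by apply: contraNneq Up => <-.
by apply: contraNneq Up => <-; rewrite inE lp orbT.
Qed.

(** Take U whose removal cuts off as few colours as possible, but at least one. If a colour W cut
    off by U itself cut off some colour, then [TT W] would be a proper subset of [TT U], as it does
    not contain W. So a class in [TT U] can be altered while every other accessible class still
    reaches c0. *)
Lemma terminal_exists : exists U, [/\ U \in A, TT U != set0 &
  forall W c, W \in TT U -> c \in A -> c != W -> connect (mvR W) c c0].
Proof.
have T0 : (c0 \in A) && (TT c0 != set0).
  rewrite c0A; have [c cA cc0] := acc_gt1; apply/set0Pn; exists c.
  rewrite inE cA cc0 /=; apply/connectP => -[p pth lst].
  case/lastP: p pth lst => [|p d] /=; first by move=> _ E; rewrite E eqxx in cc0.
  by rewrite rcons_path last_rcons => /andP[_ /and3P[_ _ /eqP]] + E; rewrite E.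
case: (@arg_minnP _ c0 (fun U => (U \in A) && (TT U != set0)) (fun U => #|TT U|) T0) => U /andP[UA TU] minU.
exists U; split=> // W c WT cA cW; apply/negPn/negP => ncW.
have WA : W \in A by move: WT; rewrite inE => /and3P[].
have cTW : c \in TT W by rewrite inE cA cW.
have W0 : (W \in A) && (TT W != set0) by rewrite WA; apply/set0Pn; exists c.
have := minU _ W0; rewrite leqNgt => /negP; apply; apply: proper_card.
rewrite properE; apply/andP; split; last first.
  by apply/subsetPn; exists W => //; rewrite inE eqxx andbF.
apply/subsetP => d; rewrite inE => /and3P[dA dW ndW].
have [dU|dU] := eqVneq d U; last first.
  by rewrite inE dA dU /=; apply: contra ndW; apply: avoidW.
have WU : W != U by move: WT; rewrite inE => /and3P[].
have [Uc0|Uc0] := eqVneq U c0; first by case/negP: ndW; rewrite dU Uc0 connect0.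
have [d' [m d'U cd']] := mvR_first UA Uc0; case/negP: ndW.
apply: connect_trans (avoidW WT cd'); apply: connect1.
rewrite /mvR dU m eq_sym WU /=; apply: contraTneq WT => <-.
by rewrite inE cd' !andbF.
Qed.

Section Terminal.
Variable U : K.
Hypothesis TU0 : TT U != set0.
Hypothesis terminal : forall W c, W \in TT U -> c \in A -> c != W -> connect (mvR W) c c0.
Notation T := (TT U).
Notation Bc := (C :\: A).

Let TA c : c \in T -> c \in A. Proof. by rewrite inE => /and3P[]. Qed.
Let TsA : T \subset A. Proof. by apply/subsetP => c; apply: TA. Qed.
Let Tnec0 c : c \in T -> c != c0.
Proof. by rewrite inE => /and3P[_ _]; apply: contraNneq => ->; apply: connect0. Qed.

Lemma T_nbr x d : x \in X -> f x \in T -> d \in A -> d != U -> d \notin T -> 0 < ncol x d.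
Proof.
move=> xX xT dA dU dT; rewrite lt0n; apply: contraNneq dT => n0.
rewrite inE dA dU /=; apply/negP => cd; move: xT; rewrite inE => /and3P[_ xU /negP]; apply.
have [<- //|dx] := eqVneq d (f x).
apply: connect_trans cd; apply: connect1; rewrite /mvR xU dU mv_ncol //.
exact: (subsetP AC).
Qed.

(** Once such a z leaves its class, y can take its place. *)
Definition solo y z := [&& z \in X, f z \in T, e y z & ncol y (f z) == 1].

(** y has at most |C| - 1 neighbours and at least one in each accessible class; a class of T in
    which it has no solo neighbour uses up two. *)
Lemma solo_count y : y \in X -> f y \in Bc ->
  #|T| + nB y + 1 <= #|[set z | solo y z]| + #|Bc|.
Proof.
move=> yX fy; have := sum_ncol yX.
have -> : [set z | solo y z] = [set z in X | (f z \in T) && (e y z && (ncol y (f z) == 1))].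
  by apply/setP => z; rewrite !inE.
rewrite card_cols.
have -> : \sum_(c in T) #|[set z in X | (f z == c) && (e y z && (ncol y (f z) == 1))]| =
    \sum_(c in T) (ncol y c == 1).
  apply: eq_bigr => c _; case: eqP => [n1|n1].
    rewrite -[RHS]n1; apply: eq_card => z; rewrite !inE.
    by case: eqP => [->|]; rewrite ?n1 ?andbT.
  apply/eqP; rewrite cards_eq0; apply/eqP/setP => z; rewrite !inE.
  by case: (eqVneq (f z) c) => [->|_]; rewrite ?andbF //; case: eqP; rewrite ?andbF.
have -> : #|C| = #|A| + #|Bc| by rewrite -(cardsID A C) (setIidPr AC).
rewrite (big_setID T) /= (setIidPr TsA).
have H1 : #|A :\: T| <= \sum_(c in A :\: T) ncol y c.
  by rewrite -sum1_card; apply: leq_sum => c; rewrite in_setD => /andP[_ /(ncol_acc yX fy)].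
have H2 : #|T| + #|T| <= \sum_(c in T) ncol y c + \sum_(c in T) (ncol y c == 1).
  rewrite -sum1_card -!big_split; apply: leq_sum => c /TA/(ncol_acc yX fy) /=.
  by case: (ncol y c) => [|[|n]].
have := cardsID T A; rewrite (setIidPr TsA); move: H1 H2; clear; lia.
Qed.

Lemma solo_uniq y z x : solo y z -> x \in X -> f x = f z -> e y x -> x = z.
Proof.
case/and4P=> zX _ eyz /cards1P[w /setP Hw] xX fx eyx.
have := Hw z; have := Hw x; rewrite !inE zX xX fx eqxx eyz eyx /=.
by move=> /esym/eqP-> /esym/eqP->.
Qed.

(** Move z to c and y to the place of z. A path from c to c0 avoiding the class of z evens out the
    accessible classes, and the inaccessible part, which has lost y, is recoloured by induction. *)
Lemma case_movable y z c : y \in X -> f y \in Bc -> solo y z -> c \in A -> c != f z ->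
  ncol z c = 0 -> exists g, equitable e X C s g.
Proof.
move=> yX fy syz cA cz n0; have /and4P[zX zT eyz _] := syz.
have [fyA fyC] : f y \notin A /\ f y \in C by move: fy; rewrite in_setD => /andP[].
have zy : z != y by apply: contraNneq fyA => <-; apply: TA.
pose X1 := y |: [set x in X | f x \in A].
pose f1 := upd (upd f z c) y (f z).
have f1y : f1 y = f z by rewrite /f1 /upd eqxx.
have f1z : f1 z = c by rewrite /f1 /upd (negPf zy) eqxx.
have f1o x : x != y -> x != z -> f1 x = f x by rewrite /f1 /upd => /negPf-> /negPf->.
have X1X x : x \in X1 -> x \in X by rewrite !inE => /orP[/eqP->|/andP[]].
have nz x : x \in X -> f x = c -> ~~ e z x.
  move=> xX fx; move/eqP: n0; rewrite cards_eq0 => /eqP/setP/(_ x).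
  by rewrite !inE xX fx eqxx /= => ->.
have fe x x' : x \in X -> x' \in X -> e x x' -> f x != f x' by case: colf => _; apply.
have nX1 x : x \in X1 -> x != y -> f x \in A by rewrite !inE => /orP[->//|/andP[]].
have prop1 x x' : x \in X1 -> x' \in X1 -> e x x' -> x != y -> f1 x != f1 x'.
  move=> xX1 x'X1 exx' xy; have [x'y|x'y] := eqVneq x' y.
    subst x'; rewrite f1y; have [->|xz] := eqVneq x z; first by rewrite f1z.
    rewrite f1o //; apply: contraNneq xz => fx; apply/eqP.
    by apply: (solo_uniq syz) => //; [apply: X1X | rewrite e_sym].
  have [xz|xz] := eqVneq x z; have [x'z|x'z] := eqVneq x' z.
  - by move: exx'; rewrite xz x'z e_irr.
  - rewrite xz f1z f1o //; apply/eqP => fx'; move: (nz x' (X1X _ x'X1) (esym fx')).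
    by rewrite -xz exx'.
  - rewrite x'z f1z f1o //; apply/eqP => fx; move: (nz x (X1X _ xX1) fx).
    by rewrite -x'z e_sym exx'.
  - by rewrite !f1o //; apply: fe => //; apply: X1X.
have col1 : colours e X1 A f1.
  split=> [x xX1|x x' xX1 x'X1 exx'].
    have [->|xy] := eqVneq x y; first by rewrite f1y; apply: TA.
    by have [->|xz] := eqVneq x z; rewrite ?f1z // f1o //; apply: nX1.
  have [xy|xy] := eqVneq x y; last exact: prop1.
  rewrite eq_sym; apply: prop1 => //; first by rewrite e_sym.
  by apply: contraTneq exx' => ->; rewrite xy e_irr.
have zA : f z \in A by apply: TA.
have clsA d : d \in A -> cls X1 f d = cls X f d.
  move=> dA; apply/setP => x; rewrite !inE; have [->|_] := eqVneq x y; last first.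
    by case: eqP => [->|]; rewrite ?andbF // dA andbT.
  by rewrite yX; case: eqP => // E; rewrite E dA in fyA.
have cls1 d : d \in A -> #|cls X1 f1 d| + (d == f z) = #|cls X f d| + (d == c) + (d == f z).
  move=> dA; have yX1 : y \in X1 by rewrite !inE eqxx.
  have zX1 : z \in X1 by rewrite !inE zX zA orbT.
  have ncfz : f z != c by rewrite eq_sym.
  have := cls_upd d zX1 ncfz; rewrite clsA //.
  have yfz : upd f z c y != f z.
    by rewrite /upd [y == z]eq_sym (negPf zy); apply: contraNneq fyA => ->.
  have := cls_upd d yX1 yfz; rewrite -/f1.
  have -> : (d == upd f z c y) = false.
    by apply/eqP => E; move: fyA; rewrite -[f y]/(f y) (_ : f y = d) ?dA // E /upd [y == z]eq_sym (negPf zy).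
  by clear; lia.
have := terminal zT cA cz; case/connectP => p0 pth0 lp0.
move: pth0 lp0; case/shortenP => p pth up _ lp.
have pA d : d \in c :: p -> d \in A /\ d != f z.
  have: all (fun d => (d \in A) && (d != f z)) (c :: p).
    rewrite /= cA cz /=; elim: (p) (c) cA cz pth lp {up} => //= d' p' IH c' c'A c'z.
    case/andP=> /and3P[m _ d'z] pth' lst.
    have d'A : d' \in A.
      rewrite AE; case/and4P: (m) => _ -> _ _ /=; apply/connectP; exists p' => //.
      by apply: sub_path pth' => k l /and3P[].
    by rewrite d'A d'z /=; apply: (IH d').
  by move/allP => H /H/andP[].
have pth1 : path (mv e X1 A f1) c p.
  apply: sub_tail_path pth => k l kp lp' /and3P[/and4P[_ _ kl /existsP[x /and3P[xX /eqP fx /movableP mx]]] kz lz].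
  have [kA _] := pA _ kp; have [lA _] : l \in A /\ l != f z by apply: pA; rewrite inE lp' orbT.
  have lc : l != c by move: up => /= /andP[cp _]; apply: contraNneq cp => <-.
  rewrite /mv kA lA kl /=; apply/existsP; exists x.
  have xy : x != y by apply: contraNneq fyA => <-; rewrite fx.
  have xz : x != z by apply: contraNneq kz => <-; rewrite fx.
  have xX1 : x \in X1 by rewrite !inE xX fx kA orbT.
  rewrite xX1 f1o // fx eqxx /=; apply/movableP => x' x'X1.
  have [->|x'y] := eqVneq x' y; first by rewrite f1y => E; rewrite E eqxx in lz.
  have [->|x'z] := eqVneq x' z; first by rewrite f1z => E; rewrite E eqxx in lc.
  by rewrite f1o // => fx'; apply: mx => //; apply: X1X.
have [f2 [col2 _ c2]] := shift_path e_sym pth1 up col1.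
have BX : Bs :\ y \proper X.
  apply: (@sub_proper_trans _ _ (X :\ y)); last exact: properD1.
  by apply: setSD; apply/subsetP => x; rewrite inE => /andP[].
have cB : #|Bs :\ y| = #|Bc| * s.
  by have := card_Bs; rewrite (cardsD1 y) inE yX fy add1n addn1 => -[].
have dB x : x \in Bs :\ y -> #|[set x' in Bs :\ y | e x x']| < #|Bc|.
  rewrite !inE => /andP[_ /andP[xX fx]]; apply: leq_ltn_trans (nB_lt xX _).
    apply: subset_leq_card; apply/subsetP => x'; rewrite !inE.
    by case/andP=> /andP[_ /andP[-> ->]] ->.
  by rewrite in_setD.
have [g [[gC gp] gc]] := IHX BX cB dB.
exists (fun x => if x \in X1 then f2 x else g x).
have [f2C f2p] := col2.
have XX x : x \in X -> x \notin X1 -> x \in Bs :\ y.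
  by move=> xX; rewrite !inE negb_or xX fC // andbT => /andP[-> ->].
split; first split=> [x xX|x x' xX x'X exx'].
- case: ifP => xX1; first by apply: (subsetP AC); apply: f2C.
  by have := gC _ (XX _ xX (negbT xX1)); rewrite in_setD => /andP[].
- case: ifP => xX1; case: ifP => x'X1.
  + exact: f2p.
  + have := gC _ (XX _ x'X (negbT x'X1)); rewrite in_setD => /andP[nA _].
    by apply: contraNneq nA => <-; apply: f2C.
  + have := gC _ (XX _ xX (negbT xX1)); rewrite in_setD => /andP[nA _].
    by apply: contraNneq nA => ->; apply: f2C.
  + by apply: gp => //; apply: XX => //; apply: negbT.
- move=> d dC; have [dA|dA] := boolP (d \in A).
    have -> : cls X (fun x => if x \in X1 then f2 x else g x) d = cls X1 f2 d.
      apply/setP => x; rewrite inE [RHS]inE; case: ifP => xX1.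
        by rewrite X1X.
      case xX: (x \in X) => //=; apply/negP => /eqP gx.
      by have := gC _ (XX _ xX (negbT xX1)); rewrite gx in_setD dA.
    have := c2 d; have := cls1 d dA; have := cls_in_A dA; rewrite -lp; clear; lia.
  have dB' : d \in Bc by rewrite in_setD dA.
  rewrite -(gc _ dB'); apply: eq_card => x; rewrite inE [RHS]inE.
  case: ifP => xX1.
    have -> : (f2 x == d) = false by apply: contraNF dA => /eqP <-; apply: f2C.
    rewrite andbF; symmetry; apply/negP; rewrite in_setD1 inE => /andP[/andP[xy /andP[_]]].
    by rewrite in_setD (nX1 _ xX1 xy).
  case xX: (x \in X) => /=; first by rewrite XX //; apply: negbT.
  by rewrite in_setD1 inE xX andbF.
Qed.

Hypothesis nomove : forall y z c, y \in Bs -> solo y z -> c \in A -> c != f z -> 0 < ncol z c.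

Let cardC : #|C| = #|A| + #|Bc|.
Proof. by rewrite -(cardsID A C) (setIidPr AC). Qed.

Let BsX y : y \in Bs -> y \in X /\ f y \in Bc.
Proof. by rewrite inE => /andP[]. Qed.

Let nBE x : #|[set y in Bs | e x y]| = nB x.
Proof. by apply: eq_card => y; rewrite 3!inE andbA. Qed.

Let clsT W : W \in T -> #|cls X f W| = s.
Proof. by move=> WT; have := cls_in_A (TA WT); rewrite (negPf (Tnec0 WT)) addn0. Qed.

(** As z cannot be moved, it has a neighbour in every accessible class but its own. *)
Lemma solo_nB y z : y \in Bs -> solo y z -> nB z <= #|Bc|.
Proof.
move=> yB syz; have /and4P[zX zT _ _] := syz; have := sum_ncol zX.
have : #|A :\ f z| <= \sum_(c in A) ncol z c.
  rewrite (bigID (pred1 (f z))) /= addnC -sum1_card.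
  apply: leq_trans (leq_addr _ _); rewrite [leqLHS](eq_bigl (fun c => (c \in A) && (c != f z))).
    by apply: leq_sum => c /andP[cA cz]; apply: nomove syz cA cz.
  by move=> c; rewrite !inE andbC.
by have := cardsD1 (f z) A; rewrite TA // cardC; clear; lia.
Qed.

Lemma clsT_nB x : x \in X -> f x \in T -> nB x <= #|Bc| + #|T|.
Proof.
move=> xX xT; have := sum_ncol xX.
have : #|(A :\: T) :\ U| <= \sum_(c in A) ncol x c.
  rewrite (bigID [pred c | (c \notin T) && (c != U)]) /= -sum1_card.
  apply: leq_trans (leq_addr _ _); rewrite [leqLHS](eq_bigl (fun c => (c \in A) && ((c \notin T) && (c != U)))).
    by apply: leq_sum => c /and3P[cA cT cU]; apply: T_nbr.
  by move=> c; rewrite in_setD1 in_setD [RHS]andbC -andbA andbCA andbC.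
have := cardsD1 U (A :\: T); have := cardsID T A; rewrite (setIidPr TsA) cardC; clear; lia.
Qed.

(** Fix a class W of T; [S] is its set of vertices that are solo for some inaccessible vertex. An
    inaccessible y has a neighbour in [S] or two neighbours in the rest of W. A vertex of [S] has at
    most |Bc| inaccessible neighbours, any other vertex of W at most |Bc| + |T|; so |T| <= |Bc|
    would give 2 (|Bc| s + 1) <= 2 |Bc| s. *)
Lemma card_T_gt : #|Bc| < #|T|.
Proof.
have [W WT] := set0Pn _ TU0.
pose S := [set z in cls X f W | [exists y in Bs, solo y z]].
have SW : S \subset cls X f W by apply/subsetP => z; rewrite inE => /andP[].
pose D := cls X f W :\: S.
have H y : y \in Bs -> 2 <= #|[set x in D | e y x]| + 2 * #|[set z in S | e y z]|.
  move=> yB; have [yX fy] := BsX yB.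
  have [|] := posnP #|[set z in S | e y z]|; last first.
    by move=> S0; apply: leq_trans (leq_mul (leqnn 2) S0) (leq_addl _ _).
  move=> nS0; rewrite nS0 muln0 addn0; move/eqP: nS0; rewrite cards_eq0 => /eqP/setP nS.
  have n1 := ncol_acc yX fy (TA WT).
  have DE : ncol y W = #|[set x in D | e y x]|.
    apply: eq_card => x; have := nS x; rewrite !inE.
    by case: (x \in X); case: (f x == W); case: (e y x); rewrite //= ?andbT ?andbF // => ->.
  rewrite -DE ltn_neqAle n1 andbT eq_sym; apply/eqP => n1'.
  move: (n1); rewrite card_gt0 => /set0Pn[x]; rewrite !inE => /and3P[xX /eqP fx eyx].
  have xS : x \in S.
    rewrite inE inE xX fx eqxx /=; apply/exists_inP; exists y => //.
    by rewrite /solo xX fx WT eyx n1' eqxx.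
  by have := nS x; rewrite in_set xS eyx inE.
have : \sum_(y in Bs) 2 <= \sum_(y in Bs) (#|[set x in D | e y x]| + 2 * #|[set z in S | e y z]|).
  exact: leq_sum.
rewrite big_split /= -big_distrr /= exchange_count [X in _ + 2 * X]exchange_count.
have HD : \sum_(x in D) #|[set y in Bs | e x y]| <= #|D| * (#|Bc| + #|T|).
  rewrite -sum_nat_const; apply: leq_sum => x; rewrite in_setD => /andP[_].
  by rewrite inE nBE => /andP[xX /eqP fx]; apply: clsT_nB; rewrite ?fx.
have HS : \sum_(x in S) #|[set y in Bs | e x y]| <= #|S| * #|Bc|.
  rewrite -sum_nat_const; apply: leq_sum => x; rewrite inE => /andP[_ /exists_inP[y yB syx]].
  by rewrite nBE; apply: solo_nB syx.
have := cardsID S (cls X f W); rewrite (setIidPr SW) -/D clsT // => Ds.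
rewrite sum_nat_const card_Bs -Ds => H1; rewrite ltnNge; apply/negP => H2.
move: HD HS H1 H2; clear.
move: #|D| #|S| #|Bc| #|T| (\sum_(x in D) _) (\sum_(x in S) _) => a b q t x1 x2 H1 H2 H3 tq.
have : a * (q + t) <= a * (q + q) by rewrite leq_mul2l leq_add2l tq orbT.
by move: H3; rewrite !mulnDl !mulnDr; move: H1; rewrite !mulnDr [b * q]mulnC [a * q]mulnC in H2 *; lia.
Qed.

(** Let I be a maximal independent set of inaccessible vertices and suppose that no z is solo for
    two of its members. Then I has at most |T| s solo neighbours altogether, while [solo_count]
    yields at least |I| (|T| - |Bc|) plus the sum of nB y + 1 over I. By maximality this sum is at
    least |Bc| s + 1, which also forces |I| >= s: a contradiction. *)
Lemma two_solo : exists z y1 y2,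
  [/\ y1 \in Bs, y2 \in Bs, solo y1 z, solo y2 z & y1 != y2 /\ ~~ e y1 y2].
Proof.
pose bad := [exists z, exists y1 in Bs, exists y2 in Bs,
  [&& solo y1 z, solo y2 z, y1 != y2 & ~~ e y1 y2]].
have [/existsP[z /exists_inP[y1 y1B /exists_inP[y2 y2B /and4P[s1 s2 y12 e12]]]]|nbad] := boolP bad.
  by exists z, y1, y2.
pose P (J : {set V}) := (J \subset Bs) && [forall x in J, forall y in J, ~~ e x y].
have [|I /maxsetP[/andP[IB /forall_inP indI] maxI] _] := @maxset_exists _ P set0.
  by rewrite /P sub0set; apply/forall_inP => x; rewrite inE.
have cover : #|Bs| <= \sum_(y in I) (nB y + 1).
  apply: leq_trans (_ : #|\bigcup_(y in I) (y |: [set x in Bs | e y x])| <= _).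
    apply: subset_leq_card; apply/subsetP => x xB; apply/bigcupP.
    have [xI|xI] := boolP (x \in I); first by exists x; rewrite ?setU11.
    have [/exists_inP[y yI eyx]|nex] := boolP [exists y in I, e y x].
      by exists y => //; rewrite in_setU1 in_set xB eyx orbT.
    move: xI; have <- : x |: I = I; last by rewrite setU11.
    apply: maxI; last exact: subsetUr.
    rewrite /P subUset sub1set xB IB; apply/forall_inP => u uI; apply/forall_inP => v vI.
    have nxI w : w \in I -> ~~ e w x.
      by move=> wI; apply: contra nex => ewx; apply/exists_inP; exists w.
    case/setU1P: uI => [->|uI]; case/setU1P: vI => [->|vI].
    - by rewrite e_irr.
    - by rewrite e_sym; apply: nxI.
    - exact: nxI.
    - by have /forall_inP := indI u uI; apply.
  apply: leq_trans (card_bigcup_le _ _ _) _; apply: leq_sum => y _.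
  apply: leq_trans (leq_card_setU _ _) _; rewrite cards1 addnC leq_add2r.
  by rewrite nBE.
have upper : \sum_(y in I) #|[set z | solo y z]| <= #|T| * s.
  have HE y : #|[set z | solo y z]| = \sum_z (solo y z : nat).
    by rewrite -sum1dep_card big_mkcond; apply: eq_bigr => z _; case: ifP.
  under eq_bigr do rewrite HE; rewrite exchange_big /=.
  rewrite (bigID [pred z | (z \in X) && (f z \in T)]) /= [X in _ + X]big1 ?addn0; last first.
    move=> z nz; apply: big1 => y _; rewrite /solo.
    by case: (z \in X) nz => //= /negPf->.
  have -> : #|T| * s = \sum_(z | (z \in X) && (f z \in T)) 1.
    rewrite sum1dep_card; have := @card_cols X f T xpredT.
    under eq_bigr => c cT.
      have -> : [set x in X | (f x == c) && true] = cls X f c.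
        by apply/setP => x; rewrite !inE andbT.
      rewrite clsT //; over.
    by rewrite sum_nat_const => <-; apply: eq_card => x; rewrite !inE andbT.
  apply: leq_sum => z _.
  have -> : \sum_(y in I) (solo y z : nat) = #|[set y in I | solo y z]|.
    by rewrite -sum1dep_card big_mkcondr; apply: eq_bigr => y _; case: ifP.
  rewrite leqNgt; apply: contra nbad => /card_gt1P[y1 [y2 []]].
  rewrite !inE => /andP[y1I s1] /andP[y2I s2] y12.
  apply/existsP; exists z; apply/exists_inP; exists y1; first exact: (subsetP IB).
  apply/exists_inP; exists y2; first exact: (subsetP IB).
  by rewrite s1 s2 y12 /=; have /forall_inP := indI y1 y1I; apply.
have lower : \sum_(y in I) (#|T| + nB y + 1) <= \sum_(y in I) (#|[set z | solo y z]| + #|Bc|).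
  by apply: leq_sum => y /(subsetP IB)/BsX[yX fy]; apply: solo_count.
have Iq : \sum_(y in I) (nB y + 1) <= #|I| * #|Bc|.
  by rewrite -sum_nat_const; apply: leq_sum => y /(subsetP IB)/BsX[yX fy]; rewrite addn1 nB_lt.
have := card_T_gt; move: cover upper lower Iq; rewrite card_Bs.
have -> : \sum_(y in I) (#|T| + nB y + 1) = #|I| * #|T| + \sum_(y in I) (nB y + 1).
  by rewrite -sum_nat_const -big_split /=; apply: eq_bigr => y _; rewrite addnA.
set x1 := \sum_(y in I) (nB y + 1); rewrite big_split /= sum_nat_const => H1 H2 H3 H4 H5.
exfalso; move: H1 H2 H3 H4 H5; move: x1 #|I| #|Bc| #|T| (\sum_(i in I) _) s; clear.
move=> x1 i q t x3 s0 H1 H2 H3 H4 qt.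
have si : s0 <= i.
  rewrite leqNgt; apply/negP => /ltnW is0; have := leq_mul is0 (leqnn q).
  by move: H1 H4; rewrite [q * s0]mulnC; lia.
have : s0 * (t - q) <= i * (t - q) by rewrite leq_mul2r si orbT.
rewrite !mulnBr; have := leq_mul (leqnn s0) (ltnW qt); have := leq_mul (leqnn i) (ltnW qt).
by move: H1 H2 H3 H4; rewrite [q * s0]mulnC [t * s0]mulnC; lia.
Qed.


(** y1 takes the place of z, the inaccessible part without y1 is recoloured by induction, and z
    joins one of its classes, which becomes the class with s + 1 vertices. The accessible colours
    remain accessible, and the new colour of y2 joins them: z was the only neighbour of y2 in its
    class, and y1 is not adjacent to y2. *)
Lemma case_stuck : exists f' c', nearly f' c0 c' /\ #|C :\: acc f' c0| < #|Bc|.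
Proof.
have [z [y1 [y2 [y1B y2B s1 s2 [y12 e12]]]]] := two_solo.
have [y1X fy1] := BsX y1B; have [y2X fy2] := BsX y2B.
have /and4P[zX zT ey1z _] := s1; have zA := TA zT.
have c0W : c0 != f z by rewrite eq_sym; apply: Tnec0.
have BX : Bs :\ y1 \proper X.
  apply: (@sub_proper_trans _ _ (X :\ y1)); last exact: properD1.
  by apply: setSD; apply/subsetP => x; rewrite inE => /andP[].
have cB : #|Bs :\ y1| = #|Bc| * s.
  by have := card_Bs; rewrite (cardsD1 y1) y1B add1n addn1 => -[].
have dB x : x \in Bs :\ y1 -> #|[set x' in Bs :\ y1 | e x x']| < #|Bc|.
  rewrite in_setD1 => /andP[_ /BsX[xX fx]]; apply: leq_ltn_trans (nB_lt xX fx).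
  rewrite -nBE; apply: subset_leq_card; apply/subsetP => x'.
  by rewrite in_set in_setD1 -andbA => /and3P[_ xB' exx']; rewrite in_set xB' exx'.
have [g [[gC gp] gc]] := IHX BX cB dB.
(* z has at most |Bc| inaccessible neighbours and y1 is one of them, so one of the |Bc| new classes
   contains none. *)
have [c' c'B nc'] : exists2 c', c' \in Bc &
    [forall x in Bs :\ y1, (g x == c') ==> ~~ e z x].
  apply/exists_inP; apply: contraT; rewrite negb_exists_in => /forall_inP nex.
  have : #|Bc| <= #|[set x in Bs :\ y1 | e z x]|.
    have -> : [set x in Bs :\ y1 | e z x] = [set x in Bs :\ y1 | (g x \in Bc) && e z x].
      by apply/setP => x; rewrite in_set [RHS]in_set; case xB: (x \in Bs :\ y1); rewrite //= gC.
    rewrite card_cols -sum1_card; apply: leq_sum => c cB'.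
    have := nex c cB'; rewrite negb_forall_in => /exists_inP[x xB].
    rewrite negb_imply negbK => /andP[gx ezx]; rewrite card_gt0; apply/set0Pn; exists x.
    by rewrite in_set xB gx.
  have := solo_nB y1B s1; rewrite -nBE (cardsD1 y1) in_set y1B e_sym ey1z /= => H1 H2.
  have := leq_trans H1 H2; rewrite add1n ltnNge => /negP; case; apply: subset_leq_card.
  by apply/subsetP => x; rewrite in_set !in_setD1 in_set andbA.
have {}nc' x : x \in Bs :\ y1 -> g x = c' -> ~~ e z x.
  by move=> xB gx; move/forall_inP: nc' => /(_ x xB); rewrite gx eqxx.
pose h x := if x == z then c' else if x == y1 then f z else if f x \in A then f x else g x.
have y1A : f y1 \notin A by move: fy1; rewrite in_setD => /andP[].
have zy1 : z != y1 by apply: contraNneq y1A => <-.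
have hz : h z = c' by rewrite /h eqxx.
have hy1 : h y1 = f z by rewrite /h eq_sym (negPf zy1) eqxx.
have hA x : x != z -> f x \in A -> h x = f x.
  move=> xz xA; rewrite /h (negPf xz) xA; case: eqP => // E; by rewrite -E xA in y1A.
have hB x : x \in Bs :\ y1 -> h x = g x.
  rewrite in_setD1 => /andP[xy1 /BsX[xX]]; rewrite in_setD => /andP[xA _].
  by rewrite /h (negPf xy1) (negPf xA); case: eqP => // E; rewrite E zA in xA.
have cases x : x \in X -> [\/ x = z, x = y1, x != z /\ f x \in A | x \in Bs :\ y1].
  move=> xX; have [->|xz] := eqVneq x z; first by constructor 1.
  have [->|xy1] := eqVneq x y1; first by constructor 2.
  have [xA|xA] := boolP (f x \in A); first by constructor 3.
  by constructor 4; rewrite in_setD1 xy1 in_set xX in_setD xA fC.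
have [c'A c'C] : c' \notin A /\ c' \in C by move: c'B; rewrite in_setD => /andP[].
have gA x : x \in Bs :\ y1 -> g x \notin A by move/gC; rewrite in_setD => /andP[].
have fe x x' : x \in X -> x' \in X -> e x x' -> f x != f x' by case: colf => _; apply.
have half x x' : x \in X -> x' \in X -> e x x' -> (h x \in A) || (x != z) && (h x' \notin A) ->
    x != y1 -> h x != h x'.
  move=> xX x'X exx' sd xy1; have [xz|xz|[xz xA]|xB] := cases x xX.
  - by move: sd; rewrite xz hz (negPf c'A) eqxx.
  - by rewrite xz eqxx in xy1.
  - have [x'z|x'z|[x'z x'A]|x'B] := cases x' x'X.
    + by rewrite x'z hz hA //; apply: contraNneq c'A => <-.
    + rewrite x'z hy1 hA //; apply/eqP => fx; case/eqP: xz.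
      by apply: (solo_uniq s1) => //; rewrite e_sym -x'z.
    + by rewrite !hA //; apply: fe.
    + by rewrite hA // hB //; apply: contraNneq (gA _ x'B) => <-.
  - have [x'z|x'z|[x'z x'A]|x'B] := cases x' x'X.
    + rewrite x'z hz hB //; apply/eqP => gx; have := nc' x xB gx.
      by rewrite e_sym -x'z exx'.
    + by rewrite x'z hy1 hB //; apply: contraNneq (gA _ xB) => ->.
    + by rewrite [h x']hA // hB //; apply: contraNneq (gA _ xB) => ->.
    + by rewrite !hB //; apply: gp.
have hval x : x \in X -> (h x \in A) = (x == y1) || (x != z) && (f x \in A).
  move=> xX; have [->|->|[xz xA]|xB] := cases x xX.
  - by rewrite hz (negPf c'A) eqxx (negPf zy1).
  - by rewrite hy1 eqxx zA.
  - by rewrite hA // xA xz orbT.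
  - rewrite hB // (negPf (gA _ xB)); move: xB; rewrite in_setD1 => /andP[/negPf-> /BsX[_]].
    by rewrite in_setD => /andP[/negPf->]; rewrite andbF.
have colh : colours e X C h.
  split=> [x xX|x x' xX x'X exx'].
    have [->|->|[xz xA]|xB] := cases x xX.
    - by rewrite hz.
    - by rewrite hy1; apply: (subsetP AC).
    - by rewrite hA //; apply: (subsetP AC).
    by rewrite hB //; have := gC x xB; rewrite in_setD => /andP[].
  have ex'x : e x' x by rewrite e_sym.
  have [xy1|xy1] := eqVneq x y1.
    have x'y1 : x' != y1 by apply: contraTneq exx' => ->; rewrite xy1 e_irr.
    rewrite eq_sym; have [x'z|x'z] := eqVneq x' z.
      by rewrite x'z xy1 hz hy1; apply: contraNneq c'A => ->.
    rewrite eq_sym; have [hA'|hA'] := boolP (h x' \in A).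
      by rewrite eq_sym; apply: half; rewrite ?hA'.
    by apply: contraNneq hA' => <-; rewrite xy1 hy1.
  have [xA|xA] := boolP (h x \in A); first by apply: half; rewrite ?xA.
  have [x'A|x'A] := boolP (h x' \in A); first by apply: contraNneq xA => ->.
  have [xz|xz] := eqVneq x z; last by apply: half; rewrite ?xz ?x'A ?orbT.
  have x'z : x' != z by apply: contraTneq exx' => ->; rewrite xz e_irr.
  have x'y1 : x' != y1 by apply: contraNneq x'A => ->; rewrite hy1.
  by rewrite eq_sym; apply: half; rewrite ?x'z ?xA ?orbT.
have clsAh c : c \in A -> #|cls X h c| = #|cls X f c|.
  move=> cA; have fzc' : f z != c' by apply: contraNneq c'A => <-.
  have H1 := cls_upd c zX fzc'.
  have fy1z : upd f z c' y1 != f z.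
    by rewrite /upd [y1 == z]eq_sym (negPf zy1); apply: contraNneq y1A => ->.
  have H2 := cls_upd c y1X fy1z.
  have E1 : (c == c') = false by apply: contraNF c'A => /eqP <-.
  have E2 : (c == upd f z c' y1) = false.
    by rewrite /upd [y1 == z]eq_sym (negPf zy1); apply: contraNF y1A => /eqP <-.
  have -> : cls X h c = cls X (upd (upd f z c') y1 (f z)) c.
    apply/setP => x; rewrite in_set [RHS]in_set; case xX: (x \in X) => //=.
    have [->|->|[xz xA]|xB] := cases x xX.
    + by rewrite hz /upd (negPf zy1) eqxx.
    + by rewrite hy1 /upd eqxx.
    + rewrite hA // /upd (negPf xz); have [E|//] := eqVneq x y1; by rewrite -E xA in y1A.
    + rewrite hB // /upd; move: (xB); rewrite in_setD1 => /andP[/negPf-> /BsX[_]].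
      rewrite in_setD => /andP[xA _]; have -> : (x == z) = false.
        by apply: contraNF xA => /eqP ->.
      have -> : (f x == c) = false by apply: contraNF xA => /eqP ->.
      by apply: contraNF (gA _ xB) => /eqP ->.
  by move: H1 H2; rewrite E1 E2; clear; lia.
have nearh : nearly h c0 c'.
  split=> //; first by apply: contraNneq c'A => <-.
  move=> c cC; have [cA|cA] := boolP (c \in A).
    rewrite clsAh // cls_in_A //; have -> : (c == c') = false by apply: contraNF c'A => /eqP <-.
    by rewrite addn0.
  have -> : (c == c0) = false by apply: contraNF cA => /eqP ->.
  have cB' : c \in Bc by rewrite in_setD cA.
  have zB : z \notin Bs :\ y1 by rewrite in_setD1 in_set in_setD zA /= !andbF.
  have -> : cls X h c = [set x in X | (x == z) && (c == c')] :|: cls (Bs :\ y1) g c.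
    apply/setP => x; rewrite in_setU in_set in_set [X in _ || X]in_set; case xX: (x \in X) => /=; last first.
      by rewrite in_setD1 in_set xX andbF.
    have [E|E|[xz xA]|xB] := cases x xX.
    + by rewrite E hz (negPf zB) eqxx orbF eq_sym.
    + rewrite E hy1 in_setD1 eqxx [y1 == z]eq_sym (negPf zy1) /=.
      by apply: contraNF cA => /eqP <-.
    + rewrite hA // (negPf xz) /=; have -> : (x \in Bs :\ y1) = false.
        by rewrite in_setD1 in_set in_setD xA /= !andbF.
      by apply: contraNF cA => /eqP <-.
    + rewrite hB // xB /=; have -> // : (x == z) = false.
      by apply: contraNF zB => /eqP <-.
  rewrite addn0 cardsU; have [cc'|cc'] := eqVneq c c'.
    have -> : [set x in X | (x == z) && true] = [set z].
      by apply/setP => x; rewrite in_set in_set1 andbT; case: eqP => [->|_]; rewrite ?zX ?andbF.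
    have -> : [set z] :&: cls (Bs :\ y1) g c = set0.
      apply/setP => x; rewrite in_setI in_set1 in_set [RHS]in_set.
      by case: eqP => // ->; rewrite (negPf zB).
    by rewrite cards0 cards1 gc // subn0 addnC.
  have -> : [set x in X | (x == z) && false] = set0.
    by apply/setP => x; rewrite !in_set andbF andbF.
  by rewrite set0I cards0 gc // addn0 subn0 add0n.
exists h, c'; split=> //.
have mov x d : d \in A -> d != f z -> movable e X f x d -> movable e X h x d.
  move=> dA dz /movableP mx; apply/movableP => y yX hy; apply: mx => //.
  have [E|E|[xz xA]|xB] := cases y yX.
  - by move: dA; rewrite -hy E hz (negPf c'A).
  - by move: dz; rewrite -hy E hy1 eqxx.
  - by rewrite -hy hA.
  - by move: dA; rewrite -hy hB // (negPf (gA _ xB)).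
have mvh d d' : d \in A -> d != f z -> d' \in A -> d' != f z ->
    mv e X C f d d' -> mv e X C h d d'.
  move=> dA dz d'A d'z /and4P[dC d'C dd' /existsP[x /and3P[xX /eqP fx mx]]].
  rewrite /mv dC d'C dd' /=; apply/existsP; exists x; rewrite xX mov //= andbT.
  by rewrite hA ?fx //; apply: contraNneq dz => <-; rewrite fx.
have sub k l : connect (mvR (f z)) k l -> connect (mv e X C f) k l.
  by apply: connect_sub => u v /and3P[m _ _]; apply: connect1.
have accT d : d \in A -> d != f z -> connect (mv e X C h) d c0.
  move=> dA dz; case/connectP: (terminal zT dA dz) => p.
  elim: p d dA dz => [|d' p IH] d dA dz /=; first by move=> _ ->; apply: connect0.
  case/andP=> /and3P[m _ d'z] pth lst.
  have d'A : d' \in A.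
    rewrite AE; case/and4P: (m) => _ -> _ _ /=; apply: sub; apply/connectP.
    by exists p.
  by apply: connect_trans (IH d' d'A d'z pth lst); apply: connect1; apply: mvh.
have accW : connect (mv e X C h) (f z) c0.
  have [|d [m dz cd]] := mvR_first zA; first by rewrite eq_sym.
  have dA : d \in A by rewrite AE; case/and4P: (m) => _ -> _ _ /=; apply: sub.
  apply: connect_trans (accT d dA dz); apply: connect1.
  case/and4P: m => WC dC Wd /existsP[w /and3P[wX /eqP fw mw]].
  have wz : w != z.
    apply/eqP => wz; have := nomove y1B s1 dA dz; rewrite lt0n => /negP; apply.
    rewrite cards_eq0; apply/eqP/setP => x; rewrite in_set [RHS]in_set.
    apply/negP => /and3P[xX /eqP fx ezx]; move/movableP: mw => /(_ x xX fx).
    by rewrite wz ezx.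
  rewrite /mv WC dC Wd /=; apply/existsP; exists w; rewrite wX mov //= andbT.
  by rewrite hA // fw.
have y2B' : y2 \in Bs :\ y1 by rewrite in_setD1 eq_sym y12.
have accy2 : connect (mv e X C h) (g y2) c0.
  apply: connect_trans accW; apply: connect1.
  have gy2C : g y2 \in C by have := gC y2 y2B'; rewrite in_setD => /andP[].
  rewrite /mv gy2C (subsetP AC) //=; apply/andP; split.
    by apply: contraNneq (gA _ y2B') => ->.
  apply/existsP; exists y2; rewrite y2X hB // eqxx /=; apply/movableP => x xX hx.
  have [E|E|[xz xA]|xB] := cases x xX.
  - by move: zA; rewrite -hx E hz (negPf c'A).
  - by rewrite E e_sym.
  - have fx : f x = f z by rewrite -hA.
    by apply: contra xz => ey2x; apply/eqP; apply: (solo_uniq s2).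
  - by move: zA; rewrite -hx hB // (negPf (gA _ xB)).
apply: proper_card; rewrite properE; apply/andP; split.
  apply/subsetP => c; rewrite in_setD in_set => /andP[nc cC]; rewrite in_setD cC andbT.
  apply: contra nc => cA; rewrite cC /=; have [->|cz] := eqVneq c (f z) => //.
  exact: accT.
apply/subsetPn; exists (g y2); first exact: gC.
have gy2C : g y2 \in C by have := gC y2 y2B'; rewrite in_setD => /andP[].
by rewrite in_setD in_set gy2C accy2.
Qed.
End Terminal.
End Fixed.

(** Induction on the number of inaccessible colours, which [case_stuck] lowers. *)
Lemma nearly_equitable f c0 c1 : nearly f c0 c1 -> exists g, equitable e X C s g.
Proof.
have [n] := ubnP #|C :\: acc f c0|; elim: n f c0 c1 => // n IH f c0 c1 le_n nf.
have [c1acc|c1acc] := boolP (c1 \in acc f c0); first exact: nearly_shift nf c1acc.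
have AE c : (c \in acc f c0) = (c \in C) && connect (mv e X C f) c c0 by rewrite inE.
move: (acc f c0) AE c1acc le_n => A AE c1acc le_n.
have [U [UA TU0 term]] := terminal_exists nf AE c1acc.
have [/existsP[y /existsP[z /existsP[c /and5P[yB syz cA cz /eqP n0]]]]|nex] :=
    boolP [exists y, exists z, exists c, [&& y \in Bs f A, solo f c0 A U y z, c \in A, c != f z & ncol f z c == 0]].
  move: (yB); rewrite inE => /andP[yX fy].
  exact: (case_movable nf AE c1acc term yX fy syz cA cz n0).
have nomove y z c : y \in Bs f A -> solo f c0 A U y z -> c \in A -> c != f z -> 0 < ncol f z c.
  move=> yB syz cA cz; rewrite lt0n; apply: contra nex => n0.
  apply/existsP; exists y; apply/existsP; exists z; apply/existsP; exists c.
  by rewrite yB syz cA cz.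
have [f' [c' [nf' lt]]] := case_stuck nf AE c1acc TU0 term nomove.
by apply: IH nf'; apply: leq_trans lt _; rewrite -ltnS.
Qed.

End NearlyEquitable.

Lemma equipartition (k0 : K) X C s : #|X| = #|C| * s ->
  exists f : V -> K, (forall x, x \in X -> f x \in C) /\ forall c, c \in C -> #|cls X f c| = s.
Proof.
have [n] := ubnP #|C|; elim: n X C => // n IH X C le_n cX.
have [C0|[c cC]] := set_0Vmem C.
  exists (fun=> k0); split=> [x|c]; last by rewrite C0 inE.
  by move: cX; rewrite C0 cards0 mul0n => /eqP; rewrite cards_eq0 => /eqP ->; rewrite inE.
pose S := [set x in take s (enum X)].
have sX : s <= #|X| by rewrite cX (cardsD1 c) cC mulnDl mul1n leq_addr.
have cS : #|S| = s.
  rewrite cardsE; have /card_uniqP -> : uniq (take s (enum X)) by rewrite take_uniq ?enum_uniq.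
  by rewrite size_take -cardE; case: ltngtP sX.
have SX : S \subset X by apply/subsetP => x; rewrite inE => /mem_take; rewrite mem_enum.
have [|| f [fC fs]] := IH (X :\: S) (C :\ c).
- by move: le_n; rewrite (cardsD1 c C) cC add1n ltnS.
- rewrite cardsD (setIidPr SX) cX cS (cardsD1 c C) cC mulnDl mul1n; lia.
exists (fun x => if x \in S then c else f x); split=> [x xX|d dC].
  case: ifP => // xS; have := fC x; rewrite in_setD xS xX => /(_ isT).
  by rewrite in_setD1 => /andP[].
have [->|dc] := eqVneq d c.
  rewrite -cS; apply: eq_card => x; rewrite in_set; case: ifP => xS.
    by rewrite eqxx (subsetP SX).
  case xX: (x \in X) => //=; have := fC x; rewrite in_setD xS xX => /(_ isT).
  by rewrite in_setD1 => /andP[/negPf->].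
rewrite -(fs d) ?in_setD1 ?dc //; apply: eq_card => x; rewrite in_set [RHS]in_set in_setD.
by case: ifP => xS //=; rewrite eq_sym (negPf dc) andbF.
Qed.

(* Edges are released one vertex at a time: each new vertex either keeps the
   colouring proper or can be moved, which leaves a nearly equitable colouring. *)
Theorem hajnal_szemeredi (k0 : K) (e : rel V) X C s :
    symmetric e -> irreflexive e -> #|X| = #|C| * s ->
    (forall x, x \in X -> #|[set y in X | e x y]| < #|C|) ->
  exists f, equitable e X C s f.
Proof.
have [n] := ubnP #|X|; elim: n e X C => // n IH e X C le_n e_sym e_irr cX degX.
pose r (ys : seq V) : rel V := fun x y => [&& e x y, x \in ys & y \in ys].
have r_sym ys : symmetric (r ys).
  by move=> x y; rewrite /r e_sym [(x \in ys) && _]andbC.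
have r_irr ys : irreflexive (r ys) by move=> x; rewrite /r e_irr.
have degr ys x : x \in X -> #|[set y in X | r ys x y]| < #|C|.
  move=> xX; apply: leq_ltn_trans (degX x xX); apply: subset_leq_card.
  by apply/subsetP => y; rewrite !inE => /and4P[-> ->].
suff H ys : exists f, equitable (r ys) X C s f.
  have [f [[fC fp] fs]] := H (enum V); exists f; split=> //; split=> // x y xX yX exy.
  by apply: fp => //; rewrite /r exy !mem_enum.
elim: ys => [|u ys [f [[fC fp] fs]]].
  have [f [fC fs]] := equipartition k0 cX; exists f; split=> //; split=> // x y _ _.
  by rewrite /r in_nil andbF.
have [uX|uX] := boolP (u \in X); last first.
  exists f; split=> //; split=> // x y xX yX /and3P[exy].
  rewrite !inE; case/orP=> [/eqP E|xs]; first by rewrite E (negPf uX) in xX.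
  case/orP=> [/eqP E|ys']; first by rewrite E (negPf uX) in yX.
  by apply: fp => //; rewrite /r exy xs ys'.
have [uys|uys] := boolP (u \in ys).
  exists f; split=> //; split=> // x y xX yX /and3P[exy xs ys'].
  apply: fp => //; rewrite /r exy /=; move: xs ys'; rewrite !inE.
  by case/orP=> [/eqP->|->]; case/orP=> [/eqP->|->]; rewrite ?uys.
pose r' := r (u :: ys).
have old x y : x != u -> y != u -> r' x y -> r ys x y.
  by move=> xu yu; rewrite /r' /r !inE (negPf xu) (negPf yu).
have [/existsP[y /and3P[yX ruy fuy]]|nex] := boolP [exists y, [&& y \in X, r' u y & f y == f u]]; last first.
  have ok y : y \in X -> r' u y -> f u != f y.
    move=> yX ruy; apply: contra nex => fuy; apply/existsP; exists y.
    by rewrite yX ruy eq_sym.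
  exists f; split=> //; split=> // x y xX yX rxy.
  have [xu|xu] := eqVneq x u; first by rewrite xu ok // -xu.
  have [yu|yu] := eqVneq y u; last exact: fp (old _ _ _ _ rxy).
  by subst y; rewrite eq_sym; apply: ok => //; rewrite /r' r_sym.
have [c1 c1C free] : exists2 c1, c1 \in C & [forall y in X, r' u y ==> (f y != c1)].
  apply/exists_inP; apply: contraT; rewrite negb_exists_in => /forall_inP nf.
  suff : #|C| <= #|[set y in X | r' u y]| by rewrite leqNgt degr.
  have -> : [set y in X | r' u y] = [set y in X | (f y \in C) && r' u y].
    by apply/setP => x; rewrite !inE; case xX: (x \in X); rewrite //= fC.
  rewrite card_cols -sum1_card; apply: leq_sum => c cC.
  have := nf c cC; rewrite negb_forall_in => /exists_inP[x xX].
  rewrite negb_imply negbK => /andP[rux fx]; rewrite card_gt0; apply/set0Pn; exists x.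
  by rewrite inE xX fx.
have {}free x : x \in X -> r' u x -> f x != c1.
  by move=> xX rux; move/forall_inP: free => /(_ x xX); rewrite rux.
have fuc1 : f u != c1 by have := free y yX ruy; rewrite (eqP fuy).
have IHX X' (C' : {set K}) : X' \proper X -> #|X'| = #|C'| * s ->
    (forall x, x \in X' -> #|[set y in X' | r' x y]| < #|C'|) ->
    exists g, equitable r' X' C' s g.
  move=> X'X cX' dX'; apply: IH => //; last exact: r_irr.
    by apply: leq_trans (proper_card X'X) _; rewrite -ltnS.
  exact: r_sym.
apply: (@nearly_equitable r' X C s (r_sym _) (r_irr _) (degr _) IHX (upd f u c1) (f u) c1).
split=> //; last 1 first.
- by move=> c cC; have := cls_upd c uX fuc1; rewrite fs // => ->.
- split=> [x xX|x z xX zX rxz]; first by rewrite /upd; case: eqP => // _; apply: fC.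
  rewrite /upd; have [xu|xu] := eqVneq x u; have [zu|zu] := eqVneq z u.
  + by move: rxz; rewrite /r' xu zu r_irr.
  + by rewrite eq_sym free // -xu.
  + by subst z; apply: free => //; rewrite /r' r_sym.
  + by apply: fp => //; apply: old.
- exact: fC.
Qed.
End EquitableColouring.

(** * Tilings of neighbourhoods *)

Section SetBijections.
Variables W V : finType.

Lemma bij_sets (A : {set W}) (B : {set V}) (v0 : V) : #|A| = #|B| ->
  exists g : {ffun W -> V}, {in A &, injective g} /\ g @: A = B.
Proof.
move=> cAB; exists [ffun x => nth v0 (enum B) (index x (enum A))].
have idx x : x \in A -> index x (enum A) < #|B|.
  by move=> xA; rewrite -cAB cardE index_mem mem_enum.
have inj : {in A &, injective [ffun x => nth v0 (enum B) (index x (enum A))]}.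
  move=> x y xA yA; rewrite !ffunE => /eqP.
  rewrite nth_uniq ?enum_uniq -?cardE ?idx // => /eqP E.
  by have := congr1 (nth x (enum A)) E; rewrite !nth_index ?mem_enum.
split=> //; apply/eqP; rewrite eqEcard (card_in_imset inj) cAB leqnn andbT.
apply/subsetP => _ /imsetP[x xA ->]; rewrite ffunE -mem_enum mem_nth // -cardE.
exact: idx.
Qed.

Lemma bij_sets2 (A : {set W}) (B : {set V}) (a b : W) (p q : V) :
    #|A| = #|B| -> a \in A -> b \in A -> a != b -> p \in B -> q \in B -> p != q ->
  exists g : {ffun W -> V}, [/\ {in A &, injective g}, g @: A = B, g a = p & g b = q].
Proof.
move=> cAB aA bA ab pB qB pq.
have [g0 [inj0 im0]] := bij_sets p cAB.
pose g1 := [ffun x => tperm (g0 a) p (g0 x)].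
have im1 x : x \in A -> g1 x \in B.
  move=> xA; rewrite ffunE; case: tpermP => [_|_|_ _] //.
    by rewrite -im0 imset_f.
  by rewrite -im0 imset_f.
have inj1 : {in A &, injective g1}.
  by move=> x y xA yA; rewrite !ffunE => /perm_inj; apply: inj0.
have g1a : g1 a = p by rewrite ffunE tpermL.
pose g2 := [ffun x => tperm (g1 b) q (g1 x)].
have inj2 : {in A &, injective g2}.
  by move=> x y xA yA; rewrite [g2 x]ffunE [g2 y]ffunE => /perm_inj; apply: inj1.
exists g2; split=> //.
- apply/eqP; rewrite eqEcard (card_in_imset inj2) cAB leqnn andbT.
  apply/subsetP => _ /imsetP[x xA ->]; rewrite ffunE; case: tpermP => [_|_|_ _] //; exact: im1.
- rewrite ffunE g1a tpermD // ?[q == p]eq_sym //.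
  by rewrite -g1a; apply: contraNneq ab => /inj1-> //.
- by rewrite ffunE tpermL.
Qed.
End SetBijections.

Lemma ex_subset (V : finType) (S : {set V}) m : m <= #|S| ->
  exists2 T : {set V}, T \subset S & #|T| = m.
Proof.
move=> mS; exists [set x in take m (enum S)].
  by apply/subsetP => x; rewrite inE => /mem_take; rewrite mem_enum.
rewrite cardsE; have /card_uniqP -> : uniq (take m (enum S)) by rewrite take_uniq ?enum_uniq.
by rewrite size_take -cardE; case: ltngtP mS.
Qed.

Section Tilings.
Variables (VF V : finType) (EF : {set {set VF}}) (N : {set VF}) (E : {set {set V}}).

(** A copy of F[N], where N will be the neighbourhood of a vertex of F. Only the values on N count;
    finite functions are used so that tiles can be listed. *)
Definition tile (g : {ffun VF -> V}) := {in N &, injective g} /\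
  forall x y, x \in N -> y \in N -> y \in enb EF x -> g y \in enb E (g x).

Definition tiling (S : {set V}) (gs : seq {ffun VF -> V}) :=
  [/\ forall g, g \in gs -> tile g,
      pairwise (fun g g' : {ffun VF -> V} => [disjoint g @: N & g' @: N]) gs
    & \bigcup_(g <- gs) g @: N = S].

Lemma tiling_classes (S : {set V}) (K : finType) (C : {set K}) (Q : K -> {set V}) :
    (forall c d, c \in C -> d \in C -> c != d -> [disjoint Q c & Q d]) ->
    \bigcup_(c in C) Q c = S ->
    (forall c, c \in C -> exists g, tile g /\ g @: N = Q c) ->
  exists gs, tiling S gs.
Proof.
move=> dis <- tiles; rewrite -big_enum /=.
have : {subset enum C <= C} by move=> c; rewrite mem_enum.
elim: (enum C) (enum_uniq C) => [|c s IH] /=.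
  by exists [::]; split=> //; rewrite !big_nil.
case/andP=> cs us sC; have [|gs [tgs pw un]] := IH us.
  by move=> d ds; apply: sC; rewrite inE ds orbT.
have cC : c \in C by apply: sC; rewrite mem_head.
have [g [tg gQ]] := tiles c cC; exists (g :: gs); split.
- by move=> h; rewrite inE => /orP[/eqP->|/tgs].
- rewrite /= pw andbT; apply/allP => h hgs.
  have hsub : h @: N \subset \bigcup_(d <- s) Q d.
    by rewrite -un (big_rem h) //= subsetUl.
  apply: disjointWr hsub _; rewrite gQ; apply: disjoint_bigcup_seq => d ds.
  apply: dis => //; first by apply: sC; rewrite inE ds orbT.
  by apply: contraNneq cs => ->.
- by rewrite !big_cons un gQ.
Qed.

(** The classes of an equitable colouring of the complement with |S| / |N| colours are cliques of
    size |N|. The vertex x is itself counted in [S :\: enb E x], which makes the bound on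
    complementary degrees strict. *)
Lemma clique_tiling (S : {set V}) : 0 < #|N| -> #|N| %| #|S| ->
    (forall x, x \in S -> #|S :\: enb E x| * #|N| <= #|S|) ->
  exists gs, tiling S gs.
Proof.
move=> N0 rS dS; have [S0|[v0 v0S]] := set_0Vmem S.
  by exists [::]; split=> //; rewrite big_nil S0.
pose m := #|S| %/ #|N|.
have cS : #|S| = m * #|N| by rewrite divnK.
have [C CS cC] : exists2 C : {set V}, C \subset S & #|C| = m.
  by apply: ex_subset; rewrite leq_div.
pose e : rel V := fun x y => (x != y) && (y \notin enb E x).
have e_sym : symmetric e by move=> x y; rewrite /e eq_sym enb_sym.
have e_irr : irreflexive e by move=> x; rewrite /e eqxx.
have [||f [[fC fp] fs]] := @hajnal_szemeredi V V v0 e S C #|N| e_sym e_irr.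
- by rewrite cC.
- move=> x xS; rewrite cC -(ltn_pmul2r N0) -cS; apply: leq_trans (dS x xS).
  rewrite ltn_pmul2r // (cardsD1 x (S :\: _)) in_setD xS enbxx /= add1n ltnS.
  by apply: subset_leq_card; apply/subsetP => y; rewrite !inE /e in_enb eq_sym => /and3P[-> -> ->].
apply: (@tiling_classes S V C (cls S f)).
- move=> c d cC' dC cd; rewrite -setI_eq0; apply/eqP/setP => x; rewrite !inE.
  by apply/negP => /andP[/andP[_ /eqP->]]; rewrite (negPf cd) andbF.
- apply/setP => x; apply/bigcupP/idP => [[c _]|xS]; first by rewrite inE => /andP[].
  by exists (f x); rewrite ?fC // inE xS eqxx.
- move=> c cC'; have [|g [gi gN]] := @bij_sets VF V N (cls S f c) v0; first by rewrite fs.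
  exists g; split=> //; split=> // x y xN yN yx.
  have gx : g x \in cls S f c by rewrite -gN imset_f.
  have gy : g y \in cls S f c by rewrite -gN imset_f.
  move: gx gy; rewrite !inE => /andP[gxS /eqP fx] /andP[gyS /eqP fy].
  have ne : g x != g y by apply: contraTneq yx => /gi-> //; rewrite enbxx.
  have := fp _ _ gxS gyS; rewrite fx fy eqxx /e ne /= in_enb.
  by move=> H; apply/negPn/negP => /H.
Qed.
End Tilings.

(** Take a permutation with as many pairs in b as possible. A pair outside b could be repaired by
    one swap, since on either side fewer than half of the elements are excluded as partners. *)
Lemma perm_matching (V : finType) (S : {set V}) (b : rel V) :
    (forall x, x \in S -> 2 * #|[set y in S | ~~ b x y]| < #|S|) ->
    (forall y, y \in S -> 2 * #|[set x in S | ~~ b x y]| < #|S|) ->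
  exists h : {perm V}, forall x, x \in S -> h x \in S /\ b x (h x).
Proof.
move=> bl br; pose P (h : {perm V}) := perm_on S h.
pose good (h : {perm V}) := [set x in S | b x (h x)].
have P1 : P (1%g : {perm V}) by apply: perm_on1.
case: (@arg_maxnP _ (1%g : {perm V}) P (fun h => #|good h|) P1) => h Ph maxh.
have hS x : x \in S -> h x \in S by move=> xS; rewrite perm_closed.
exists h => x xS; split; first exact: hS.
apply: contraT => nb; exfalso.
pose B1 := [set x' in S | ~~ b x (h x')]; pose B2 := [set x' in S | ~~ b x' (h x)].
have cB1 : 2 * #|B1| < #|S|.
  apply: leq_ltn_trans (bl x xS); rewrite leq_mul2l /= -(card_imset _ (@perm_inj _ h)).
  apply: subset_leq_card; apply/subsetP => _ /imsetP[y yB ->].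
  by move: yB; rewrite !inE => /andP[yS ->]; rewrite hS.
have cB2 : 2 * #|B2| < #|S| := br (h x) (hS x xS).
have [y yS yB] : exists2 y, y \in S & y \notin B1 :|: B2.
  apply/exists_inP; apply: contraT; rewrite negb_exists_in => /forall_inP H.
  have : #|S| <= #|B1 :|: B2|.
    by apply: subset_leq_card; apply/subsetP => y yS; apply: negbNE (H y yS).
  have [H2 _] := leq_card_setU B1 B2; move: cB1 cB2 H2; clear; lia.
move: yB; rewrite !inE negb_or yS /= !negbK => /andP[b1 b2].
have xy : x != y by apply: contraNneq nb => E; rewrite {1}E.
pose h' := (tperm x y * h)%g.
have Ph' : P h'.
  apply: perm_onM => //; apply/subsetP => z; rewrite inE.
  by case: tpermP => [->|->|]; rewrite ?eqxx.
have : #|good h'| <= #|good h| := maxh h' Ph'; rewrite leqNgt => /negP; apply; apply: proper_card.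
rewrite properE; apply/andP; split.
  apply/subsetP => z; rewrite !inE permM => /andP[zS bz]; rewrite zS /=.
  by case: tpermP => [->|->|].
by apply/subsetPn; exists x; rewrite !inE ?permM ?tpermL xS // b1.
Qed.

Section NoncliqueTiling.
Variable R : realType.
Local Open Scope ring_scope.

(** A random subset of density 1/(k+1), then corrected to the exact size; the correction changes
    every intersection by at most al/2 |S|. *)
Lemma balanced_subset (k : nat) (al : R) : 0 < al ->
  exists n0 : nat, forall (V : finType) (S : {set V}) (A : V -> {set V}),
    (n0 <= #|S|)%N -> (k.+1 %| #|S|)%N -> (forall x, x \in S -> A x \subset S) ->
  exists S0 : {set V}, [/\ S0 \subset S, (#|S0| * k.+1)%N = #|S| &
    forall x, x \in S -> `| #|A x :&: S0|%:R - #|A x|%:R / k.+1%:R | <= al * #|S|%:R].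
Proof.
move=> al0; have al2 : 0 < al / 2 by rewrite divr_gt0.
have [n0 rnd] := random_map_large 2 al2.
exists n0.+1 => V S A nS kS AS; set n := #|S| in nS kS *.
have [||c|f rf] := rnd V 'I_k.+1 (option V) (None |: [set Some x | x in S])
   (fun o => if o is Some x then A x else S) (fun _ _ => ord0) n (ltnW nS).
- by rewrite card_ord.
- rewrite cardsU1 card_imset; last by move=> ? ? [].
  by case: (_ \notin _); rewrite -/n; lia.
- by case/setU1P=> [->|/imsetP[x xS ->]]; rewrite ?leqnn // subset_leq_card // AS.
pose m := (n %/ k.+1)%N; have nm : (m * k.+1)%N = n by rewrite divnK.
have k0 : k.+1%:R != 0 :> R by rewrite pnatr_eq0.
have n0' : 0 <= n%:R :> R by rewrite ler0n.
pose B0 := [set x in S | f x == ord0].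
have cB0 : `| #|B0|%:R - m%:R | <= al / 2 * n%:R.
  have := rf None; rewrite in_setU1 eqxx card_ord => /(_ isT).
  by rewrite -/B0 -/n -{1}nm natrM mulfK.
have cA x : x \in S -> `| #|A x :&: B0|%:R - #|A x|%:R / k.+1%:R | <= al / 2 * n%:R.
  move=> xS; have := rf (Some x); rewrite in_setU1 imset_f //= card_ord => /(_ isT).
  congr (`| _%:R - _ | <= _); apply: eq_card => y; rewrite !inE.
  by case yA: (y \in A x) => //=; rewrite (subsetP (AS x xS)).
suff [S0 [S0S cS0 near]] : exists S0 : {set V}, [/\ S0 \subset S, #|S0| = m &
    forall B : {set V}, `| #|B :&: S0|%:R - #|B :&: B0|%:R | <= al / 2 * n%:R].
  exists S0; split=> // [|x xS]; first by rewrite cS0.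
  apply: le_trans (ler_distD #|A x :&: B0|%:R _ _) _.
  by rewrite (_ : al * n%:R = al / 2 * n%:R + al / 2 * n%:R) ?lerD ?near ?cA //; field.
have [mB|mB] := leqP m #|B0|.
  have [S0 S0B cS0] := ex_subset mB; exists S0; split=> // [|B].
    by apply: subset_trans S0B _; apply/subsetP => x; rewrite inE => /andP[].
  have sub : (#|B :&: S0| <= #|B :&: B0|)%N by apply/subset_leq_card/setIS.
  have le : (#|B :&: B0| <= #|B :&: S0| + #|B0 :\: S0|)%N.
    apply: leq_trans (leq_card_setU _ _); apply/subset_leq_card/subsetP => x.
    by rewrite !inE => /andP[-> ->]; case: (x \in S0).
  move: cB0; rewrite cardsD (setIidPr S0B) cS0 in le.
  have le' : #|B :&: B0|%:R <= #|B :&: S0|%:R + (#|B0|%:R - m%:R) :> R.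
    by rewrite -natrB // -natrD ler_nat.
  rewrite -(ler_nat R) in sub; have mB' : m%:R <= #|B0|%:R :> R by rewrite ler_nat.
  by rewrite ger0_norm ?subr_ge0 // distrC ger0_norm ?subr_ge0 //; lra.
have B0S : B0 \subset S by apply/subsetP => x; rewrite inE => /andP[].
have [|T TS cT] := @ex_subset V (S :\: B0) (m - #|B0|).
  rewrite cardsD (setIidPr B0S) leq_sub2r // -/n -nm leq_pmulr //.
exists (B0 :|: T); split=> [||B].
- by rewrite subUset B0S (subset_trans TS) ?subsetDl.
- rewrite cardsU cT (_ : B0 :&: T = set0) ?cards0 ?subn0 ?subnKC ?(ltnW mB) //.
  apply/setP => x; rewrite !inE; apply/negP => /andP[/andP[xS fx] /(subsetP TS)].
  by rewrite !inE xS fx.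
have sub : (#|B :&: B0| <= #|B :&: (B0 :|: T)|)%N by apply/subset_leq_card/setIS/subsetUl.
have le : (#|B :&: (B0 :|: T)| <= #|B :&: B0| + #|T|)%N.
  apply: leq_trans (leq_card_setU _ _); apply/subset_leq_card/subsetP => x.
  by rewrite setIUr !in_setU => /orP[->|/setIP[_ ->]]; rewrite ?orbT.
rewrite cT in le.
have le' : #|B :&: (B0 :|: T)|%:R <= #|B :&: B0|%:R + (m%:R - #|B0|%:R) :> R.
  by rewrite -natrB ?(ltnW mB) // -natrD ler_nat.
rewrite -(ler_nat R) in sub; have mB' : #|B0|%:R <= m%:R :> R by rewrite ler_nat ltnW.
by move: cB0; rewrite distrC ger0_norm ?subr_ge0 // ger0_norm ?subr_ge0 //; lra.
Qed.

(* A set S0 of |S|/(k+1) vertices is matched to the cliques K_k of a K_k-factor of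
   the rest so that each vertex of S0 misses at most one vertex of its clique. *)
Lemma nonclique_tiling (VF : finType) (EF : {set {set VF}}) (N : {set VF}) (a b : VF) (k : nat) (eps : R) :
    (0 < k)%N -> #|N| = k.+1 -> a \in N -> b \in N -> a != b -> b \notin enb EF a -> 0 < eps ->
  exists d0 : nat, forall (V : finType) (E : {set {set V}}) (S : {set V}),
    (d0 <= #|S|)%N -> (k.+1 %| #|S|)%N ->
    (forall x, x \in S -> #|S :\: enb E x|%:R <= (k%:R^-1 - eps) * #|S|%:R) ->
  exists gs, tiling EF N E S gs.
Proof.
move=> k0 cN aN bN ab nab eps0.
pose al := eps / (4 * k.+1%:R).
have k1 : 1 <= k%:R :> R by rewrite ler1n.
have kS0 : 0 < k.+1%:R :> R by rewrite ltr0n.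
have al0 : 0 < al by rewrite divr_gt0 // mulr_gt0.
have [n0 bal] := balanced_subset k al0.
exists n0 => V E S nS kS dS; set n := #|S| in nS kS dS *.
have [S0|[v0 v0S]] := set_0Vmem S.
  by exists [::]; split=> //; rewrite big_nil S0.
have n_gt0 : (0 < n)%N by rewrite /n card_gt0; apply/set0Pn; exists v0.
have [S0 [S0S cS0 near]] := bal V S (fun x => S :\: enb E x) nS kS (fun x _ => subsetDl _ _).
set m := #|S0| in cS0; rewrite -/n in cS0 near.
have m0 : (0 < m)%N by move: n_gt0; rewrite -cS0; case: (m).
pose S1 := S :\: S0.
have cS1 : #|S1| = (m * k)%N by rewrite /S1 cardsD (setIidPr S0S) -/n -cS0 mulnS addKn.
have mR : 0 < m%:R :> R by rewrite ltr0n.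
have nR : n%:R = m%:R * k.+1%:R :> R by rewrite -natrM cS0.
have fe (K e mm : R) : 0 < K -> e / (4 * K) * (mm * K) = e / 4 * mm.
  by move=> K0; field; rewrite gt_eqF.
have aln : al * n%:R = eps / 4 * m%:R by rewrite nR /al fe.
have kk : k%:R * k%:R^-1 = 1 :> R by rewrite mulfV // gt_eqF // ltr0n.
have kV0 : 0 < k%:R^-1 :> R by rewrite invr_gt0 ltr0n.
have div x : x \in S -> #|S :\: enb E x|%:R / k.+1%:R <= (k%:R^-1 - eps) * m%:R.
  by move=> /dS; rewrite ler_pdivrMr // nR mulrA.
have c0 x : x \in S -> (k * #|S0 :\: enb E x| < m)%N.
  move=> xS; have -> : S0 :\: enb E x = (S :\: enb E x) :&: S0.
    apply/setP => y; rewrite !inE; case yS: (y \in S0); rewrite ?andbF //.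
    by rewrite (subsetP S0S) ?andbT.
  rewrite -(ltr_nat R) natrM; have := near x xS; rewrite ler_norml aln => /andP[_ H].
  have Hd := div x xS.
  have : k%:R * #|(S :\: enb E x) :&: S0|%:R <= k%:R * ((k%:R^-1 - 3 / 4 * eps) * m%:R) :> R.
    rewrite ler_wpM2l //.
    by move: H Hd; clear; move: (_ / k.+1%:R) #|_ :&: _|%:R k%:R^-1 => w u v; lra.
  have ke : 0 < k%:R * (eps * m%:R) by rewrite !mulr_gt0 // ltr0n.
  by rewrite mulrA mulrBr kk; move: ke; clear; lra.
have c1 x : x \in S -> (#|S1 :\: enb E x| < m)%N.
  move=> xS; have -> : S1 :\: enb E x = (S :\: enb E x) :\: S0.
    by apply/setP => y; rewrite !inE andbCA.
  rewrite -(ltr_nat R) cardsD natrB ?subset_leq_card ?subsetIl //.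
  have := near x xS; rewrite ler_norml aln => /andP[H _].
  have Hd := div x xS; set w := #|S :\: _|%:R in H Hd *.
  have wE : w = w / k.+1%:R * k%:R + w / k.+1%:R.
    by rewrite -[X in _ + X]mulr1 -mulrDr natr1 divfK // gt_eqF.
  have : w / k.+1%:R * k%:R <= (k%:R^-1 - eps) * m%:R * k%:R by rewrite ler_wpM2r // ler0n.
  have -> : (k%:R^-1 - eps) * m%:R * k%:R = m%:R * (k%:R * k%:R^-1) - k%:R * (eps * m%:R) by ring.
  have ke : eps * m%:R <= k%:R * (eps * m%:R) by rewrite ler_peMl // mulr_ge0 // ltW.
  have em : 0 < eps * m%:R by rewrite mulr_gt0.
  rewrite kk; move: H ke em wE; move: (w / _) => z; move: (z * _) => zk; clear; lra.
pose e : rel V := fun x y => (x != y) && (y \notin enb E x).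
have e_sym : symmetric e by move=> x y; rewrite /e eq_sym enb_sym.
have e_irr : irreflexive e by move=> x; rewrite /e eqxx.
have [||f [[fC fp] fs]] := @hajnal_szemeredi V V v0 e S1 S0 k e_sym e_irr.
- by rewrite cS1.
- move=> x; rewrite inE => /andP[_ /c1]; apply: leq_ltn_trans; apply: subset_leq_card.
  by apply/subsetP => y; rewrite !inE -in_enb => /andP[-> /andP[_ ->]].
have clsS c : cls S1 f c \subset S by apply/subsetP => x; rewrite !inE => /andP[/andP[_ ->]].
(* x fits the clique of colour c if it misses at most one of its vertices. By [c1], x misses fewer
   than m vertices of S1, so fewer than m/2 cliques do not fit x; [c0] gives the dual bound by
   double counting. *)
pose bb : rel V := fun x c => (#|cls S1 f c :\: enb E x| <= 1)%N.
have two (A : {set V}) (q : V -> nat) : (2 * #|[set x in A | ~~ (q x <= 1)%N]| <= \sum_(x in A) q x)%N.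
  rewrite mulnC -sum_nat_const [leqRHS](bigID (fun x => (q x <= 1)%N)) /= addnC.
  apply: leq_trans (leq_addr _ _).
  rewrite [leqLHS](eq_bigl (fun x => (x \in A) && ~~ (q x <= 1)%N)) => [|x]; last by rewrite inE.
  by apply: leq_sum => x /andP[_]; rewrite -ltnNge.
have [||h hP] := @perm_matching V S0 bb.
- move=> x xS0; apply: leq_ltn_trans (two _ _) _; apply: leq_ltn_trans (c1 x (subsetP S0S _ xS0)).
  have := @card_cols V V S1 f S0 (fun y => y \notin enb E x).
  rewrite (eq_bigr (fun c => #|cls S1 f c :\: enb E x|)) => [<-|c cS].
    by apply/subset_leq_card/subsetP => y; rewrite !inE -in_enb => /and3P[/andP[-> ->] _ ->].
  by apply: eq_card => y; rewrite in_set in_setD andbA andbC [y \in cls _ _ _]in_set.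
- move=> c cS; apply: leq_ltn_trans (two _ (fun x => #|cls S1 f c :\: enb E x|)) _.
  rewrite (eq_bigr (fun x => #|[set y in cls S1 f c | y \notin enb E x]|)) => [|x _]; last first.
    by apply: eq_card => y; rewrite in_set in_setD andbC.
  rewrite double_count -(ltn_pmul2l k0) big_distrr /= -(fs c cS).
  apply: leq_ltn_trans (_ : \sum_(i in cls S1 f c) (m.-1) < _)%N.
    apply: leq_sum => y yc; rewrite -ltnS prednK // fs //.
    apply: leq_ltn_trans (c0 y (subsetP (clsS c) _ yc)); rewrite leq_mul2l; apply/orP; right.
    by apply/subset_leq_card/subsetP => x; rewrite in_set in_setD enb_sym andbC.
  by rewrite sum_nat_const ltn_pmul2l ?prednK // fs.
have hS x : x \in S0 -> h x \in S0 by move/hP => [].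
have adjc c y y' : y \in cls S1 f c -> y' \in cls S1 f c -> y != y' -> y' \in enb E y.
  rewrite !inE -/S1 => /andP[yS /eqP fy] /andP[y'S /eqP fy'] yy'; rewrite -in_enb.
  have := fp y y'; rewrite !inE => /(_ yS y'S); rewrite fy fy' eqxx /e yy' -in_enb /=.
  by case: (_ \in enb E y) => // /(_ isT).
have clsD c d : c != d -> [disjoint cls S1 f c & cls S1 f d].
  move=> cd; rewrite -setI_eq0; apply/eqP/setP => x; rewrite !inE.
  by apply/negP => /andP[/andP[_ /eqP->]]; rewrite (negPf cd) andbF.
have S0cls x c : x \in S0 -> x \notin cls S1 f c by move=> xS; rewrite !inE xS.
apply: (@tiling_classes VF V EF N E S V S0 (fun x => x |: cls S1 f (h x))).
- move=> x y xS yS xy; rewrite -setI_eq0 setIUl !setIUr !setU_eq0.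
  have hxy : h x != h y by rewrite (inj_eq perm_inj).
  rewrite [cls _ _ _ :&: cls _ _ _](disjoint_setI0 (clsD _ _ hxy)) eqxx andbT.
  apply/andP; split; first (apply/andP; split).
  + by apply/eqP/setP => z; rewrite !inE; apply/negP => /andP[/eqP->]; rewrite (negPf xy).
  + by apply/eqP/setP => z; rewrite in_setI in_set1 [RHS]inE; case: eqP => // ->; apply: negPf; apply: S0cls.
  + by apply/eqP/setP => z; rewrite in_setI in_set1 [RHS]inE andbC; case: eqP => // ->; apply: negPf; apply: S0cls.
- apply/setP => y; apply/bigcupP/idP => [[x xS0]|yS].
    by rewrite in_setU1 => /orP[/eqP->|/(subsetP (clsS _))//]; apply: (subsetP S0S).
  have [yS0|yS0] := boolP (y \in S0); first by exists y; rewrite ?setU11.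
  have yS1 : y \in S1 by rewrite in_setD yS0.
  have fyS := fC y yS1; exists ((h^-1)%g (f y)).
    have [x xS hx] : exists2 x, x \in S0 & h x = f y.
      have : h @: S0 = S0.
        apply/eqP; rewrite eqEcard card_imset ?leqnn ?andbT; last exact: perm_inj.
        by apply/subsetP => _ /imsetP[x xS ->]; apply: hS.
      by move/setP/(_ (f y)); rewrite fyS => /imsetP[x xS ->]; exists x.
    by rewrite -hx permK.
  by rewrite in_setU1 permKV [X in _ || X]inE yS1 eqxx orbT.
- move=> x xS; have [hxS bx] := hP x xS; set Q := cls S1 f (h x) in bx *.
  have cQ : #|Q| = k by apply: fs.
  have xQ : x \notin Q by apply: S0cls.
  (* The one vertex q of the clique that x may miss receives b, and x receives a: the nonadjacent
     pair of F[N]. *)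
  have [q qQ qall] : exists2 q, q \in Q & forall y, y \in Q -> y != q -> y \in enb E x.
    have [Q0|[q]] := set_0Vmem (Q :\: enb E x).
      have /set0Pn[q qQ] : Q != set0 by rewrite -card_gt0 cQ.
      exists q => // y yQ _; apply: contraT => yE; move/setP: Q0 => /(_ y).
      by rewrite in_setD yQ yE in_set0.
    rewrite in_setD => /andP[qE qQ]; exists q => // y yQ yq; apply: contraT => yE.
    move: bx; rewrite /bb -/Q leqNgt => /negP; case; apply/card_gt1P; exists y, q.
    by rewrite !in_setD yQ yE qQ qE yq.
  have xq : x != q by apply: contraNneq xQ => ->.
  have [||||g [gi gN ga gb]] := @bij_sets2 VF V N (x |: Q) a b x q _ aN bN ab.
  + by rewrite cardsU1 xQ cQ cN.
  + exact: setU11.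
  + by rewrite in_setU1 qQ orbT.
  + by [].
  exists g; split=> //; split=> // u v uN vN vu.
  have uv : u != v by apply: contraTneq vu => ->; rewrite enbxx.
  have guv : g u != g v by apply: contraNneq uv => /gi->.
  have gQ w : w \in N -> w = a \/ w != a /\ g w \in Q.
    move=> wN; have [->|wa] := eqVneq w a; [by left | right; split=> //].
    have : g w \in x |: Q by rewrite -gN imset_f.
    by rewrite in_setU1 -ga => /orP[/eqP/gi Ew|//]; rewrite Ew // eqxx in wa.
  have gq w : w \in N -> w != b -> g w != q.
    by move=> wN; apply: contraNneq; rewrite -gb => /gi->.
  have [ua|[ua uQ]] := gQ u uN; have [va|[va vQ]] := gQ v vN.
  + by rewrite ua va eqxx in uv.
  + rewrite ua ga; apply: qall => //; apply: gq => //; apply: contraNneq nab => <-.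
    by rewrite -ua.
  + rewrite va ga enb_sym; apply: qall => //; apply: gq => //; apply: contraNneq nab => <-.
    by rewrite -va enb_sym.
  + exact: adjc uQ vQ guv.
Qed.
End NoncliqueTiling.

(** * Greedy embedding *)

Section EmbedOne.
Variables (W V : finType) (ET : {set {set W}}) (P : {set W}) (s : seq W) (d : nat).
Hypothesis s_uniq : uniq s.
Hypothesis s_mem : s =i ~: P.
Hypothesis back : forall s1 w s2, s = s1 ++ w :: s2 ->
  #|enb ET w :&: (P :|: [set x in s1])| <= d.
Variables (phi : W -> V) (G : {set {set V}}) (Y Z : {set V}).
Hypothesis phi_inj : {in P &, injective phi}.
Hypothesis YZ : Y \subset Z.
Hypothesis PZ : forall p w, p \in P -> w \notin P -> p \in enb ET w -> phi p \in Z.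
Hypothesis cand : forall X : {set V}, X \subset Z -> #|X| <= d ->
  #|W| <= #|[set y in Y | X \subset enb G y]|.

(** When w is reached, at most d of its neighbours have been placed, all in Z; their images have at
    least |W| common neighbours in Y, and fewer than |W| vertices are occupied. *)
Lemma embed_one : exists f : W -> V, [/\ injective f, {in P, f =1 phi},
  forall w, w \notin P -> f w \in Y &
  forall x y, x \in enb ET y -> y \notin P -> f x \in enb G (f y)].
Proof.
suff H s1 s2 : s = s1 ++ s2 -> exists f : W -> V,
    [/\ {in P :|: [set x in s1] &, injective f}, {in P, f =1 phi},
      forall w, w \in s1 -> f w \in Y &
      forall x y, x \in enb ET y -> x \in P :|: [set z in s1] -> y \in s1 -> f x \in enb G (f y)].
  have [|f [finj fP fY fG]] := H s [::]; first by rewrite cats0.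
  have allP x : x \in P :|: [set z in s] by rewrite !inE s_mem inE orbN.
  exists f; split=> // [x y|w|x y xy yP]; first exact: finj.
    by move=> wP; apply: fY; rewrite s_mem inE.
  by apply: fG => //; rewrite s_mem inE.
elim/last_ind: s1 s2 => [|s1 w IH] s2 Ds.
  by exists phi; split=> // x y; rewrite !inE !orbF; apply: phi_inj.
rewrite cat_rcons in Ds; have [f [finj fP fY fG]] := IH _ Ds.
pose Q := P :|: [set x in s1].
have wP : w \notin P.
  by rewrite -in_setC -s_mem Ds mem_cat mem_head orbT.
have ws1 : w \notin s1.
  by move: s_uniq; rewrite Ds cat_uniq /= => /and3P[_ /norP[]].
have wQ : w \notin Q by rewrite !inE negb_or wP.
pose X := f @: (enb ET w :&: Q).
have XZ : X \subset Z.
  apply/subsetP => _ /imsetP[x xin ->]; move: xin; rewrite in_setI => /andP[xw xQ].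
  have [xP|xP] := boolP (x \in P); first by rewrite fP //; apply: PZ xw.
  by apply: (subsetP YZ); apply: fY; move: xQ; rewrite !inE (negPf xP).
have Xd : #|X| <= d by apply: leq_trans (leq_imset_card _ _) (back Ds).
have [y yC yQ] : exists2 y, y \in [set y in Y | X \subset enb G y] & y \notin f @: Q.
  apply/exists_inP; apply: contraT; rewrite negb_exists_in => /forall_inP H.
  have : #|W| <= #|f @: Q|.
    apply: leq_trans (cand XZ Xd) _; apply: subset_leq_card; apply/subsetP => y yC.
    exact: negbNE (H y yC).
  rewrite leqNgt => /negP; case; apply: leq_ltn_trans (leq_imset_card _ _) _.
  by rewrite -[X in _ < X]cardsT; apply: proper_card; rewrite properT; apply: contraNneq wQ => ->; rewrite inE.
move: yC; rewrite inE => /andP[yY /subsetP yX].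
pose f' x := if x == w then y else f x.
have f'w : f' w = y by rewrite /f' eqxx.
have f'o x : x != w -> f' x = f x by rewrite /f' => /negPf->.
have QE x : x \in P :|: [set z in rcons s1 w] -> x = w \/ x != w /\ x \in Q.
  rewrite !inE mem_rcons inE; have [->|_] := eqVneq x w; by [left | right].
have Qw x : x \in Q -> x != w by apply: contraTneq => ->.
exists f'; split.
- move=> x x' /QE[->|[xw xQ]] /QE[->|[x'w x'Q]] //.
  + by rewrite f'w f'o // => E; case/negP: yQ; rewrite E imset_f.
  + by rewrite f'w f'o // => E; case/negP: yQ; rewrite -E imset_f.
  + by rewrite !f'o //; apply: finj.
- by move=> x xP; rewrite f'o ?fP // Qw // inE xP.
- move=> x; rewrite mem_rcons inE => /orP[/eqP->|xs1]; first by rewrite f'w.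
  by rewrite f'o ?fY //; apply: contraNneq ws1 => <-.
- move=> x x' xx' /QE[xw|[xw xQ]]; rewrite mem_rcons inE => /orP[/eqP x'w|x's1].
  + by move: xx'; rewrite xw x'w enbxx.
  + have x'w : x' != w by apply: contraNneq ws1 => <-.
    rewrite xw f'w f'o // enb_sym; apply: yX; rewrite imset_f // in_setI.
    by rewrite enb_sym -xw xx' !inE x's1 orbT.
  + rewrite x'w f'w f'o //; apply: yX; rewrite imset_f // inE xQ andbT.
    by rewrite -x'w.
  + have x'w : x' != w by apply: contraNneq ws1 => <-.
    by rewrite !f'o //; apply: fG.
Qed.
End EmbedOne.

Section EmbedMany.
Variables (VF V : finType) (EF : {set {set VF}}) (r : nat) (P : {set VF}).
Hypothesis EFgr : within setT EF.
Hypothesis EFreg : forall w, #|enb EF w| <= r.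
Implicit Types (G J : {set {set V}}) (t : {ffun VF -> V} * {set V} * {set V}).

(* A task is a partial copy of F (only its values on P matter), a set Y that
   receives the new vertices, and a set Z holding Y and the attachment points. *)
Definition tphi t := t.1.1.
Definition tY t := t.1.2.
Definition tZ t := t.2.

Definition EP : {set {set VF}} := [set e in EF | e \subset P].

Definition task_ok G c t :=
  [/\ {in P &, injective (tphi t)}, tY t \subset tZ t,
    forall p w, p \in P -> w \notin P -> p \in enb EF w -> tphi t p \in tZ t
  & forall X : {set V}, X \subset tZ t -> #|X| <= r ->
      c <= #|[set y in tY t | X \subset enb G y]|].

Definition rootE t : {set {set V}} := imE (tphi t) EP.

Variables (D : {set V}) (G : {set {set V}}) (Rt cap ov c : nat).
Hypothesis Ggr : within D G.
Hypothesis c_ge : #|VF| + ov + r * (r * Rt + cap) <= c.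

(** The copies are embedded one after another. New vertices avoid the set [Ov] of vertices whose
    degree in J is within r of [cap]; as J has few edges, [Ov] has at most [ov] elements. So degrees
    exceed [cap] only through the at most [Rt] tasks that have the vertex as a root. Of the c
    candidates, |VF| survive the removal of [Ov] and of the J-neighbours of at most r attachment
    points. *)
Lemma embed_many (ts : seq ({ffun VF -> V} * {set V} * {set V})) :
    (forall t, t \in ts -> task_ok G c t) ->
    (forall v, v \in D -> count (fun t => v \in tphi t @: P) ts <= Rt) ->
    2 * (size ts * #|EF|) < ov.+1 * (cap - r).+1 -> r <= cap ->
    pairwise (fun t t' => [disjoint rootE t & rootE t']) ts ->
    (forall t, t \in ts -> [disjoint rootE t & G]) ->
  exists J : {set {set V}}, [/\ J \subset G,
    dec EF (J :|: \bigcup_(t <- ts) rootE t)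
  & forall v, #|enb J v| <= r * Rt + cap].
Proof.
move=> okts cnt small rcap disR disG.
suff H : forall ts1 ts2, ts = ts1 ++ ts2 -> exists J : {set {set V}}, [/\ J \subset G,
    dec EF (J :|: \bigcup_(t <- ts1) rootE t), #|J| <= size ts1 * #|EF|
  & forall v, #|enb J v| <= r * count (fun t => v \in tphi t @: P) ts1 + cap].
  have [|J [JG dJ _ degJ]] := H ts [::]; first by rewrite cats0.
  exists J; split=> // v; have [vD|vD] := boolP (v \in D); last first.
    by rewrite (enb_out (within_sub JG Ggr)) // cards0.
  apply: leq_trans (degJ v) _.
  by rewrite leq_add2r leq_mul2l cnt // orbT.
elim/last_ind => [|ts1 t IH] ts2 Dts.
  exists set0; split; rewrite ?sub0set ?big_nil ?setU0 ?cards0 //; first exact: dec0.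
  by move=> v; rewrite enb0 cards0.
rewrite cat_rcons in Dts; have [J [JG dJ cJ degJ]] := IH _ Dts.
have tts : t \in ts by rewrite Dts mem_cat mem_head orbT.
have [phiinj YZ PZ cnd] := okts t tts.
pose Ov := [set v | cap < #|enb J v| + r].
have Ov_le : #|Ov| <= ov.
  have : #|Ov| * (cap - r).+1 <= 2 * #|J|.
    rewrite -(sum_enb (within_sub JG Ggr)) -sum_nat_const.
    rewrite [leqRHS](bigID [in Ov]) /=; apply: leq_trans (leq_addr _ _).
    by apply: leq_sum => v; rewrite inE; clear -rcap; lia.
  move=> H1; have H2 : 2 * #|J| <= 2 * (size ts * #|EF|).
    rewrite leq_mul2l /=; apply: leq_trans cJ _; rewrite leq_mul2r Dts size_cat leq_addr orbT //.
  have := leq_ltn_trans (leq_trans H1 H2) small.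
  by rewrite ltn_pmul2r.
have cntJ v : #|enb J v| <= r * Rt + cap.
  have [vD|vD] := boolP (v \in D); last first.
    by rewrite (enb_out (within_sub JG Ggr)) // cards0.
  apply: leq_trans (degJ v) _; rewrite leq_add2r leq_mul2l; apply/orP; right.
  by apply: leq_trans (cnt v vD); rewrite Dts count_cat leq_addr.
pose G' := G :\: J; pose Y' := tY t :\: Ov.
have cand' (X : {set V}) : X \subset tZ t -> #|X| <= r ->
    #|VF| <= #|[set y in Y' | X \subset enb G' y]|.
  move=> XZ Xr; pose A := [set y in tY t | X \subset enb G y].
  pose B := Ov :|: \bigcup_(x in X) enb J x.
  have AB : A :\: B \subset [set y in Y' | X \subset enb G' y].
    apply/subsetP => y; rewrite !inE negb_or -!andbA => /and4P[yO /bigcupP nb yY /subsetP Xy].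
    rewrite yO yY /=; apply/subsetP => x xX; rewrite enbD inE Xy // andbT.
    by apply/negP => xy; apply: nb; exists x; rewrite // enb_sym.
  apply: leq_trans (subset_leq_card AB).
  have cA : c <= #|A| := cnd X XZ Xr.
  have cB : #|B| <= ov + r * (r * Rt + cap).
    apply: leq_trans (leq_card_setU _ _) _; apply: leq_add => //.
    apply: leq_trans (card_bigcup_le _ _ _) _; apply: leq_trans (_ : #|X| * (r * Rt + cap) <= _).
      by rewrite -sum_nat_const; apply: leq_sum.
    by rewrite leq_mul2r Xr orbT.
  have := cardsD A B; have : #|A :&: B| <= #|B| by apply/subset_leq_card/subsetIr.
  by move: cA cB c_ge; clear; lia.
have [f [finj fP fY fG]] := @embed_one _ _ EF P (enum (~: P)) r (enum_uniq _)
  (mem_enum _) (fun s1 w s2 _ => leq_trans (subset_leq_card (subsetIl _ _)) (EFreg w))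
  (tphi t) G' Y' (tZ t) phiinj (subset_trans (subsetDl _ _) YZ) PZ cand'.
pose N := imE f (EF :\: EP).
have NG' : N \subset G'.
  apply/subsetP => _ /imsetP[e eN ->]; move: eN; rewrite in_setD => /andP[eP eE].
  move: eP; rewrite inE eE /= => /subsetPn[w we wP].
  have [x [y [xy De _ _ yx]]] := edgeP EFgr eE.
  have [z [De' zw]] : exists z, e = [set z; w] /\ z \in enb EF w.
    move: we; rewrite De !inE => /orP[]/eqP->.
      by exists y; rewrite setUC.
    by exists x; rewrite enb_sym.
  by have := fG z w zw wP; rewrite De' imset_set2 setUC in_enb => /andP[].
have rootf : rootE t = imE f EP.
  apply/esym; apply: (@imE_eq _ _ _ _ P) => [e|]; first by rewrite inE => /andP[].
  exact: fP.
have NrootE : imE f EF = N :|: rootE t.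
  rewrite rootf -imEU; congr imE; apply/setP => e; rewrite !inE.
  by case: (e \in EF); rewrite //= ?orbF; case: (_ \subset _).
have NJ : [disjoint N & J].
  by rewrite disjoints_subset; apply: subset_trans NG' _; rewrite /G' setDE subsetIr.
have NG : N \subset G by apply: subset_trans NG' (subsetDl _ _).
have rootJ : [disjoint rootE t & J] by apply: disjointWr JG _; apply: disG.
have ts1ts t' : t' \in ts1 -> t' \in ts by rewrite Dts mem_cat => ->.
exists (J :|: N); split.
- by rewrite subUset JG.
- have -> : J :|: N :|: \bigcup_(t0 <- rcons ts1 t) rootE t0 =
      imE f EF :|: (J :|: \bigcup_(t0 <- ts1) rootE t0).
    rewrite -cats1 big_cat big_seq1 /= NrootE; apply/setP => e; rewrite !inE.
    by do ![case: (e \in _)].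
  apply: decS => //; rewrite NrootE -setI_eq0 setIUl setU_eq0 !setIUr !setU_eq0 !setI_eq0.
  rewrite NJ rootJ /=; apply/andP; split.
    apply: disjoint_bigcup_seq => t' t'ts; rewrite disjoint_sym.
    by apply: disjointWr NG _; apply: disG; apply: ts1ts.
  apply: disjoint_bigcup_seq => t' t'ts; rewrite disjoint_sym.
  move: disR; rewrite Dts pairwise_cat => /and3P[/allrelP H _ _].
  by apply: H; rewrite ?mem_head.
- rewrite size_rcons mulSn addnC; apply: leq_trans (leq_card_setU _ _) _; apply: leq_add => //.
  by rewrite imE_inj //; apply/subset_leq_card/subsetDl.
- move=> v; rewrite enbU -cats1 count_cat /= addn0 mulnDr.
  apply: leq_trans (leq_card_setU _ _) _.
  have [/codomP[w vw]|vf] := boolP (v \in codom f); last first.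
    rewrite enb_imE_out // cards0 addn0; apply: leq_trans (degJ v) _.
    by rewrite leq_add2r leq_addr.
  have cN : #|enb N v| <= r.
    rewrite vw enb_imE // card_imset //; apply: leq_trans (EFreg w).
    by apply/subset_leq_card/enbS/subsetDl.
  have [wP|wP] := boolP (w \in P).
    have -> : v \in tphi t @: P by rewrite vw fP // imset_f.
    by rewrite muln1; have := degJ v; move: cN; clear; lia.
  have : v \notin Ov by rewrite vw; have := fY w wP; rewrite inE => /andP[].
  by rewrite inE -leqNgt; move: cN; clear; lia.
Qed.
End EmbedMany.

(** * Covering stars *)

Section DisjointFamilies.
Variables (T : finType) (I : eqType) (A : I -> {set T}).
Notation dis := (pairwise (fun i j => [disjoint A i & A j])).

Lemma pairwise_disjoint_eq s i j x : dis s -> i \in s -> j \in s ->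
  x \in A i -> x \in A j -> i = j.
Proof.
elim: s => //= k s IH /andP[/allP ks ps]; rewrite !inE.
have no l : l \in s -> x \in A k -> x \in A l -> False.
  by move=> ls xk xl; have := disjoint_setI0 (ks l ls); move/setP/(_ x); rewrite !inE xk xl.
case/orP=> [/eqP->|is_]; case/orP=> [/eqP->|js] // xi xj; first by case: (no j).
  by case: (no i).
exact: IH.
Qed.

Lemma sum_pairwise_disjoint s : dis s -> \sum_(i <- s) #|A i| = #|\bigcup_(i <- s) A i|.
Proof.
elim: s => [|i s IH] /=; first by rewrite !big_nil cards0.
case/andP=> /allP ds ps; rewrite !big_cons IH // cardsU disjoint_setI0 ?cards0 ?subn0 //.
exact: disjoint_bigcup_seq.
Qed.

Lemma count_pairwise_disjoint s x : dis s ->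
  count (fun i => x \in A i) s <= (x \in \bigcup_(i <- s) A i).
Proof.
elim: s => //= i s IH /andP[/allP ds ps]; rewrite big_cons inE.
have [xi|xi] /= := boolP (x \in A i); last exact: IH.
rewrite -[X in _ <= X]addn0 leq_add2l; apply: leq_trans (IH ps) _.
rewrite leqn0 eqb0; apply/negP => xs.
have := disjoint_setI0 (disjoint_bigcup_seq (A := A) ds).
by move/setP/(_ x); rewrite !inE xi xs.
Qed.
End DisjointFamilies.

Section Stars.
Variables (R : realType) (VF : finType) (EF : {set {set VF}}) (r : nat) (v0 : VF).
Hypothesis EFgr : within setT EF.
Hypothesis EFreg : forall w, #|enb EF w| = r.
Hypothesis r_gt0 : 0 < r.
Local Notation N := (enb EF v0).
Local Notation P := (v0 |: N).

(** A minimum degree condition for F[N(v0)]-factors, with an arbitrary slack. It will hold for kinv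
    = 1/r if F is a union of cliques, and for kinv = 1/(r-1) otherwise. *)
Definition tileable (kinv : R) := forall eps : R, (0 < eps)%R ->
  exists d0 : nat, forall (V : finType) (E : {set {set V}}) (S : {set V}),
    d0 <= #|S| -> r %| #|S| ->
    (forall x, x \in S -> (#|S :\: enb E x|%:R <= (kinv - eps) * #|S|%:R)%R) ->
  exists gs, tiling EF N E S gs.

Lemma v0N : v0 \notin N. Proof. by rewrite enbxx. Qed.

Lemma EP_star : EP EF P = star v0 N :|: eind EF N.
Proof.
apply/setP => e; apply/idP/idP; rewrite !inE.
  case/andP=> eE eP; have [x [y [xy De _ _ yx]]] := edgeP EFgr eE.
  have [/eqP xv|xv] := eqVneq x v0.
    by apply/orP; left; rewrite De (eqP xv); apply: imset_f; rewrite -(eqP xv).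
  have [/eqP yv|yv] := eqVneq y v0.
    by apply/orP; left; rewrite De (eqP yv) setUC; apply: imset_f; rewrite enb_sym -(eqP yv).
  apply/orP; right; rewrite eE /=; apply/subsetP => w we; move: (subsetP eP _ we).
  rewrite in_setU1 => /orP[/eqP wv|//]; move: we; rewrite wv De !inE.
  by rewrite ![v0 == _]eq_sym (negPf xv) (negPf yv).
case/orP=> [/imsetP[w wN ->]|/andP[-> eN]]; last by apply: subset_trans eN (subsetUr _ _).
by move: (wN); rewrite in_enb => /andP[_ ->]; rewrite subUset !sub1set !in_setU1 eqxx wN orbT.
Qed.

Section Host.
Variable V : finType.
Variables (Y : {set V}).
Notation task := ({ffun VF -> V} * {set V} * {set V})%type.

(** The centre z of a star receives v0 and a tile receives its neighbourhood; the task asks for the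
    rest of a copy of F. *)
Definition mkt z (g : {ffun VF -> V}) : task :=
  ([ffun w => if w == v0 then z else g w], Y, Y).

Definition tileE (g : {ffun VF -> V}) : {set {set V}} := imE g (eind EF N).

Lemma mkt_v0 z g : tphi (mkt z g) v0 = z. Proof. by rewrite ffunE eqxx. Qed.

Lemma mkt_N z g w : w \in N -> tphi (mkt z g) w = g w.
Proof. by move=> wN; rewrite ffunE; case: eqP => // E; case/negP: v0N; rewrite -{1}E. Qed.

Lemma mkt_imN z g : tphi (mkt z g) @: N = g @: N.
Proof. by apply: eq_in_imset => w; apply: mkt_N. Qed.

Lemma mkt_imP z g : tphi (mkt z g) @: P = z |: g @: N.
Proof. by rewrite imsetU1 mkt_v0 mkt_imN. Qed.

Lemma rootE_mkt z g : rootE EF P (mkt z g) = star z (g @: N) :|: tileE g.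
Proof.
rewrite /rootE EP_star imEU imE_star mkt_v0 mkt_imN; congr (_ :|: _).
by apply: (@imE_eq _ _ _ _ N) => [e|w]; [rewrite inE => /andP[] | apply: mkt_N].
Qed.

Lemma tileE_nbr E g x y : tile EF N E g -> y \in enb (tileE g) x ->
  [/\ x \in g @: N, y \in g @: N & y \in enb E x].
Proof.
case=> gi gE yx; have [u [v [uN vN -> -> vu]]] := enb_imE_sub (within_ind EFgr) yx.
by rewrite !imset_f //; split=> //; apply: gE => //; apply: (subsetP (enbS _ (eind_sub _ _))) vu.
Qed.

Lemma tileE_deg E g x : tile EF N E g -> #|enb (tileE g) x| <= r.
Proof.
move=> tg; have [gi gE] := tg; have [->|[y yx]] := set_0Vmem (enb (tileE g) x).
  by rewrite cards0.
have [/imsetP[u uN Dx] _ _] := tileE_nbr tg yx.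
rewrite -(EFreg u); apply: leq_trans (leq_imset_card g (mem (enb EF u))).
apply: subset_leq_card; apply/subsetP => y' y'x.
have [u' [v' [u'N v'N Dx' -> v'u]]] := enb_imE_sub (within_ind EFgr) y'x.
apply: imset_f; rewrite (gi _ _ uN u'N) -?Dx //.
exact: (subsetP (enbS _ (eind_sub _ _))) v'u.
Qed.

Lemma tileE_sub E g : tile EF N E g -> tileE g \subset E.
Proof.
move=> [gi gE]; apply/subsetP => _ /imsetP[e e0 ->]; move: (e0); rewrite inE => /andP[eE eN].
have [u [v [uv De uN vN vu]]] := edgeP (within_ind (X := N) EFgr) e0.
have : g v \in enb E (g u) by apply: gE => //; apply: (subsetP (enbS _ (eind_sub _ _))) vu.
by rewrite De imset_set2 in_enb => /andP[].
Qed.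

Lemma tileE_within E g : tile EF N E g -> within (g @: N) (tileE g).
Proof.
move=> [gi gE] _ /imsetP[e e0 ->]; move: e0; rewrite inE => /andP[eE eN].
split; last exact: imsetS.
by rewrite card_in_imset; [have [] := EFgr eE | move=> u v /(subsetP eN) uN /(subsetP eN); apply: gi].
Qed.

Lemma within_disjoint (A B : {set V}) E E' : within A E -> within B E' -> [disjoint A & B] ->
  [disjoint E & E'].
Proof.
move=> wE wE' dAB; rewrite -setI_eq0; apply/eqP/setP => e; rewrite !inE; apply/negP.
case/andP=> eE eE'; have [x [y [_ De xA _ _]]] := edgeP wE eE.
have [_ /subsetP/(_ x)] := wE' e eE'; rewrite De set21 => /(_ isT) xB.
by have := disjoint_setI0 dAB; move/setP/(_ x); rewrite !inE xA xB.
Qed.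

Lemma star_within_disjoint z (S : {set V}) E : within Y E -> z \notin Y -> [disjoint star z S & E].
Proof.
move=> wE zY; rewrite -setI_eq0; apply/eqP/setP => e; rewrite !inE; apply/negP.
by case/andP=> /star_sub ze /wE[_ /subsetP/(_ z ze)]; rewrite (negPf zY).
Qed.

Lemma star_disjoint z z' (S S' : {set V}) : z \notin Y -> S' \subset Y -> z != z' ->
  [disjoint star z S & star z' S'].
Proof.
move=> zY S'Y zz'; rewrite -setI_eq0; apply/eqP/setP => e; rewrite !inE; apply/negP.
case/andP=> /star_sub ze /imsetP[w wS' De]; move: ze; rewrite De !inE (negPf zz') => /eqP zw.
by case/negP: zY; rewrite zw (subsetP S'Y).
Qed.

Lemma star_disjointl z (S S' : {set V}) : z \notin S -> [disjoint S & S'] -> [disjoint star z S & star z S'].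
Proof.
move=> zS dS; rewrite -setI_eq0; apply/eqP/setP => e; rewrite !inE; apply/negP.
case/andP=> /imsetP[w wS ->] /imsetP[w' wS' /set2_inj E].
have zw : w != z by apply: contraNneq zS => <-.
by have /setP/(_ w) := disjoint_setI0 dS; rewrite !inE wS (E zw) wS'.
Qed.

Variables (K : finType) (J : {set {set V}}) (Jl : K -> {set {set V}}) (L : V -> K)
  (S : V -> {set V}).
Hypothesis JY : within Y J.
Hypothesis JlJ : forall k, Jl k \subset J.
Hypothesis Jl_dis : forall k l, k != l -> [disjoint Jl k & Jl l].

(** Only stars with the same label draw on the same layer [Jl]. Disjoint tiles give each vertex
    degree at most r, so when z is treated, a vertex has lost at most r edges of the layer for each
    earlier star of that label containing it; the last hypothesis keeps this below eps/2 |S z|. *)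
Lemma star_tiles (kinv eps : R) d0 (zs : seq V) :
    (forall (E : {set {set V}}) (T : {set V}), d0 <= #|T| -> r %| #|T| ->
       (forall x, x \in T -> (#|T :\: enb E x|%:R <= (kinv - eps / 2) * #|T|%:R)%R) ->
       exists gs, tiling EF N E T gs) ->
    uniq zs ->
    (forall z, z \in zs -> [/\ z \notin Y, S z \subset Y, r %| #|S z| & d0 <= #|S z|]) ->
    (forall z x, z \in zs -> x \in S z ->
      (#|S z :\: enb (Jl (L z)) x|%:R <= (kinv - eps) * #|S z|%:R)%R) ->
    (forall z x, z \in zs ->
      ((r * count (fun z' => (L z' == L z) && (x \in S z')) zs)%:R <= eps / 2 * #|S z|%:R)%R) ->
  exists (ts : seq task) (TE : {set {set V}}),
    [/\ [/\ TE \subset J,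
        \bigcup_(t <- ts) rootE EF P t = \bigcup_(z <- zs) star z (S z) :|: TE &
        pairwise (fun t t' => [disjoint rootE EF P t & rootE EF P t']) ts],
      forall t, t \in ts -> exists z g, [/\ t = mkt z g, z \in zs, {in N &, injective g},
        g @: N \subset S z & tileE g \subset TE],
      forall v, v \in Y -> count (fun t => v \in tphi t @: P) ts <= count (fun z => v \in S z) zs,
      size ts <= \sum_(z <- zs) #|S z| &
      forall x, #|enb TE x| <= r * count (fun z => x \in S z) zs].
Proof.
move=> tl uzs zsP deg cnt.
suff H zs1 zs2 : zs = zs1 ++ zs2 -> exists (ts : seq task) (TE : {set {set V}}),
    [/\ [/\ TE \subset J,
        \bigcup_(t <- ts) rootE EF P t = \bigcup_(z <- zs1) star z (S z) :|: TE &
        pairwise (fun t t' => [disjoint rootE EF P t & rootE EF P t']) ts],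
      forall t, t \in ts -> exists z g, [/\ t = mkt z g, z \in zs1, {in N &, injective g},
        g @: N \subset S z & tileE g \subset TE],
      forall v, v \in Y -> count (fun t => v \in tphi t @: P) ts <= count (fun z => v \in S z) zs1,
      size ts <= \sum_(z <- zs1) #|S z| &
      (forall x, #|enb TE x| <= r * count (fun z => x \in S z) zs1) /\
      forall k x, #|enb (TE :&: Jl k) x| <= r * count (fun z => (L z == k) && (x \in S z)) zs1].
  by have [|ts [TE [? ? ? ? [? _]]]] := H zs [::]; rewrite ?cats0 //; exists ts, TE; split.
elim/last_ind: zs1 zs2 => [|zs1 z IH] zs2 Dzs.
  exists [::], set0; split=> //.
  - by split; rewrite ?sub0set // !big_nil setU0.
  - by split=> [x|k x]; rewrite ?set0I enb0 cards0.
rewrite cat_rcons in Dzs; have [ts [TE [[TEJ un pw] tsP cnt1 sz [dTE dTEk]]]] := IH _ Dzs.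
have zzs : z \in zs by rewrite Dzs mem_cat mem_head orbT.
have zs1zs z' : z' \in zs1 -> z' \in zs by rewrite Dzs mem_cat => ->.
have z_zs1 : z \notin zs1.
  by move: uzs; rewrite Dzs cat_uniq /= => /and3P[_ /norP[]].
have [zY SY rS d0S] := zsP z zzs.
have zS : z \notin S z by apply: contra zY; apply: (subsetP SY).
pose E := Jl (L z) :\: TE.
have [//|//|x xS|gs [tgs pwgs ungs]] := tl E (S z).
  have H1 : #|S z :\: enb E x| <= #|S z :\: enb (Jl (L z)) x| + #|enb (TE :&: Jl (L z)) x|.
    apply: leq_trans (leq_card_setU _ _); apply/subset_leq_card/subsetP => y.
    rewrite enbD enbI !in_setU !in_setI !in_setD => /andP[+ ->].
    by case: (y \in enb TE x); case: (y \in enb (Jl _) x).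
  have H2 := dTEk (L z) x.
  have H3 : r * count (fun z' => (L z' == L z) && (x \in S z')) zs1 <=
            r * count (fun z' => (L z' == L z) && (x \in S z')) zs.
    by rewrite leq_mul2l Dzs count_cat leq_addr orbT.
  have := deg z x zzs xS; have := cnt z x zzs.
  have : (#|S z :\: enb E x|%:R <= #|S z :\: enb (Jl (L z)) x|%:R +
     (r * count (fun z' => (L z' == L z) && (x \in S z')) zs)%:R :> R)%R.
    by rewrite -natrD ler_nat; apply: leq_trans H1 _; rewrite leq_add2l; apply: leq_trans H2 H3.
  by move: (r * count _ zs)%N #|_ :\: enb E x| => c c' /=; lra.
have EJ : E \subset J by apply: subset_trans (subsetDl _ _) (JlJ _).
pose TE' := \bigcup_(g <- gs) tileE g.
have gsS g : g \in gs -> g @: N \subset S z.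
  by move=> ggs; rewrite -ungs (big_rem g) //= subsetUl.
have TE'E : TE' \subset E.
  by apply: sub_bigcup_seq => g ggs; apply: tileE_sub (tgs g ggs).
have TE'TE : [disjoint TE' & TE].
  by rewrite disjoints_subset; apply: subset_trans TE'E _; rewrite /E setDE subsetIr.
have tileTE' g : g \in gs -> tileE g \subset TE' by move=> ggs; rewrite /TE' (big_rem g) //= subsetUl.
have deg' x : #|enb TE' x| <= r * (x \in S z).
  have [->|[y yx]] := set_0Vmem (enb TE' x); first by rewrite cards0.
  move: (yx); rewrite enb_bigcup => /mem_bigcup_seq[g ggs yg].
  have [xg _ _] := tileE_nbr (tgs g ggs) yg.
  rewrite (subsetP (gsS g ggs)) // muln1; apply: leq_trans (tileE_deg x (tgs g ggs)).
  apply: subset_leq_card; apply/subsetP => y' y'x.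
  move: (y'x) => /mem_bigcup_seq[g' g'gs y'g'].
  have [xg' _ _] := tileE_nbr (tgs g' g'gs) y'g'.
  by rewrite (pairwise_disjoint_eq pwgs ggs g'gs xg xg').
have TE'Y : within Y TE' by apply: within_sub (subset_trans TE'E EJ) JY.
have gsY g : g \in gs -> g @: N \subset Y by move=> /gsS/subset_trans; apply.
exists (ts ++ [seq mkt z g | g <- gs]), (TE :|: TE'); split.
- split.
  + by rewrite subUset TEJ (subset_trans TE'E).
  + rewrite big_cat /= un big_map -cats1 [X in _ = X :|: _]big_cat /= big_seq1.
    rewrite (eq_bigr (fun g : {ffun VF -> V} => star z (g @: N) :|: tileE g)); last first.
      by move=> g _; rewrite rootE_mkt.
    rewrite big_split /= -/TE'.
    have -> : \bigcup_(g <- gs) star z (g @: N) = star z (S z).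
      rewrite -ungs; elim: (gs) => [|g s IHs]; first by rewrite !big_nil /star imset0.
      by rewrite !big_cons IHs starU.
    by rewrite setUACA.
  + rewrite pairwise_cat pw /= pairwise_map; apply/andP; split.
      apply/allrelP => t _ tts /mapP[g ggs ->].
      have [z' [g' [-> z'zs gi gS gTE]]] := tsP t tts.
      have [z'Y Sz'Y _ _] := zsP z' (zs1zs _ z'zs).
      have z'z : z' != z by apply: contraNneq z_zs1 => <-.
      have TEY := within_sub TEJ JY.
      rewrite !rootE_mkt -setI_eq0 setIUl !setIUr !setU_eq0 !setI_eq0.
      rewrite (star_disjoint _ z'Y (gsY g ggs) z'z).
      rewrite (star_within_disjoint _ (within_sub (tileTE' g ggs) TE'Y) z'Y) /=.
      rewrite disjoint_sym (star_within_disjoint _ (within_sub gTE TEY) zY) /=.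
      by rewrite disjoint_sym; apply: disjointWl (tileTE' g ggs) _; apply: disjointWr gTE _.
    apply: (sub_in_pairwise (P := [in gs])) pwgs; last exact/allP.
    move=> g g' ggs g'gs /= dgg'; rewrite !rootE_mkt -setI_eq0 setIUl !setIUr !setU_eq0 !setI_eq0.
    rewrite star_disjointl //; last by apply: contra zS; apply: (subsetP (gsS g ggs)).
    rewrite (star_within_disjoint _ (within_sub (tileTE' g' g'gs) TE'Y) zY) /=.
    rewrite disjoint_sym (star_within_disjoint _ (within_sub (tileTE' g ggs) TE'Y) zY) /=.
    exact: within_disjoint (tileE_within (tgs g ggs)) (tileE_within (tgs g' g'gs)) dgg'.
- move=> t; rewrite mem_cat => /orP[/tsP[z' [g [-> z'zs gi gS gTE]]]|/mapP[g ggs ->]].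
    exists z', g; split=> //; first by rewrite mem_rcons inE z'zs orbT.
    exact: subset_trans gTE (subsetUl _ _).
  exists z, g; split=> //; first by rewrite mem_rcons mem_head.
  + by have [] := tgs g ggs.
  + exact: gsS.
  + exact: subset_trans (tileTE' g ggs) (subsetUr _ _).
- move=> v vY; rewrite count_cat -cats1 count_cat /= addn0; apply: leq_add; first exact: cnt1.
  have zv : v != z by apply: contraNneq zY => <-.
  rewrite -ungs count_map; apply: leq_trans (count_pairwise_disjoint v pwgs).
  apply: sub_count => g /=; by rewrite mkt_imP in_setU1 (negPf zv).
- rewrite size_cat size_map -cats1 big_cat big_seq1; apply: leq_add => //.
  rewrite -ungs -(sum_pairwise_disjoint pwgs) -sum1_size; rewrite ![\sum_(i <- gs) _]big_seq.
  by apply: leq_sum => g /tgs[gi _]; rewrite card_in_imset // EFreg.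
- split=> [x|k x]; rewrite -cats1 count_cat /= addn0 mulnDr.
    rewrite enbU; apply: leq_trans (leq_card_setU _ _) _; exact: leq_add.
  rewrite setIUl enbU; apply: leq_trans (leq_card_setU _ _) _; apply: leq_add => //.
  have [Lk|Lk] := eqVneq (L z) k => /=.
    by apply: leq_trans (deg' x); apply/subset_leq_card/enbS/subsetIl.
  have -> : TE' :&: Jl k = set0.
    apply/eqP; rewrite setI_eq0; apply: disjointWl TE'E _.
    by apply: disjointWl (subsetDl _ _) _; apply: Jl_dis.
  by rewrite enb0 cards0.
Qed.
End Host.

Lemma card_commonC (V : finType) (Y X : {set V}) (G : {set {set V}}) :
  #|Y :\: [set y in Y | X \subset enb G y]| <= \sum_(x in X) #|Y :\: enb G x|.
Proof.
apply: leq_trans (card_bigcup_le _ _ _); apply/subset_leq_card/subsetP => y.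
rewrite !inE negb_and => /andP[+ yY]; rewrite yY /= => /subsetPn[x xX xy].
by apply/bigcupP; exists x => //; rewrite in_setD yY andbT enb_sym.
Qed.

(** [star_tiles] turns the stars into roots of partial copies, and [embed_many] completes them
    inside Y. Every vertex of Y belongs to at most mu roots, hence the bound by a multiple of mu. *)
Lemma star_cover (kinv eps : R) : tileable kinv -> (0 < eps)%R ->
  exists (n0 C : nat) (c0 : R), (0 < c0)%R /\
  forall (V K : finType) (Y : {set V}) (J : {set {set V}}) (Jl : K -> {set {set V}})
    (L : V -> K) (S : V -> {set V}) (zs : seq V) (mu : nat),
  within Y J -> (forall k, Jl k \subset J) -> (forall k l, k != l -> [disjoint Jl k & Jl l]) ->
  uniq zs ->
  (forall z, z \in zs -> [/\ z \notin Y, S z \subset Y, r %| #|S z| & n0 <= #|S z|]) ->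
  (forall z x, z \in zs -> x \in S z ->
      (#|S z :\: enb (Jl (L z)) x|%:R <= (kinv - eps) * #|S z|%:R)%R) ->
  (forall z x, z \in zs ->
      ((r * count (fun z' => (L z' == L z) && (x \in S z')) zs)%:R <= eps / 2 * #|S z|%:R)%R) ->
  (forall x, x \in Y -> (#|Y :\: enb J x|%:R <= (r%:R^-1 - eps) * #|Y|%:R)%R) ->
  (forall x, x \in Y -> count (fun z => x \in S z) zs <= mu) ->
  0 < mu -> n0 <= #|Y| -> (mu%:R <= c0 * #|Y|%:R)%R ->
  exists Es : {set {set V}}, [/\ Es \subset J, dec EF (Es :|: \bigcup_(z <- zs) star z (S z)) &
    forall x, #|enb Es x| <= C * mu].
Proof.
move=> tl eps0; have [d0 tld0] := tl (eps / 2)%R (divr_gt0 eps0 (ltr0Sn R 1)).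
(* There are at most |Y| mu tasks, hence at most |Y| mu |EF| edges in the copies. With cap = C1 mu
   and ov about eps |Y| / 4, the inequality C1 - r > 8 |EF| / eps puts twice that number below ov.+1
   times cap - r + 1, as [embed_many] requires. *)
pose b : R := (8 * #|EF|%:R / eps)%R.
have b0 : (0 <= b)%R by rewrite divr_ge0 ?mulr_ge0 ?ler0n // ltW.
have [C1 C1r C1b] : exists2 C1 : nat, r < C1 & (b < (C1 - r)%:R)%R.
  exists (r + (Num.bound b)).+1; first by rewrite ltnS leq_addr.
  by apply: lt_le_trans (archi_boundP b0) _; rewrite ler_nat; lia.
pose B := (8 * #|VF|%:R / eps)%R.
have B0 : (0 <= B)%R by rewrite divr_ge0 ?mulr_ge0 ?ler0n // ltW.
pose M : R := (8 * (r%:R * (r + C1)%:R + r%:R * r%:R))%R.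
have M0 : (0 <= M)%R by rewrite mulr_ge0 // addr_ge0 // mulr_ge0.
exists (maxn d0 (Num.bound B)), (C1 + r + r), (eps / (M + 1))%R.
split; first by rewrite divr_gt0 // ltr_wpDl.
move=> V K Y J Jl L S zs mu JY JlJ Jld uzs zsP deg cnt degJ cntmu mu0 nY muY.
set y := #|Y| in nY muY *.
have [|ts [TE [[TEJ un pw] tsP cnt1 sz dTE]]] := @star_tiles V Y K J Jl L S JY JlJ Jld kinv eps d0 zs (tld0 V) uzs _ deg cnt.
  by move=> z /zsP[zY SY rS nS]; split=> //; apply: leq_trans nS; apply: leq_maxl.
have yB : (B < y%:R)%R.
  apply: lt_le_trans (archi_boundP B0) _; rewrite ler_nat; apply: leq_trans nY; exact: leq_maxr.
have y0 : (0 < y%:R :> R)%R by apply: le_lt_trans yB.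
have r1 : (1 <= r%:R :> R)%R by rewrite ler1n.
have rV : (r%:R * r%:R^-1 = 1 :> R)%R by rewrite mulfV // gt_eqF // (lt_le_trans _ r1).
pose ov := Num.truncn (eps / 4 * y%:R)%R.
have nonneg : (0 <= (r%:R^-1 - eps) * y%:R)%R.
  have /card_gt0P[x xY] : 0 < #|Y| by rewrite -(ltr0n R).
  by apply: le_trans (degJ x xY).
have sumS : \sum_(z <- zs) #|S z| <= y * mu.
  have -> : \sum_(z <- zs) #|S z| = \sum_(x in Y) count (fun z => x \in S z) zs.
    under [RHS]eq_bigr do rewrite -sum1_count big_mkcond.
    rewrite exchange_big /= big_seq [RHS]big_seq; apply: eq_bigr => z /zsP[_ SY _ _].
    rewrite -big_mkcondr -sum1_card; apply: eq_bigl => x.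
    by case xS: (x \in S z); rewrite ?andbF // (subsetP SY).
  by rewrite -sum_nat_const; apply: leq_sum.
have ovP : (ov%:R <= eps / 4 * y%:R < ov.+1%:R)%R.
  by apply: Num.Theory.truncn_itv; rewrite mulr_ge0 ?divr_ge0 // ltW.
pose G := J :\: TE.
have TEmu x : x \in Y -> #|enb TE x| <= r * mu.
  by move=> xY; apply: leq_trans (dTE x) _; rewrite leq_mul2l cntmu ?orbT.
pose c := #|VF| + ov + r * (r * mu + C1 * mu).
have cY : (c%:R + r%:R * (r%:R * mu%:R) <= eps * y%:R :> R)%R.
  have H1 : (#|VF|%:R <= eps / 8 * y%:R :> R)%R.
    move: yB; rewrite /B ltr_pdivrMr // => H; rewrite (_ : eps / 8 * y%:R = y%:R * eps / 8)%R; last by field.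
    by rewrite ler_pdivlMr // mulrC ltW.
  have H2 : (M * mu%:R <= eps * y%:R)%R.
    have M1 : (0 < M + 1)%R by rewrite ltr_wpDl.
    have : ((M + 1) * mu%:R <= eps * y%:R)%R.
      rewrite mulrC -ler_pdivlMr //; move: muY; rewrite [X in (_ <= X)%R](_ : _ = eps * y%:R / (M + 1))%R //.
      by rewrite mulrAC.
    by apply: le_trans; rewrite ler_wpM2r // lerDl.
  have /andP[H3 _] := ovP.
  have epy : (0 <= eps * y%:R)%R by rewrite mulr_ge0 // ltW.
  move: H2; rewrite /M /c !natrD !natrM !natrD; move: H1 H3 epy; lra.
have GY : within Y G by apply: within_sub (subsetDl _ _) JY.
have [|t tts|v vY||||t tts|Jx [JxG dJx degx]] := @embed_many VF V EF r P EFgr _ Y G mu (C1 * mu) ov c GY (leqnn _) ts.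
- by move=> w; rewrite EFreg.
- have [z [g [-> zzs gi gS gTE]]] := tsP t tts; have [zY SY _ _] := zsP z zzs.
  have gY : g @: N \subset Y by apply: subset_trans gS SY.
  split.
  + move=> u w; rewrite !in_setU1; have [->|uv] := eqVneq u v0; have [->|wv] := eqVneq w v0 => //= uN wN.
    * rewrite mkt_v0 mkt_N // => zE; case/negP: zY; rewrite zE (subsetP gY) //; exact: imset_f.
    * rewrite mkt_v0 mkt_N // => zE; case/negP: zY; rewrite -zE (subsetP gY) //; exact: imset_f.
    * by rewrite !mkt_N //; apply: gi.
  + exact: subxx.
  + move=> p w pP wP pw'; have [pv|pv] := eqVneq p v0.
      by case/negP: wP; rewrite in_setU1 enb_sym -pv pw' orbT.
    have pN : p \in N by move: pP; rewrite in_setU1 (negPf pv).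
    by rewrite mkt_N //; apply: (subsetP gY); apply: imset_f.
  + move=> X XY Xr; set A := [set _ in _ | _].
    have AY : A \subset Y by apply/subsetP => u; rewrite inE => /andP[].
    have cA : (#|A| + #|Y :\: A| = y)%N by rewrite /y -(cardsID A Y) (setIidPr AY).
    have bound x : x \in X -> (#|Y :\: enb G x|%:R <= (r%:R^-1 - eps) * y%:R + r%:R * mu%:R :> R)%R.
      move=> xX; have xY := subsetP XY _ xX.
      apply: le_trans (lerD (degJ x xY) (_ : (r * mu)%:R <= r%:R * mu%:R)%R); last by rewrite natrM.
      rewrite -/y; apply: le_trans (_ : (#|Y :\: enb J x| + #|enb TE x|)%:R <= _)%R; last first.
        by rewrite natrD lerD2l ler_nat TEmu.
      rewrite ler_nat; apply: leq_trans (leq_card_setU _ _); apply/subset_leq_card/subsetP => u.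
      rewrite enbD !in_setU !in_setD => /andP[+ ->]; rewrite negb_and negbK andbT.
      by rewrite orbC.
    have YA : (#|Y :\: A|%:R <= r%:R * ((r%:R^-1 - eps) * y%:R + r%:R * mu%:R) :> R)%R.
      apply: le_trans (_ : (\sum_(x in X) #|Y :\: enb G x|)%:R <= _)%R.
        by rewrite ler_nat; apply: card_commonC.
      rewrite natr_sum; apply: le_trans (ler_sum _ bound) _.
      rewrite sumr_const -[X in (X <= _)%R]mulr_natl ler_wpM2r ?ler_nat //.
      by rewrite addr_ge0 // mulr_ge0.
    have cAR : (#|A|%:R + #|Y :\: A|%:R = y%:R :> R)%R by rewrite -natrD cA.
    have re : (eps * y%:R <= r%:R * (eps * y%:R))%R by rewrite ler_peMl // mulr_ge0 // ltW.
    rewrite -(ler_nat R).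
    have rE : (r%:R * ((r%:R^-1 - eps) * y%:R + r%:R * mu%:R) =
        r%:R * r%:R^-1 * y%:R - r%:R * (eps * y%:R) + r%:R * (r%:R * mu%:R))%R by ring.
    move: YA cY cAR re; rewrite rE rV mul1r; lra.
- exact: leq_trans (cnt1 v vY) (cntmu v vY).
- apply: leq_ltn_trans (_ : 2 * (y * mu * #|EF|) < _)%N.
    by rewrite leq_mul2l leq_mul2r (leq_trans sz sumS) orbT.
  apply: leq_trans (_ : ov.+1 * ((C1 - r) * mu) <= _); last first.
    by rewrite leq_mul2l; apply/orP; right; move: mu0 C1r; clear; nia.
  rewrite -(ltr_nat R) !natrM; have /andP[_ H] := ovP.
  apply: le_lt_trans (_ : eps / 4 * y%:R * (b * mu%:R) < _)%R.
    by rewrite /b le_eqVlt; apply/orP; left; apply/eqP; field; rewrite gt_eqF.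
  have muR : (0 < mu%:R :> R)%R by rewrite ltr0n.
  apply: ltr_pM => //; first by rewrite mulr_ge0 ?divr_ge0 // ltW.
    by rewrite mulr_ge0.
  by rewrite ltr_pM2r.
- by move: mu0 C1r; clear; nia.
- exact: pw.
- have [z [g [-> zzs gi gS gTE]]] := tsP t tts; have [zY SY _ _] := zsP z zzs.
  rewrite rootE_mkt -setI_eq0 setIUl setU_eq0 !setI_eq0.
  rewrite (star_within_disjoint _ GY zY) disjoint_sym disjoints_subset.
  by rewrite /G setDE; apply: subset_trans (subsetIr _ _) _; rewrite setCS.
exists (Jx :|: TE); split.
- by rewrite subUset TEJ (subset_trans JxG) ?subsetDl.
- by move: dJx; rewrite un setUA [Jx :|: TE]setUC -setUA [X in _ :|: X]setUC setUA [TE :|: _]setUC -setUA.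
- move=> x; rewrite enbU; apply: leq_trans (leq_card_setU _ _) _.
  have [xY|xY] := boolP (x \in Y); last first.
    by rewrite (enb_out (within_sub JxG GY)) // (enb_out (within_sub TEJ JY)) // cards0.
  rewrite mulnDl [in X in _ <= X]mulnDl [X in _ <= X + _]addnC.
  by apply: leq_add (degx x) (TEmu x xY).
Qed.
End Stars.

(** * Packings with small leftover degree *)

Local Open Scope ring_scope.

Ltac only_ineqs := repeat match goal with
  | H : is_true (@Order.le _ _ _ _) |- _ => revert H
  | H : is_true (@Order.lt _ _ _ _) |- _ => revert H
  | H : @eq _ _ _ |- _ => revert H end; clear; intros.
Ltac qlra := only_ineqs; lra.
Ltac qnra := only_ineqs; nra.
Ltac glra := clear; intros; lra.
Ltac gnra := clear; intros; nra.

Section Numbers.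
Variable R : realType.

Lemma large_nat (a b : R) : 0 < b -> exists n0 : nat, forall n : nat, (n0 <= n)%N -> a <= b * n%:R.
Proof.
move=> b0; exists (Num.bound (`|a| / b)) => n nn.
have H : `|a| / b < n%:R.
  by apply: lt_le_trans (archi_boundP _) _; rewrite ?divr_ge0 ?ler_nat // ltW.
by rewrite mulrC; move: H; rewrite ltr_pdivrMr // => /ltW; apply: le_trans; apply: ler_norm.
Qed.

Lemma small_pos (s : seq R) : all (fun a => 0 < a) s -> exists2 b, 0 < b & all (fun a => b <= a) s.
Proof.
elim: s => [|a s IH] /=; first by exists 1.
case/andP=> a0 /IH[b b0 bs]; exists (Num.min a b); first by rewrite lt_min a0.
rewrite ge_min lexx /=; apply: sub_all bs => c bc; rewrite ge_min bc orbT //.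
Qed.
End Numbers.

Section MaxDegree.
Variables (R : realType) (VF : finType) (EF : {set {set VF}}) (r : nat).

Definition approximable (eta theta : R) (n1 : nat) :=
  forall (V : finType) (E : {set {set V}}) (X : {set V}),
    within X E -> (n1 <= #|X|)%N -> (forall x, x \in X -> theta * #|X|%:R <= #|enb E x|%:R) ->
  exists E' : {set {set V}}, [/\ E' \subset E, dec EF E' & #|E :\: E'|%:R <= eta * #|X|%:R ^+ 2].

(** With kinv = 1/k the second condition reads theta >= 1 - 1/(k+1): a neighbourhood has at least
    theta n vertices, and a vertex misses at most (1 - theta) n of them, a fraction 1/k. By the
    third, any r vertices have many common neighbours as soon as the density exceeds theta by a
    constant. *)
Definition good_theta (kinv theta : R) := [/\ theta <= 1, 1 - theta <= kinv * theta & 1 - theta <= r%:R^-1].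

Definition trunc_nbr (V : finType) (A : {set V}) : {set V} := [set x in take (r * (#|A| %/ r)) (enum A)].

Lemma trunc_nbrP (r_gt0 : (0 < r)%N) (V : finType) (A : {set V}) :
  [/\ trunc_nbr A \subset A, (r %| #|trunc_nbr A|)%N & (#|A :\: trunc_nbr A| <= r)%N].
Proof.
have sub : trunc_nbr A \subset A by apply/subsetP => x; rewrite inE => /mem_take; rewrite mem_enum.
have le : (r * (#|A| %/ r) <= #|A|)%N by rewrite mulnC leq_trunc_div.
have cT : #|trunc_nbr A| = (r * (#|A| %/ r))%N.
  rewrite cardsE; have /card_uniqP -> : uniq (take (r * (#|A| %/ r)) (enum A)) by rewrite take_uniq ?enum_uniq.
  by rewrite size_take -cardE; case: ltngtP le.
split=> //; first by rewrite cT dvdn_mulr.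
rewrite cardsD (setIidPr sub) cT {1}(divn_eq #|A| r) mulnC addKn ltnW // ltn_pmod //.
Qed.

End MaxDegree.

(* The vertices of D, bad for the previous packings, have all their edges covered by
   stars first, so that the bad vertices of the new packing lie outside D. *)
Lemma avoid_bad (R : realType) (VF : finType) (EF : {set {set VF}}) (r : nat) (v0 : VF)
    (EFgr : within setT EF) (EFreg : forall w, #|enb EF w| = r) (r_gt0 : (0 < r)%N) (kinv eps : R)
    (tl : tileable EF r v0 kinv) (kinv_range : 0 < kinv <= 1) (eps_range : 0 < eps <= kinv) (gam : R) : 0 < gam -> exists2 b0 : R, 0 < b0 & forall (eta : R) (n1 : nat), 0 < eta ->
  exists n2 : nat, forall theta, good_theta r kinv theta -> approximable EF eta (theta + eps / 2) n1 ->
  forall (V : finType) (E : {set {set V}}) (X D : {set V}),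
    within X E -> (n2 <= #|X|)%N -> (forall x, x \in X -> (theta + eps) * #|X|%:R <= #|enb E x|%:R) ->
    D \subset X -> #|D|%:R <= b0 * #|X|%:R ->
  exists (P : {set {set V}}) (D' : {set V}),
    [/\ P \subset E, dec EF P, D' \subset X :\: D, #|D'|%:R <= 4 * eta / gam * #|X|%:R
    & forall x, x \in X -> x \notin D' -> #|enb (E :\: P) x|%:R <= gam * #|X|%:R].
Proof.
move=> gam0; have /andP[k0 k1] := kinv_range; have /andP[eps0 epsk] := eps_range.
have e4 : 0 < eps / 4 by rewrite divr_gt0.
have [n0 [C [c0 [c00 stc]]]] := star_cover EFgr EFreg r_gt0 tl e4.
have rR : 1 <= r%:R :> R by rewrite ler1n.
have C0 : 0 <= C%:R :> R by rewrite ler0n.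
have [b b_gt0 /and5P[b_eps b_C b_r b_gam /andP[b_c _]]] : exists2 b : R, 0 < b &
    all (fun a => b <= a) [:: eps / 16; eps / (16 * (C%:R + 1)); eps / (32 * r%:R); gam / 8; c0 / 8].
  by apply: small_pos; rewrite /= !divr_gt0 ?mulr_gt0 ?ltr_wpDl // (lt_le_trans _ rR).
exists b => // eta n1 eta0.
have [N1 HN1] := large_nat (r%:R + 1 : R) b_gt0.
have q0 : 0 < 1 / 4 :> R by rewrite divr_gt0.
have [N3 HN3] := large_nat (n0%:R + n1%:R + 1 : R) q0.
exists (maxn N1 N3) => theta [th1 thk thr] apx V E X D EX nX degE DX cD.
set n := #|X| in nX degE cD *.
have nN1 : r%:R + 1 <= b * n%:R by apply: HN1; apply: leq_trans nX; apply: leq_maxl.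
have nN3 : n0%:R + n1%:R + 1 <= 1 / 4 * n%:R := HN3 n (leq_trans (leq_maxr _ _) nX).
have n_gt0 : 0 < n%:R :> R by have := ler0n R n0; have := ler0n R n1; qlra.
have th_half : 1 / 2 <= theta by qnra.
have eps1 : eps <= 1 by qlra.
pose Y := X :\: D; pose J := eind E Y; pose A z := enb E z :&: Y; pose S z := trunc_nbr r (A z).
have JY : within Y J by apply: within_ind EX.
have cY : #|Y|%:R + #|D|%:R = n%:R :> R by rewrite -natrD /n -(cardsID D X) (setIidPr DX) addnC.
have YX : Y \subset X by apply: subsetDl.
have dn : #|D|%:R <= 1 / 16 * n%:R :> R by apply: le_trans cD _; rewrite ler_wpM2r ?ler0n //; qlra.
have bn x : x <= b * n%:R -> forall y, b <= y -> x <= y * n%:R.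
  by move=> H y by_; apply: le_trans H _; rewrite ler_wpM2r ?ler0n.
have YJ x : x \in Y -> #|Y :\: enb J x|%:R <= (1 - theta - eps) * n%:R.
  move=> xY; have xX := subsetP YX _ xY.
  have H : (#|Y :\: enb J x| + #|enb E x| <= n)%N.
    rewrite /n -(cardsID (enb E x) X) (setIidPr (enb_within x EX)) addnC leq_add2l.
    apply/subset_leq_card/subsetP => u; rewrite in_setD enb_ind // in_setI => /andP[nu uY].
    by move: nu; rewrite uY andbT in_setD => ->; apply: (subsetP YX).
  by have := degE x xX; move: H; rewrite -(ler_nat R) natrD; qlra.
have AX z : z \in D -> (theta + eps) * n%:R - #|D|%:R <= #|A z|%:R.
  move=> zD; have zX := subsetP DX _ zD; have := degE z zX.
  have : (#|enb E z| <= #|A z| + #|D|)%N.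
    apply: leq_trans (leq_card_setU _ _); apply/subset_leq_card/subsetP => u uz.
    rewrite in_setU in_setI uz in_setD (subsetP (enb_within z EX) _ uz) andbT /=.
    by case: (u \in D); rewrite ?orbT.
  by rewrite -(ler_nat R) natrD; qlra.
have SA z : (#|A z| <= #|S z| + r)%N.
  have [sub _ le] := trunc_nbrP r_gt0 (A z).
  by rewrite -(cardsID (S z) (A z)) (setIidPr sub) leq_add2l.
have SX z : z \in D -> (theta + 3 / 4 * eps) * n%:R <= #|S z|%:R.
  move=> /AX H; have := SA z; rewrite -(ler_nat R) natrD.
  have := bn _ cD _ b_eps; have : r%:R <= b * n%:R by qlra.
  by move=> /bn/(_ _ b_eps); qlra.
have SY z : S z \subset Y.
  by have [sub _ _] := trunc_nbrP r_gt0 (A z); apply: subset_trans sub (subsetIr _ _).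
have n_half z : z \in D -> 1 / 2 * n%:R <= #|S z|%:R :> R by move=> /SX; qnra.
(* A single layer suffices as D is small. [mu] is |D| + 1, because it must be positive and D may be
   empty. *)
have [||||||||||||Es [EsJ dEs degEs]] := stc V unit Y J (fun=> J) (fun=> tt) S (enum D) #|D|.+1.
- exact: JY.
- by [].
- by case=> -[].
- exact: enum_uniq.
- move=> z; rewrite mem_enum => zD; have [_ rS _] := trunc_nbrP r_gt0 (A z); split=> //.
    by rewrite in_setD zD.
  by rewrite -(ler_nat R); have := n_half z zD; have := ler0n R n1; qlra.
- move=> z x; rewrite mem_enum => zD xS; have xY := subsetP (SY z) _ xS.
  apply: le_trans (_ : #|Y :\: enb J x|%:R <= _); first by rewrite ler_nat subset_leq_card ?setSD.
  apply: le_trans (YJ x xY) _; apply: le_trans (_ : (kinv - eps / 4) * ((theta + 3 / 4 * eps) * n%:R) <= _).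
    rewrite mulrA ler_wpM2r ?ler0n //; qnra.
  by apply: ler_wpM2l (SX z zD); qlra.
- move=> z x; rewrite mem_enum => zD.
  apply: le_trans (_ : (r * #|D|)%:R <= _).
    by rewrite ler_nat leq_mul2l (leq_trans (count_size _ _)) ?orbT // -cardE.
  rewrite natrM; apply: le_trans (_ : r%:R * (eps / (32 * r%:R) * n%:R) <= _).
    by rewrite ler_wpM2l ?ler0n //; apply: bn cD _ b_r.
  rewrite (_ : _ * _ = eps / 32 * n%:R); last by field; rewrite gt_eqF // (lt_le_trans _ rR).
  by have := n_half z zD; qnra.
- move=> x xY; apply: le_trans (YJ x xY) _; have := bn _ cD _ b_eps.
  have : r%:R^-1 <= 1 :> R by rewrite invf_le1 // (lt_le_trans _ rR).
  have : 0 < r%:R^-1 :> R by rewrite invr_gt0 (lt_le_trans _ rR).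
  have d0 := ler0n R #|D|.
  have H1 : (1 - theta - eps) * n%:R <= (r%:R^-1 - eps) * n%:R by rewrite ler_wpM2r ?ler0n // lerB.
  have -> : #|Y|%:R = n%:R - #|D|%:R :> R by rewrite -cY addrK.
  move=> ri0 ri1 dE; have H2 : r%:R^-1 * #|D|%:R <= #|D|%:R :> R by rewrite ler_piMl.
  have H3 : 0 <= eps * #|D|%:R by rewrite mulr_ge0 // ltW.
  have H4 : 0 <= eps * n%:R by rewrite mulr_ge0 // ltW.
  by move: H1 H2 H3 H4 dE; qlra.
- by move=> x xY; apply: leq_trans (count_size _ _) _; rewrite -cardE.
- by [].
- by rewrite -(ler_nat R); have := ler0n R n1; qlra.
- rewrite -natr1; have := bn _ cD _ b_c; have : 1 <= b * n%:R by qlra.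
  by move=> /bn/(_ _ b_c); qnra.
pose E2 := J :\: Es; have E2J : E2 \subset J by apply: subsetDl.
have E2Y : within Y E2 by apply: within_sub E2J JY.
have Cmu : (C * #|D|.+1)%:R <= eps / 8 * n%:R :> R.
  rewrite natrM -natr1; have H1 := bn _ cD _ b_C; have : 1 <= b * n%:R by qlra.
  move=> /bn/(_ _ b_C) H2; apply: le_trans (_ : (C%:R + 1) * (#|D|%:R + 1) <= _).
    by rewrite ler_wpM2r ?lerDl // addr_ge0.
  apply: le_trans (_ : (C%:R + 1) * (2 * (eps / (16 * (C%:R + 1)) * n%:R)) <= _).
    by rewrite ler_wpM2l ?addr_ge0 //; qlra.
  by rewrite le_eqVlt; apply/orP; left; apply/eqP; field; rewrite gt_eqF // ltr_wpDl.
have [||E' [E'E2 dE' cE']] := apx V E2 Y E2Y.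
- by rewrite -(ler_nat R); have := ler0n R n0; qlra.
- move=> x xY; have xX := subsetP YX _ xY; have := degE x xX.
  have : (#|enb E x| <= #|enb E2 x| + C * #|D|.+1 + #|D|)%N.
    apply: leq_trans (_ : #|enb E2 x| + #|enb Es x| + #|D| <= _)%N; last first.
      by rewrite leq_add2r leq_add2l.
    apply: card_sub3; apply/subsetP => u ux; rewrite /E2 enbD !in_setU in_setD enb_ind // in_setI ux in_setD.
    rewrite (subsetP (enb_within x EX) _ ux) andbT.
    by case: (u \in D); case: (u \in enb Es x); rewrite ?orbT.
  rewrite -(ler_nat R) !natrD; have := bn _ cD _ b_eps; have := ler0n R #|D|; qnra.
(* Bad vertices are counted by their share of the at most eta |X|^2 uncovered edges, which gives 4
   eta / gam |X|. They lie in Y, hence outside D. *)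
pose L := E2 :\: E'; pose D' := [set x in Y | gam / 2 * n%:R < #|enb L x|%:R].
have LY : within Y L by apply: within_sub (subsetDl _ _) E2Y.
pose ST := \bigcup_(z <- enum D) star z (S z).
have STE : ST \subset E.
  apply: sub_bigcup_seq => z _; apply/subsetP => _ /imsetP[u uS ->].
  have [sub _ _] := trunc_nbrP r_gt0 (A z); move: (subsetP sub _ uS); rewrite in_setI in_enb.
  by case/andP=> /andP[].
have dST : [disjoint E' & ST].
  apply: disjoint_bigcup_seq => z; rewrite mem_enum => zD; rewrite disjoint_sym.
  apply: (@star_within_disjoint _ Y); last by rewrite in_setD zD.
  exact: within_sub E'E2 E2Y.
exists (E' :|: (Es :|: ST)), D'; split.
- rewrite !subUset STE andbT (subset_trans E'E2 (subset_trans E2J (eind_sub _ _))) /=.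
  exact: subset_trans EsJ (eind_sub _ _).
- apply: decU => //; rewrite -setI_eq0 setIUr setU_eq0 !setI_eq0 dST andbT.
  by rewrite disjoints_subset; apply: subset_trans E'E2 _; rewrite /E2 setDE subsetIr.
- by apply/subsetP => x; rewrite inE => /andP[].
- have n2 : 0 < gam / 2 * n%:R by rewrite mulr_gt0 // divr_gt0.
  have : #|D'|%:R * (gam / 2 * n%:R) <= 2 * (eta * n%:R ^+ 2).
    apply: le_trans (_ : (\sum_x #|enb L x|)%:R <= _).
      rewrite natr_sum mulr_natl -sumr_const [leRHS](bigID [in D']) /=.
      apply: ler_wpDr; first by apply: sumr_ge0 => x _; rewrite ler0n.
      by apply: ler_sum => x; rewrite inE => /andP[_ /ltW].
    rewrite (sum_enb LY) natrM ler_pM2l //; apply: le_trans cE' _.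
    apply: ler_wpM2l; first exact: ltW.
    by apply: lerXn2r; rewrite ?nnegrE ?ler0n // ler_nat subset_leq_card.
  rewrite -ler_pdivlMr // => /le_trans; apply; rewrite le_eqVlt; apply/orP; left; apply/eqP.
  by field; rewrite !gt_eqF.
- move=> x xX xD'; have dg : #|D|%:R <= gam / 8 * n%:R by apply: bn cD _ b_gam.
  have rg : r%:R <= gam / 8 * n%:R by apply: (bn _ _ _ b_gam); qlra.
  have gn : 0 < gam * n%:R by rewrite mulr_gt0.
  have [xD|xD] := boolP (x \in D).
    apply: le_trans (_ : (#|D| + r)%:R <= _); last by rewrite natrD; qlra.
    have [_ _ le] := trunc_nbrP r_gt0 (A x).
    rewrite ler_nat; apply: leq_trans (_ : #|D| + #|A x :\: S x| <= _)%N; last by rewrite leq_add2l.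
    apply: leq_trans (leq_card_setU _ _); apply/subset_leq_card/subsetP => u.
    rewrite enbD in_setD => /andP[nu ux]; rewrite in_setU in_setD in_setI ux in_setD /=.
    rewrite (subsetP (enb_within x EX) _ ux) andbT; have [//|uD /=] := boolP (u \in D).
    rewrite andbT; apply: contra nu => uS; rewrite !enbU !in_setU; apply/orP; right; apply/orP; right.
    rewrite enb_bigcup; apply/mem_bigcup_seq; exists x; rewrite ?mem_enum // enb_star //.
    by apply/negP => /(subsetP (SY x)); rewrite in_setD xD.
  have xY : x \in Y by rewrite in_setD xD.
  apply: le_trans (_ : (#|enb L x| + #|D|)%:R <= _); last first.
    rewrite natrD; move: xD'; rewrite inE xY /= -leNgt; qlra.
  rewrite ler_nat; apply: leq_trans (leq_card_setU _ _); apply/subset_leq_card/subsetP => u.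
  rewrite enbD in_setD => /andP[nu ux]; rewrite in_setU; have [|uD] := boolP (u \in D); first by rewrite orbT.
  rewrite orbF /L !enbD !in_setD enb_ind // in_setI ux in_setD uD (subsetP (enb_within x EX) _ ux) /= andbT.
  by move: nu; rewrite !enbU !in_setU !negb_or => /and3P[-> -> _].
Qed.

Local Close Scope ring_scope.

Local Open Scope ring_scope.

(** [avoid_bad] is iterated K times, D being the union of the bad sets so far. With eta = c gam / 4
    each bad set has at most c |X| elements, and c = b / K keeps D within the allowed b |X|. As the
    bad sets are disjoint, x is bad for at most one packing, namely number [t x]. *)
Lemma disjoint_bad (R : realType) (VF : finType) (EF : {set {set VF}}) (r : nat) (v0 : VF)
    (EFgr : within setT EF) (EFreg : forall w, #|enb EF w| = r) (r_gt0 : (0 < r)%N) (kinv eps : R)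
    (tl : tileable EF r v0 kinv) (kinv_range : 0 < kinv <= 1) (eps_range : 0 < eps <= kinv) (gam : R) (K : nat) : 0 < gam -> (0 < K)%N ->
  exists2 eta : R, 0 < eta & forall n1 : nat, exists n2 : nat,
  forall theta, good_theta r kinv theta -> approximable EF eta (theta + eps / 2) n1 ->
  forall (V : finType) (E : {set {set V}}) (X : {set V}),
    within X E -> (n2 <= #|X|)%N -> (forall x, x \in X -> (theta + eps) * #|X|%:R <= #|enb E x|%:R) ->
  exists (P : 'I_K -> {set {set V}}) (t : V -> 'I_K),
    (forall k, P k \subset E /\ dec EF (P k)) /\
    forall k x, x \in X -> k != t x -> #|enb (E :\: P k) x|%:R <= gam * #|X|%:R.
Proof.
move=> gam0 K0; have [b b0 Hb] := avoid_bad EFgr EFreg r_gt0 tl kinv_range eps_range gam0.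
pose c := b / K%:R; have KR : 0 < K%:R :> R by rewrite ltr0n.
have c0 : 0 < c by rewrite divr_gt0.
exists (c * gam / 4) => [|n1]; first by rewrite divr_gt0 // mulr_gt0.
have [|n2 Hn2] := Hb (c * gam / 4) n1; first by rewrite divr_gt0 // mulr_gt0.
exists n2 => theta gth apx V E X EX nX degE.
have {}Hn2 D DX := Hn2 theta gth apx V E X D EX nX degE DX.
suff [P [D [t [DX cD PE bad]]]] : exists (P : nat -> {set {set V}}) (D : {set V}) (t : V -> nat),
    [/\ D \subset X, #|D|%:R <= K%:R * (c * #|X|%:R),
      forall k, (k < K)%N -> P k \subset E /\ dec EF (P k) &
      forall k x, (k < K)%N -> x \in X -> (x \in D) && (t x == k) = false ->
        #|enb (E :\: P k) x|%:R <= gam * #|X|%:R].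
  exists (fun k => P k), (fun x => odflt (Ordinal K0) (insub (t x))); split=> [k|k x xX kt]; first exact: PE.
  apply: bad => //; apply: contraNF kt => /andP[_ /eqP->].
  by rewrite (insubT (fun i => (i < K)%N) (ltn_ord k)) /=; apply/eqP/val_inj.
have {Hb}: (K <= K)%N by []; elim: {1 3 4 5}K => [_|j IH jK].
  by exists (fun=> set0), set0, (fun=> 0%N); split; rewrite ?sub0set ?cards0 ?mul0r.
have [P [D [t [DX cD PE bad]]]] := IH (ltnW jK).
have [|P' [D' [P'E dP' D'X cD' bad']]] := Hn2 D DX.
  apply: le_trans cD _; rewrite mulrA ler_wpM2r ?ler0n //.
  by rewrite /c mulrA ler_pdivrMr // mulrC ler_pM2l // ler_nat ltnW.
exists (fun k => if k == j then P' else P k), (D :|: D'), (fun x => if x \in D then t x else j); split.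
- by rewrite subUset DX (subset_trans D'X (subsetDl _ _)).
- apply: le_trans (_ : (#|D| + #|D'|)%:R <= _); first by rewrite ler_nat; apply: leq_card_setU.
  rewrite natrD -natr1 mulrDl mul1r; apply: lerD => //; apply: le_trans cD' _.
  by rewrite le_eqVlt; apply/orP; left; apply/eqP; field; rewrite gt_eqF.
- move=> k; rewrite ltnS; case: eqP => [//|/eqP kj] kle; apply: PE; rewrite ltn_neqAle kj //.
- move=> k x; rewrite ltnS in_setU => kle xX; have [->|kj] := eqVneq k j.
    have [xD _|xD] := boolP (x \in D).
      by apply: bad' => //; apply/negP => /(subsetP D'X); rewrite in_setD xD.
    by rewrite eqxx andbT /= => xD'; apply: bad' => //; rewrite xD'.
  move=> H; apply: bad => //; first by rewrite ltn_neqAle kj.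
  by move: H; case: (x \in D).
Qed.

(* X is mapped to the affine plane over a field of size about (log |X|)^2. Two points with distinct first coordinates
   lie on one line; on each line one of K packings with disjoint sets of bad vertices is chosen at random. *)
Lemma small_leftover (R : realType) (VF : finType) (EF : {set {set VF}}) (r : nat) (v0 : VF)
    (EFgr : within setT EF) (EFreg : forall w, #|enb EF w| = r) (r_gt0 : (0 < r)%N) (kinv eps : R)
    (tl : tileable EF r v0 kinv) (kinv_range : 0 < kinv <= 1) (eps_range : 0 < eps <= kinv) (gam : R) : 0 < gam ->
  exists2 eta : R, 0 < eta & forall n1 : nat, exists n2 : nat,
  forall theta, good_theta r kinv theta -> approximable EF eta (theta + eps / 2) n1 ->
  forall (V : finType) (E : {set {set V}}) (X : {set V}),
    within X E -> (n2 <= #|X|)%N -> (forall x, x \in X -> (theta + 2 * eps) * #|X|%:R <= #|enb E x|%:R) ->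
  exists P : {set {set V}}, [/\ P \subset E, dec EF P & forall x, #|enb (E :\: P) x|%:R <= gam * #|X|%:R].
Proof.
move=> gam0; have /andP[k0 k1] := kinv_range; have /andP[eps0 epsk] := eps_range.
have eps1 : eps <= 1 by qlra.
(* A vertex may lose all its edges on the lines where its bad packing is chosen, about one in K;
   this choice of K makes that loss small against gam. *)
pose K := (Num.bound (16 / gam)).+1; have KR : 16 / gam <= K%:R.
  by apply: le_trans (ltW (archi_boundP _)) _; rewrite ?ler_nat // divr_ge0 // ltW.
have K_gt0 : (0 < K)%N by []. have KR0 : 0 < K%:R :> R by rewrite ltr0n.
have g16 : 0 < gam / 16 by rewrite divr_gt0.
have [eta eta0 Heta] := disjoint_bad EFgr EFreg r_gt0 tl kinv_range eps_range g16 K_gt0; exists eta => // n1.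
have [n3 Hn3] := Heta n1.
pose c1 := (gam / 16) ^+ 2 / 8; pose c2 := (eps / 10) ^+ 2 / 8.
have c10 : 0 < c1 by rewrite divr_gt0 ?exprn_gt0.
have c20 : 0 < c2 by rewrite divr_gt0 ?exprn_gt0 ?divr_gt0.
pose Q0 := (Num.bound (16 / gam) + Num.bound (20 / eps))%N.
have [n2 Hn2] := field_size n3 Q0 c10 c20; exists (maxn n2 1) => theta gth apx V E X EX nX degE.
have [th1 th2 _] := gth; have th_half : 1 / 2 <= theta by qnra.
have {Hn2}[|m [m0 small1 small2 qQ0 qn]] := Hn2 #|X|; first by apply: leq_trans nX; apply: leq_maxl.
have [Kf _ cardK] := @pPrimePowerField 2 m isT m0.
rewrite -cardK in small1 small2 qQ0 qn; set q := #|Kf| in cardK small1 small2 qQ0 qn.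
have q0 : (0 < q)%N by rewrite cardK expn_gt0.
set n := #|X| in small1 small2 qn nX degE; have n0 : (0 < n)%N by apply: leq_trans nX; apply: leq_maxr.
pose N : R := n%:R; pose Q : R := q%:R.
have N0 : 0 < N by rewrite ltr0n. have Q_gt0 : 0 < Q by rewrite ltr0n.
have Qg : 16 / gam <= Q.
  apply: le_trans (ltW (archi_boundP _)) _; rewrite ?ler_nat ?divr_ge0 ?ltW //.
  by apply: leq_trans qQ0; apply: leq_addr.
have Qe : 20 / eps <= Q.
  apply: le_trans (ltW (archi_boundP _)) _; rewrite ?ler_nat ?divr_ge0 ?ltW //.
  by apply: leq_trans qQ0; apply: leq_addl.
pose m1 := N / Q; have m10 : 0 < m1 by rewrite divr_gt0.
have [||||xi Hxi] := @random_map R V Kf Kf (fun=> X) (fun a _ => a) n Q^-1; rewrite ?invr_gt0 //.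
  apply: le_lt_trans small2; apply: ler_pM; rewrite ?mulr_ge0 ?expR_ge0 ?ler0n //.
    rewrite ler_pM2l // ler_nat -/q addn1; apply: leq_trans (leq_pmull _ _) => //.
    by rewrite -mulnn leq_pmulr.
  rewrite ler_expR lerN2 -/N -/Q [leRHS](_ : _ = Q^-1 ^+ 2 * N / 8); last by field; rewrite gt_eqF.
  rewrite [leLHS](_ : _ = c2 * (Q^-1 ^+ 2 * N)); last by field; rewrite gt_eqF.
  rewrite mulrC ler_wpM2l ?mulr_ge0 ?exprn_ge0 ?invr_ge0 ?ltW //.
  rewrite /c2 ltr_pdivrMr //; qnra.
pose fib s := [set u in X | xi u == s].
have cfib s : #|fib s|%:R <= 2 * m1.
  have := Hxi s; rewrite -/(fib s) -/n -/q -/N -/Q ler_distl => /andP[_].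
  by rewrite -/m1 [Q^-1 * N]mulrC -/m1; qlra.
pose C := (option ({x : V | x \in X} + Kf) * (Kf * Kf))%type.
pose A (c : C) : {set V} :=
  match c.1 with None => X | Some (inl x) => enb E (val x) | Some (inr s) => fib s end.
pose al := eps / 10 / Q; have al0 : 0 < al by rewrite !divr_gt0.
(* Each line has to receive its share of X, of every neighbourhood and of every fibre of the first
   coordinate. The value that puts u on the line depends on [xi u], which is why [random_map] lets
   the target vary with the argument. *)
have [||ups Hups] := @random_map R V Kf C A (fun c u => c.2.1 * xi u + c.2.2) n al al0 q0.
- move=> [[[x|s]|] l] /=; rewrite /A /= subset_leq_card //; first exact: enb_within EX.
  by apply/subsetP => u; rewrite inE => /andP[].
- rewrite card_prod card_option card_sum card_sig card_prod -/q.
  apply: le_lt_trans small2; rewrite -/n -/N -/Q [(_ + _ + 1)%N]addn1 -mulnn.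
  rewrite le_eqVlt; apply/orP; left; apply/eqP; congr (_ * expR (- _)).
  by rewrite /al /c2; field; rewrite gt_eqF.
pose line (l : Kf * Kf) := [set u in X | ups u == l.1 * xi u + l.2].
(* The ends of an edge inside a fibre of [xi] do not determine a line, so these edges stay
   uncovered; a fibre has at most 2 |X| / q vertices. *)
pose E' := [set e in E | [forall u in e, forall v in e, (u != v) ==> (xi u != xi v)]].
have enbE' x u : u \in enb E' x = (u \in enb E x) && (xi u != xi x).
  rewrite !in_enb inE; have [//|ux /=] := eqVneq u x; congr (_ && _).
  apply/forall_inP/idP => [/(_ u)|xux v]; first rewrite set22 => /(_ isT)/forall_inP/(_ x); rewrite ?set21.
    by move=> /(_ isT)/implyP; apply.
  rewrite !inE => /orP[] /eqP->; apply/forall_inP => w; rewrite !inE => /orP[] /eqP->; rewrite ?eqxx //=.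
    by rewrite [xi x == _]eq_sym xux implybT.
  by rewrite xux implybT.
have lineX l : line l \subset X by apply/subsetP => u; rewrite inE => /andP[].
have nline l : `| #|line l|%:R - m1 | <= eps / 10 * m1.
  have := Hups (None, l); rewrite /A /= -/(line l) -/n -/N -/q -/Q -/m1.
  by rewrite (_ : al * N = eps / 10 * m1) // /al /m1; field; rewrite gt_eqF.
have line_lb l : 1 / 2 * m1 <= #|line l|%:R by have := nline l; rewrite ler_distl => /andP[]; qnra.
have line_ub l : #|line l|%:R <= (1 + eps / 10) * m1 by have := nline l; rewrite ler_distl => /andP[]; qnra.
have line_ub2 l : #|line l|%:R <= 2 * m1 by apply: le_trans (line_ub l) _; rewrite ler_wpM2r ?ltW //; qlra.
pose El l := eind E' (line l).
have E'E : E' \subset E by apply/subsetP => e; rewrite inE => /andP[].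
have ElE l : El l \subset E by apply: subset_trans (eind_sub _ _) E'E.
have Elline l : within (line l) (El l) by apply: within_ind; apply: within_sub E'E EX.
have degl l x : x \in line l -> (theta + eps) * #|line l|%:R <= #|enb (El l) x|%:R.
  move=> xl; have xX := subsetP (lineX l) _ xl.
  have H1 : `| #|enb E x :&: line l|%:R - #|enb E x|%:R / Q | <= eps / 10 * m1.
    have := Hups (Some (inl (Sub x xX)), l); rewrite /A /= -/n -/N -/q -/Q.
    rewrite (_ : [set _ in _ | _] = enb E x :&: line l); last first.
      apply/setP => u; rewrite in_setI !inE; case ux: (_ && (_ \in _)) => //=.
      by rewrite (subsetP (enb_within x EX)) // in_enb.
    by rewrite (_ : al * N = eps / 10 * m1) // /al /m1; field; rewrite gt_eqF.
  have H2 : #|fib (xi x) :&: line l|%:R <= 2 * m1 / Q + eps / 10 * m1.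
    have := Hups (Some (inr (xi x)), l); rewrite /A /= -/n -/N -/q -/Q.
    rewrite (_ : [set _ in _ | _] = fib (xi x) :&: line l); last first.
      by apply/setP => u; rewrite in_setI !inE; case: (u \in X).
    rewrite (_ : al * N = eps / 10 * m1); last by rewrite /al /m1; field; rewrite gt_eqF.
    rewrite ler_distl => /andP[_ /le_trans]; apply; rewrite lerD2r.
    by apply: ler_wpM2r (cfib _); rewrite invr_ge0 ltW.
  have H3 : (#|enb E x :&: line l| <= #|enb (El l) x| + #|fib (xi x) :&: line l|)%N.
    apply: card_sub2; apply/subsetP => u; rewrite in_setI => /andP[ux ul].
    rewrite in_setU enb_ind // !in_setI enbE' ux ul /= !andbT inE (subsetP (lineX l)) //=.
    by rewrite orbC orbN.
  have H4 : (theta + 2 * eps) * m1 <= #|enb E x|%:R / Q.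
    by rewrite /m1 mulrA; apply: ler_wpM2r; [rewrite invr_ge0 ltW|apply: degE].
  have H5 : 2 * m1 / Q <= eps / 10 * m1.
    rewrite mulrAC ler_pM2r // ler_pdivrMr //; move: Qe; rewrite ler_pdivrMr //; qlra.
  move: H1 H3; rewrite ler_distl -(ler_nat R) natrD => /andP[H1 _] H3.
  apply: le_trans (_ : (theta + eps) * ((1 + eps / 10) * m1) <= _).
    by apply: ler_wpM2l (line_ub l); qlra.
  have : (theta + eps) * (1 + eps / 10) <= theta + eps + eps / 5 by qnra.
  by move/(ler_wpM2r (ltW m10)); qnra.
have nl l : (n3 <= #|line l|)%N.
  rewrite -(ler_nat R); apply: le_trans (line_lb l).
  by move: qn; rewrite -(ler_nat R) !natrM -/N -/Q /m1 mulrA ler_pdivlMr //; qlra.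
have /fin_all_exists[f Hf] : forall l, exists Pt : ('I_K -> {set {set V}}) * (V -> 'I_K),
    (forall k, Pt.1 k \subset El l /\ dec EF (Pt.1 k)) /\
    forall k x, x \in line l -> k != Pt.2 x -> #|enb (El l :\: Pt.1 k) x|%:R <= gam / 16 * #|line l|%:R.
  move=> l; have [P [t Pt]] := Hn3 theta gth apx V (El l) (line l) (Elline l) (nl l) (degl l).
  by exists (P, t).
pose Ax (x : {x : V | x \in X}) := [set l | val x \in line l].
have cAx x : (#|Ax x| <= q)%N.
  pose h (a : Kf) := (a, ups (val x) - a * xi (val x)).
  have -> : q = #|[set: Kf]| by rewrite cardsT.
  apply: leq_trans (leq_imset_card h _).
  apply/subset_leq_card/subsetP => -[a b]; rewrite !inE /= => /andP[_ /eqP E1].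
  by apply/imsetP; exists a; rewrite ?inE // /h E1 addrC addKr.
(* One condition for each vertex, each with at most q random choices: this is why q has to outgrow
   log |X|. *)
have [||||kap Hkap] := @random_map R (Kf * Kf)%type 'I_K {x : V | x \in X} Ax (fun x l => (f l).2 (val x)) q (gam / 16).
- by [].
- by rewrite card_ord.
- exact: cAx.
- apply: le_lt_trans small1; rewrite card_sig -/n.
  rewrite le_eqVlt; apply/orP; left; apply/eqP; congr (_ * expR (- _)).
  by rewrite /c1; field.
pose P l := (f l).1 (kap l); have PE l : P l \subset El l by have [/(_ (kap l))[]] := Hf l.
have dP l : dec EF (P l) by have [/(_ (kap l))[]] := Hf l.
have disE l l' : l != l' -> [disjoint El l & El l'].
  move=> ll; rewrite -setI_eq0; apply/eqP/setP => e; rewrite in_setI inE [RHS]inE; apply/negP.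
  case/andP=> /andP[eE' el]; rewrite inE => /andP[_ el'].
  have [x [u [xu De xX uX ux]]] := edgeP (within_sub E'E EX) eE'.
  have := enbE' x u; rewrite ux => /esym/andP[_ xiux]; move: el el'; rewrite De !subUset !sub1set !inE.
  rewrite xX uX /= => /andP[/eqP xl /eqP ul] /andP[/eqP xl' /eqP ul']; case/eqP: ll.
  case: l xl ul => a b /= xl ul; case: l' xl' ul' => a' b' /= xl' ul'.
  have E1 : (a - a') * (xi u - xi x) = 0.
    have -> : (a - a') * (xi u - xi x) = (a * xi u + b) - (a' * xi u + b') - ((a * xi x + b) - (a' * xi x + b')) by ring.
    by rewrite -xl -xl' -ul -ul' !subrr.
  move/eqP: E1; rewrite mulf_eq0 !subr_eq0 (negPf xiux) orbF => /eqP aa; congr (_, _) => //.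
  by move: xl; rewrite xl' aa => /addrI.
exists (\bigcup_(l <- enum {: Kf * Kf}) P l); split.
- by apply: sub_bigcup_seq => l _; apply: subset_trans (PE l) (ElE l).
- apply: dec_bigcup; rewrite ?enum_uniq // => l l' _ _ ll.
  by apply: disjointWl (PE l) _; apply: disjointWr (PE l') _; apply: disE.
move=> x; have [xX|xX] := boolP (x \in X); last first.
  by rewrite enbD (enb_out EX) // set0D cards0 mulr_ge0 ?ler0n // ltW.
pose sx : {x : V | x \in X} := Sub x xX.
have sub : enb (E :\: \bigcup_(l <- enum {: Kf * Kf}) P l) x \subset
    fib (xi x) :|: \bigcup_(l <- enum (Ax sx)) enb (El l :\: P l) x.
  apply/subsetP => u; rewrite enbD in_setD => /andP[nu ux]; rewrite in_setU inE.
  have uX := subsetP (enb_within x EX) _ ux; rewrite uX /=.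
  have [//|xiux /=] := eqVneq (xi u) (xi x).
  pose a := (ups u - ups x) / (xi u - xi x); pose l := (a, ups x - a * xi x).
  have xiux0 : xi u - xi x != 0 by rewrite subr_eq0.
  have xl : x \in line l by rewrite inE xX /= addrC subrK.
  have ul : u \in line l by rewrite inE uX /=; apply/eqP; rewrite /a; field.
  apply/mem_bigcup_seq; exists l; first by rewrite mem_enum inE.
  rewrite enbD in_setD enb_ind // in_setI enbE' ux ul xiux /= andbT.
  apply: contra nu => uP; rewrite enb_bigcup; apply/mem_bigcup_seq; exists l; rewrite ?mem_enum //.
have H := leq_trans (card_sub2 sub) (leq_add (leqnn _) (card_bigcup_le _ _ _)).
move: H; rewrite -(ler_nat R) natrD natr_sum => /le_trans; apply.
apply: le_trans (_ : 2 * m1 + \sum_(l <- enum (Ax sx)) (gam / 16 * (2 * m1) + (kap l == (f l).2 x)%:R * (2 * m1)) <= _).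
  apply: lerD (cfib _) _; rewrite big_seq [leRHS]big_seq; apply: ler_sum => l; rewrite mem_enum inE /= => xl.
  have [_ Hl] := Hf l; have [kt|kt] := eqVneq (kap l) ((f l).2 x); last first.
    rewrite mul0r addr0; apply: le_trans (Hl _ _ xl kt) _; by rewrite ler_wpM2l // ltW.
  rewrite mul1r; apply: ler_wpDl; first by rewrite mulr_ge0 ?(ltW g16) // mulr_ge0 // ltW.
  apply: le_trans (line_ub2 l); rewrite ler_nat subset_leq_card //.
  by apply: enb_within; apply: within_sub (subsetDl _ _) (Elline l).
rewrite big_enum big_split /= sumr_const -mulr_suml -natr_sum.
have -> : (\sum_(l in Ax sx) (kap l == (f l).2 x) = #|[set l in Ax sx | kap l == (f l).2 x]|)%N.
  rewrite -sum1_card big_mkcond [RHS]big_mkcond /=; apply: eq_bigr => l _.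
  by rewrite [in RHS]in_set; case: (l \in Ax sx) => //=; case: (kap l == _).
have HA : #|Ax sx|%:R <= Q by rewrite ler_nat.
have HB : #|[set l in Ax sx | kap l == (f l).2 x]|%:R <= gam / 8 * Q.
  have := Hkap sx; rewrite card_ord -/Q ler_distl => /andP[_ /le_trans]; apply.
  have : #|Ax sx|%:R / K%:R <= gam / 16 * Q.
    rewrite ler_pdivrMr //; apply: le_trans HA _; move: KR; rewrite ler_pdivrMr // => KR.
    by have := ler_wpM2r (ltW Q_gt0) KR; qlra.
  qlra.
have HC : 2 * m1 <= gam / 8 * N.
  rewrite /m1 mulrA ler_pdivrMr //; move: Qg; rewrite ler_pdivrMr // => Qg.
  by have := ler_wpM2r (ltW N0) Qg; qlra.
have HD : gam / 16 * (2 * m1) *+ #|Ax sx| <= gam / 8 * N.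
  rewrite -mulr_natr; apply: le_trans (_ : gam / 16 * (2 * m1) * Q <= _).
    by rewrite ler_wpM2l // mulr_ge0 ?(ltW g16) // mulr_ge0 // ltW.
  by rewrite le_eqVlt; apply/orP; left; apply/eqP; rewrite /m1; field; rewrite gt_eqF.
have HE : #|[set l in Ax sx | kap l == (f l).2 x]|%:R * (2 * m1) <= gam / 4 * N.
  apply: le_trans (_ : gam / 8 * Q * (2 * m1) <= _).
    by rewrite ler_wpM2r // mulr_ge0 // ltW.
  by rewrite le_eqVlt; apply/orP; left; apply/eqP; rewrite /m1; field; rewrite gt_eqF.
have : 0 < gam * N by rewrite mulr_gt0.
by move: HC HD HE; rewrite -/N; qlra.
Qed.

Local Close Scope ring_scope.

(** * The cover-down step *)

Local Open Scope ring_scope.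

Section Plane.
Variable Kf : finFieldType.

(* The affine plane with its points at infinity, except the one of the vertical lines. *)
Definition point := (Kf * Kf + Kf)%type.
Definition incident (l : Kf * Kf) (p : point) : bool :=
  match p with inl xy => xy.2 == l.1 * xy.1 + l.2 | inr c => c == l.1 end.

(** Parallel lines meet at infinity. In [cover_down] this provides a common block for the two ends
    of a leftover edge. *)
Lemma lines_meet l l' : exists p, incident l p && incident l' p.
Proof.
case: l l' => [a b] [a' b']; have [->|aa] := eqVneq a a'; first by exists (inr a'); rewrite /= eqxx.
exists (inl ((b' - b) / (a - a'), a * ((b' - b) / (a - a')) + b)); rewrite /= eqxx /=.
by apply/eqP; field; rewrite subr_eq0.
Qed.

Lemma line_through p p' l l' : p != p' -> incident l p -> incident l p' -> incident l' p ->
  incident l' p' -> l = l'.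
Proof.
case: l l' => [a b] [a' b']; case: p p' => [[x y]|c] [[x' y']|c'] /=; last first.
- by move=> cc /eqP cE /eqP cE'; rewrite cE cE' eqxx in cc.
- by move=> _ /eqP-> /eqP-> /eqP<- /eqP/addrI->.
- by move=> _ /eqP-> /eqP-> /eqP/[swap]/eqP<- /addrI->.
move=> pp /eqP yE /eqP yE' /eqP zE /eqP zE'.
have xx : x != x' by apply: contraNneq pp => xx; rewrite yE yE' xx.
have E1 : (a - a') * (x - x') = 0.
  have -> : (a - a') * (x - x') = (a * x + b) - (a' * x + b') - ((a * x' + b) - (a' * x' + b')) by ring.
  by rewrite -yE -zE -yE' -zE' !subrr.
move/eqP: E1; rewrite mulf_eq0 !subr_eq0 (negPf xx) orbF => /eqP aa; congr (_, _) => //.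
by move: yE; rewrite zE aa => /addrI.
Qed.

Lemma card_point : #|{: point}| = (#|Kf| * #|Kf| + #|Kf|)%N.
Proof. by rewrite card_sum card_prod. Qed.

Lemma card_line l : #|[set p | incident l p]| = #|Kf|.+1.
Proof.
case: l => a b; pose h (o : option Kf) : point := if o is Some x then inl (x, a * x + b) else inr a.
rewrite -(card_option Kf) -cardsT -(card_imset (f := h)); last by move=> [x|] [y|] //= [] ->.
apply: eq_card => -[[x y]|c]; rewrite !inE /=.
  apply/eqP/imsetP => [->|[[z|] _]]; first by exists (Some x).
    by case=> -> ->.
  by [].
by apply/eqP/imsetP => [->|[[z|] _]] => [|//|[]]; first by exists None.
Qed.

Lemma card_pencil p : (#|[set l | incident l p]| <= #|Kf|)%N.
Proof.
rewrite -cardsT; case: p => [[x y]|c] /=.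
  apply: leq_trans (_ : #|[set (a, (y - a * x)%R) | a in [set: Kf]]| <= _)%N; last exact: leq_imset_card.
  apply/subset_leq_card/subsetP => -[a b]; rewrite inE /= => /eqP->.
  by apply/imsetP; exists a; rewrite ?inE // addrC addKr.
apply: leq_trans (_ : #|[set (c, b) | b in [set: Kf]]| <= _)%N; last exact: leq_imset_card.
apply/subset_leq_card/subsetP => -[a b]; rewrite inE /= => /eqP->.
by apply/imsetP; exists b; rewrite ?inE.
Qed.
End Plane.

(** Points index the blocks of U and lines label the vertices outside U, both at random. The plane
    has constant size here, so [random_map_large] applies. *)
Lemma block_map (R : realType) (Kf : finFieldType) (eps : R) (N : nat) : 0 < eps <= 1 ->
  exists n2 : nat, forall (V : finType) (E : {set {set V}}) (X U : {set V}) (theta : R),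
    0 <= theta <= 1 -> within X E -> U \subset X -> (n2 <= #|U|)%N -> (#|X| <= N * #|U|)%N ->
    (forall x, x \in X -> (theta + 4 * eps) * #|U|%:R <= #|enb E x :&: U|%:R) ->
  exists (blk : V -> point Kf) (lam : V -> Kf * Kf),
    [/\ forall b, #|U|%:R / (2 * #|{: point Kf}|%:R) <= #|[set u in U | blk u == b]|%:R :> R,
      forall b, #|[set u in U | blk u == b]|%:R <= 2 * #|U|%:R / #|{: point Kf}|%:R :> R,
      forall b x, x \in X -> #|[set u in U | blk u == b] :\: enb E x|%:R <=
        (1 - theta - 3 * eps) * #|[set u in U | blk u == b]|%:R
    & forall l, #|[set z in X :\: U | lam z == l]|%:R <= 2 * #|X|%:R / #|{: Kf * Kf}|%:R :> R].
Proof.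
move=> /andP[eps0 eps1]; set T := #|{: point Kf}|; set Q := #|{: Kf * Kf}|.
have T0 : (0 < T)%N by apply/card_gt0P; exists (inr 0).
have Q0 : (0 < Q)%N by apply/card_gt0P; exists (0, 0).
have TR : 0 < T%:R :> R by rewrite ltr0n. have QR : 0 < Q%:R :> R by rewrite ltr0n.
have a0 : 0 < eps / 5 / T%:R by rewrite !divr_gt0.
have [m1 H1] := random_map_large (N.+1 * T) a0.
have b0 : 0 < (Q%:R : R)^-1 by rewrite invr_gt0.
have [m2 H2] := random_map_large Q b0.
exists (maxn (maxn m1 m2) 1) => V E X U theta /andP[th0 th1] EX UX nU XU deg.
have nU1 : (m1 <= #|U|)%N by move: nU; rewrite !geq_max => /andP[/andP[]].
have nU2 : (m2 <= #|X|)%N.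
  by apply: leq_trans (subset_leq_card UX); move: nU; rewrite !geq_max => /andP[/andP[]].
have U0 : (0 < #|U|)%N by move: nU; rewrite !geq_max => /andP[].
have X0 : (0 < #|X|)%N by apply: leq_trans (subset_leq_card UX).
pose C := (option {x : V | x \in X} * point Kf)%type.
pose A (c : C) := if c.1 is Some x then enb E (val x) :&: U else U.
have [||blk Hblk] := H1 V (point Kf) C [set: C] A (fun c _ => c.2) #|U| nU1 T0.
- rewrite cardsT card_prod card_option card_sig -/T mulnAC leq_mul2r.
  by apply/orP; right; rewrite mulSn; move: XU U0; rewrite (_ : #|[pred x | x \in X]| = #|X|) //; clear; lia.
- by move=> [[x|] b] _; rewrite /A //= subset_leq_card ?subsetIr.
have [||lam Hlam] := H2 V (Kf * Kf)%type (Kf * Kf)%type [set: Kf * Kf] (fun=> X :\: U) (fun l _ => l) #|X| nU2 Q0.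
- by rewrite cardsT -/Q leq_pmulr.
- by move=> l _; rewrite subset_leq_card ?subsetDl.
pose m : R := #|U|%:R / T%:R; have m0 : 0 < m by rewrite divr_gt0 ?ltr0n.
have am : eps / 5 / T%:R * #|U|%:R = eps / 5 * m by rewrite /m; field; rewrite gt_eqF.
have Bm b : `| #|[set u in U | blk u == b]|%:R - m| <= eps / 5 * m.
  by have := Hblk (None, b); rewrite inE /A /= -/T am; apply.
have Blb b : (1 - eps / 5) * m <= #|[set u in U | blk u == b]|%:R.
  by have := Bm b; rewrite ler_distl => /andP[]; rewrite mulrBl mul1r.
have Bub b : #|[set u in U | blk u == b]|%:R <= (1 + eps / 5) * m.
  by have := Bm b; rewrite ler_distl => /andP[_]; rewrite mulrDl mul1r.
have m1' : 0 <= eps * m by rewrite mulr_ge0 // ltW.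
have m2' : eps * m <= m by rewrite ler_piMl // ltW.
exists blk, lam; split=> [b|b|b x xX|l].
- apply: le_trans (Blb b).
  by rewrite (_ : _ / _ = m / 2); [qlra|rewrite /m; field; rewrite gt_eqF].
- apply: le_trans (Bub b) _.
  by rewrite (_ : _ / _ = 2 * m); [qlra|rewrite /m; field; rewrite gt_eqF].
- set B := [set u in U | blk u == b].
  have : `| #|B :&: enb E x|%:R - #|enb E x :&: U|%:R / T%:R| <= eps / 5 * m.
    have := Hblk (Some (Sub x xX), b); rewrite inE /A /= -/T am => /(_ isT).
    rewrite (_ : [set _ in _ | _] = B :&: enb E x) //.
    by apply/setP => u; rewrite in_set !in_setI [u \in B]in_set [RHS]andbC andbA.
  rewrite ler_distl => /andP[lb _].
  have : (theta + 4 * eps) * m <= #|enb E x :&: U|%:R / T%:R.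
    by rewrite /m mulrA; apply: ler_wpM2r; [rewrite invr_ge0 ltW|apply: deg].
  have cB : #|B|%:R = #|B :&: enb E x|%:R + #|B :\: enb E x|%:R :> R by rewrite -natrD cardsID.
  have BU := Bub b; rewrite -/B in BU.
  have H : 0 <= (theta + 3 * eps) by apply: addr_ge0 => //; rewrite mulr_ge0 // ltW.
  have := ler_wpM2l H BU; have := ler_wpM2r m1' th1.
  have : eps * (eps * m) <= eps * m by rewrite ler_piMl.
  move: lb cB; move: #|B|%:R #|B :&: _|%:R (#|_ :\: _|%:R) => x1 x2 x3; move: (_ / T%:R) => x4; qnra.
have := Hlam l; rewrite inE => /(_ isT); rewrite ler_distl => /andP[_ /le_trans]; apply.
rewrite -/Q; have : #|X :\: U|%:R <= #|X|%:R :> R by rewrite ler_nat subset_leq_card ?subsetDl.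
rewrite -(ler_pM2r b0) [_^-1 * _]mulrC => H; rewrite [2 * _ / _](_ : _ = #|X|%:R / Q%:R + #|X|%:R / Q%:R) ?lerD2r //.
by rewrite -mulrDl -mulr2n mulr_natl.
Qed.

Lemma card_edges_at (V : finType) (X : {set V}) (L : {set {set V}}) v : within X L ->
  (#|[set e in L | v \in e]| <= #|enb L v|)%N.
Proof.
move=> LX; apply: leq_trans (leq_imset_card (fun u => [set v; u]) _).
apply/subset_leq_card/subsetP => e; rewrite inE => /andP[eL].
have [x [y [xy -> _ _ yx]]] := edgeP LX eL.
rewrite !inE => /orP[]/eqP->; apply/imsetP; first by exists y.
by exists x; rewrite 1?enb_sym // setUC.
Qed.

(** Each edge e of L is the root of a task: it receives the edge of F from v0 to one of its
    neighbours, and all new vertices come from [Bk e]. *)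
Lemma embed_leftover (VF V : finType) (EF : {set {set VF}}) (r : nat) (v0 : VF) (X : {set V})
    (G L : {set {set V}}) (Bk : {set V} -> {set V}) (Rt cap ov c : nat) :
    within setT EF -> (forall w, #|enb EF w| = r) -> (0 < r)%N ->
    within X G -> within X L -> [disjoint L & G] ->
    (#|VF| + ov + r * (r * Rt + cap) <= c)%N ->
    (forall e (X' : {set V}), e \in L -> X' \subset e :|: Bk e -> (#|X'| <= r)%N ->
      (c <= #|[set y in Bk e | X' \subset enb G y]|)%N) ->
    (forall v, #|enb L v| <= Rt)%N -> (2 * (#|L| * #|EF|) < ov.+1 * (cap - r).+1)%N -> (r <= cap)%N ->
  exists J : {set {set V}}, [/\ J \subset G, dec EF (J :|: L) & forall v, (#|enb J v| <= r * Rt + cap)%N].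
Proof.
move=> EFgr EFreg r0 GX LX dLG cge cand degL small rcap.
have /card_gt0P[b0 b0v] : (0 < #|enb EF v0|)%N by rewrite EFreg.
have [bv vbE] : b0 != v0 /\ [set v0; b0] \in EF by move: b0v; rewrite in_enb => /andP[].
have [L0|[e0 e0L]] := set_0Vmem L.
  by exists set0; rewrite sub0set L0 setU0; split=> // [|v]; [apply: dec0|rewrite enb0 cards0].
have [x0 [_ [_ _ _ _ _]]] := edgeP LX e0L.
pose P := [set v0; b0].
have /fin_all_exists[phi Hphi] : forall e : {set V}, exists phi : {ffun VF -> V},
    e \in L -> phi v0 != phi b0 /\ e = [set phi v0; phi b0].
  move=> e; have [eL|eL] := boolP (e \in L); last by exists [ffun=> x0].
  have [x [y [xy De _ _ _]]] := edgeP LX eL.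
  by exists [ffun v => if v == v0 then x else y]; rewrite !ffunE eqxx (negPf bv).
have DEP : EP EF P = [set P].
  apply/setP => e; rewrite in_set1; apply/setIdP/eqP => [[eE eP]|->]; last by rewrite subxx.
  by apply/eqP; rewrite eqEcard eP cards2 (eq_sym v0) bv /=; have [-> _] := EFgr _ eE.
have phiP e : phi e @: P = [set phi e v0; phi e b0] by rewrite imset_set2.
have rootL e : e \in L -> rootE EF P (phi e, Bk e, e :|: Bk e) = [set e].
  by move=> eL; rewrite /rootE /imE DEP imset_set1 /tphi /= phiP; have [_ <-] := Hphi e eL.
pose ts := [seq (phi e, Bk e, e :|: Bk e) | e <- enum L].
have Dts : \bigcup_(t <- ts) rootE EF P t = L.
  rewrite big_map; apply/setP => e; apply/mem_bigcup_seq/idP => [[e' /[!mem_enum] eL]|eL].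
    by rewrite rootL // => /set1P->.
  by exists e; rewrite ?mem_enum // rootL // set11.
have [|||||||J [JG dJ degJ]] := @embed_many VF V EF r P EFgr _ X G Rt cap ov c GX cge ts.
- by move=> w; rewrite EFreg.
- move=> t /mapP[e /[!mem_enum] eL ->]; have [pne De] := Hphi e eL; split; rewrite /tphi /tY /tZ /=.
  + move=> x y; rewrite !inE => /orP[]/eqP-> /orP[]/eqP-> // /eqP; first by rewrite (negPf pne).
    by rewrite eq_sym (negPf pne).
  + exact: subsetUr.
  + by move=> p w pP _ _; have := imset_f (phi e) pP; rewrite phiP -De in_setU => ->.
  + by move=> X'; apply: cand.
- move=> v vX; rewrite count_map; apply: leq_trans (degL v); apply: leq_trans (card_edges_at v LX).
  rewrite (@eq_in_count _ _ (fun e : {set V} => v \in e)); last first.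
    by move=> e /[!mem_enum] eL; rewrite /= /tphi /= phiP; have [_ <-] := Hphi e eL.
  rewrite cardE -size_filter; apply: uniq_leq_size => [|e]; first by apply: filter_uniq; apply: enum_uniq.
  by rewrite mem_filter !mem_enum inE andbC.
- by rewrite size_map -cardE.
- by [].
- rewrite pairwise_map; apply/(pairwiseP e0) => i j; rewrite !inE => iL jL ij /=.
  have [eiL ejL] : nth e0 (enum L) i \in L /\ nth e0 (enum L) j \in L by rewrite -!(mem_enum L) !mem_nth.
  rewrite !rootL // disjoints1 in_set1 nth_uniq ?enum_uniq //.
  by rewrite neq_ltn ij.
- move=> t /mapP[e /[!mem_enum] eL ->]; rewrite rootL // disjoints1.
  by have := disjoint_setI0 dLG; move/setP/(_ e); rewrite in_setI eL inE /= => ->.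
by exists J; split; rewrite ?Dts // in dJ *.
Qed.

Local Close Scope ring_scope.

Local Open Scope ring_scope.

Lemma card_fibers (V S : finType) (A : {set V}) (f : V -> S) (p : pred S) :
  #|[set u in A | p (f u)]| = (\sum_(b | p b) #|[set u in A | f u == b]|)%N.
Proof.
rewrite -sum1_card (partition_big f p) /=; last by move=> u; rewrite inE => /andP[].
apply: eq_bigr => b pb; rewrite -sum1_card; apply: eq_bigl => u.
by rewrite !inE -andbA; case: eqP => [->|]; rewrite ?pb ?andbF ?andbT.
Qed.

Lemma truncn_bounds (R : realType) (x : R) : 0 <= x -> (Num.truncn x)%:R <= x < (Num.truncn x).+1%:R.
Proof. exact: Num.Theory.truncn_itv. Qed.

(** Reserve, for each w outside U, the star at w to the blocks on its line, together with all edges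
    inside U, and pack the rest by [small_leftover]. A leftover edge is covered by reserved edges
    through the block where the lines of its ends meet; an end in U poses no condition, all its
    edges in U being reserved. What is then uncovered outside U consists of stars of size divisible
    by r, and [star_cover] applies with the lines as labels. A vertex of U lies in at most 2 |X| / q
    of these stars, hence few edges inside U are used. *)
Lemma cover_down (R : realType) (VF : finType) (EF : {set {set VF}}) (r : nat) (v0 : VF)
    (EFgr : within setT EF) (EFreg : forall w, #|enb EF w| = r) (r_gt0 : (0 < r)%N) (kinv eps : R)
    (tl : tileable EF r v0 kinv) (kinv_range : 0 < kinv <= 1) (eps_range : 0 < eps <= kinv)
    (N : nat) (gam : R) : 0 < gam ->
  exists2 eta : R, 0 < eta & forall n1 : nat, exists n2 : nat,
  forall theta, good_theta r kinv theta -> approximable EF eta (theta + eps / 2) n1 ->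
  forall (V : finType) (E : {set {set V}}) (X U : {set V}),
    within X E -> U \subset X -> (n2 <= #|U|)%N -> (#|X| <= N * #|U|)%N -> #|U|%:R <= eps / 2 * #|X|%:R ->
    (forall x, x \in X -> (theta + 4 * eps) * #|X|%:R <= #|enb E x|%:R) ->
    (forall x, x \in X -> (theta + 4 * eps) * #|U|%:R <= #|enb E x :&: U|%:R) ->
    (forall z, z \in X -> z \notin U -> (r %| #|enb E z|)%N) ->
  exists P : {set {set V}}, [/\ P \subset E, dec EF P, E :\: eind E U \subset P
    & forall x, x \in U -> #|enb P x :&: U|%:R <= gam * #|U|%:R].
Proof.
move=> gam0; have /andP[k0 k1] := kinv_range; have /andP[eps0 epsk] := eps_range.
have eps1 : eps <= 1 := le_trans epsk k1.
have [n0 [C [c0 [c00 stc]]]] := star_cover EFgr EFreg r_gt0 tl eps0.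
have rR : 1 <= r%:R :> R by rewrite ler1n.
have rp : 0 < r%:R :> R by apply: lt_le_trans rR.
have [nn Dnn] : {nn : R | nn = N.+1%:R} by exists N.+1%:R.
have nn1 : 1 <= nn by rewrite Dnn ler1n.
have nn0 : 0 < nn by apply: lt_le_trans nn1.
have C0 : 0 <= C%:R :> R by rewrite ler0n.
have [b b0 /and5P[b1 b2 b3 b4 _]] : exists2 b : R, 0 < b &
    all (fun a => b <= a) [:: eps / (16 * r%:R * nn); c0 / (4 * nn); gam / (8 * nn * (C%:R + 1)); eps / 32].
  by apply: small_pos; rewrite /= !divr_gt0 ?mulr_gt0 ?ltr_wpDl ?(lt_le_trans _ rR).
(* The order q = 2^m of the field is a constant with 1/q <= b, where b is below all the fractions
   that the losses of order 1/q are compared with. *)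
pose m := (Num.bound b^-1).+1.
have [Kf _ cardK] := @pPrimePowerField 2 m isT isT.
set q := #|Kf| in cardK; pose Q : R := q%:R.
have Qb : 1 <= b * Q.
  rewrite -ler_pdivrMl // mulr1; apply: le_trans (ltW (archi_boundP _)) _; first by rewrite invr_ge0 ltW.
  by rewrite ler_nat cardK; apply: leq_trans (ltnW (ltn_expl m (isT : 1 < 2)%N)).
have Q0 : 0 < Q by rewrite -(pmulr_rgt0 _ b0); apply: lt_le_trans Qb.
pose T : R := #|{: point Kf}|%:R.
have DT : T = Q * (Q + 1) by rewrite /T card_point natrD natrM mulrDr mulr1.
have T0 : 0 < T by rewrite DT mulr_gt0 // addr_gt0.
have [z z0 /and3P[z1 z2 _]] : exists2 z : R, 0 < z & all (fun a => z <= a) [:: eps / (16 * T); gam / 4].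
  by apply: small_pos; rewrite /= !divr_gt0 ?mulr_gt0.
pose rr : R := 1 + r%:R + r%:R ^+ 2; have rr0 : 0 < rr by rewrite !addr_gt0 ?exprn_gt0 ?(lt_le_trans _ rR).
(* The fraction z of |U| is the number of candidates that may be given up in a block, and s |U| is
   the size allowed for the overloaded set. The leftover degree g is so small that the copies on all
   leftover edges meet the counting condition of [embed_many] with both ov and cap - r equal to the
   integer part of s |U|. *)
pose s : R := z / (4 * rr); have s0 : 0 < s by rewrite divr_gt0 // mulr_gt0.
pose f : R := #|EF|%:R + 1; have f0 : 0 < f by rewrite ltr_wpDl.
pose g := s ^+ 2 / (nn ^+ 2 * f); have g0 : 0 < g by rewrite divr_gt0 ?exprn_gt0 // mulr_gt0 // exprn_gt0.
have [eta eta0 Heta] := small_leftover EFgr EFreg r_gt0 tl kinv_range eps_range g0.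
exists eta => // n1; have [n3 Hn3] := Heta n1.
have e1 : 0 < eps <= 1 by rewrite eps0.
have [n4 Hn4] := block_map Kf N e1.
have z4 : 0 < z / 4 by rewrite divr_gt0.
have [n5 Hn5] := large_nat (#|VF|%:R + r%:R ^+ 2 + r%:R : R) z4.
have b8 : 0 < 1 / (8 * Q) by rewrite divr_gt0 ?mulr_gt0.
have [n6 Hn6] := large_nat (n0%:R + 1 : R) b8.
have c2 : 0 < c0 / 4 by rewrite divr_gt0.
have [n7 Hn7] := large_nat (1 : R) c2.
have g4 : 0 < gam / 4 by rewrite divr_gt0.
have [n8 Hn8] := large_nat (C%:R : R) g4.
exists (\sum_(x <- [:: 1; n3; n4; n5; n6; n7; n8]) x)%N => theta gth apx V E X U EX UX nU XU UsX degE degU divE.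
have [th1 thk thr] := gth; have th_half : 1 / 2 <= theta by move: thk k0 k1 th1; gnra.
have {}nU x : x \in [:: 1; n3; n4; n5; n6; n7; n8]%N -> (x <= #|U|)%N.
  by move=> xs; apply: leq_trans nU; rewrite (big_rem x) //= leq_addr.
have U0 : (0 < #|U|)%N by apply: nU; rewrite inE.
have cUX := subset_leq_card UX; have X0 : (0 < #|X|)%N by apply: leq_trans cUX.
set u : R := #|U|%:R in UsX degU *; set n : R := #|X|%:R in UsX degE *.
have u0 : 0 < u by rewrite ltr0n. have n_gt0 : 0 < n by rewrite ltr0n.
have nu : n <= nn * u by rewrite Dnn -natrM ler_nat; apply: leq_trans XU _; rewrite leq_mul2r leqnSn orbT.
have {Hn5} H5 : #|VF|%:R + r%:R ^+ 2 + r%:R <= z / 4 * u by apply: Hn5; apply: nU; rewrite !inE eqxx !orbT.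
have {Hn6} H6 : n0%:R + 1 <= 1 / (8 * Q) * u by apply: Hn6; apply: nU; rewrite !inE eqxx !orbT.
have {Hn7} H7 : 1 <= c0 / 4 * u by apply: Hn7; apply: nU; rewrite !inE eqxx !orbT.
have {Hn8} H8 : C%:R <= gam / 4 * u by apply: Hn8; apply: nU; rewrite !inE eqxx !orbT.
have eps8 : eps <= 1 / 8.
  have /card_gt0P[x xX] := X0; have := degU x xX.
  have : #|enb E x :&: U|%:R <= u by rewrite ler_nat subset_leq_card ?subsetIr.
  move=> Hu /le_trans/(_ Hu); rewrite -[leRHS]mul1r ler_pM2r //; move: th_half; glra.
have Q1 : 1 <= Q by move: Q0; rewrite ler1n ltr0n.
have iQ : Q^-1 <= b by rewrite -[leRHS]mulr1 -ler_pdivrMl // -invfM invf_le1 ?mulr_gt0.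
have divQ x c : 0 <= x -> b <= c -> x / Q <= c * x.
  by move=> x0 bc; rewrite mulrC ler_wpM2r // (le_trans iQ bc).
have un : u <= n by rewrite ler_nat.
have nQ : 2 * n / Q <= eps / 16 * n.
  by have := divQ n _ (ltW n_gt0) b4; rewrite -mulrA; glra.
have uQ : 2 * u / Q <= eps / 16 * u.
  by have := divQ u _ (ltW u0) b4; rewrite -mulrA; glra.
pose w0 := u / (2 * Q); have w00 : 0 < w0 by rewrite divr_gt0 // mulr_gt0.
have w0u : w0 <= u / 2.
  by rewrite /w0 invfM mulrA -[leRHS]mulr1 ler_wpM2l ?invf_le1 // ltW // divr_gt0.
have uT : 2 * u / T <= eps / 8 * w0.
  have -> : 2 * u / T = 4 * (w0 / (Q + 1)) by rewrite /w0 DT; field; rewrite !gt_eqF // addr_gt0.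
  have : w0 / (Q + 1) <= w0 / Q by rewrite ler_wpM2l ?(ltW w00) // lef_pV2 ?posrE ?addr_gt0 // lerDl.
  by have := divQ w0 _ (ltW w00) b4; glra.
have uT0 : 0 < u / T by rewrite divr_gt0.
have zT : z * u <= eps / 16 * (u / T).
  by apply: le_trans (ler_wpM2r (ltW u0) z1) _; rewrite le_eqVlt; apply/orP; left; apply/eqP; field; rewrite gt_eqF.
have zu0 : 0 < z * u by rewrite mulr_gt0.
have T1 : 1 <= T by rewrite DT; move: Q1; gnra.
have z_eps : z <= eps / 16.
  by apply: le_trans z1 _; rewrite ler_pM2l // lef_pV2 ?posrE ?mulr_gt0 //; move: T1; glra.
have rr1 : 1 <= rr by have := sqr_ge0 (r%:R : R); rewrite /rr; move: rR; glra.
have srr : s * rr = z / 4 by rewrite /s; field; rewrite gt_eqF.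
have s1 : s <= 1.
  have : s <= s * rr by rewrite ler_peMr // ltW.
  by rewrite srr; move: z_eps eps1; glra.
have K1 : 1 - theta - 2 * eps <= (kinv - eps) * (theta + 11 / 4 * eps).
  have := mulr_ge0 (ltW eps0) (_ : 0 <= kinv - eps); rewrite subr_ge0 => /(_ epsk).
  have := mulr_ge0 (ltW eps0) (_ : 0 <= 1 - theta); rewrite subr_ge0 => /(_ th1).
  by move: thk eps0; glra.
have [||blk [lam [Blb Bub Bnb lamub]]] := Hn4 V E X U theta _ EX UX (nU _ _) XU degU.
- by rewrite th1 andbT; move: th_half; glra.
- by rewrite !inE eqxx !orbT.
rewrite -/u -/T in Blb Bub; set B := fun b => [set u in U | blk u == b].
have {}Blb p : u / (2 * T) <= #|B p|%:R by exact: Blb.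
have {}Bub p : #|B p|%:R <= 2 * u / T by exact: Bub.
have {}Bnb p x : x \in X -> #|B p :\: enb E x|%:R <= (1 - theta - 3 * eps) * #|B p|%:R by exact: Bnb.
have BU p : B p \subset U by apply/subsetP => y; rewrite in_set => /andP[].
pose W l := [set y in U | incident l (blk y)]; pose Cs := X :\: U.
have WU l : W l \subset U by apply/subsetP => y; rewrite in_set => /andP[].
have Wlb l : u / (2 * Q) <= #|W l|%:R.
  rewrite /W card_fibers natr_sum; apply: le_trans (_ : \sum_(p | incident l p) u / (2 * T) <= _).
    rewrite sumr_const -[leRHS]mulr_natr -[#|_|]cardsE card_line -/q -natr1 -/Q DT.
    by rewrite le_eqVlt; apply/orP; left; apply/eqP; field; rewrite !gt_eqF // addr_gt0.
  by apply: ler_sum => p _; apply: Blb.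
have Wub l : #|W l|%:R <= 2 * u / Q.
  rewrite /W card_fibers natr_sum; apply: le_trans (_ : \sum_(p | incident l p) 2 * u / T <= _).
    by apply: ler_sum => p _; apply: Bub.
  rewrite sumr_const -[leLHS]mulr_natr -[#|_|]cardsE card_line -/q -natr1 -/Q DT.
  by rewrite le_eqVlt; apply/orP; left; apply/eqP; field; rewrite !gt_eqF // addr_gt0.
have Wnb l x : x \in X -> #|W l :\: enb E x|%:R <= (1 - theta - 3 * eps) * #|W l|%:R.
  move=> xX; have -> : W l :\: enb E x = [set y in U :\: enb E x | incident l (blk y)].
    by apply/setP => y; rewrite in_setD [y \in W l]in_set [RHS]in_set in_setD andbA.
  rewrite !card_fibers !natr_sum mulr_sumr; apply: ler_sum => p _; apply: le_trans (Bnb p x xX).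
  rewrite ler_nat; apply/subset_leq_card/subsetP => y.
  by rewrite [y \in _]in_set !in_setD [y \in B p]in_set andbA.
have load x : #|[set w in Cs | incident (lam w) (blk x)]|%:R <= 2 * n / Q.
  rewrite (card_fibers Cs lam (fun l => incident l (blk x))) natr_sum.
  apply: le_trans (_ : \sum_(l | incident l (blk x)) 2 * n / (Q * Q) <= _).
    by apply: ler_sum => l _; apply: le_trans (lamub l) _; rewrite card_prod natrM.
  rewrite sumr_const -[leLHS]mulr_natr -[#|_|]cardsE; apply: le_trans (_ : 2 * n / (Q * Q) * Q <= _).
    rewrite ler_wpM2l ?ler_nat ?card_pencil // ltW // divr_gt0 ?mulr_gt0 //.
  by rewrite le_eqVlt; apply/orP; left; apply/eqP; field; rewrite !gt_eqF.
pose S w := enb E w :&: W (lam w).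
have SU w : S w \subset U by apply: subset_trans (subsetIr _ _) (WU _).
have CsP w : (w \in Cs) = (w \in X) && (w \notin U) by rewrite in_setD andbC.
pose Rv := \bigcup_(w <- enum Cs) star w (S w).
have inRv x y : y \in enb Rv x = (x \in Cs) && (y \in S x) || (y \in Cs) && (x \in S y).
  have CS w v : w \in Cs -> v \in S w -> v != w.
    by rewrite CsP => /andP[_ wU] /(subsetP (SU w)) vU; apply: contraNneq wU => <-.
  rewrite enb_bigcup; apply/mem_bigcup_seq/orP => [[w /[!mem_enum] wC]|].
    rewrite starE => /andP[_ /orP[]/andP[/eqP Dw yS]]; [left|right]; by rewrite Dw wC.
  case=> /andP[wC yS]; [exists x|exists y]; rewrite ?mem_enum // starE eqxx yS /= ?orbT andbT.
    exact: CS wC yS.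
  by rewrite eq_sym; apply: CS wC yS.
have RvE : Rv \subset E.
  apply: sub_bigcup_seq => w _; apply/subsetP => _ /imsetP[y /setIP[yw _] ->].
  by move: yw; rewrite in_enb => /andP[].
have UCs x : x \in U -> (x \in Cs) = false by move=> xU; rewrite CsP xU andbF.
pose EU := eind E U; pose G := Rv :|: EU; pose E0 := E :\: G.
have EUE : EU \subset E by apply: eind_sub.
have GE : G \subset E by rewrite subUset RvE.
have E0X : within X E0 by apply: within_sub (subsetDl _ _) EX.
have Sub w : #|S w|%:R <= 2 * u / Q.
  by apply: le_trans (Wub (lam w)); rewrite ler_nat subset_leq_card ?subsetIr.
have enbEU x : x \notin U -> enb EU x = set0 by apply: enb_out; apply: within_ind EX.
have [||P1 [P1E0 dP1 degP1]] := Hn3 theta gth apx V E0 X E0X.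
- by apply: leq_trans cUX; apply: nU; rewrite !inE eqxx !orbT.
- move=> x xX; have := degE x xX.
  have [xU|xU] := boolP (x \in U).
    have H1 : (#|enb E x| <= #|enb E0 x| + #|[set w in Cs | incident (lam w) (blk x)]| + #|U|)%N.
      apply: card_sub3; apply/subsetP => y yx; rewrite !in_setU /E0 enbD in_setD yx andbT /G enbU in_setU inRv.
      rewrite (UCs x xU) /= in_set; have [yU|yU] := boolP (y \in U); first by rewrite orbT.
      rewrite CsP yU (subsetP (enb_within x EX) _ yx) /= !orbF.
      have [|xS /=] := boolP (x \in S y); first by rewrite in_setI [x \in W _]in_set xU orbC /= => /andP[_ ->].
      by rewrite /EU enb_ind // in_setI (negPf yU) andbF.
    by move: H1 (load x); rewrite -(ler_nat R) !natrD -/n -/u; move: nQ UsX (mulr_gt0 eps0 n_gt0); glra.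
  have H1 : (#|enb E x| <= #|enb E0 x| + #|S x|)%N.
    apply: card_sub2; apply/subsetP => y yx; rewrite !in_setU /E0 enbD in_setD yx andbT /G enbU in_setU inRv CsP xX xU /=.
    have [//|yS /=] := boolP (y \in S x).
    rewrite orbF negb_or enbEU // in_set0 andbT.
    by apply/negP => /andP[_ /(subsetP (SU y))]; rewrite (negPf xU).
  by move: H1 (Sub x); rewrite -(ler_nat R) natrD; move: uQ (ler_wpM2l (ltW eps0) un) (mulr_gt0 eps0 n_gt0); glra.
pose L := E0 :\: P1; have LE0 : L \subset E0 by apply: subsetDl.
have LX : within X L by apply: within_sub LE0 E0X.
have GX : within X G by apply: within_sub GE EX.
have dE0G : [disjoint E0 & G] by rewrite -setI_eq0 setIDAC setDIl setDv setI0 eqxx.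
have dLG : [disjoint L & G] by apply: disjointWl LE0 dE0G.
have /fin_all_exists[pt Hpt] : forall e : {set V}, exists p, e \in L -> forall x, x \in e -> incident (lam x) p.
  move=> e; have [eL|eL] := boolP (e \in L); last by exists (inr 0).
  have [x [y [_ -> _ _ _]]] := edgeP LX eL.
  have [p /andP[px py]] := lines_meet (lam x) (lam y).
  by exists p => _ w; rewrite !inE => /orP[]/eqP->.
have s_u : 0 <= s * u by rewrite ltW // mulr_gt0.
have gn0 : 0 <= g * n by rewrite ltW // mulr_gt0.
pose ov := Num.truncn (s * u); pose Rt := Num.truncn (g * n).
have /andP[ov1 ov2] := truncn_bounds s_u; have /andP[Rt1 Rt2] := truncn_bounds gn0.
rewrite -/ov in ov1 ov2; rewrite -/Rt in Rt1 Rt2.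
have gsu : g * n <= s * u.
  apply: le_trans (_ : s * (s / (nn * f)) * u <= _).
    rewrite [s * _](_ : _ = g * nn); first by rewrite -mulrA ler_wpM2l // ltW.
    by rewrite /g; clearbody f; field; rewrite !gt_eqF.
  rewrite ler_wpM2r ?(ltW u0) // ler_piMr ?(ltW s0) // ler_pdivrMr ?mulr_gt0 // mul1r.
  have : 1 <= f by rewrite lerDr.
  by move=> f1; apply: le_trans s1 _; move: nn1 f1; gnra.
have rRt : r%:R * Rt%:R <= r%:R * (s * u) by rewrite ler_wpM2l // (le_trans Rt1).
have su_rr : s * u * rr = z / 4 * u by rewrite mulrAC srr.
have r2 : 0 <= r%:R ^+ 2 * (s * u) by rewrite mulr_ge0 // exprn_ge0.
have VF0 := ler0n R #|VF|; have r20 : 0 <= r%:R ^+ 2 :> R by rewrite exprn_ge0.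
have Jb : (r * Rt + (r + ov))%:R <= z / 2 * u.
  move: su_rr; rewrite !natrD natrM /rr !mulrDr mulr1 [s * u * r%:R]mulrC [s * u * _ ^+ 2]mulrC.
  by move: rRt ov1 r2 H5 VF0 r20 zu0; glra.
have cb : (#|VF| + ov + r * (r * Rt + (r + ov)))%:R <= z * u.
  have : r%:R * (r%:R * Rt%:R + (r%:R + ov%:R)) <= r%:R * (r%:R * (s * u) + (r%:R + s * u)) :> R.
    by rewrite ler_wpM2l //; move: rRt ov1; glra.
  rewrite [leRHS](_ : _ = r%:R ^+ 2 * (s * u) + r%:R ^+ 2 + r%:R * (s * u)); last by ring.
  move: su_rr; rewrite !natrD natrM !natrD natrM /rr !mulrDr mulr1 [s * u * r%:R]mulrC [s * u * _ ^+ 2]mulrC.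
  by move: ov1 H5 rR zu0; glra.
have degL v : (#|enb L v| <= Rt)%N by rewrite Num.Theory.truncn_ge_nat.
have := @embed_leftover VF V EF r v0 X G L (fun e => B (pt e)) Rt (r + ov) ov _ EFgr EFreg r_gt0 GX LX dLG (leqnn _).
case=> [||||J [JG dJ degJ]].
- move=> e X' eL X'e cX'; rewrite -(ler_nat R); apply: le_trans cb _.
  have X'X : X' \subset X.
    apply: subset_trans X'e _; rewrite subUset (subset_trans (BU _) UX) andbT.
    by have [_ ->] := LX e eL.
  have sub : B (pt e) \subset [set y in B (pt e) | X' \subset enb G y] :|: \bigcup_(x in X') (B (pt e) :\: enb E x).
    apply/subsetP => y yB; rewrite in_setU in_set yB /=; have [//|/subsetPn[x xX' xy]] := boolP (X' \subset _).
    apply/bigcupP; exists x => //; rewrite in_setD yB andbT; apply: contra xy => yx.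
    have yU := subsetP (BU _) _ yB; rewrite -enb_sym /G enbU in_setU.
    have [xU|xU] := boolP (x \in U); first by rewrite /EU enb_ind // in_setI yx yU orbT.
    have xe : x \in e.
      by have := subsetP X'e _ xX'; rewrite in_setU => /orP[//|/(subsetP (BU _))]; rewrite (negPf xU).
    rewrite inRv CsP (subsetP X'X) // xU in_setI yx in_set yU /=.
    by move: yB; rewrite in_set yU /= => /eqP->; rewrite (Hpt e eL).
  have := leq_trans (card_sub2 sub) (leq_add (leqnn _) (card_bigcup_le _ _ _)).
  rewrite -(ler_nat R) natrD natr_sum => H.
  have : \sum_(x in X') #|B (pt e) :\: enb E x|%:R <= (1 - 3 * eps) * #|B (pt e)|%:R.
    apply: le_trans (_ : \sum_(x in X') (1 - 3 * eps) / r%:R * #|B (pt e)|%:R <= _).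
      apply: ler_sum => x xX'; apply: le_trans (Bnb _ _ (subsetP X'X _ xX')) _.
      rewrite ler_wpM2r ?ler0n // mulrBl mul1r.
      have : r%:R^-1 <= 1 :> R by rewrite invf_le1 // (lt_le_trans _ rR).
      by move=> r1; have := ler_wpM2l (ltW eps0) r1; move: thr; glra.
    rewrite sumr_const -[leLHS]mulr_natr; apply: le_trans (_ : (1 - 3 * eps) / r%:R * #|B (pt e)|%:R * r%:R <= _).
      rewrite ler_wpM2l ?ler_nat // mulr_ge0 // divr_ge0 //; move: eps8; glra.
    by rewrite mulrAC divfK // gt_eqF // (lt_le_trans _ rR).
  have : 3 * eps * (1 / 2 * (u / T)) <= 3 * eps * #|B (pt e)|%:R.
    rewrite ler_pM2l ?mulr_gt0 //; apply: le_trans (Blb _).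
    by rewrite le_eqVlt; apply/orP; left; apply/eqP; field; rewrite gt_eqF.
  have : 0 < eps * (u / T) by rewrite mulr_gt0.
  by move: H zT; glra.
- exact: degL.
- have L2 : 2 * #|L|%:R <= n * (g * n) :> R.
    rewrite -natrM -(sum_enb LX) natr_sum (bigID [in X]) /= [X in _ + X]big1 ?addr0; last first.
      by move=> x xX; rewrite (enb_out LX xX) cards0.
    apply: le_trans (_ : \sum_(x in X) g * n <= _).
      by apply: ler_sum => x _; apply: degP1.
    by rewrite sumr_const -[leLHS]mulr_natr mulrC.
  rewrite -(ltr_nat R) !natrM addKn mulrA; apply: le_lt_trans (_ : n * (g * n) * #|EF|%:R < _).
    by rewrite ler_wpM2r.
  apply: le_lt_trans (_ : (s * u) * (s * u) < _); last by apply: ltr_pM.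
  apply: le_trans (_ : (nn * u) * (g * (nn * u)) * f <= _).
    apply: ler_pM; rewrite ?lerDl //; first by apply: mulr_ge0 => //; apply: ltW.
    by apply: ler_pM => //; rewrite ler_wpM2l // ltW.
  rewrite le_eqVlt; apply/orP; left; apply/eqP; rewrite /g; clearbody s f; field; rewrite !gt_eqF //.
- exact: leq_addr.
have JE : J \subset E by apply: subset_trans GE.
have degJ' v : #|enb J v|%:R <= z / 2 * u by apply: le_trans Jb; rewrite ler_nat.
pose Eu := P1 :|: (J :|: L).
have dJE0 : [disjoint E0 & J] by apply: disjointWr JG dE0G.
have dEu : dec EF Eu.
  apply: decU => //; rewrite -setI_eq0 setIUr setU_eq0 !setI_eq0 (disjointWl P1E0 dJE0) /=.
  by rewrite disjoint_sym disjoints_subset /L setDE subsetIr.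
have EuE : Eu \subset E by rewrite !subUset JE (subset_trans P1E0 (subsetDl _ _)) (subset_trans LE0 (subsetDl _ _)).
have inE0 e : e \in E0 -> e \in Eu.
  by move=> eE0; rewrite !in_setU /L in_setD eE0 andbT; case: (e \in P1); rewrite //= orbT.
pose S' w := enb (E :\: Eu) w.
have DS' w : w \in Cs -> S' w = S w :\: enb J w.
  move=> wC; have wU : w \notin U by move: wC; rewrite CsP => /andP[].
  apply/setP => y; rewrite /S' !in_setD enbD in_setD /Eu !enbU !in_setU !negb_or.
  apply/idP/idP => [/andP[/and3P[yP1 yJ yL] yw]|/andP[yJ yS]].
    rewrite yJ; move: yL; rewrite /L enbD in_setD yP1 /E0 enbD in_setD yw andbT negbK /G enbU in_setU.
    rewrite inRv wC /= enbEU // in_set0 orbF => /orP[//|/andP[_ /(subsetP (SU _))]].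
    by rewrite (negPf wU).
  rewrite yJ /=; have yw : y \in enb E w by move: yS; rewrite in_setI => /andP[].
  have yE0 : y \notin enb E0 w by rewrite enbD in_setD /G enbU in_setU inRv wC yS.
  by rewrite yw andbT (contra (subsetP (enbS w P1E0) y) yE0) (contra (subsetP (enbS w LE0) y) yE0).
have S'S w : w \in Cs -> S' w \subset S w by move=> wC; rewrite DS' // subsetDl.
(* All other edges at w are covered by now, and a copy of F has r edges or none at w. *)
have divS' w : w \in Cs -> (r %| #|S' w|)%N.
  move=> wC; move: (wC); rewrite CsP => /andP[wX wU]; have := divE w wX wU.
  rewrite -(cardsID (enb Eu w) (enb E w)) -enbI -enbD (setIidPr EuE) dvdn_addr //; exact: dec_deg.
pose J' := EU :\: J; have J'EU : J' \subset EU by apply: subsetDl.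
have J'U : within U J' by apply: within_sub J'EU (within_ind EX).
(* Edges inside a single block are left out because a block lies on several lines; two lines share
   at most one block, so the layers become disjoint. *)
pose Jl l := [set e in eind J' (W l) | ~~ [exists p, e \subset B p]].
have JlJ' l : Jl l \subset J' by apply/subsetP => e; rewrite in_set => /andP[/(subsetP (eind_sub _ _))].
have enbJl l x y : x \in W l -> y \in W l -> y \in enb E x -> y \notin enb J x -> y \notin B (blk x) ->
    y \in enb (Jl l) x.
  move=> xW yW yx yJ yB; have xU := subsetP (WU l) _ xW; have yU := subsetP (WU l) _ yW.
  have yJ' : y \in enb (eind J' (W l)) x.
    by rewrite enb_ind // in_setI yW andbT /J' enbD in_setD yJ /EU enb_ind // in_setI yx.
  move: (yJ'); rewrite !in_enb => /andP[->] H; rewrite in_set H /=; apply: contra yB => /existsP[p].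
  by rewrite subUset !sub1set !in_set xU => /andP[/eqP-> ->].
have degS' w : w \in Cs -> (theta + 11 / 4 * eps) * #|W (lam w)|%:R <= #|S' w|%:R.
  move=> wC; move: (wC); rewrite CsP => /andP[wX wU].
  have H1 : (#|W (lam w)| <= #|S' w| + #|W (lam w) :\: enb E w| + #|enb J w|)%N.
    apply: card_sub3; apply/subsetP => y yW; rewrite !in_setU DS' // !in_setD in_setI yW !andbT.
    by case: (y \in enb J w); rewrite ?orbT //= orbF orbN.
  move: H1 (Wnb (lam w) w wX) (degJ' w) (Wlb (lam w)); rewrite -(ler_nat R) !natrD -/w0 => H1 H2 H3 H4.
  have := ler_wpM2l (ltW eps0) H4; have : 0 < eps * w0 by rewrite mulr_gt0.
  have : eps * w0 <= w0 by rewrite ler_piMl // ltW.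
  have : eps * (eps * w0) <= eps * w0 by rewrite ler_piMl // mulr_ge0 // ltW.
  move: H1 H2 H3 uT zT; rewrite -[2 * u / T]mulrA => H1 H2 H3 H5' H6'.
  by move: H1 H2 H3 H5' H6' (ler_wpM2l (ltW eps0) H5'); glra.
have half_S' w : w \in Cs -> 1 / 2 * #|W (lam w)|%:R <= #|S' w|%:R :> R.
  by move=> wC; apply: le_trans (degS' w wC); rewrite ler_wpM2r //; move: th_half eps0; glra.
pose mu := (Num.truncn (2 * n / Q)).+1.
have mub : mu%:R <= 2 * nn * u / Q + 1.
  rewrite /mu -natr1 lerD2r; apply: le_trans (_ : 2 * n / Q <= _).
    have nQ0 : 0 <= 2 * n / Q by rewrite ltW // divr_gt0 // mulr_gt0.
    by have /andP[] := truncn_bounds nQ0.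
  by rewrite ler_wpM2r ?invr_ge0 ?(ltW Q0) // -mulrA ler_wpM2l.
have [||||||||||||Es [EsJ dEs degEs]] := stc V (Kf * Kf)%type U J' Jl lam S' (enum Cs) mu.
- exact: J'U.
- exact: JlJ'.
- move=> l l' ll; rewrite -setI_eq0; apply/eqP/setP => e; rewrite in_setI [RHS]in_set0; apply/negP => /andP[].
  rewrite [e \in Jl l]in_set [e \in Jl l']in_set => /andP[/setIdP[eJ' eW] nB] /andP[/setIdP[_ eW'] _].
  have [x [y [xy De xU yU yx]]] := edgeP J'U eJ'; move: eW eW' nB.
  rewrite De !subUset !sub1set !in_set xU yU /= => /andP[xl yl] /andP[xl' yl'] /existsP nB.
  have [bxy|bxy] := eqVneq (blk x) (blk y).
    by case: nB; exists (blk x); rewrite subUset !sub1set !in_set xU yU bxy eqxx.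
  by case/eqP: ll; apply: line_through bxy _ _ _ _.
- exact: enum_uniq.
- move=> w; rewrite mem_enum => wC; move: (wC); rewrite CsP => /andP[wX wU]; split=> //.
  + exact: subset_trans (S'S w wC) (SU w).
  + exact: divS'.
  + by rewrite -(ler_nat R); have := half_S' w wC; have := Wlb (lam w); rewrite -/w0;
    move: w00 H6; rewrite (_ : 1 / (8 * Q) * u = w0 / 4); [glra|rewrite /w0; field; rewrite gt_eqF].
- move=> w x; rewrite mem_enum => wC xS'; have xS := subsetP (S'S w wC) _ xS'.
  have xW : x \in W (lam w) by move: xS; rewrite in_setI => /andP[].
  have xX := subsetP UX _ (subsetP (WU _) _ xW).
  have H1 : (#|S' w :\: enb (Jl (lam w)) x| <= #|W (lam w) :\: enb E x| + #|enb J x| + #|B (blk x)|)%N.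
    apply: card_sub3; apply/subsetP => y; rewrite in_setD => /andP[yJl /(subsetP (S'S w wC))].
    rewrite in_setI => /andP[_ yW]; rewrite !in_setU in_setD yW andbT; apply: contraNT yJl.
    rewrite !negb_or negbK => /andP[/andP[yx yJ] yB]; exact: enbJl.
  move: H1 (Wnb (lam w) x xX) (degJ' x) (Wlb (lam w)) (Bub (blk x)) (degS' w wC); rewrite -(ler_nat R) !natrD -/w0 => H1 H2 H3 H4 H5' H6'.
  apply: le_trans (_ : (1 - theta - 2 * eps) * #|W (lam w)|%:R <= _).
    have := ler_wpM2l (ltW eps0) H4; have : 0 < eps * w0 by rewrite mulr_gt0.
    have : eps * w0 <= w0 by rewrite ler_piMl // ltW.
    have : eps * (eps * w0) <= eps * w0 by rewrite ler_piMl // mulr_ge0 // ltW.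
    move: H1 H2 H3 H5' uT zT; rewrite -[2 * u / T]mulrA => G1 G2 G3 G4 G5 G6; move: G1 G2 G3 G4 G5 G6 (ler_wpM2l (ltW eps0) G5); glra.
  apply: le_trans (_ : (kinv - eps) * ((theta + 11 / 4 * eps) * #|W (lam w)|%:R) <= _).
    by rewrite mulrA ler_wpM2r.
  by rewrite ler_wpM2l //; move: epsk; glra.
- move=> w x; rewrite mem_enum => wC.
  have H1 : (count (fun z' => (lam z' == lam w) && (x \in S' z')) (enum Cs) <= #|[set y in Cs | lam y == lam w]|)%N.
    rewrite -size_filter [leqRHS]cardE; apply: uniq_leq_size => [|y]; first by apply: filter_uniq; apply: enum_uniq.
    by rewrite mem_filter !mem_enum => /andP[/andP[lw _] yC]; apply/setIdP.
  move: H1 (lamub (lam w)) (degS' w wC) (Wlb (lam w)); rewrite -(ler_nat R) natrM card_prod natrM -/n -/q -/Q -/w0 => H2 H3 H4 H5'.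
  have H6' : 2 * (r%:R * n) / (Q * Q) <= eps / 4 * w0.
    apply: le_trans (_ : 2 * (r%:R * (nn * u)) / (Q * Q) <= _).
      rewrite ler_wpM2r ?invr_ge0 ?mulr_ge0 ?(ltW Q0) // ler_wpM2l // ler_wpM2l //.
    have := divQ (4 * (r%:R * nn * w0)) _ _ b1; rewrite (_ : _ / Q = 2 * (r%:R * (nn * u)) / (Q * Q)); last first.
      by rewrite /w0; field; rewrite gt_eqF.
    rewrite (_ : _ * (4 * _) = eps / 4 * w0); last by field; rewrite !gt_eqF.
    by apply; rewrite ltW // mulr_gt0 // mulr_gt0 // mulr_gt0.
  apply: le_trans (_ : r%:R * (2 * n / (Q * Q)) <= _).
    by rewrite ler_wpM2l // (le_trans H2).
  rewrite [leLHS](_ : _ = 2 * (r%:R * n) / (Q * Q)); last by field; rewrite gt_eqF.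
  apply: le_trans H6' _; rewrite (_ : eps / 4 = eps / 2 * (1 / 2)); last by field.
  rewrite -mulrA ler_wpM2l ?divr_ge0 ?(ltW eps0) //; apply: le_trans (half_S' w wC); move: H5'; glra.
- move=> x xU; have xX := subsetP UX _ xU.
  have H1 : (#|U :\: enb J' x| + #|enb E x :&: U| <= #|U| + #|enb J x|)%N.
    apply: leq_trans (_ : #|U :\: enb J' x| + #|U :&: enb J' x| + #|enb J x| <= _)%N; last first.
      by rewrite [(#|U :\: _| + _)%N]addnC cardsID.
    rewrite -addnA leq_add2l; apply: card_sub2; apply/subsetP => y; rewrite in_setI => /andP[yx yU].
    rewrite in_setU in_setI yU /J' enbD in_setD /EU enb_ind // in_setI yx yU andbT /=; by case: (y \in enb J x).
  move: H1 (degU x xX) (degJ' x); rewrite -(ler_nat R) !natrD -/u; have := ler_wpM2r (ltW u0) z_eps;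
  have := ler_wpM2r (ltW u0) thr; have : 0 < eps * u by rewrite mulr_gt0.
  glra.
- move=> x xU; apply: leqW; rewrite /mu Num.Theory.truncn_ge_nat; last by rewrite ltW // divr_gt0 // mulr_gt0.
  apply: le_trans (load x); rewrite ler_nat -size_filter [leqRHS]cardE.
  apply: uniq_leq_size => [|y]; first by apply: filter_uniq; apply: enum_uniq.
  rewrite mem_filter !mem_enum => /andP[xS' yC]; apply/setIdP; split=> //.
  move: (subsetP (S'S y yC) _ xS'); rewrite in_setI => /andP[_]; rewrite [x \in W _]in_set => /andP[] //.
- by [].
- rewrite -(ler_nat R); move: H6; rewrite (_ : 1 / (8 * Q) * u = w0 / 4); [rewrite -/u; move: w0u w00 u0; glra|by rewrite /w0; field; rewrite gt_eqF].
- apply: le_trans mub _; rewrite -/u.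
  have := divQ (2 * (nn * u)) _ _ b2; rewrite (_ : _ * (2 * _) = c0 / 2 * u); last by field; rewrite gt_eqF.
  have -> : 2 * (nn * u) / Q = 2 * nn * u / Q by rewrite mulrA.
  have nnu : 0 <= 2 * (nn * u) by rewrite !mulr_ge0 // ltW.
  by move=> /(_ nnu); move: H7; glra.
pose ST := \bigcup_(w <- enum Cs) star w (S' w).
have inST e : e \in ST -> exists w y, [/\ w \in Cs, y \in S' w & e = [set w; y]].
  by case/mem_bigcup_seq => w /[!mem_enum] wC /imsetP[y yS ->]; exists w, y.
have EsE : Es \subset E by apply: subset_trans EsJ (subset_trans J'EU EUE).
exists (Eu :|: (Es :|: ST)); split.
- rewrite subUset EuE subUset EsE /=; apply/subsetP => _ /inST[w [y [_ + ->]]].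
  by rewrite in_enb in_setD => /and3P[].
- apply: decU => //; rewrite -setI_eq0 setIUr setU_eq0; apply/andP; split; apply/eqP/setP => e; rewrite in_setI in_set0.
    apply/negP => /andP[eEu /(subsetP EsJ)]; rewrite in_setD => /andP[eJ eEU].
    have eG : e \in G by rewrite in_setU eEU orbT.
    have eE0 : e \notin E0 by rewrite in_setD eG.
    move: eEu; rewrite !in_setU (negPf eJ) /= => /orP[/(subsetP P1E0)|/(subsetP LE0)]; exact/negP.
  apply/negP => /andP[eEu /inST[w [y [_ + De]]]]; rewrite in_enb in_setD -De eEu andbF //.
- apply/subsetP => e; rewrite in_setD => /andP[eU eE]; rewrite in_setU.
  have [//|eEu /=] := boolP (e \in Eu); rewrite in_setU; apply/orP; right.
  have [x [y [xy De xX yX yx]]] := edgeP EX eE.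
  have inSTI w v : w \in X -> w \notin U -> v != w -> e = [set w; v] -> e \in ST.
    move=> wX wU vw De'; apply/mem_bigcup_seq; exists w; first by rewrite mem_enum CsP wX.
    by rewrite De'; apply: imset_f; rewrite /S' in_enb vw in_setD -De' eEu.
  have [xU|xU] := boolP (x \in U); last by apply: inSTI De; rewrite // eq_sym.
  apply: (inSTI y x) => //; last by rewrite setUC.
  by apply: contra eU => yU; rewrite in_set eE De subUset !sub1set xU.
move=> x xU; have H1 : (#|enb (Eu :|: (Es :|: ST)) x :&: U| <= #|enb J x| + #|enb Es x|)%N.
  apply: card_sub2; apply/subsetP => y; rewrite in_setI => /andP[+ yU].
  have notE0 (A : {set {set V}}) : A \subset E0 -> y \notin enb A x.
    move=> AE0; apply/negP => /(subsetP (enbS x AE0)); rewrite in_enb !in_setD !in_setU negb_or in_set.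
    by rewrite subUset !sub1set xU yU andbT => /and3P[_ /andP[_ nE] eE]; rewrite eE in nE.
  rewrite !enbU !in_setU (negPf (notE0 _ P1E0)) (negPf (notE0 _ LE0)) !orbF /= => /orP[->//|/orP[->|]]; first by rewrite orbT.
  rewrite enb_bigcup => /mem_bigcup_seq[w]; rewrite mem_enum CsP => /andP[_ wU].
  by rewrite starE => /andP[_ /orP[]/andP[/eqP Dw _]]; rewrite -Dw ?xU ?yU in wU.
move: H1 (degJ' x) (degEs x); rewrite -!(ler_nat R) natrD natrM -/u => G1 G2 G3.
have G4 : C%:R * mu%:R <= gam / 4 * u + C%:R.
  apply: le_trans (ler_wpM2l C0 mub) _; rewrite mulrDr mulr1 lerD2r.
  have := divQ (2 * (C%:R * nn * u)) _ _ b3; rewrite (_ : _ / Q = C%:R * (2 * nn * u / Q)); last by field; rewrite gt_eqF.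
  have nnu : 0 <= 2 * (C%:R * nn * u) by rewrite !mulr_ge0 // ltW.
  move=> /(_ nnu)/le_trans; apply; rewrite (_ : _ * (2 * _) = gam / 4 * u * (C%:R / (C%:R + 1))); last first.
    by field; rewrite !gt_eqF // ltr_wpDl.
  have C1 : 0 < C%:R + 1 :> R by rewrite ltr_wpDl.
  have cc : C%:R / (C%:R + 1) <= 1 :> R by rewrite ler_pdivrMr // mul1r lerDl.
  by rewrite ler_piMr // mulr_ge0 ?(ltW u0) // divr_ge0 // ltW.
by have := ler_wpM2r (ltW u0) z2; have : 0 < gam * u by [rewrite mulr_gt0]; move: G1 G2 G3 G4 H8; glra.
Qed.

Local Close Scope ring_scope.

(** * Vortices *)

Local Open Scope ring_scope.

Section Vortex.
Variables (R : realType) (V : finType) (O : {set {set V}}) (tau : R) (N n2 : nat).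

Fixpoint vortex (U : {set V}) (s : seq {set V}) : Prop :=
  if s is U' :: s' then
    [/\ U' \subset U, (n2 <= #|U'|)%N, (#|U| <= 2 * N * #|U'|)%N & (N * #|U'| <= 2 * #|U|)%N] /\
    [/\ forall x, x \in U -> tau * #|U|%:R <= #|enb O x :&: U|%:R,
        forall x, x \in U -> tau * #|U'|%:R <= #|enb O x :&: U'|%:R & vortex U' s']
  else True.

Lemma vortex_last U s : vortex U s -> last U s \subset U.
Proof.
by elim: s U => [|U' s IH] U //= [[UU' _ _ _] [_ _ /IH]] /subset_trans; apply.
Qed.
End Vortex.

(* One level of the vortex: sampling with error 1 / (4 N L^2), L = log |U|, so that the total loss telescopes. *)
Lemma vortex_step (R : realType) (N : nat) : (2 < N)%N ->
  exists n0 : nat, forall (V : finType) (O : {set {set V}}) (U : {set V}) (t : R),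
    (n0 <= #|U|)%N -> 0 <= t <= 1 ->
    (forall x, x \in U -> t * #|U|%:R <= #|enb O x :&: U|%:R) ->
  exists U' : {set V}, [/\ U' \subset U, (#|U| <= 2 * N * #|U'|)%N, (N * #|U'| <= 2 * #|U|)%N,
    (2 * #|U'| <= #|U|)%N & forall x, x \in U ->
      (t - (trunc_log 2 #|U|)%:R ^- 2) * #|U'|%:R <= #|enb O x :&: U'|%:R].
Proof.
move=> N2; have [L1 HL1] := expn2_ge_poly (640 * N%:R ^+ 2 : R) 5.
exists (2 ^ maxn L1 4)%N => V O U t nU /andP[t0 t1] deg.
set n := #|U| in nU deg *; set L := trunc_log 2 n.
have n0 : (0 < n)%N by apply: leq_trans nU; rewrite expn_gt0.
have LL : (maxn L1 4 <= L)%N by apply: trunc_log_max.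
have [LL1 L4] : (L1 <= L)%N /\ (4 <= L)%N by move: LL; rewrite geq_max => /andP[].
have /andP[Ln nL] : (2 ^ L <= n < 2 ^ L.+1)%N by apply: (@trunc_log_bounds 2).
have N3 : 3 <= N%:R :> R by rewrite ler_nat.
have L4R : 4 <= L%:R :> R by rewrite ler_nat.
have N0 : 0 < N%:R :> R by move: N3; glra. have L0 : 0 < L%:R :> R by move: L4R; glra.
pose al : R := 1 / (4 * N%:R * L%:R ^+ 2).
have al0 : 0 < al by rewrite divr_gt0 // !mulr_gt0 ?exprn_gt0.
pose C := option {x : V | x \in U}.
pose A (c : C) := if c is Some x then enb O (val x) :&: U else U.
have J0 : (0 < #|'I_N|)%N by rewrite card_ord; apply: leq_trans N2.
pose i0 : 'I_N := Ordinal (ltnW (ltnW N2)).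
have [||f Hf] := @random_map R V 'I_N C A (fun _ _ => i0) n al al0 J0.
- by case=> [x|]; rewrite /A //= subset_leq_card ?subsetIr.
- rewrite card_option card_sig (_ : #|[pred x | x \in U]| = n) //.
  have e2 x : 2 ^+ x <= expR x%:R :> R.
    rewrite -[x%:R]mulr1 expRM_natl; apply: lerXn2r; rewrite ?nnegrE ?expR_ge0 //.
    by have := expR_ge1Dx (1 : R).
  apply: le_lt_trans (_ : expR (L + 3)%:R * expR (- (al ^+ 2 * n%:R / 8)) < 1).
    rewrite ler_wpM2r ?expR_ge0 //; apply: le_trans (e2 _).
    rewrite -natrX -natrM ler_nat expnD; move: nL n0; rewrite expnS; move: (2 ^ L)%N; clear; lia.
  rewrite -expRD -[ltRHS]expR0 ltr_expR subr_lt0.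
  have H := HL1 L LL1; have nR : 2 ^+ L <= n%:R :> R by rewrite -natrX ler_nat.
  rewrite (_ : al ^+ 2 * n%:R / 8 = n%:R / (128 * N%:R ^+ 2 * L%:R ^+ 4)); last first.
    by rewrite /al; field; rewrite !gt_eqF.
  rewrite ltr_pdivlMr ?mulr_gt0 ?exprn_gt0 //; apply: lt_le_trans nR; apply: lt_le_trans H.
  rewrite natrD [ltRHS](_ : _ = (5 * L%:R) * (128 * N%:R ^+ 2 * L%:R ^+ 4)); last by ring.
  by rewrite ltr_pM2r ?mulr_gt0 ?exprn_gt0 //; move: L4R; glra.
pose U' := [set u in U | f u == i0].
have cU' : `| #|U'|%:R - n%:R / N%:R| <= al * n%:R :> R.
  by have := Hf None; rewrite card_ord.
have dU' x : x \in U -> `| #|enb O x :&: U'|%:R - #|enb O x :&: U|%:R / N%:R| <= al * n%:R.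
  move=> xU; have := Hf (Some (Sub x xU)); rewrite card_ord /A /=.
  rewrite (_ : [set _ in _ | _] = enb O x :&: U') //.
  by apply/setP => u; rewrite in_set !in_setI [u \in U']in_set andbA.
have nR : 0 < n%:R :> R by rewrite ltr0n.
pose m := n%:R / N%:R : R; have m0 : 0 < m by rewrite divr_gt0.
have Dn : n%:R = N%:R * m by rewrite /m; field; rewrite gt_eqF.
have il0 : 0 < L%:R ^- 2 :> R by rewrite invr_gt0 exprn_gt0.
have il1 : L%:R ^- 2 <= 1 / 16 :> R.
  rewrite ler_pdivlMr // mulrC ler_pdivrMr ?exprn_gt0 // mul1r expr2; move: L4R; gnra.
have aln : al * n%:R = L%:R ^- 2 / 4 * m.
  by rewrite /al /m; field; rewrite !gt_eqF.
rewrite aln -/m in cU' dU'.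
move: cU'; rewrite ler_distl => /andP[lb ub].
have ilm : L%:R ^- 2 * m <= 1 / 16 * m by rewrite ler_wpM2r // ltW.
exists U'; split.
- by apply/subsetP => u; rewrite in_set => /andP[].
- by rewrite -(ler_nat R) !natrM Dn mulrAC [_ * N%:R]mulrC ler_pM2l //; move: lb ilm m0; glra.
- by rewrite -(ler_nat R) !natrM Dn mulrCA ler_pM2l //; move: ub ilm m0; glra.
- rewrite -(ler_nat R) !natrM Dn; apply: le_trans (_ : 3 * m <= _); first by move: ub ilm m0; glra.
  by rewrite ler_pM2r.
- move=> x xU; have := dU' x xU; rewrite ler_distl => /andP[+ _]; apply: le_trans.
  have : t * m <= #|enb O x :&: U|%:R / N%:R by rewrite /m mulrA ler_pM2r ?invr_gt0 ?deg.
  have H : 0 <= L%:R ^- 2 * m by rewrite mulr_ge0 // ltW.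
  rewrite -/L mulrBl; have := ler_wpM2l t0 ub; have : t * (L%:R ^- 2 / 4 * m) <= L%:R ^- 2 / 4 * m.
    by rewrite ler_piMl // mulr_ge0 ?divr_ge0 // ltW.
  have : L%:R ^- 2 * (m - L%:R ^- 2 / 4 * m) <= L%:R ^- 2 * #|U'|%:R by rewrite ler_wpM2l // ltW.
  have : L%:R ^- 2 * (L%:R ^- 2 / 4 * m) <= 1 / 16 * (L%:R ^- 2 / 4 * m).
    by rewrite ler_wpM2r // mulr_ge0 ?divr_ge0 // ltW.
  by move: H; glra.
Qed.

(** The invariant is a density of at least tau + c - 1 / log |X|. A level costs 1 / log^2, and 1/b +
    1/b^2 <= 1/a whenever b >= a + 1, so the cost is paid by the logarithm dropping by at least 1.
    All sets are large enough for the correction 1 / log to stay below c. *)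
Lemma vortex_exists (R : realType) (N : nat) (c : R) : (2 < N)%N -> 0 < c ->
  forall n2 : nat, exists m1 : nat, forall (V : finType) (O : {set {set V}}) (X : {set V}) (tau : R),
    0 <= tau <= 1 - c -> (m1 <= #|X|)%N ->
    (forall x, x \in X -> (tau + c) * #|X|%:R <= #|enb O x :&: X|%:R) ->
  exists s, vortex O tau N n2 X s /\ (#|last X s| <= m1)%N.
Proof.
move=> N2 c0 n2; have [n0 Hn0] := vortex_step R N2.
pose L0 := (Num.bound c^-1).+2; pose k := maxn (maxn n0 n2) (2 ^ L0).
exists (2 * N * k)%N => V O X tau /andP[tau0 tau1] nX degX.
have N0 : (0 < N)%N by apply: leq_trans N2.
have kX : (k <= #|X|)%N by apply: leq_trans nX; rewrite leq_pmull // muln_gt0.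
have LX (U : {set V}) : (k <= #|U|)%N -> (L0 <= trunc_log 2 #|U|)%N.
  by move=> kU; apply: trunc_log_max => //; apply: leq_trans kU; apply: leq_maxr.
have cL (U : {set V}) : (k <= #|U|)%N -> (trunc_log 2 #|U|)%:R^-1 <= c.
  move=> /LX LU; have t0 : 0 < (trunc_log 2 #|U|)%:R :> R by rewrite ltr0n; apply: leq_trans LU.
  rewrite -[leRHS]invrK lef_pV2 ?posrE ?invr_gt0 //.
  apply: le_trans (ltW (archi_boundP _)) _; first by rewrite invr_ge0 ltW.
  by rewrite ler_nat; apply: leq_trans LU; rewrite /L0; do 2!apply: leqW.
have {degX} : forall x, x \in X -> (tau + c - (trunc_log 2 #|X|)%:R^-1) * #|X|%:R <= #|enb O x :&: X|%:R.
  move=> x xX; apply: le_trans (degX x xX); rewrite ler_wpM2r // gerBl invr_ge0 //.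
have [s] := ubnP #|X|; elim: s X {nX} kX => // s IH X kX Xs degX.
have [Xm|mX] := leqP #|X| (2 * N * k); first by exists [::].
set t := _ - _ in degX; have t_tau : tau <= t by rewrite /t; move: (cL X kX); glra.
have t1 : t <= 1.
  have H : 0 <= (trunc_log 2 #|X|)%:R^-1 :> R by rewrite invr_ge0.
  by move: tau1 H; rewrite /t; move: (_^-1) => y; glra.
have [|||U' [U'X XU' U'2 U'h degU']] := Hn0 V O X t.
- by apply: leq_trans kX; rewrite /k !leq_max leqnn.
- by rewrite t1 (le_trans tau0).
- exact: degX.
have kU' : (k <= #|U'|)%N.
  by have := leq_trans (ltnW mX) XU'; rewrite leq_pmul2l // muln_gt0.
have L1 : (0 < trunc_log 2 #|U'|)%N by apply: leq_trans (LX U' kU').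
have U'0 : (0 < #|U'|)%N by apply: leq_trans kU'; rewrite /k leq_max expn_gt0 orbT.
have LL : ((trunc_log 2 #|U'|).+1 <= trunc_log 2 #|X|)%N.
  apply: trunc_log_max => //; apply: leq_trans U'h; rewrite expnS leq_mul2l /=.
  by have /andP[] := @trunc_log_bounds 2 #|U'| isT U'0.
pose a : R := (trunc_log 2 #|U'|)%:R; pose b : R := (trunc_log 2 #|X|)%:R.
have a0 : 0 < a by rewrite ltr0n.
have ab : a + 1 <= b by rewrite natr1 ler_nat.
have b0 : 0 < b by move: a0 ab; glra.
have key : b^-1 + b ^- 2 <= a^-1.
  have -> : b^-1 + b ^- 2 = (b + 1) / b ^+ 2 by field; rewrite gt_eqF.
  rewrite ler_pdivrMr ?exprn_gt0 // [leRHS]mulrC ler_pdivlMr // expr2.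
  by move: a0 ab b0; clear; move: a b => a b; nra.
have dU' x : x \in X -> (tau + c - a^-1) * #|U'|%:R <= #|enb O x :&: U'|%:R.
  move=> xX; apply: le_trans (degU' x xX); rewrite ler_wpM2r // /t -/b; move: key.
  by move: (b^-1) (b ^- 2) (a^-1); clear; move=> *; lra.
have tU' : tau <= tau + c - a^-1 by move: (cL U' kU'); rewrite -/a; move: (a^-1); clear; move=> *; lra.
have [||s' [vs' ls']] := IH U' kU'.
- by move: Xs U'h U'0; clear; lia.
- by move=> x xU'; apply: dU'; apply: (subsetP U'X).
exists (U' :: s'); split=> //=; split; first split=> //.
- by apply: leq_trans kU'; rewrite /k !leq_max leqnn orbT.
- split=> // x xX; first by apply: le_trans (degX x xX); rewrite ler_wpM2r.
  by apply: le_trans (dU' x xX); rewrite ler_wpM2r.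
Qed.

(** C is the uncovered part of O inside U. It must contain all edges of O inside the next set and
    lack few edges at any vertex. To preserve this, the edges inside the set after the next, [U2],
    are withheld from the cover-down step, whose last conclusion bounds the new loss. *)
Lemma iterate (R : realType) (VF : finType) (EF : {set {set VF}}) (r : nat) (v0 : VF)
    (EFgr : within setT EF) (EFreg : forall w, #|enb EF w| = r) (r_gt0 : (0 < r)%N) (kinv eps : R)
    (tl : tileable EF r v0 kinv) (kinv_range : 0 < kinv <= 1) (eps_range : 0 < eps <= kinv)
    (N : nat) : 8 / eps <= N%:R ->
  exists2 eta : R, 0 < eta & forall n1 : nat, exists n2 : nat,
  forall theta, good_theta r kinv theta -> approximable EF eta (theta + eps / 2) n1 ->
  forall (V : finType) (O : {set {set V}}) (U : {set V}) (s : seq {set V}) (C : {set {set V}}),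
    within setT O -> vortex O (theta + 6 * eps) N n2 U s ->
    C \subset eind O U -> eind O (head set0 s) \subset C ->
    (forall x, x \in U -> #|enb (eind O U) x :\: enb C x|%:R <= eps / (2 * N%:R) * #|U|%:R) ->
    (forall x, (r %| #|enb C x|)%N) ->
  exists P : {set {set V}}, [/\ P \subset C, dec EF P & C :\: P \subset eind O (last U s)].
Proof.
move=> Ne; have /andP[eps0 epsk] := eps_range; have /andP[k0 k1] := kinv_range.
have eps1 : eps <= 1 := le_trans epsk k1.
have N0 : 0 < N%:R :> R by apply: lt_le_trans Ne; rewrite divr_gt0.
have eN : 8 <= eps * N%:R by move: Ne; rewrite ler_pdivrMr // mulrC.
have g0 : 0 < eps / (2 * N%:R) by rewrite divr_gt0 ?mulr_gt0.
have [eta eta0 Heta] := cover_down EFgr EFreg r_gt0 tl kinv_range eps_range (2 * N) g0.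
exists eta => // n1; have [n2 Hn2] := Heta n1; exists n2 => theta gth apx V O U s C OV.
have N8 : 8 <= N%:R :> R by apply: le_trans eN _; rewrite ler_piMl // ltW.
elim: s U C => [|U' s IH] U C /=.
  by move=> _ CU _ _ _; exists set0; rewrite sub0set setD0; split=> //; apply: dec0.
case=> [[U'U nU' UU' U'2] [degU degU' vs]] CU U'C loss divC.
pose U2 := head set0 s; pose D := eind C U2; pose E := C :\: D.
have U2U' : U2 \subset U' by rewrite /U2; case: (s) vs => [|U3 s'] /=; [rewrite sub0set|case=> [[]]].
have U2c : N%:R * #|U2|%:R <= 2 * #|U'|%:R :> R.
  rewrite -!natrM ler_nat /U2; case: (s) vs => [|U3 s'] /=; first by rewrite cards0 muln0.
  by case=> [[]].
have U'2R : N%:R * #|U'|%:R <= 2 * #|U|%:R :> R by rewrite -!natrM ler_nat.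
have UU'R : #|U|%:R <= 2 * N%:R * #|U'|%:R :> R by rewrite -!natrM ler_nat.
set u : R := #|U|%:R in degU UU'R U'2R loss *; set u' : R := #|U'|%:R in degU' UU'R U'2R U2c *.
have u0 : 0 <= u by rewrite ler0n. have u'0 : 0 <= u' by rewrite ler0n.
have eu' : u' <= eps / 4 * u.
  rewrite -(ler_pM2l N0); apply: le_trans U'2R _.
  by have := ler_wpM2r u0 eN; glra.
have eu2 : #|U2|%:R <= eps / 4 * u'.
  rewrite -(ler_pM2l N0); apply: le_trans U2c _.
  by have := ler_wpM2r u'0 eN; glra.
have uu' : u' <= u by rewrite ler_nat subset_leq_card.
have gu : eps / (2 * N%:R) * u <= eps / 16 * u.
  apply: ler_wpM2r => //; rewrite ler_pM2l // lef_pV2 ?posrE ?mulr_gt0 //; move: N8; glra.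
have gu' : eps / (2 * N%:R) * u <= eps * u'.
  rewrite mulrAC ler_pdivrMr ?mulr_gt0 // -mulrA ler_pM2l //; move: UU'R; glra.
have CUw : within U C by apply: within_sub CU (within_ind OV).
have EU : within U E by apply: within_sub (subsetDl _ _) CUw.
have degC x : x \in U -> #|enb O x :&: U|%:R <= #|enb C x|%:R + eps / (2 * N%:R) * u.
  move=> xU; apply: le_trans (_ : (#|enb C x| + #|enb (eind O U) x :\: enb C x|)%:R <= _).
    rewrite ler_nat -(enb_ind O xU); apply: card_sub2; apply/subsetP => y yx.
    by rewrite in_setU in_setD yx andbT orbN.
  by rewrite natrD lerD2l loss.
have enbE_sub x A : (#|enb C x :&: A| <= #|enb E x :&: A| + #|U2|)%N.
  apply: card_sub2; apply/subsetP => y; rewrite in_setI => /andP[yx yA].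
  rewrite in_setU in_setI yA andbT /E enbD in_setD yx andbT.
  have [yD|//] := boolP (y \in enb D x); rewrite /=.
  by move: yD; rewrite in_enb inE subUset !sub1set => /andP[_ /andP[_ /andP[]]].
have degCU' x : x \in U -> (theta + 5 * eps) * u' <= #|enb C x :&: U'|%:R.
  move=> xU; have := degU' x xU.
  have : (#|enb O x :&: U'| <= #|enb C x :&: U'| + #|enb (eind O U) x :\: enb C x|)%N.
    apply: card_sub2; apply/subsetP => y; rewrite in_setI => /andP[yx yU'].
    rewrite in_setU in_setI yU' andbT in_setD enb_ind // in_setI yx (subsetP U'U) //.
    by case: (y \in enb C x).
  by rewrite -(ler_nat R) natrD; move: (loss x xU) gu'; glra.
have [||||||||P [PE dP covP degP]] := Hn2 theta gth apx V E U U'.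
- exact: EU.
- exact: U'U.
- exact: nU'.
- exact: UU'.
- by move: eu' (mulr_ge0 (ltW eps0) u0); glra.
- move=> x xU; have := enbE_sub x setT; rewrite !setIT -(ler_nat R) natrD.
  move: (degC x xU) (degU x xU) gu eu2 uu' (ler_wpM2l (ltW eps0) uu') (mulr_ge0 (ltW eps0) u0); glra.
- move=> x xU; have := enbE_sub x U'; rewrite -(ler_nat R) natrD.
  move: (degCU' x xU) eu2 (mulr_ge0 (ltW eps0) u'0); glra.
- move=> z zU zU'; rewrite /E enbD (_ : enb D z = set0) ?setD0 //.
  by apply/setP => y; rewrite in_enb !inE subUset !sub1set; apply/negP => /andP[_ /andP[_ /andP[/(subsetP U2U')]]]; rewrite (negPf zU').
have PC : P \subset C by apply: subset_trans PE (subsetDl _ _).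
have CPU' : C :\: P \subset eind O U'.
  apply/subsetP => e; rewrite in_setD => /andP[eP eC].
  have eO : e \in O by apply: (subsetP (eind_sub O U)); apply: (subsetP CU).
  rewrite inE eO /=; have [eD|eD] := boolP (e \in D).
    by move: eD; rewrite inE => /andP[_ /subset_trans]; apply.
  have eE : e \in E by rewrite in_setD eD.
  apply: contraNT eP => eU'; apply: (subsetP covP); rewrite in_setD eE andbT inE eE //.
have [|||P' [P'C dP' covP']] := IH U' (C :\: P) vs CPU'.
- apply/subsetP => e eO2; rewrite in_setD; move: (eO2); rewrite inE => /andP[eO eU2].
  have eC : e \in C by apply: (subsetP U'C); rewrite inE eO (subset_trans eU2).
  rewrite eC andbT; apply/negP => /(subsetP PE); rewrite in_setD inE eC eU2 //.
- move=> x xU'; apply: le_trans (degP x xU'); rewrite ler_nat subset_leq_card //.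
  apply/subsetP => y; rewrite in_setD enbD in_setD negb_and negbK => /andP[H yx].
  move: (yx); rewrite enb_ind // in_setI => /andP[_ yU']; rewrite in_setI yU' andbT.
  case/orP: H => // /negP[]; apply: (subsetP (enbS x U'C)); exact: yx.
- move=> x; have := divC x; rewrite -(cardsID (enb P x) (enb C x)) -enbI -enbD (setIidPr PC).
  by rewrite dvdn_addr //; exact: dec_deg.
exists (P :|: P'); split.
- by rewrite subUset PC (subset_trans P'C (subsetDl _ _)).
- apply: decU => //; rewrite disjoint_sym disjoints_subset; apply: subset_trans P'C _.
  by rewrite setDE subsetIr.
- by rewrite -setDDl.
Qed.

Local Close Scope ring_scope.

(** * Transformers *)

Section Graphs.
Variable V : finType.
Implicit Types (G H : sgraph V) (E : {set {set V}}).

Lemma edgesP G e : reflect (exists x y, G x y /\ e = [set x; y]) (e \in edges G).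
Proof.
rewrite inE; apply: (iffP existsP) => [[x /existsP[y /andP[xy /eqP->]]]|[x [y [xy ->]]]]; first by exists x, y.
by exists x; apply/existsP; exists y; rewrite xy eqxx.
Qed.

Lemma adj_neq G x y : G x y -> x != y.
Proof. by apply: contraTneq => ->; rewrite adj_irr. Qed.

Lemma in_edges G x y : ([set x; y] \in edges G) = G x y.
Proof.
apply/edgesP/idP => [[a [b [ab]]]|xy]; last by exists x, y.
by case/set2_eq => -[-> ->] //; rewrite adj_sym.
Qed.

Lemma edges_within G : within setT (edges G).
Proof. by move=> e /edgesP[x [y [xy ->]]]; rewrite cards2 (adj_neq xy) subsetT. Qed.

Lemma enb_edges G x : enb (edges G) x = nbhd G x.
Proof.
apply/setP => y; rewrite in_enb in_edges inE; have [->|//] := eqVneq y x; by rewrite adj_irr.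
Qed.

Lemma sg_sym E : symmetric (fun x y => y \in enb E x).
Proof. by move=> x y; rewrite enb_sym. Qed.
Lemma sg_irr E : irreflexive (fun x y => y \in enb E x).
Proof. by move=> x; rewrite enbxx. Qed.
Definition sg E := SGraph (sg_sym E) (sg_irr E).

Lemma edges_sg E : within setT E -> edges (sg E) = E.
Proof.
move=> EV; apply/setP => e; apply/edgesP/idP => [[x [y [/= + ->]]]|eE].
  by rewrite in_enb => /andP[].
by have [x [y [_ -> _ _ yx]]] := edgeP EV eE; exists x, y.
Qed.

Lemma edges_gunion G H : edges (gunion G H) = edges G :|: edges H.
Proof.
apply/setP => e; rewrite in_setU; apply/edgesP/orP => [[x [y [/= /orP[] xy ->]]]|]; rewrite ?in_edges; auto.
by case=> /edgesP[x [y [xy ->]]]; exists x, y; rewrite /= /gunion_rel /= xy ?orbT.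
Qed.

End Graphs.

Lemma edges_gimage (V W : finType) (f : V -> W) (G : sgraph V) : injective f -> edges (gimage f G) = imE f (edges G).
Proof.
move=> finj; apply/setP => e; rewrite /imE; apply/edgesP/imsetP => [[x [y [/= /andP[_ /existsP[u /existsP[v]]]]]]|].
  by case/and3P=> /eqP<- /eqP<- uv ->; exists [set u; v]; rewrite ?in_edges ?imset_set2.
case=> _ /edgesP[u [v [uv ->]]] ->; exists (f u), (f v); rewrite imset_set2; split=> //=.
rewrite /gimage_rel /= (inj_eq finj) (adj_neq uv) /=; apply/existsP; exists u; apply/existsP; exists v.
by rewrite !eqxx uv.
Qed.

Lemma imEP (V W : finType) (f : V -> W) (A : {set {set V}}) (e : {set W}) : within setT A -> e \in imE f A ->
  exists x y, [/\ x != y, [set x; y] \in A & e = [set f x; f y]].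
Proof.
move=> AV /imsetP[e' e'A ->]; have [x [y [xy De _ _ _]]] := edgeP AV e'A.
by exists x, y; rewrite -De e'A De imset_set2.
Qed.

Lemma orient (V : finType) (E : {set {set V}}) : within setT E -> exists a b : 'I_#|E| -> V,
  [/\ forall i, a i != b i, injective (fun i => [set a i; b i]) & E = [set [set a i; b i] | i : 'I_#|E|]].
Proof.
move=> EV; have H (i : 'I_#|E|) : exists ab : V * V, ab.1 != ab.2 /\ enum_val i = [set ab.1; ab.2].
  have [x [y [xy De _ _ _]]] := edgeP EV (enum_valP i); by exists (x, y).
have [ab Hab] := fin_all_exists H; exists (fun i => (ab i).1), (fun i => (ab i).2); split.
- by move=> i; have [] := Hab i.
- by move=> i j /=; have [_ <-] := Hab i; have [_ <-] := Hab j; apply: enum_val_inj.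
apply/setP => e; apply/idP/imsetP => [eE|[i _ ->]]; last by have [_ <-] := Hab i; apply: enum_valP.
by exists (enum_rank_in eE e) => //; have [_ <-] := Hab (enum_rank_in eE e); rewrite enum_rankK_in.
Qed.

Lemma card_incident (V : finType) (E : {set {set V}}) x : within setT E -> #|[set e in E | x \in e]| = #|enb E x|.
Proof.
move=> EV; rewrite -(card_in_imset (f := fun y => [set x; y]) (D := enb E x)).
  apply: eq_card => e; apply/setIdP/imsetP => [[eE]|[y yx ->]].
    have [a [b [ab -> _ _ ba]]] := edgeP EV eE; rewrite !inE => /orP[]/eqP->; first by exists b.
    by exists a; rewrite 1?enb_sym // setUC.
  by rewrite set21; move: yx; rewrite in_enb => /andP[].
by move=> y z; rewrite !in_enb => /andP[yx _] _; apply: set2_inj.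
Qed.

Lemma has_decP (VF V : finType) (F : sgraph VF) (G : sgraph V) : edges F != set0 ->
  has_decomposition F G <-> dec (edges F) (edges G).
Proof.
move=> F0; split=> [[P [/and3P[/eqP cP tP _] copy]]|/(dec_partition F0)[P [pP copy]]].
  rewrite -cP; apply: trivIset_dec tP _ => A /copy[f [finj _ ->]]; by exists f.
exists P; split=> // A AP; have [f finj DA] := copy A AP; exists f; split=> // x y xy.
rewrite -in_edges; have /and3P[/eqP <- _ _] := pP; apply/bigcupP; exists A => //.
by rewrite DA mem_imE // in_edges.
Qed.

Lemma degeneracy_le (V : finType) (T : sgraph V) (U : {set V}) (d : nat) :
  (forall x, x \notin U -> #|nbhd T x| <= d) -> degeneracy T U <= d.
Proof.
move=> dT; rewrite /degeneracy; case: ex_minnP => m _; apply.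
have sz : size (enum U ++ enum (~: U)) == #|V| by rewrite size_cat -!cardE cardsC.
have mem x : x \in tval (Tuple sz) by rewrite /= mem_cat !mem_enum in_setC orbN.
apply/existsP; exists (Tuple sz); apply/andP; split => /=.
  rewrite cat_uniq !enum_uniq andbT; apply/hasPn => x /=; by rewrite !mem_enum inE.
have ltU : (#|U| < #|V|.+1)%N by rewrite ltnS max_card.
apply/existsP; exists (Ordinal ltU); apply/andP; split.
  by apply/eqP/setP => x; rewrite inE /= take_size_cat ?mem_enum //= [in RHS]cardE.
apply/forallP => j; apply/implyP => /= Uj; apply: leq_trans (subset_leq_card (subsetIl _ _)) (dT _ _).
rewrite (tnth_nth (tnth (Tuple sz) j)) /= nth_cat -cardE ltnNge Uj /=.
have : nth (tnth (Tuple sz) j) (enum (~: U)) (j - #|U|) \in enum (~: U).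
  by apply: mem_nth; rewrite -cardE ltn_subLR // cardsC ltn_ord.
by rewrite mem_enum in_setC.
Qed.

Section Transformer.
Variables (VF : finType) (EF : {set {set VF}}) (r : nat) (u v : VF).
Hypothesis EFgr : within setT EF.
Hypothesis EFreg : forall w, #|enb EF w| = r.
Hypothesis uv : v \in enb EF u.
Variables (V V' : finType) (h : nat) (a b : 'I_h -> V).
Hypothesis ab_neq : forall i, a i != b i.
Hypothesis ab_inj : injective (fun i => [set a i; b i]).
Local Notation I := 'I_h.
Variables (be : V -> VF -> I) (sg : VF -> VF).
(* be x : N(u) -> edges at x and sg : N(u) - v -> N(v) - u are bijections. *)
Local Notation J := (enb EF u :\ v).
Hypothesis be_inj : forall x, {in enb EF u &, injective (be x)}.
Hypothesis be_im : forall x i, reflect (exists2 z, z \in enb EF u & be x z = i) ((x == a i) || (x == b i)).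
Hypothesis sg_inj : {in J &, injective sg}.
Hypothesis sg_im : sg @: J = enb EF v :\ u.

Definition TW : Type := ((V + V') + (I * VF + V * VF * VF))%type.
Local Notation iE i w := (inr (inl (i, w)) : TW).
Local Notation iZ x j z := (inr (inr (x, j, z)) : TW).

Definition slot x i j := if x == a i then j else sg j.
Definition gf (q : V -> TW) i (w : VF) : TW := if w == u then q (a i) else if w == v then q (b i) else iE i w.
Definition gg (q : V -> TW) x j (z : VF) : TW :=
  if z == u then q x else if z \in enb EF u then iE (be x z) (slot x (be x z) j) else iZ x j z.

Definition E0 := EF :\ [set u; v].
Definition Em := [set e in EF | u \notin e].
Definition TG (q q' : V -> TW) := (\bigcup_(i : I) imE (gf q i) EF) :|: \bigcup_(x : V) \bigcup_(j in J) imE (gg q' x j) EF.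
(** For each edge i of H, new vertices carry F minus u and v; they are joined as u and v would be to
    the ends of the edge under q, and again to those under q'. Adding the edges of H placed by q
    completes the copies of F at q, and the stars from the vertices q' x to the new vertices remain.
    These are regrouped: [be x] matches N(u) with the r edges at x, and for each j the vertices of
    slot j in these r gadgets become the neighbourhood of q' x in one more copy of F, whose edges
    avoiding u are the third part. That part does not depend on q, so q and q' can be exchanged. *)
Definition Tcore (q q' : V -> TW) : {set {set TW}} :=
  (\bigcup_(i : I) imE (gf q i) E0 :|: \bigcup_(i : I) imE (gf q' i) E0) :|: \bigcup_(x : V) \bigcup_(j in J) imE (gg q x j) Em.

Lemma uv_neq : u != v. Proof. by apply: contraTneq uv => <-; rewrite enbxx. Qed.
Let vu : v == u = false. Proof. by rewrite eq_sym (negPf uv_neq). Qed.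
Lemma uvE : [set u; v] \in EF. Proof. by move: uv; rewrite in_enb => /andP[]. Qed.

Lemma gg_Em q q' x j : imE (gg q x j) Em = imE (gg q' x j) Em.
Proof.
apply: (@imE_eq _ _ _ _ (~: [set u])) => [e|z]; rewrite inE.
  by move=> /andP[_ ue]; apply/subsetP => z ze; rewrite !inE; apply: contraNneq ue => <-.
by rewrite inE /gg => /negPf->.
Qed.

Lemma Tcore_sym q q' : Tcore q q' = Tcore q' q.
Proof.
rewrite /Tcore [in LHS]setUC [in RHS]setUC; congr (_ :|: _); last exact: setUC.
by apply: eq_bigr => x _; apply: eq_bigr => j _; apply: gg_Em.
Qed.

Lemma gf_uv q i : imE (gf q i) EF = [set q (a i); q (b i)] |: imE (gf q i) E0.
Proof.
rewrite -{1}(setD1K uvE) imEU /imE imset_set1 imset_set2 /gf eqxx eqxx vu //.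
Qed.

Lemma inE0 s w : [set s; w] \in EF -> w != u -> w != v -> [set s; w] \in E0.
Proof.
move=> sw wu wv; rewrite in_setD1 sw andbT; apply/eqP => /setP/(_ w).
by rewrite !inE eqxx (negPf wu) (negPf wv) orbT.
Qed.

Lemma E0P s w : [set s; w] \in E0 -> s != w -> [/\ [set s; w] \in EF, (s == u) || (s == v) -> w != u /\ w != v
  & (w == u) || (w == v) -> s != u /\ s != v].
Proof.
rewrite in_setD1 => /andP[nuv sw] nsw; split=> // /orP[]/eqP Ds; split; apply: contraNneq nuv => Dw //.
- by rewrite Ds Dw eqxx in nsw.
- by rewrite Ds Dw.
- by rewrite Ds Dw setUC.
- by rewrite Ds Dw eqxx in nsw.
- by rewrite Ds Dw eqxx in nsw.
- by rewrite Ds Dw setUC.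
- by rewrite Ds Dw.
- by rewrite Ds Dw eqxx in nsw.
Qed.

Lemma gg_star q x j z : j \in J -> z \in enb EF u ->
  [set gg q x j u; gg q x j z] \in imE (gf q (be x z)) E0.
Proof.
move=> jJ zu; have zu' : z == u = false by apply: contraTF zu => /eqP->; rewrite enbxx.
rewrite /gg eqxx zu' zu; set i := be x z; have xi : (x == a i) || (x == b i) by apply/be_im; exists z.
move: (jJ); rewrite in_setD1 in_enb /slot => /and3P[jv ju uj]; have [xa|xa] := eqVneq x (a i).
  have -> : [set q x; iE i j] = [set gf q i u; gf q i j] by rewrite /gf eqxx (negPf ju) (negPf jv) xa.
  by apply: mem_imE; apply: inE0.
have : sg j \in enb EF v :\ u by rewrite -sg_im imset_f.
move: xi; rewrite (negPf xa) /= => /eqP xb; rewrite in_setD1 in_enb => /and3P[su sv vs].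
have -> : [set q x; iE i (sg j)] = [set gf q i v; gf q i (sg j)].
  by rewrite /gf eqxx vu (negPf su) (negPf sv) xb.
by apply: mem_imE; apply: inE0.
Qed.

Lemma gf_star q i s w : (s == u) || (s == v) -> [set s; w] \in E0 -> s != w ->
  exists x j, j \in J /\ [set gf q i s; gf q i w] \in imE (gg q x j) EF.
Proof.
move=> suv sw nsw; have [swE /(_ suv)[wu wv] _] := E0P sw nsw.
have bi x : (x == a i) || (x == b i) -> exists2 z, z \in enb EF u & be x z = i by move/be_im.
have key x j z : j \in J -> z \in enb EF u -> be x z = i -> [set q x; iE i (slot x i j)] \in imE (gg q x j) EF.
  move=> jJ zu bz; have zu' : z == u = false by apply: contraTF zu => /eqP->; rewrite enbxx.
  have -> : [set q x; iE i (slot x i j)] = [set gg q x j u; gg q x j z] by rewrite /gg eqxx zu' zu bz.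
  by apply: mem_imE; move: zu; rewrite in_enb => /andP[].
rewrite /gf (negPf wu) (negPf wv); case/orP: suv => /eqP Ds.
  have [|z zu bz] := bi (a i); first by rewrite eqxx.
  exists (a i), w; have wJ : w \in J by rewrite in_setD1 wv in_enb wu -Ds swE.
  by split=> //; rewrite Ds eqxx; have := key _ _ _ wJ zu bz; rewrite /slot eqxx.
have [|z zu bz] := bi (b i); first by rewrite eqxx orbT.
have : w \in enb EF v :\ u by rewrite in_setD1 wu in_enb wv -Ds swE.
rewrite -sg_im => /imsetP[j jJ Dw]; exists (b i), j; split=> //.
by rewrite Ds vu eqxx; have := key _ _ _ jJ zu bz; rewrite /slot eq_sym (negPf (ab_neq i)) Dw.
Qed.

Lemma TcoreE q q' : Tcore q q' :|: [set [set q (a i); q (b i)] | i : I] = TG q q'.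
Proof.
have E0E : E0 \subset EF by apply: subD1set.
apply/setP => e; apply/idP/idP; rewrite !in_setU.
  case/orP=> [/orP[/orP[]|]|].
  - by case/bigcupP=> i _ ei; apply/orP; left; apply/bigcupP; exists i => //; apply: (subsetP (imES _ E0E)).
  - case/bigcupP=> i _ /(imEP (within_sub E0E EFgr))[s [w [nsw sw ->]]].
    have [suv|suv] := boolP ((s == u) || (s == v)).
      have [x [j [jJ xj]]] := gf_star q' i suv sw nsw.
      by apply/orP; right; apply/bigcupP; exists x => //; apply/bigcupP; exists j.
    have [wuv|wuv] := boolP ((w == u) || (w == v)).
      have ws : [set w; s] \in E0 by rewrite setUC.
      have nws : w != s by rewrite eq_sym.
      have [x [j [jJ xj]]] := gf_star q' i wuv ws nws.
      by apply/orP; right; apply/bigcupP; exists x => //; apply/bigcupP; exists j => //; rewrite setUC.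
    move: suv wuv; rewrite !negb_or => /andP[su sv] /andP[wu wv].
    apply/orP; left; apply/bigcupP; exists i => //; move: (mem_imE (gf q i) (subsetP E0E _ sw)).
    by rewrite /gf (negPf su) (negPf sv) (negPf wu) (negPf wv).
  - case/bigcupP=> x _ /bigcupP[j jJ exj]; apply/orP; right; apply/bigcupP; exists x => //; apply/bigcupP; exists j => //.
    have sub : Em \subset EF by apply/subsetP => e'; rewrite inE => /andP[].
    by rewrite (gg_Em q q') in exj; apply: (subsetP (imES _ sub) _ exj).
  - case/imsetP=> i _ ->; apply/orP; left; apply/bigcupP; exists i => //.
    by rewrite gf_uv in_setU1 eqxx.
case/orP=> /bigcupP[].
  move=> i _; rewrite gf_uv in_setU1 => /orP[/eqP->|ei]; first by apply/orP; right; apply: imset_f.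
  by do 3!(apply/orP; left); apply/bigcupP; exists i.
move=> x _ /bigcupP[j jJ /(imEP EFgr)[s [w [nsw sw De]]]]; apply/orP; left.
have [ue|ue] := boolP (u \in [set s; w]); last first.
  apply/orP; right; apply/bigcupP; exists x => //; apply/bigcupP; exists j => //.
  by rewrite De (gg_Em q q'); apply: mem_imE; rewrite inE sw.
have [z zu Dz] : exists2 z, z \in enb EF u & e = [set gg q' x j u; gg q' x j z].
  move: ue; rewrite !inE => /orP[]/eqP Du.
    by subst s; exists w; rewrite // in_enb sw eq_sym nsw.
  by subst w; exists s; [rewrite in_enb nsw setUC | rewrite De setUC].
apply/orP; left; apply/orP; right; apply/bigcupP; exists (be x z) => //.
by rewrite Dz; apply: gg_star.
Qed.

Variables (q q' : V -> TW).
Hypothesis q_ab : forall i, q (a i) != q (b i).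
Hypothesis q_inj : injective (fun i => [set q (a i); q (b i)]).
Hypothesis q_out : forall x y, exists z, q x = inl z /\ exists z', q' y = inl z' /\ z != z'.
Hypothesis q'_ab : forall i, q' (a i) != q' (b i).

Let q_iE x w : q x <> inr w. Proof. by have [z [-> _]] := q_out x x. Qed.
Let q'_iE x w : q' x <> inr w. Proof. by have [_ [_ [z' [-> _]]]] := q_out x x. Qed.
Let qq' x y : q x <> q' y. Proof. by have [z [-> [z' [-> zz]]]] := q_out x y; case=> /eqP; rewrite (negPf zz). Qed.

Lemma gf_inj i : injective (gf q i).
Proof.
move=> s w; rewrite /gf; have [Ds|su] := eqVneq s u; [|have [Ds|sv] := eqVneq s v];
  (have [Dw|wu] := eqVneq w u; [|have [Dw|wv] := eqVneq w v]); rewrite ?Ds ?Dw //;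
  first [by move/q_iE | by move/esym/q_iE | by case | by move/eqP; rewrite (negPf (q_ab i))
        | by move/esym/eqP; rewrite (negPf (q_ab i))].
Qed.

Lemma slot_inj x i : {in J &, injective (slot x i)}.
Proof. by move=> j j' jJ j'J; rewrite /slot; case: ifP => // _; apply: sg_inj. Qed.

Lemma gg_eq x j x' j' s s' : gg q' x j s = gg q' x' j' s' ->
  [\/ [/\ s = u, s' = u & q' x = q' x'],
      [/\ s \in enb EF u, s' \in enb EF u, be x s = be x' s' & slot x (be x s) j = slot x' (be x' s') j']
    | [/\ x = x', j = j' & s = s']].
Proof.
rewrite /gg; have [->|su] := eqVneq s u; have [->|s'u] := eqVneq s' u; first by move=> ?; constructor 1.
- by case: ifP => _ /q'_iE.
- by case: ifP => _ /esym/q'_iE.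
case: ifP => sN; case: ifP => s'N //; first by case=> H1 H2; constructor 2.
by case=> -> -> ->; constructor 3.
Qed.

Lemma gg_inj x j : injective (gg q' x j).
Proof. by move=> s w /gg_eq[[-> ->]|[sN wN /be_inj->]|[]]. Qed.

Let incident2 x x' i : x != x' -> (x == a i) || (x == b i) -> (x' == a i) || (x' == b i) -> [set a i; b i] = [set x; x'].
Proof.
by move=> xx /orP[]/eqP Dx /orP[]/eqP Dx'; rewrite Dx Dx' ?eqxx // in xx *; rewrite setUC.
Qed.

Let be_inc x z : z \in enb EF u -> (x == a (be x z)) || (x == b (be x z)).
Proof. by move=> zu; apply/be_im; exists z. Qed.

(** For distinct x and x', a common edge would either join the gadgets of two edges of H, both of
    which would then join x to x', or contain q' x = q' x' and a vertex in the gadget of an edge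
    joining x to x', whose ends q' keeps apart. *)
Lemma gg_dis x j x' j' e : j \in J -> j' \in J -> e \in imE (gg q' x j) EF -> e \in imE (gg q' x' j') EF ->
  x = x' /\ j = j'.
Proof.
move=> jJ j'J /(imEP EFgr)[s [w [nsw sw De]]] /(imEP EFgr)[s' [w' [nsw' sw' De']]].
suff H s1 w1 : s1 != w1 -> gg q' x j s = gg q' x' j' s1 -> gg q' x j w = gg q' x' j' w1 -> x = x' /\ j = j'.
  by move: De; rewrite De' => /esym/set2_eq[] [E1 E2]; [apply: (H s' w')|apply: (H w' s')]; rewrite // eq_sym.
move=> nsw1 /gg_eq[[Ds Ds1 Eq]|[sN s1N E1 E2]|[]//] /gg_eq[[Dw Dw1 Eq']|[wN w1N E1' E2']|[]//].
- by rewrite Ds Dw eqxx in nsw.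
- have [xx|xx] := eqVneq x x'; first by split=> //; rewrite -xx in E1' E2'; move: E2'; rewrite -E1' => /slot_inj->.
  have := be_inc x' w1N; rewrite -E1' => /(incident2 xx (be_inc x wN)) H.
  have := q'_ab (be x w); move: H => /set2_eq[] [-> ->]; rewrite Eq eqxx //.
- have [xx|xx] := eqVneq x x'; first by split=> //; rewrite -xx in E1 E2; move: E2; rewrite -E1 => /slot_inj->.
  have := be_inc x' s1N; rewrite -E1 => /(incident2 xx (be_inc x sN)) H.
  have := q'_ab (be x s); move: H => /set2_eq[] [-> ->]; rewrite Eq' eqxx //.
have [xx|xx] := eqVneq x x'; first by split=> //; rewrite -xx in E1 E2; move: E2; rewrite -E1 => /slot_inj->.
have := be_inc x' s1N; rewrite -E1 => /(incident2 xx (be_inc x sN)) H1.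
have := be_inc x' w1N; rewrite -E1' => /(incident2 xx (be_inc x wN)) H2.
have : be x s = be x w by apply: ab_inj; rewrite H1 H2.
by move/be_inj => /(_ sN wN) sw1; rewrite sw1 eqxx in nsw.
Qed.

Lemma gf_eq i i' s s' : gf q i s = gf q i' s' -> i = i' \/ (s == u) || (s == v).
Proof.
rewrite /gf; have [_|su] := eqVneq s u; first by right.
have [_|sv] := eqVneq s v; first by right.
by case: ifP => _; [move/esym/q_iE|case: ifP => _; [move/esym/q_iE|case; left]].
Qed.

Lemma gf_ends i s w : s != w -> (s == u) || (s == v) -> (w == u) || (w == v) ->
  [set gf q i s; gf q i w] = [set q (a i); q (b i)].
Proof.
move=> nsw /orP[]/eqP Ds /orP[]/eqP Dw; rewrite Ds Dw ?eqxx // in nsw *; rewrite /gf eqxx vu eqxx //.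
by rewrite setUC.
Qed.

Lemma gf_dis i i' e : e \in imE (gf q i) EF -> e \in imE (gf q i') EF -> i = i'.
Proof.
move=> /(imEP EFgr)[s [w [nsw sw De]]] /(imEP EFgr)[s' [w' [nsw' sw' De']]].
have E : [set gf q i s; gf q i w] = [set gf q i' s'; gf q i' w'] by rewrite -De -De'.
have [//|suv] : i = i' \/ (s == u) || (s == v).
  by case/set2_eq: E => -[E1 _]; case/gf_eq: E1; auto.
have [//|wuv] : i = i' \/ (w == u) || (w == v).
  by case/set2_eq: E => -[_ E1]; case/gf_eq: E1; auto.
have [//|suv'] : i = i' \/ (s' == u) || (s' == v).
  by case/esym/set2_eq: E => -[E1 _]; case/gf_eq: E1; auto.
have [//|wuv'] : i = i' \/ (w' == u) || (w' == v).
  by case/esym/set2_eq: E => -[_ E1]; case/gf_eq: E1; auto.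
by apply: q_inj; rewrite -(gf_ends i nsw suv wuv) -(gf_ends i' nsw' suv' wuv').
Qed.

Lemma gf_gg i x j e : e \in imE (gf q i) EF -> e \in imE (gg q' x j) EF -> False.
Proof.
move=> /(imEP EFgr)[s [w [nsw sw De]]] /(imEP EFgr)[s' [w' [nsw' sw' De']]].
have key s1 s2 : gf q i s1 = gg q' x j s2 -> s2 \in enb EF u /\ be x s2 = i.
  rewrite /gg /gf; have [_|su] := eqVneq s2 u.
    by case: ifP => _; [move/qq'|case: ifP => _; [move/qq'|move/esym/q'_iE]].
  case sN: (s2 \in enb EF u); last by case: ifP => _; [move/q_iE|case: ifP => _; [move/q_iE|]].
  by case: ifP => _; [move/q_iE|case: ifP => _; [move/q_iE|case=> ->]].
have E : [set gf q i s; gf q i w] = [set gg q' x j s'; gg q' x j w'] by rewrite -De -De'.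
have [[sN si] [wN wi]] : (s' \in enb EF u /\ be x s' = i) /\ (w' \in enb EF u /\ be x w' = i).
  by case/set2_eq: E => -[/key H1 /key H2].
by rewrite (be_inj sN wN (etrans si (esym wi))) eqxx in nsw'.
Qed.

Lemma dec_TG : dec EF (TG q q').
Proof.
apply: decU.
- rewrite -setI_eq0; apply/eqP/setP => e; rewrite in_setI in_set0; apply/negP.
  by case/andP=> /bigcupP[i _ ei] /bigcupP[x _ /bigcupP[j _]]; apply: gf_gg ei.
- apply: dec_bigcup => [|i _|i j _ _ ij]; [exact: index_enum_uniq|exact: dec_copy (gf_inj (i := i))|].
  rewrite -setI_eq0; apply/eqP/setP => e; rewrite in_setI in_set0; apply/negP => /andP[ei ej].
  by rewrite (gf_dis ei ej) eqxx in ij.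
apply: dec_bigcup => [|x _|x x' _ _ xx]; first exact: index_enum_uniq.
  rewrite -big_enum /=; apply: dec_bigcup => [|j _|j j']; [exact: enum_uniq|exact: dec_copy (gg_inj (x := x) (j := j))|].
  rewrite !mem_enum => jJ jJ' jj; rewrite -setI_eq0; apply/eqP/setP => e; rewrite in_setI in_set0; apply/negP => /andP[ej ej'].
  by have [_ jE] := gg_dis jJ jJ' ej ej'; rewrite jE eqxx in jj.
rewrite -setI_eq0; apply/eqP/setP => e; rewrite in_setI in_set0; apply/negP.
case/andP=> /bigcupP[j jJ ej] /bigcupP[j' jJ' ej'].
by have [xE _] := gg_dis jJ jJ' ej ej'; rewrite xE eqxx in xx.
Qed.

Lemma Tcore_TG q1 q2 : Tcore q1 q2 \subset TG q1 q2.
Proof. by rewrite -TcoreE subsetUl. Qed.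

Lemma Tcore_out q1 q2 e : e \in Tcore q1 q2 -> exists w, inr w \in e.
Proof.
have E0w : within setT E0 by apply: within_sub (subD1set _ _) EFgr.
have gfo q0 i0 : e \in imE (gf q0 i0) E0 -> exists w, inr w \in e.
  case/(imEP E0w)=> s [w [nsw sw ->]]; have [_ H1 _] := E0P sw nsw.
  have [suv|suv] := boolP ((s == u) || (s == v)).
    by have [wu wv] := H1 suv; exists (inl (i0, w)); rewrite {2}/gf (negPf wu) (negPf wv) set22.
  by move: suv; rewrite negb_or => /andP[su sv]; exists (inl (i0, s)); rewrite {1}/gf (negPf su) (negPf sv) set21.
rewrite !in_setU => /orP[/orP[]|] /bigcupP[x _]; [exact: gfo|exact: gfo|].
case/bigcupP=> j _; have Emw : within setT Em by apply: within_sub EFgr; apply/subsetP => e'; rewrite inE => /andP[].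
case/(imEP Emw) => s [w [nsw]]; rewrite inE => /andP[_]; rewrite !inE negb_or => /andP[us _] ->.
rewrite {1}/gg eq_sym (negPf us); case: ifP => _; first by eexists; apply: set21.
by eexists; apply: set21.
Qed.

Lemma Tcore_deg (w : (I * VF + V * VF * VF)%type) : #|enb (Tcore q q') (inr w)| <= 2 * #|VF| + 2 * (#|VF| * #|VF|).
Proof.
have gfI q0 x s i w' : (forall x y, q0 x <> inr y) -> iE i w' = gf q0 x s -> x = i.
  by move=> q0E; rewrite /gf; case: ifP => _; [move/esym/q0E|case: ifP => _; [move/esym/q0E|case]].
have gfZ q0 x s w' : (forall x y, q0 x <> inr y) -> inr (inr w') = gf q0 x s -> False.
  by move=> q0E; rewrite /gf; case: ifP => _; [move/esym/q0E|case: ifP => _; [move/esym/q0E|]].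
have E0w : within setT E0 by apply: within_sub (subD1set _ _) EFgr.
have Emw : within setT Em by apply: within_sub EFgr; apply/subsetP => e'; rewrite inE => /andP[].
have im (S : finType) (f : S -> TW) : #|[set f z | z : S]| <= #|S| by apply: leq_trans (leq_imset_card _ _) (max_card _).
case: w => [[i w]|[[x j] z]].
  pose gb (t : bool * VF * VF) := gg q (if t.1.1 then a i else b i) t.1.2 t.2.
  apply: leq_trans (_ : #|[set gf q i z | z : VF]| + #|[set gf q' i z | z : VF]| + #|[set gb t | t : bool * VF * VF]| <= _).
    apply: card_sub3; apply/subsetP => y; rewrite !enbU !in_setU !enb_bigcup => /orP[/orP[]|] /bigcupP[x _].
    - by case/(enb_imE_sub E0w) => s [t [_ _ /(gfI _ _ _ _ _ q_iE) <- -> _]]; rewrite imset_f.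
    - by case/(enb_imE_sub E0w) => s [t [_ _ /(gfI _ _ _ _ _ q'_iE) <- -> _]]; rewrite imset_f ?orbT.
    rewrite enb_bigcup => /bigcupP[j jJ /(enb_imE_sub Emw) [s [t [_ _ E -> _]]]].
    have xi : (x == a i) || (x == b i).
      move: E; rewrite /gg; case: ifP => _; first by move/esym/q_iE.
      by case: ifP => // sN; case=> -> _; apply: be_inc.
    apply/orP; right; apply/imsetP; exists (x == a i, j, t) => //; rewrite /gb /=.
    by case: eqVneq xi => [->|_ /eqP->].
  apply: leq_trans (leq_add (leq_add (im _ _) (im _ _)) (im _ _)) _.
  by rewrite !card_prod card_bool; lia.
apply: leq_trans (_ : #|[set gg q x j z | z : VF]| <= _); last by apply: leq_trans (im _ _) _; lia.
apply/subset_leq_card/subsetP => y; rewrite !enbU !in_setU !enb_bigcup => /orP[/orP[]|] /bigcupP[x' _].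
- by case/(enb_imE_sub E0w) => s [t [_ _ /(gfZ _ _ _ _ q_iE)]].
- by case/(enb_imE_sub E0w) => s [t [_ _ /(gfZ _ _ _ _ q'_iE)]].
rewrite enb_bigcup => /bigcupP[j' _ /(enb_imE_sub Emw) [s [t [_ _ E -> _]]]].
move: E; rewrite {1}/gg; case: ifP => _; first by move/esym/q_iE.
by case: ifP => // _; case=> -> -> _; rewrite imset_f.
Qed.
End Transformer.

Section Admissible.
Variables (VF : finType) (F : sgraph VF) (r : nat).
Hypothesis F_reg : regular r F.
Hypothesis r_gt0 : 0 < r.

(** Disjoint closed neighbourhoods mean that an identification creates neither a loop nor a double
    edge; so along the whole chain no two edges are merged. *)
Lemma identify_quot (V V' : finType) (H : sgraph V) (H' : sgraph V') : identifications H H' ->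
  exists p : V -> V', [/\ forall w, exists u, p u = w,
    forall w w', H' w w' <-> exists u v, [/\ p u = w, p v = w' & H u v] &
    forall u v u' v', H u v -> H u' v' -> p u = p u' -> p v = p v' -> u = u' /\ v = v'].
Proof.
elim=> [|V1 V2 H1 H2 _ [p [psur pH pinj]] [x [y [p2 [dis p2sur p2E p2H]]]]].
  exists id; split=> [w|w w'|]; [by exists w| |by []].
  by split=> [ww'|[u [v [<- <-]]]//]; exists w, w'.
have inj2 u v u' v' : H1 u v -> H1 u' v' -> p2 u = p2 u' -> p2 v = p2 v' -> u = u' /\ v = v'.
  move=> uv uv' /p2E Eu /p2E Ev.
  have no z : z \in x |: nbhd H1 x -> z \in y |: nbhd H1 y -> False.
    by move=> zx zy; have := disjoint_setI0 dis; move/setP/(_ z); rewrite in_setI zx zy inE.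
  have xy : H1 x y -> False by move=> xy; apply: (no y); rewrite !inE ?eqxx // xy orbT.
  have nb z w : H1 z w -> w \in z |: nbhd H1 z by move=> zw; rewrite !inE zw orbT.
  case: Eu => [Eu|[Du Du']|[Du Du']]; case: Ev => [Ev|[Dv Dv']|[Dv Dv']]; subst => //.
  - by case: (no u'); apply: nb; rewrite adj_sym.
  - by case: (no u'); apply: nb; rewrite adj_sym.
  - by case: (no v'); apply: nb.
  - by rewrite adj_irr in uv.
  - by case: (no v'); apply: nb.
  - by rewrite adj_irr in uv.
exists (p2 \o p); split=> [w|w w'|u v u' v' uv uv' /= Eu Ev].
- by have [z <-] := p2sur w; have [u <-] := psur z; exists u.
- rewrite p2H; split=> [[u1 [v1 [<- <- /pH[u [v [<- <- uv]]]]]]|[u [v [<- <- uv]]]]; first by exists u, v.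
  by exists (p u), (p v); split=> //; apply/pH; exists u, v.
have [E1 E2] := inj2 _ _ _ _ (proj2 (pH _ _) (ex_intro _ u (ex_intro _ v (And3 erefl erefl uv))))
  (proj2 (pH _ _) (ex_intro _ u' (ex_intro _ v' (And3 erefl erefl uv')))) Eu Ev.
exact: pinj.
Qed.

(** The transformer built above has, outside the vertices of H and H', degrees bounded in terms of F
    alone. Hence the minimum that defines [dF] exists. *)
Lemma dF_admissible_ex : 0 < #|VF| -> exists d, dF_admissible r F d.
Proof.
case/card_gt0P=> u _; pose EF := edges F; have EFgr : within setT EF by apply: edges_within.
have EFreg w : #|enb EF w| = r by rewrite enb_edges; apply: F_reg.
have /card_gt0P[v uv] : 0 < #|enb EF u| by rewrite EFreg.
have vu : u \in enb EF v by rewrite enb_sym.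
pose k := #|VF|; exists (2 * k + 4 * k * k) => V V' H H' regH [V0 [H0 [[g [gbij gH]] /identify_quot[p0 [_ p0H p0inj]]]]].
pose p := p0 \o g; have pH w w' : H' w w' <-> exists x y, [/\ p x = w, p y = w' & H x y].
  rewrite p0H; split=> [[x [y [<- <- xy]]]|[x [y [<- <- xy]]]]; last by exists (g x), (g y); rewrite gH.
  have [g' gK g'K] := gbij; exists (g' x), (g' y); rewrite /p /= !g'K; split=> //.
  by rewrite -gH !g'K.
have pinj x y x' y' : H x y -> H x' y' -> p x = p x' -> p y = p y' -> x = x' /\ y = y'.
  rewrite -!gH => xy xy' Ex Ey; have [Ex' Ey'] := p0inj _ _ _ _ xy xy' Ex Ey.
  by split; apply: (bij_inj gbij).
have [a [b [ab abinj EH]]] := orient (@edges_within _ H); set h := #|edges H| in a b ab abinj EH.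
have Hab i : H (a i) (b i) by rewrite -in_edges EH; apply/imsetP; exists i.
have H'ab i : H' (p (a i)) (p (b i)) by apply/pH; exists (a i), (b i).
have pab i : p (a i) != p (b i) by apply: adj_neq.
have pabinj : injective (fun i => [set p (a i); p (b i)]).
  move=> i j /set2_eq[] [E1 E2]; apply: abinj => /=.
    by have [-> ->] := pinj _ _ _ _ (Hab i) (Hab j) E1 E2.
  have ba : H (b j) (a j) by rewrite adj_sym.
  by have [-> ->] := pinj _ _ _ _ (Hab i) ba E1 E2; rewrite setUC.
have EH' : edges H' = [set [set p (a i); p (b i)] | i : 'I_h].
  apply/setP => e; apply/edgesP/imsetP => [[w [w' [/pH[x [y [<- <- xy]]] ->]]]|[i _ ->]]; last by exists (p (a i)), (p (b i)).
  have : [set x; y] \in edges H by rewrite in_edges.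
  rewrite EH => /imsetP[i _ /set2_eq[] [-> ->]]; exists i => //; exact: setUC.
pose inc x i := (x == a i) || (x == b i).
have cinc x : #|enb EF u| = #|[set i | inc x i]|.
  rewrite EFreg -(regH x) /deg -enb_edges -(card_incident x (@edges_within _ H)).
  rewrite -(card_imset _ abinj); apply: eq_card => e; apply/setIdP/imsetP.
    case; rewrite EH => /imsetP[i _ ->]; rewrite !inE => xi; by exists i; rewrite ?inE.
  by case=> i; rewrite inE => xi ->; rewrite EH; split; [apply/imsetP; exists i|rewrite !inE].
have /fin_all_exists[be Hbe] x : exists g : {ffun VF -> 'I_h}, {in enb EF u &, injective g} /\ g @: enb EF u = [set i | inc x i].
  have : 0 < #|[set i | inc x i]| by rewrite -cinc EFreg.
  by case/card_gt0P=> i0 _; apply: bij_sets (cinc x).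
have [|sg0 [sginj sgim]] := @bij_sets VF VF (enb EF u :\ v) (enb EF v :\ u) u.
  by have := cardsD1 v (enb EF u); have := cardsD1 u (enb EF v); rewrite uv vu !EFreg; lia.
have beP x i : reflect (exists2 z, z \in enb EF u & be x z = i) ((x == a i) || (x == b i)).
  have [_ im] := Hbe x; rewrite -[_ || _]/(inc x i); have -> : inc x i = (i \in [set i | inc x i]) by rewrite inE.
  by rewrite -im; apply: (iffP imsetP) => [[z zu ->]|[z zu <-]]; exists z.
have beI x : {in enb EF u &, injective (be x)} by have [] := Hbe x.
pose W : finType := TW VF V V' h.
pose q x : W := inl (inl x); pose i' w : W := inl (inr w); pose q' := i' \o p.
have qinj : injective q by move=> x y [].
have i'inj : injective i' by move=> x y [].
have q_ab i : q (a i) != q (b i) by rewrite (inj_eq qinj).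
have q'_ab i : q' (a i) != q' (b i) by rewrite (inj_eq i'inj).
have q_set i : [set q (a i); q (b i)] = q @: [set a i; b i] by rewrite imset_set2.
have q'_set i : [set q' (a i); q' (b i)] = i' @: [set p (a i); p (b i)] by rewrite imset_set2.
have q_inj : injective (fun i => [set q (a i); q (b i)]).
  by move=> i j; rewrite !q_set => /(imset_inj qinj)/abinj.
have q'_inj : injective (fun i => [set q' (a i); q' (b i)]).
  by move=> i j; rewrite !q'_set => /(imset_inj i'inj)/pabinj.
have q_out x y : exists z, q x = inl z /\ exists z', q' y = inl z' /\ z != z'.
  by exists (inl x); split=> //; exists (inr (p y)).
have q'_out x y : exists z, q' x = inl z /\ exists z', q y = inl z' /\ z != z'.
  by exists (inr (p x)); split=> //; exists (inl y).
pose E := Tcore EF u v a b be sg0 q q'.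
have dT := dec_TG EFgr uv abinj beI beP sginj q_ab q_inj q_out q'_ab.
have dT' := dec_TG EFgr uv abinj beI beP sginj q'_ab q'_inj q'_out q_ab.
have EW : within setT E.
  by apply: within_sub (dec_within EFgr dT); exact (Tcore_TG EFgr uv ab beP sgim q q').
have F0 : edges F != set0 by apply/set0Pn; exists [set u; v]; move: uv; rewrite in_enb => /andP[].
have imq : imE q (edges H) = [set [set q (a i); q (b i)] | i : 'I_h].
  by rewrite EH /imE -imset_comp; apply: eq_imset => i /=; rewrite q_set.
have imi' : imE i' (edges H') = [set [set q' (a i); q' (b i)] | i : 'I_h].
  by rewrite EH' /imE -imset_comp; apply: eq_imset => i /=; rewrite q'_set.
exists W, (sg E), q, i'; split; first split=> //.
- move=> x y; rewrite !mem_cat => rx ry; rewrite /= in_enb negb_and negbK; apply/orP; right; apply/negP.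
  move/(Tcore_out EFgr) => [w].
  rewrite !inE => /orP[]/eqP Dw; [move: rx|move: ry]; rewrite -Dw => /orP[]/codomP[z]; by rewrite /q /i'.
- by apply: (proj2 (has_decP _ F0)); rewrite edges_gunion edges_gimage // edges_sg // imq (TcoreE EFgr uv ab beP sgim).
- apply: (proj2 (has_decP _ F0)); rewrite edges_gunion edges_gimage // edges_sg // imi'.
  by rewrite /E Tcore_sym (TcoreE EFgr uv ab beP sgim).
apply: degeneracy_le => x; rewrite inE mem_cat negb_or => /andP[x1 x2].
rewrite -enb_edges edges_sg //; case: x x1 x2 => [[x|x]|w] x1 x2.
- by rewrite codom_f in x1.
- by rewrite codom_f in x2.
apply: leq_trans (Tcore_deg EFgr uv sg0 beP q_out w) _; rewrite -/k; lia.
Qed.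
End Admissible.

Definition edge_quot (V V' : finType) (H : sgraph V) (H' : sgraph V') (p : V -> V') :=
  [/\ forall w, exists u, p u = w,
    forall w w', H' w w' <-> exists u v, [/\ p u = w, p v = w' & H u v] &
    forall u v u' v', H u v -> H u' v' -> p u = p u' -> p v = p v' -> u = u' /\ v = v'].

Lemma surj_card (V V' : finType) (p : V -> V') : (forall w, exists u, p u = w) -> #|V'| <= #|V|.
Proof. by case/fin_all_exists => g gK; apply: (@leq_card _ _ g) => x y E; rewrite -(gK x) E gK. Qed.

(* The last identification of the chain is found first: it splits one vertex of V' in two, which gives a graph on option V'. *)
Lemma edge_quot_ident (V V' : finType) (H : sgraph V) (H' : sgraph V') (p : V -> V') : edge_quot H H' p ->
  exists (V0 : finType) (H0 : sgraph V0), giso H H0 /\ identifications H0 H'.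
Proof.
have [n] := ubnP (#|V| - #|V'|); elim: n V' H' p => // n IH V' H' p Vn [psur pH pinj].
have loop u v : H u v -> p u <> p v.
  move=> uv puv; have : H' (p u) (p v) by apply/pH; exists u, v.
  by rewrite puv adj_irr.
have [/injectiveP inj|/injectivePn[x [y xy Exy]]] := boolP (injectiveb p).
  exists V', H'; split; last exact: identifications0.
  have [g gK] := fin_all_exists psur; exists p; split; first by exists g => // z; apply: inj; rewrite gK.
  move=> u v; apply/idP/idP => [/pH[u' [v' [/inj<- /inj<-]]]//|uv]; by apply/pH; exists u, v.
pose p1 z := if z == x then None else Some (p z).
have p1x z : p1 z = None -> z = x by rewrite /p1; case: eqP.
have p1p z a : p1 z = Some a -> z != x /\ p z = a by rewrite /p1; case: eqP => // _ [].
pose pi (o : option V') := if o is Some a then a else p x.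
have pip1 z : pi (p1 z) = p z by rewrite /p1; case: eqP => [->|].
have p1sur w : exists u, p1 u = w.
  case: w => [w|]; last by exists x; rewrite /p1 eqxx.
  have [u Eu] := psur w; have [ux|ux] := eqVneq u x; last by exists u; rewrite /p1 (negPf ux) Eu.
  by exists y; rewrite /p1 eq_sym (negPf xy) -Exy -ux Eu.
pose H1 := sg (imE p1 (edges H)).
have H1P w w' : H1 w w' <-> exists u v, [/\ p1 u = w, p1 v = w' & H u v].
  rewrite /= in_enb; split=> [/andP[ww' /(imEP (@edges_within _ _))[u [v [_ + /set2_eq E]]]]|[u [v [<- <- uv]]]].
    by rewrite in_edges => uv; case: E => -[-> ->]; [exists u, v|exists v, u; rewrite adj_sym].
  rewrite mem_imE ?in_edges // andbT; apply/eqP => /(congr1 pi); rewrite !pip1; exact/nesym/loop.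
have [||V0 [H0 [iso id0]]] := IH _ H1 p1.
- by have := surj_card p1sur; rewrite card_option; move: Vn; lia.
- split=> // u v u' v' uv uv' /(congr1 pi) + /(congr1 pi); rewrite !pip1; exact: pinj.
exists V0, H0; split=> //; apply: identificationsS id0 _.
exists None, (Some (p x)), pi; split.
- rewrite -setI_eq0; apply/eqP/setP => z; rewrite in_setI in_set0; apply/negP => /andP[].
  rewrite !in_setU1 !inE => /orP[/eqP->|/H1P[u [v [/p1x-> vz xv]]]] /orP[/eqP E|/H1P[u' [v' [/p1p[u'x pu'] vz' uv']]]] //.
  + by case: (loop _ _ uv'); rewrite pu' (p1x _ vz').
  + by case: (loop _ _ xv); have [_ ->] := p1p _ _ (etrans vz E).
  have [E _] := pinj _ _ _ _ xv uv' (esym pu') (etrans (esym (pip1 v)) (etrans (congr1 pi (etrans vz (esym vz'))) (pip1 v'))).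
  by rewrite -E eqxx in u'x.
- by move=> w; exists (Some w).
- move=> [a|] [c|] /=; split; try by case=> [[->]|[//]|[//]].
  + by move=> ->; constructor 1.
  + by move=> ->; constructor 3.
  + by case=> // -[] // [->].
  + by move=> <-; constructor 2.
  + by case=> // -[] // _ [->].
  + by constructor 1.
  + by [].
- move=> w w'; rewrite pH; split=> [[u [v [<- <- uv]]]|[o [o' [<- <- /H1P[u [v [<- <- uv]]]]]]].
    by exists (p1 u), (p1 v); rewrite !pip1; split=> //; apply/H1P; exists u, v.
  by exists u, v; rewrite !pip1.
Qed.

Section Split.
Variables (S : finType) (X : {set {set S}}) (r : nat).
Hypothesis XS : within setT X.
Hypothesis divX : forall x, r %| #|enb X x|.
Hypothesis posX : forall x, 0 < #|enb X x|.
Hypothesis r_gt0 : 0 < r.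

Let idx x y := index y (enum (enb X x)).
Let slot x y := idx x y %/ r.
Let SP := {t : S * 'I_#|S|.+1 | t.2 < #|enb X t.1| %/ r}.
Let adj0 (s t : SP) := [&& (val t).1 \in enb X (val s).1, slot (val s).1 (val t).1 == (val s).2 & slot (val t).1 (val s).1 == (val t).2].

(** Split each vertex x into deg(x) / r vertices, each taking r consecutive entries in an
    enumeration of the neighbours of x. *)
Lemma splitting : exists (S0 : finType) (H0 : sgraph S0) (p : S0 -> S), regular r H0 /\ edge_quot H0 (sg X) p.
Proof.
have sym0 : symmetric adj0 by move=> s t; rewrite /adj0 enb_sym; congr (_ && _); exact: andbC.
have irr0 : irreflexive adj0 by move=> s; rewrite /adj0 enbxx.
have slot_lt x y : y \in enb X x -> slot x y < #|enb X x| %/ r.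
  by move=> yx; rewrite ltn_divLR // divnK // /idx cardE index_mem mem_enum.
have deg_lt x : #|enb X x| %/ r < #|S|.+1 by rewrite ltnS; apply: leq_trans (leq_div _ _) (max_card _).
have mk x i : i < #|enb X x| %/ r -> exists t : SP, (val t).1 = x /\ (val t).2 = i :> nat.
  move=> ix; have iS : i < #|S|.+1 by apply: ltn_trans ix (deg_lt x).
  by exists (Sub (x, Ordinal iS) ix).
have val_eq (a b : SP) : (val a).1 = (val b).1 -> (val a).2 = (val b).2 :> nat -> a = b.
  move=> H1 H2; apply: val_inj; case: (val a) H1 H2 => [a1 a2] /=; case: (val b) => [b1 b2] /= -> H2.
  by congr (_, _); apply: val_inj.
exists SP, (SGraph sym0 irr0), (fun s => (val s).1); split.
  move=> s; set x := (val s).1; set i := (val s).2; set A := enb X x; have ix : i < #|A| %/ r := valP s.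
  have im k : k < r -> i * r + k < #|A|.
    move=> kr; rewrite -(divnK (divX x)) -/A; apply: leq_trans (_ : i.+1 * r <= _); last by rewrite leq_mul2r ix orbT.
    by rewrite mulSn addnC ltn_add2r.
  have /card_gt0P[y0 _] := posX x.
  have nthA k : k < r -> nth y0 (enum A) (i * r + k) \in A by move=> /im kA; rewrite -mem_enum mem_nth -?cardE.
  have /fin_all_exists[t Ht] (k : 'I_r) : exists t : SP, (val t).1 = nth y0 (enum A) (i * r + k) /\ (val t).2 = slot (nth y0 (enum A) (i * r + k)) x :> nat.
    by apply: mk; apply: slot_lt; rewrite enb_sym nthA.
  have idxA (k : 'I_r) : idx x (nth y0 (enum A) (i * r + k)) = i * r + k.
    by rewrite /idx index_uniq ?enum_uniq // -cardE im.
  rewrite /deg -[RHS]card_ord -(card_imset (f := t)).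
    apply: eq_card => s'; rewrite in_set /= /adj0 -/x -/i -/A; apply/and3P/imsetP => [[yA /eqP E1 /eqP E2]|[k _ ->]].
      have kr : idx x (val s').1 - i * r < r.
        by rewrite ltn_subLR -E1 ?leq_trunc_div // /slot; rewrite -mulSnr ltn_ceil.
      have E3 : i * r + (idx x (val s').1 - i * r) = idx x (val s').1 by rewrite subnKC // -E1 leq_trunc_div.
      have E4 : nth y0 (enum A) (idx x (val s').1) = (val s').1 by rewrite nth_index // mem_enum.
      exists (Ordinal kr) => //; have [T1 T2] := Ht (Ordinal kr); rewrite /= E3 E4 in T1 T2.
      by apply: val_eq; [exact: (esym T1)|rewrite -E2; exact: (esym T2)].
    have [-> ->] := Ht k; split; [exact: nthA|by rewrite /slot idxA divnMDl // divn_small ?addn0 //|by []].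
  move=> k k' E; have [T1 _] := Ht k; have [T1' _] := Ht k'; apply: val_inj => /=.
  by have := idxA k; rewrite -T1 E T1' idxA => /addnI.
split=> [x|x y|s t s' t'].
- have [|s [sx _]] := mk x 0; last by exists s.
  by rewrite divn_gt0 // dvdn_leq.
- split=> [/= yx|[s [t [<- <- /and3P[]]]]//].
  have [s [sx s2]] := mk x (slot x y) (slot_lt x y yx); rewrite enb_sym in yx.
  have [t [ty t2]] := mk y (slot y x) (slot_lt y x yx).
  by exists s, t; split=> //; rewrite /= /adj0 sx ty s2 t2 !eqxx -enb_sym yx.
move=> /and3P[_ /eqP E1 /eqP E2] /and3P[_ /eqP E1' /eqP E2'] Ex Ey.
by split; apply: val_eq => //; [rewrite -E1 -E1' Ex Ey|rewrite -E2 -E2' Ex Ey].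
Qed.
End Split.

(** The order of [rooted_order] with the roots left out, as a plain list: the form that [embed_one]
    takes. *)
Definition rooted (W : finType) (ET : {set {set W}}) (P : {set W}) (D : nat) := exists s : seq W,
  [/\ uniq s, s =i ~: P & forall s1 w s2, s = s1 ++ w :: s2 -> #|enb ET w :&: (P :|: [set x in s1])| <= D].

Lemma rooted_deg (W : finType) (ET : {set {set W}}) (P : {set W}) (D : nat) :
  (forall w, w \notin P -> #|enb ET w| <= D) -> rooted ET P D.
Proof.
move=> degP; exists (enum (~: P)); split; [exact: enum_uniq|exact: mem_enum|move=> s1 w s2 Es].
apply: leq_trans (subset_leq_card (subsetIl _ _)) (degP _ _).
by rewrite -in_setC -mem_enum Es mem_cat mem_head orbT.
Qed.

Lemma rooted_le (W : finType) (ET : {set {set W}}) (P : {set W}) (D D' : nat) :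
  D <= D' -> rooted ET P D -> rooted ET P D'.
Proof. by move=> DD [s [us ms bs]]; exists s; split=> // s1 w s2 /bs/leq_trans; apply. Qed.

Lemma rooted_degeneracy (W : finType) (T : sgraph W) (P : {set W}) (D : nat) :
  degeneracy T P <= D -> rooted (edges T) P D.
Proof.
rewrite /degeneracy; case: ex_minnP => d /existsP[s /andP[us /existsP[a /andP[/eqP DP /forallP bs]]]] _ dD.
apply: rooted_le dD _; have sz := size_tuple s.
have mem x : x \in tval s.
  have [||_ ->] := uniq_min_size (s2 := enum W) us; rewrite ?mem_enum ?sz -?cardT //.
  by move=> y _; rewrite mem_enum.
have us' : uniq (take a s ++ drop a s) by rewrite cat_take_drop.
exists (drop a s); split; first by rewrite drop_uniq.
  move=> x; have : x \in take a s ++ drop a s by rewrite cat_take_drop.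
  rewrite in_setC DP inE mem_cat; move: us'; rewrite cat_uniq => /and3P[_ /hasPn no _].
  by have [/no/negPf->|] := boolP (x \in drop a s); rewrite ?orbF => // _ ->.
move=> s1 w s2 Es; have js : a + size s1 < #|W|.
  have := congr1 size (cat_take_drop a s); rewrite size_cat Es size_cat /= sz size_takel; last by rewrite sz -ltnS.
  move=> E; apply: leq_trans (leq_addr (size s2) _) _.
  by rewrite -[leqRHS]E addnA addnS addSn.
have := bs (Ordinal js); rewrite /= leq_addr /= enb_edges (tnth_nth w) /=.
have sa : size (take a s) = a by rewrite size_takel // sz -ltnS.
have -> : nth w s (a + size s1) = w by rewrite -(cat_take_drop a s) Es nth_cat sa ltnNge leq_addr /= addKn nth_cat ltnn subnn.
have -> : take (a + size s1) s = take a s ++ s1.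
  by rewrite -{1}(cat_take_drop a s) Es take_cat sa ltnNge leq_addr /= addKn take_size_cat.
by rewrite DP; congr (#|_ :&: _| <= _); apply/setP => x; rewrite !inE mem_cat.
Qed.

Lemma transformer (VF : finType) (F : sgraph VF) (r d : nat) : dF_admissible r F d -> edges F != set0 ->
  forall (S0 S : finType) (H0 : sgraph S0) (X : {set {set S}}) (p : S0 -> S), within setT X -> regular r H0 -> edge_quot H0 (sg X) p ->
  exists (W : finType) (T : {set {set W}}) (i : S0 -> W) (i' : S -> W),
    [/\ injective i, injective i', forall u v, i u != i' v,
       within setT T /\ forall e, e \in T -> ~~ (e \subset i @: setT :|: i' @: setT) &
       [/\ dec (edges F) (T :|: imE i (edges H0)), dec (edges F) (T :|: imE i' X) & rooted T (i @: setT :|: i' @: setT) d]].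
Proof.
move=> adm F0 S0 S H0 X p XS reg /edge_quot_ident id0.
have [W [T [i [i' [[[iI i'I] ii' noT dT dT'] degT]]]]] := adm _ _ _ _ reg id0.
have mem y : (y \in i @: setT :|: i' @: setT) = (y \in codom i ++ codom i').
  rewrite mem_cat in_setU; congr (_ || _); apply/imsetP/codomP => -[x]; [|by move=> ->; exists x| |by move=> ->; exists x];
  by move=> _ ->; exists x.
exists W, (edges T), i, i'; split=> //; first split; first exact: edges_within.
  move=> e /edgesP[x [y [xy ->]]]; rewrite subUset !sub1set !mem; apply/negP => /andP[xr yr].
  by have := noT _ _ xr yr; rewrite xy.
move/(has_decP _ F0): dT; move/(has_decP _ F0): dT'; rewrite !edges_gunion !edges_gimage // edges_sg // => dT' dT.
split=> //; apply: rooted_degeneracy; rewrite (_ : _ :|: _ = [set x in codom i ++ codom i']) //.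
by apply/setP => y; rewrite mem inE.
Qed.

(** * Absorbers *)

Section Place.
Variable D : nat.

(** What a greedy embedding, outside [Fb], of a graph of rooted degeneracy at most D asks of its
    host. *)
Definition rich (V : finType) (G : {set {set V}}) (M : nat) (Fb : {set V}) :=
  forall X : {set V}, #|X| <= D -> M <= #|[set y in ~: Fb | X \subset enb G y]|.

Lemma rich_sub (V : finType) (G : {set {set V}}) (M M' m : nat) (Fb Fb' N : {set V}) :
  rich G M Fb -> Fb' \subset Fb :|: N -> #|N| <= m -> M' + m <= M -> rich G M' Fb'.
Proof.
move=> rG FbN Nm MM X XD; rewrite -(leq_add2r m); apply: leq_trans MM _; apply: leq_trans (rG X XD) _.
apply: leq_trans (_ : #|[set y in ~: Fb' | X \subset enb G y]| + #|N| <= _); last by rewrite leq_add2l.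
apply: card_sub2; apply/subsetP => y /setIdP[yF Xy]; rewrite in_setU.
have [|yN] := boolP (y \in N); first by rewrite orbT.
rewrite orbF; apply/setIdP; split=> //; rewrite in_setC; apply/negP => /(subsetP FbN).
by rewrite in_setU (negPf yN) orbF; apply/negP; rewrite -in_setC.
Qed.

Lemma place (S W V : finType) (i : S -> W) (ET : {set {set W}}) (G : {set {set V}}) (phi : S -> V) (Fb : {set V}) :
  injective i -> injective phi -> within setT ET -> (forall e, e \in ET -> ~~ (e \subset i @: setT)) ->
  rooted ET (i @: setT) D -> rich G #|W| (Fb :|: phi @: setT) ->
  exists f : W -> V, [/\ injective f, forall s, f (i s) = phi s,
    forall w, w \notin i @: setT -> f w \notin Fb :|: phi @: setT & imE f ET \subset G].
Proof.
move=> iI phiI ETW noE [s [us ms bs]] rG; set P := i @: setT in noE ms bs *; set Y := ~: (Fb :|: phi @: setT).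
have /fin_all_exists[phi0 Hphi0] : forall w, exists y, forall s, i s = w -> y = phi s.
  move=> w; have [/imsetP[s0 _ ->]|wP] := boolP (w \in P); first by exists (phi s0) => s1 /iI->.
  have /card_gt0P[y _] : 0 < #|[set y in Y | set0 \subset enb G y]|.
    by apply: leq_trans (rG set0 _); rewrite ?cards0 //; apply/card_gt0P; exists w.
  by exists y => s1 E; rewrite -E imset_f // in wP.
have [||||f [fI fP fY fG]] := @embed_one W V ET P s D us ms bs phi0 G Y setT.
- by move=> _ _ /imsetP[x _ ->] /imsetP[y _ ->]; rewrite !(Hphi0 _ _ erefl) => /phiI->.
- exact: subsetT.
- by [].
- by move=> X _ XD; apply: rG.
exists f; split=> // [x|w /fY|]; [by rewrite fP ?imset_f // (Hphi0 _ _ erefl)|by rewrite in_setC|].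
apply/subsetP => _ /imsetP[e eE ->]; have [x [y [xy De _ _ yx]]] := edgeP ETW eE.
have := noE e eE; rewrite De subUset !sub1set imset_set2 negb_and => /orP[xP|yP].
  by have := fG y x yx xP; rewrite in_enb => /andP[].
by have := fG x y; rewrite enb_sym => /(_ yx yP); rewrite in_enb setUC => /andP[].
Qed.

Lemma place_free (W V : finType) (ET : {set {set W}}) (G : {set {set V}}) (Fb : {set V}) :
  within setT ET -> rooted ET set0 D -> rich G #|W| Fb ->
  exists f : W -> V, [/\ injective f, forall w, f w \notin Fb & imE f ET \subset G].
Proof.
move=> ETW rt rG; pose i := of_void W; pose phi := of_void V.
have i0 : i @: setT = set0 by apply/setP => x; rewrite inE; apply/imsetP => -[[]].
have p0 : phi @: setT = set0 by apply/setP => x; rewrite inE; apply/imsetP => -[[]].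
have [|||||f [fI _ fN fG]] := @place void W V i ET G phi Fb _ _ ETW.
- by case.
- by case.
- move=> e eE; have [ce _] := ETW e eE; rewrite i0 subset0.
  by apply/eqP => e0; rewrite e0 cards0 in ce.
- by rewrite i0.
- by rewrite p0 setU0.
by exists f; split=> // w; have := fN w; rewrite i0 p0 setU0 inE; apply.
Qed.
End Place.

Lemma dec_within_sub (V : finType) (Y : {set V}) (A B : {set {set V}}) :
  within Y A -> (forall e, e \in B -> ~~ (e \subset Y)) -> [disjoint A & B].
Proof.
move=> AY BN; rewrite -setI_eq0; apply/eqP/setP => e; rewrite in_setI in_set0; apply/negP => /andP[eA /BN].
by have [_ ->] := AY e eA.
Qed.

Section Absorb.
Variables (VF : finType) (EF : {set {set VF}}) (r D : nat).
Hypothesis EFgr : within setT EF.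
Hypothesis EFreg : forall w, #|enb EF w| = r.
Hypothesis r_gt0 : 0 < r.
Hypothesis rD : r <= D.
Local Notation rich := (rich D).
Local Notation dec := (dec EF).
Local Notation rooted E P := (rooted E P D).

(* The position phi of H is prescribed in absorbable, while psi is chosen in fabs. *)
Definition absorbable (S : finType) (H : {set {set S}}) := exists M : nat,
  forall (V : finType) (G : {set {set V}}) (phi : S -> V) (Fb : {set V}), injective phi -> rich G M Fb ->
  exists (A : {set {set V}}) (N : {set V}),
    [/\ A \subset G, [disjoint N & Fb :|: phi @: setT], #|N| <= M, within (phi @: setT :|: N) A &
      forall e, e \in A -> ~~ (e \subset phi @: setT)] /\ (dec A /\ dec (A :|: imE phi H)).

Definition fabs (S : finType) (H : {set {set S}}) := exists M : nat,
  forall (V : finType) (G : {set {set V}}) (Fb : {set V}), rich G M Fb ->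
  exists (psi : S -> V) (A : {set {set V}}) (N : {set V}),
    [/\ injective psi, psi @: setT \subset N, [disjoint N & Fb], #|N| <= M & within N A] /\
    [/\ A \subset G, imE psi H \subset G, [disjoint A & imE psi H], dec A & dec (A :|: imE psi H)].

Lemma imset_setT_card (S V : finType) (phi : S -> V) : #|phi @: setT| <= #|S|.
Proof. by apply: leq_trans (leq_imset_card _ _) _; rewrite cardsT. Qed.

Lemma imE_withinT (S V : finType) (phi : S -> V) H : injective phi -> within setT H -> within (phi @: setT) (imE phi H).
Proof. exact: imE_within. Qed.

Lemma abs_fabs (S : finType) (H : {set {set S}}) : absorbable H -> within setT H -> rooted H set0 -> fabs H.
Proof.
case=> M absH HS rt; exists (M + #|S| + #|S|) => V G Fb rG.
have rG1 : rich G #|S| Fb by apply: (rich_sub (m := 0) (N := set0) rG); rewrite ?setU0 ?cards0 //; lia.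
have [psi [psiI psiF psiG]] := place_free HS rt rG1.
have [|A [N [[AG dN cN AN nA] [dA dAH]]]] := absH V G psi Fb psiI.
  by apply: (rich_sub (m := 0) (N := set0) rG); rewrite ?setU0 ?cards0 //; lia.
exists psi, A, (psi @: setT :|: N); split; split=> //; first exact: subsetUl.
- rewrite -setI_eq0 setIUl setU_eq0 !setI_eq0; apply/andP; split.
    by rewrite disjoints_subset; apply/subsetP => _ /imsetP[x _ ->]; rewrite in_setC.
  exact: disjointWr (subsetUl _ _) dN.
- apply: leq_trans (leq_card_setU _ _) _; have := imset_setT_card psi; lia.
- by rewrite disjoint_sym; apply: dec_within_sub (imE_withinT psiI HS) nA.
Qed.

Lemma abs_sub (S S' : finType) (j : S' -> S) (H : {set {set S'}}) : injective j -> absorbable H -> absorbable (imE j H).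
Proof.
move=> jI [M absH]; exists (M + #|S|) => V G phi Fb phiI rG.
have pjI : injective (phi \o j) by apply: inj_comp.
have [|A [N [[AG dN cN AN nA] dA]]] := absH V G (phi \o j) (Fb :|: phi @: setT) pjI.
  by apply: (rich_sub (m := #|S|) (N := phi @: setT) rG); rewrite ?imset_setT_card.
have sub : (phi \o j) @: setT \subset phi @: setT by rewrite imset_comp imsetS // subsetT.
exists A, N; split; last by rewrite -imE_comp.
split=> //.
- exact: disjointWr (subsetUl _ _) dN.
- exact: leq_trans cN (leq_addr _ _).
- by apply: withinS AN; apply: setSU.
move=> e eA; have [_ eN] := AN e eA; have := nA e eA; apply: contra => ephi.
apply/subsetP => x xe; have := subsetP eN x xe; rewrite in_setU => /orP[//|xN].
have := disjoint_setI0 dN; move/setP/(_ x); rewrite in_setI xN !in_setU (subsetP ephi _ xe) orbT inE //.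
Qed.

Lemma fabs_sub (S S' : finType) (j : S' -> S) (H : {set {set S'}}) : injective j -> fabs (imE j H) -> fabs H.
Proof.
move=> jI [M absH]; exists M => V G Fb rG; have [psi [A [N [[psiI psiN dN cN AN]]]]] := absH V G Fb rG.
rewrite -imE_comp => dA; exists (psi \o j), A, N; split=> //; split=> //; first exact: inj_comp.
by apply: subset_trans psiN; rewrite imset_comp imsetS // subsetT.
Qed.

(** Let A absorb a copy of Y in G and let T join X to that copy. Then T + Y + A absorbs X: alone it
    splits as (T + Y) + A, together with X as (T + X) + (Y + A). *)
Lemma abs_transformer (S S' W : finType) (X : {set {set S}}) (Y : {set {set S'}}) (T : {set {set W}}) (i : S -> W) (i' : S' -> W) :
  injective i -> injective i' -> (forall u v, i u != i' v) -> within setT X -> within setT Y ->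
  within setT T -> (forall e, e \in T -> ~~ (e \subset i @: setT :|: i' @: setT)) ->
  dec (T :|: imE i X) -> dec (T :|: imE i' Y) -> rooted T (i @: setT :|: i' @: setT) -> fabs Y -> absorbable X.
Proof.
move=> iI i'I ii' XS YS TW noT dX dY rt [M absY]; exists (M + #|S| + M + #|W| + #|S|) => V G phi Fb phiI rG.
have [|psi [A [N [[psiI psiN dN cN AN] [AG YG dAY dA dAY']]]]] := absY V G (Fb :|: phi @: setT).
  by apply: (rich_sub (m := #|S|) (N := phi @: setT) rG); rewrite ?imset_setT_card //; lia.
pose ii (s : S + S') := match s with inl x => i x | inr y => i' y end.
pose pp (s : S + S') := match s with inl x => phi x | inr y => psi y end.
have im (Z : finType) (f : S -> Z) (g : S' -> Z) : (fun s : S + S' => match s with inl x => f x | inr y => g y end) @: setT = f @: setT :|: g @: setT.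
  apply/setP => z; rewrite in_setU; apply/imsetP/orP => [[[x|y] _ ->]|[] /imsetP[x _ ->]].
  - by left; rewrite imset_f.
  - by right; rewrite imset_f.
  - by exists (inl x).
  - by exists (inr x).
have NP : [disjoint N & phi @: setT] by apply: disjointWr (subsetUr _ _) dN.
have pN x : phi x \notin N.
  by apply/negP => H; have := disjoint_setI0 NP; move/setP/(_ (phi x)); rewrite in_setI H imset_f // inE.
have psN y : psi y \in N by apply: (subsetP psiN); rewrite imset_f.
have iiI : injective ii.
  move=> [x|x] [y|y] /=; [by move/iI->| | |by move/i'I->].
    by move/eqP; rewrite (negPf (ii' x y)).
  by move/esym/eqP; rewrite (negPf (ii' y x)).
have ppI : injective pp.
  move=> [x|x] [y|y] /=; [by move/phiI->| | |by move/psiI->].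
    by move=> E; have := pN x; rewrite E psN.
  by move=> E; have := pN y; rewrite -E psN.
have [|||f [fI fr fN fG]] := @place D (S + S')%type W V ii T G pp (Fb :|: N) iiI ppI TW.
- by rewrite im.
- by rewrite im.
- apply: (rich_sub (m := M + #|S|) (N := N :|: phi @: setT) rG).
  + rewrite im; apply/subsetP => x; rewrite !in_setU => /orP[/orP[->|->]|/orP[->|xp]]; rewrite ?orbT //.
    by rewrite (subsetP psiN x xp) ?orbT.
  + by apply: leq_trans (leq_card_setU _ _) _; apply: leq_add => //; apply: imset_setT_card.
  + lia.
rewrite !im in fN; pose Rt := i @: setT :|: i' @: setT; rewrite -/Rt in fN.
have fi s : f (i s) = phi s by apply: (fr (inl s)).
have fi' s : f (i' s) = psi s by apply: (fr (inr s)).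
pose N2 := f @: ~: Rt.
have fX : imE phi X = imE f (imE i X) by rewrite -imE_comp; apply: (@imE_eq _ _ _ _ setT) => [e _|x _]; rewrite ?subsetT //= fi.
have fY : imE psi Y = imE f (imE i' Y) by rewrite -imE_comp; apply: (@imE_eq _ _ _ _ setT) => [e _|x _]; rewrite ?subsetT //= fi'.
have noTf e : e \in imE f T -> exists x, [/\ x \in e, x \notin Fb, x \notin N & x \notin phi @: setT].
  case/imsetP=> e' e'T ->; have /subsetPn[w we wR] := noT e' e'T; exists (f w); split; first exact: imset_f.
  - by have := fN w wR; rewrite !in_setU !negb_or -andbA => /and3P[].
  - by have := fN w wR; rewrite !in_setU !negb_or -andbA => /and3P[].
  - by have := fN w wR; rewrite !in_setU !negb_or => /and3P[].
have TfN (B : {set {set V}}) : within N B -> [disjoint imE f T & B].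
  move=> BN; rewrite disjoint_sym; apply: dec_within_sub BN _ => e /noTf[x [xe _ xN _]].
  by apply: contra xN => /subsetP; apply.
have YN : within N (imE psi Y) by apply: withinS psiN _; apply: imE_withinT.
exists (imE f T :|: (imE psi Y :|: A)), (N2 :|: N); split; [split|split].
- by rewrite !subUset fG YG AG.
- rewrite -setI_eq0 setIUl setU_eq0 !setI_eq0 dN andbT disjoints_subset; apply/subsetP => _ /imsetP[w wR ->].
  by have := fN w; rewrite -in_setC => /(_ wR); rewrite in_setC !in_setU !negb_or -!andbA => /and3P[-> _ /andP[-> _]].
- apply: leq_trans (leq_card_setU _ _) _; have := leq_imset_card f (mem (~: Rt)); have := max_card (mem (~: Rt)).
  by rewrite -/N2; lia.
- apply: withinU; last first.
    by apply: withinU; [apply: withinS YN|apply: withinS AN]; rewrite !setUA subsetUr.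
  move=> e /imsetP[e' e'T ->]; have [ce _] := TW e' e'T; rewrite card_imset //; split=> //.
  apply/subsetP => _ /imsetP[w we ->]; rewrite !in_setU; have [|wR] := boolP (w \in Rt); last first.
    by rewrite (imset_f f) ?orbT // in_setC.
  rewrite in_setU => /orP[]/imsetP[x _ ->]; rewrite ?fi ?fi' ?psN ?orbT //; by rewrite imset_f.
- move=> e; rewrite !in_setU => /or3P[/noTf[x [xe _ _ xp]]|eY|eA]; first by apply: contra xp => /subsetP; apply.
    have [ce eN] := YN e eY; apply/negP => ep; have := disjoint_setI0 NP => /setP H.
    by have /card_gt0P[x xe] : 0 < #|e| by [rewrite ce]; have := H x; rewrite in_setI (subsetP eN) // (subsetP ep) // inE.
  have [ce eN] := AN e eA; apply/negP => ep; have := disjoint_setI0 NP => /setP H.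
  by have /card_gt0P[x xe] : 0 < #|e| by [rewrite ce]; have := H x; rewrite in_setI (subsetP eN) // (subsetP ep) // inE.
- rewrite setUA; apply: decU => //; last by rewrite fY -imEU; apply: dec_imE.
  rewrite -setI_eq0 setIUl setU_eq0 !setI_eq0 (TfN _ AN) //= disjoint_sym //.
rewrite setUAC; apply: decU; [|by rewrite fX -imEU; apply: dec_imE|by rewrite setUC].
rewrite -setI_eq0 setIUl setU_eq0 !setI_eq0 TfN /=; last exact: withinU.
rewrite disjoint_sym; apply: dec_within_sub (withinU YN AN) _ => e eX; have [ce eP] := imE_withinT phiI XS eX.
apply/negP => eN; have := disjoint_setI0 NP => /setP H.
by have /card_gt0P[x xe] : 0 < #|e| by [rewrite ce]; have := H x; rewrite in_setI (subsetP eN) // (subsetP eP) // inE.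
Qed.

(** If A absorbs B, then B + A absorbs H: it is decomposable itself, and together with H it splits
    as (B + H) + A. *)
Lemma abs_gadget (S W : finType) (H : {set {set S}}) (B : {set {set W}}) (i : S -> W) :
  injective i -> within setT H -> within setT B -> (forall e, e \in B -> ~~ (e \subset i @: setT)) ->
  rooted B (i @: setT) -> dec (B :|: imE i H) -> absorbable B -> absorbable H.
Proof.
move=> iI HS BW noB rt dBH [M absB]; exists (M + #|W| + #|S|) => V G phi Fb phiI rG.
have [|f [fI fi fN fG]] := place iI phiI BW noB rt (V := V) (G := G) (Fb := Fb).
  by apply: (rich_sub (m := #|S|) (N := phi @: setT) rG); rewrite ?imset_setT_card //; lia.
have [|A [N [[AG dN cN AN nA] [dA dAB]]]] := absB V G f Fb fI.
  by apply: (rich_sub (m := 0) (N := set0) rG); rewrite ?setU0 ?cards0 //; lia.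
pose P := i @: setT; have fP : f @: P = phi @: setT by rewrite -imset_comp; apply: eq_imset => s /=.
have fW : f @: setT = phi @: setT :|: f @: (~: P) by rewrite -fP -imsetU setUCr.
have dNf : [disjoint N & f @: setT] := disjointWr (subsetUr _ _) dN.
have BfN : [disjoint imE f B & A] by apply: dec_within_sub (imE_withinT fI BW) nA.
exists (imE f B :|: A), (f @: (~: P) :|: N); split; [split|split].
- by rewrite subUset fG AG.
- rewrite -setI_eq0 setIUl setU_eq0 !setI_eq0; apply/andP; split.
    by rewrite disjoints_subset; apply/subsetP => _ /imsetP[w wP ->]; rewrite in_setC; apply: fN; rewrite -in_setC.
  by apply: disjointWr dN; apply: setUS; rewrite fW subsetUl.
- have c1 : #|f @: (~: P)| <= #|W| := leq_trans (leq_imset_card f _) (max_card _).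
  by apply: leq_trans (leq_card_setU _ _) _; lia.
- apply: withinU; first by apply: withinS (imE_withinT fI BW); rewrite fW setUA subsetUl.
  by apply: withinS AN; rewrite fW setUA.
- move=> e; rewrite in_setU => /orP[/imsetP[e' e'B ->]|eA].
    have /subsetPn[w we wP] := noB e' e'B; apply/subsetPn; exists (f w); first exact: imset_f.
    by have := fN w wP; rewrite in_setU negb_or => /andP[].
  by apply: contra (nA e eA) => /subset_trans; apply; rewrite fW subsetUl.
- by rewrite setUC.
have -> : imE phi H = imE f (imE i H).
  by rewrite -imE_comp; apply: (@imE_eq _ _ _ _ setT) => [e _|x _]; rewrite ?subsetT //= fi.
rewrite setUAC -imEU; apply: decU => //; last exact: dec_imE.
rewrite imEU -setI_eq0 setIUl setU_eq0 !setI_eq0 BfN /=; apply: dec_within_sub nA.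
by apply: imE_withinT fI _; apply: withinS (subsetT _) (imE_withinT iI HS).
Qed.

(* Both graphs are quotients of the same r-regular graph. Isolated vertices have no preimage and are removed first. *)
Section Link.
Variables (F : sgraph VF) (d : nat).
Hypothesis DEF : edges F = EF.
Hypothesis adm : dF_admissible r F d.
Hypothesis dD : d <= D.
Hypothesis EF0 : EF != set0.

Lemma support (S : finType) (X : {set {set S}}) : within setT X -> exists (S' : finType) (j : S' -> S) (X' : {set {set S'}}),
  [/\ injective j, within setT X', X = imE j X', forall x, 0 < #|enb X' x| & forall x, #|enb X (j x)| = #|enb X' x|] /\
  forall x, 0 < #|enb X x| -> exists x', j x' = x.
Proof.
move=> XS; pose S' := {x | 0 < #|enb X x|}; pose j : S' -> S := val; have jI : injective j by apply: val_inj.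
pose X' := [set e : {set S'} | j @: e \in X].
have DX : X = imE j X'.
  apply/setP => e; apply/idP/imsetP => [eX|[e' + ->]]; last by rewrite inE.
  have [x [y [xy De _ _ yx]]] := edgeP XS eX.
  have xp : 0 < #|enb X x| by apply/card_gt0P; exists y.
  have yp : 0 < #|enb X y| by apply/card_gt0P; exists x; rewrite enb_sym.
  by exists [set Sub x xp; Sub y yp : S']; rewrite ?inE imset_set2 /j ?SubK -?De.
have cX' x : #|enb X (j x)| = #|enb X' x| by rewrite {1}DX enb_imE // card_imset.
exists S', j, X'; split; last by move=> x xp; exists (Sub x xp); rewrite /j SubK.
split=> // [e|x]; last by rewrite -cX'; exact: (valP x).
by rewrite inE => /XS[ce _]; rewrite -ce card_imset // subsetT.
Qed.

Lemma link (S S' : finType) (X : {set {set S}}) (Y : {set {set S'}}) (q : S -> S') :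
  within setT X -> within setT Y -> imE q X = Y -> (forall x, r %| #|enb X x|) ->
  (forall x y x' y', y \in enb X x -> y' \in enb X x' -> q x = q x' -> q y = q y' -> x = x' /\ y = y') ->
  (fabs Y -> absorbable X) /\ (fabs X -> absorbable Y).
Proof.
move=> XS YS qX divX qI.
have [S1 [j [X' [[jI X'S DX posX' cX'] _]]]] := support XS.
have [S2 [k [Y' [[kI Y'S DY posY' cY'] supY]]]] := support YS.
have qloop x y : y \in enb X x -> q x != q y.
  rewrite in_enb => /andP[_ /(imset_f (fun e : {set S} => q @: e))]; rewrite -/(imE q X) qX imset_set2 => /YS[].
  by rewrite cards2; case: eqP.
have qE x y : y \in enb X x -> q y \in enb Y (q x).
  move=> yx; rewrite in_enb eq_sym qloop // -qX mem_imE //; by move: yx; rewrite in_enb => /andP[].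
have /fin_all_exists[q' Hq'] x : exists y, k y = q (j x).
  apply: supY; have /card_gt0P[y yx] := posX' x; apply/card_gt0P; exists (q (j y)).
  by apply: qE; rewrite DX enb_imE // imset_f.
have divX' x : r %| #|enb X' x| by rewrite -cX'.
have [S0 [H0 [p [reg [psur pH pinj]]]]] := splitting divX' posX' r_gt0.
have inX' x y : y \in enb X' x -> j y \in enb X (j x) by move=> yx; rewrite DX enb_imE // imset_f.
have quot : edge_quot H0 (sg Y') (q' \o p).
  have Y'P w w' : w' \in enb Y' w <-> exists x y, [/\ q' x = w, q' y = w' & y \in enb X' x].
    have kY : (w' \in enb Y' w) = (k w' \in enb Y (k w)) by rewrite DY enb_imE // mem_imset.
    rewrite kY; split=> [|[x [y [<- <- yx]]]]; last by rewrite !Hq'; apply/qE/inX'.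
    rewrite -qX => /(enb_imE_sub XS)[x [y [_ _ Ex Ey]]]; rewrite {1}DX => /(enb_imE_sub X'S)[x' [y' [_ _ Ex' Ey' yx]]].
    by exists x', y'; split=> //; apply: kI; rewrite Hq' -?Ex' -?Ey'.
  split=> [w|w w'|u v u' v' uv uv' /= Eu Ev].
  - have /card_gt0P[w' /Y'P[x [y [<- _ _]]]] := posY' w; have [u <-] := psur x; by exists u.
  - rewrite /= Y'P; split=> [[x [y [<- <- /pH[u [v [<- <- uv]]]]]]|[u [v [<- <- uv]]]]; first by exists u, v.
    by exists (p u), (p v); split=> //; apply/pH; exists u, v.
  have puv : p v \in enb X' (p u) by apply/pH; exists u, v.
  have puv' : p v' \in enb X' (p u') by apply/pH; exists u', v'.
  have [||E1 E2] := qI _ _ _ _ (inX' _ _ puv) (inX' _ _ puv'); rewrite -?Hq' ?Eu ?Ev //.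
  by apply: pinj => //; apply: jI.
have F0 : edges F != set0 by rewrite DEF.
(* X and Y are each linked to the regular graph [H0] by a transformer. Passing from one to the other
   requires a free copy of [H0] in the host, which exists since its degrees are r <= D. *)
have key (Z : finType) (X1 : {set {set Z}}) (p1 : S0 -> Z) : within setT X1 -> edge_quot H0 (sg X1) p1 ->
    (fabs X1 -> absorbable (edges H0)) /\ (fabs (edges H0) -> absorbable X1).
  move=> X1S q1; have [W [T [i [i' [iI i'I ii' [TW noT] []]]]]] := transformer adm F0 X1S reg q1.
  rewrite DEF => d1 d2 /(rooted_le dD) rt; split.
    exact: (abs_transformer iI i'I ii' (@edges_within _ _) X1S TW noT d1 d2 rt).
  apply: (abs_transformer i'I iI _ X1S (@edges_within _ _) TW _ d2 d1); rewrite 1?setUC //.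
  by move=> u v; rewrite eq_sym.
have H0f : absorbable (edges H0) -> fabs (edges H0).
  move=> aH; apply: abs_fabs aH (@edges_within _ _) _; apply: rooted_deg => w _.
  by rewrite enb_edges; apply: leq_trans rD; rewrite -(reg w).
have [kX1 kX2] := key _ _ _ X'S (And3 psur pH pinj); have [kY1 kY2] := key _ _ _ Y'S quot.
split; [rewrite DX DY|rewrite DX DY] => /fabs_sub fZ.
  by apply: abs_sub => //; apply/kX2/H0f/kY1/fZ.
by apply: abs_sub => //; apply/kY2/H0f/kX1/fZ.
Qed.
End Link.
End Absorb.

(** * Gadgets *)

Lemma imE_bigcup (I : finType) (V W : finType) (f : V -> W) (A : I -> {set {set V}}) :
  imE f (\bigcup_i A i) = \bigcup_i imE f (A i).
Proof. by apply: (big_morph (imE f)) => [B C|]; [exact: imEU|exact: imset0]. Qed.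

(** List the independent set Q first: its vertices have no earlier neighbours. *)
Lemma rooted_indep (W : finType) (ET : {set {set W}}) (Q : {set W}) (D : nat) :
  within setT ET -> (forall e, e \in ET -> ~~ (e \subset Q)) -> (forall w, w \notin Q -> #|enb ET w| <= D) ->
  rooted ET set0 D.
Proof.
move=> ETW noQ degQ; exists (enum Q ++ enum (~: Q)); split.
- by rewrite cat_uniq !enum_uniq andbT; apply/hasPn => x /=; rewrite !mem_enum inE.
- by move=> x; rewrite mem_cat !mem_enum !inE orbN.
move=> s1 w s2 Es; have [wQ|wQ] := boolP (w \in Q); last first.
  by apply: leq_trans (subset_leq_card (subsetIl _ _)) (degQ _ _).
rewrite (_ : _ :&: _ = set0) ?cards0 //; apply/setP => x; rewrite in_setI set0U [x \in [set _ in _]]in_set in_set0; apply/negP => /andP[xw xs1].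
have sub : [set y in s1] \subset Q.
  have us : uniq (enum Q ++ enum (~: Q)) by rewrite cat_uniq !enum_uniq andbT; apply/hasPn => y /=; rewrite !mem_enum inE.
  have [sQ|Qs] := leqP (size (enum Q)) (size s1).
    have : w \in drop (size (enum Q)) (enum Q ++ enum (~: Q)).
      rewrite Es drop_cat; case: ifP => _; first by rewrite mem_cat mem_head orbT.
      by rewrite (_ : _ - _ = 0) ?drop0 ?mem_head //; apply/eqP; rewrite subn_eq0.
    by rewrite drop_size_cat // mem_enum in_setC wQ.
  have E : take (size s1) (enum Q ++ enum (~: Q)) = s1 by rewrite Es take_size_cat.
  move: E; rewrite take_cat Qs => E; rewrite -E.
  by apply/subsetP => y; rewrite in_set => /mem_take; rewrite mem_enum.
have := noQ [set w; x]; rewrite subUset !sub1set wQ (subsetP sub) ?inE //.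
by move: xw; rewrite in_enb => /andP[_ ->] /(_ isT).
Qed.

Section Gadget.
Variables (VF : finType) (EF : {set {set VF}}) (r : nat) (u v : VF).
Hypothesis EFgr : within setT EF.
Hypothesis EFreg : forall w, #|enb EF w| = r.
Hypothesis uv : v \in enb EF u.
Local Notation E0 := (E0 EF u v).
Let vu : v == u = false. Proof. by apply: contraTF uv => /eqP->; rewrite enbxx. Qed.
Let E0w : within setT E0. Proof. by apply: within_sub (subD1set _ _) EFgr. Qed.

Definition gmap (W : Type) (p q : W) (nw : VF -> W) (w : VF) : W := if w == u then p else if w == v then q else nw w.

Section OneGadget.
Variables (S I : finType) (a b : I -> S).
Hypothesis ab : forall i, a i != b i.
Hypothesis ab_inj : injective (fun i => [set a i; b i]).
(* Every edge [a i; b i] gets its own copy of F minus the edge uv, with u at a i and v at b i: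
   GA is the union of these copies, and GX the graph formed by the edges. *)
Definition GW : finType := (S + I * VF)%type.
Definition gm i : VF -> GW := gmap (inl (a i)) (inl (b i)) (fun w => inr (i, w)).
Definition GA : {set {set GW}} := \bigcup_i imE (gm i) E0.
Definition GX := [set [set a i; b i] | i : I].
Local Notation iS := (inl : S -> GW).

Lemma gm_inj i : injective (gm i).
Proof.
move=> s w; rewrite /gm /gmap; have [->|su] := eqVneq s u; [|have [->|sv] := eqVneq s v];
  (have [->|wu] := eqVneq w u; [|have [->|wv] := eqVneq w v]) => //; try by case.
- by case=> E; move: (ab i); rewrite E eqxx.
- by case=> E; move: (ab i); rewrite E eqxx.
Qed.

Lemma gm_uv i : imE (gm i) EF = [set inl (a i); inl (b i)] |: imE (gm i) E0.
Proof.
have uvE : [set u; v] \in EF by move: uv; rewrite in_enb => /andP[].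
by rewrite -{1}(setD1K uvE) imEU /imE imset_set1 imset_set2 /gm /gmap !eqxx vu.
Qed.

Lemma gm_new i e : e \in imE (gm i) E0 -> exists w, inr (i, w) \in e.
Proof.
case/(imEP E0w) => s [w [nsw sw ->]]; have [_ H1 _] := E0P sw nsw.
have [suv|] := boolP ((s == u) || (s == v)).
  by have [wu wv] := H1 suv; exists w; rewrite {2}/gm /gmap (negPf wu) (negPf wv) set22.
by rewrite negb_or => /andP[su sv]; exists s; rewrite {1}/gm /gmap (negPf su) (negPf sv) set21.
Qed.

Lemma gm_codom i i' e w : e \in imE (gm i) EF -> inr (i', w) \in e -> i' = i.
Proof.
case/imsetP=> e' _ -> /imsetP[s _]; rewrite /gm /gmap; case: ifP => // _; case: ifP => // _ []//.
Qed.

Lemma gm_dis i i' e : e \in imE (gm i) EF -> e \in imE (gm i') EF -> i = i'.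
Proof.
move=> ei ei'; move: (ei); rewrite gm_uv in_setU1 => /orP[/eqP De|/gm_new[w]]; last exact: gm_codom ei'.
move: (ei'); rewrite gm_uv in_setU1 => /orP[/eqP De'|/gm_new[w]]; last by move/(gm_codom ei).
apply: ab_inj; move: De'; rewrite De => /set2_eq[][[-> []-> //]]; exact: setUC.
Qed.

Lemma GX_within : within setT GX.
Proof. by move=> _ /imsetP[i _ ->]; rewrite cards2 ab subsetT. Qed.

Lemma GA_X : GA :|: imE iS GX = \bigcup_i imE (gm i) EF.
Proof.
apply/setP => e; rewrite in_setU; apply/orP/bigcupP => [[/bigcupP[i _ ei]|]|[i _]].
- by exists i => //; rewrite gm_uv in_setU1 ei orbT.
- by case/imsetP=> _ /imsetP[i _ ->] ->; exists i => //; rewrite gm_uv in_setU1 imset_set2 eqxx.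
rewrite gm_uv in_setU1 => /orP[/eqP->|ei]; [right|by left; apply/bigcupP; exists i].
by apply/imsetP; exists [set a i; b i]; rewrite ?imset_set2 //; apply/imsetP; exists i.
Qed.

Lemma GA_dec : dec EF (GA :|: imE iS GX).
Proof.
rewrite GA_X; apply: dec_bigcup => [|i _|i j _ _ ij]; [exact: index_enum_uniq|exact: dec_copy (gm_inj (i := i))|].
rewrite -setI_eq0; apply/eqP/setP => e; rewrite in_setI in_set0; apply/negP => /andP[ei ej].
by rewrite (gm_dis ei ej) eqxx in ij.
Qed.

Lemma GA_within : within setT GA.
Proof. by apply: within_sub (dec_within EFgr GA_dec); apply: subsetUl. Qed.

Lemma GA_new e : e \in GA -> exists k, inr k \in e.
Proof. by case/bigcupP=> i _ /gm_new[w]; exists (i, w). Qed.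

Lemma GA_out e : e \in GA -> ~~ (e \subset iS @: setT).
Proof. by case/GA_new => k ke; apply/subsetPn; exists (inr k) => //; apply/imsetP => -[]. Qed.

Lemma GA_nb i w y : y \in enb GA (inr (i, w)) -> y \in gm i @: enb EF w.
Proof.
rewrite enb_bigcup => /bigcupP[i' _ /(enb_imE_sub E0w)[s [t [_ _ E -> ts]]]].
move: E; rewrite {1}/gm /gmap; case: ifP => // _; case: ifP => // _ [<- Ew]; subst s.
by apply: imset_f; apply: (subsetP (enbS _ (subD1set _ _))) ts.
Qed.

Lemma GA_deg k : #|enb GA (inr k)| <= r.
Proof.
case: k => i w; rewrite -(EFreg w); apply: leq_trans (leq_imset_card (gm i) _).
by apply/subset_leq_card/subsetP => y; apply: GA_nb.
Qed.

Lemma GA_rooted : rooted GA (iS @: setT) r.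
Proof. by apply: rooted_deg => -[s|k] // ns; [rewrite imset_f in ns|exact: GA_deg]. Qed.

Lemma GA_div : (forall x, r %| #|enb GX x|) -> forall w, r %| #|enb GA w|.
Proof.
move=> divX w; have := dec_deg w EFreg GA_dec; rewrite enbU cardsU.
have -> : enb GA w :&: enb (imE iS GX) w = set0.
  rewrite -enbI disjoint_setI0 ?enb0 //; rewrite disjoint_sym.
  by apply: dec_within_sub GA_out; apply: imE_within GX_within => x y [].
rewrite cards0 subn0 addnC dvdn_addr //; case: w => [x|k].
  by rewrite enb_imE ?card_imset => [//|x1 x2 []|x1 x2 []].
by rewrite enb_imE_out ?cards0 //; apply/codomP => -[].
Qed.

Lemma GA_end i w s : inl s \in enb GA (inr (i, w)) -> s = a i \/ s = b i.
Proof.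
by case/GA_nb/imsetP => t _; rewrite /gm /gmap; case: ifP => _; [case; left|case: ifP => // _ []; right].
Qed.

Variables al be : 'I_#|E0| -> VF.
Hypothesis albe : forall e, al e != be e.
Hypothesis albe_inj : injective (fun e => [set al e; be e]).
Hypothesis DE0 : E0 = [set [set al e; be e] | e : 'I_#|E0|].
Definition a1 (k : I * 'I_#|E0|) : GW := gm k.1 (al k.2).
Definition b1 (k : I * 'I_#|E0|) : GW := gm k.1 (be k.2).

Lemma albeE e : [set al e; be e] \in E0.
Proof.
have : [set al e; be e] \in [set [set al e; be e] | e : 'I_#|E0|] by apply/imsetP; exists e.
by rewrite -DE0.
Qed.

Lemma albeP e0 : e0 \in E0 -> exists e, e0 = [set al e; be e].
Proof.
move=> e0E; have : e0 \in [set [set al e; be e] | e : 'I_#|E0|] by rewrite -DE0.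
by case/imsetP=> e _ ->; exists e.
Qed.

Lemma ab1 k : a1 k != b1 k.
Proof. by rewrite (inj_eq (gm_inj (i := k.1))). Qed.

Lemma ab1_inj : injective (fun k => [set a1 k; b1 k]).
Proof.
have set1 k : [set a1 k; b1 k] = gm k.1 @: [set al k.2; be k.2] by rewrite imset_set2.
have memE k : [set a1 k; b1 k] \in imE (gm k.1) EF.
  by rewrite set1; apply: imset_f; apply: (subsetP (subD1set _ _)); apply: albeE.
move=> [i e] [i' e'] E; have ii : i = i' by apply: gm_dis (memE (i, e)) _; rewrite E; apply: (memE (i', e')).
by move: E; rewrite !set1 /= -ii => /(imset_inj (gm_inj (i := i)))/albe_inj->.
Qed.

Lemma GX1 : [set [set a1 k; b1 k] | k : I * 'I_#|E0|] = GA.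
Proof.
apply/setP => e; apply/imsetP/bigcupP => [[[i e'] _ ->]|[i _ /imsetP[e0]]].
  by exists i => //; rewrite /a1 /b1 /= -imset_set2; apply: imset_f; apply: albeE.
by case/albeP=> e' -> ->; exists (i, e') => //; rewrite imset_set2.
Qed.
End OneGadget.
End Gadget.

Section Chain.
Variables (VF : finType) (F : sgraph VF) (r d D : nat).
Local Notation EF := (edges F).
Hypothesis EFreg : forall w, #|enb EF w| = r.
Hypothesis r_gt0 : 0 < r.
Hypothesis adm : dF_admissible r F d.
Hypothesis dD : d <= D.
Hypothesis rD : r <= D.
Variables (u v : VF).
Hypothesis uv : v \in enb EF u.
Let EFgr : within setT EF := @edges_within _ F.
Local Notation E0 := (E0 EF u v).
Variables al be : 'I_#|E0| -> VF.
Hypothesis albe : forall e, al e != be e.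
Hypothesis albe_inj : injective (fun e => [set al e; be e]).
Hypothesis DE0 : E0 = [set [set al e; be e] | e : 'I_#|E0|].

Section Canonical.
Variables I : finType.
Local Notation I1 := ((I * 'I_#|E0|)%type : finType).
(* The gadgets put on the edges of the gadgets of I independent edges, with all the ends of those edges
   identified with None: up to this identification A2 below depends on the number of edges only. *)
Definition KT : finType := option (I * VF + I1 * VF).
Definition kap (i : I) : VF -> KT := gmap u v None None (fun x => Some (inl (i, x))).
Definition Kan : {set {set KT}} :=
  \bigcup_(k : I1) imE (gmap u v (kap k.1 (al k.2)) (kap k.1 (be k.2)) (fun w => Some (inr (k, w)))) E0.

Variables (S : finType) (a b : I -> S).
Hypothesis ab : forall i, a i != b i.
Hypothesis ab_inj : injective (fun i => [set a i; b i]).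
Local Notation W1 := (GW VF S I).
Local Notation A1 := (GA EF u v a b).
Local Notation aa := (a1 a b al).
Local Notation bb := (b1 a b be).
Local Notation W2 := (GW VF W1 I1).
Local Notation A2 := (GA EF u v aa bb).
Let aab k : aa k != bb k := ab1 ab albe k.
Let aabI : injective (fun k => [set aa k; bb k]) := ab1_inj EFgr uv ab ab_inj albe_inj DE0.
Let A1X : GX aa bb = A1 := GX1 a b DE0.

Definition coll (x : W2) : KT :=
  match x with inl (inl _) => None | inl (inr y) => Some (inl y) | inr y => Some (inr y) end.

Lemma coll_A2 : imE coll A2 = Kan.
Proof.
rewrite imE_bigcup; apply: eq_bigr => k _; rewrite -imE_comp; apply: (@imE_eq _ _ _ _ setT) => [e _|x _]; first exact: subsetT.
rewrite /gm /gmap /=; case: ifP => _; first by rewrite /a1 /gm /kap /gmap; do 2?case: ifP.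
by case: ifP => _ //; rewrite /b1 /gm /kap /gmap; do 2?case: ifP.
Qed.

Lemma coll_eq x x' : coll x = coll x' -> x = x' \/ exists s s', x = inl (inl s) /\ x' = inl (inl s').
Proof. by case: x => [[s|y]|y]; case: x' => [[s'|y']|y'] //= E; try (by left; case: E => ->); right; exists s, s'. Qed.

Lemma A2_within : within setT A2. Proof. exact (GA_within EFgr uv aab aabI). Qed.

(** This is where the second round of gadgets is needed. After a single round, a gadget vertex may
    be adjacent to both ends of its edge, and these are identified. In A2 an edge at a vertex of S
    leads to the gadget of an edge of A1, and such an edge has at most one end in S. *)
Lemma coll_inj1 x y x' y' : y \in enb A2 x -> y' \in enb A2 x' -> coll x = coll x' -> coll y = coll y' -> x = x'.
Proof.
move=> yx yx' Ex Ey; case: (coll_eq Ex) => [//|[s [s' [Dx Dx']]]].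
have inr_y z (t : S) : z \in enb A2 (inl (inl t)) -> exists k w, z = inr (k, w).
  rewrite in_enb => /andP[_ /(GA_new EFgr)[[k w]]]; rewrite !inE => /orP[/eqP//|/eqP<-]; by exists k, w.
rewrite Dx in yx; rewrite Dx' in yx'; have [k [w Dy]] := inr_y _ _ yx; have [k' [w' Dy']] := inr_y _ _ yx'.
move: Ey; rewrite Dy Dy' => -[Ek _]; subst k'.
move: yx yx'; rewrite Dy Dy' enb_sym => /(GA_end EFgr) H; rewrite enb_sym => /(GA_end EFgr) H'.
have out : ~ exists t t' : S, aa k = inl t /\ bb k = inl t'.
  case=> t [t' [Ea Eb]]; have : [set aa k; bb k] \in A1 by rewrite -A1X; apply/imsetP; exists k.
  by move/(GA_out EFgr); rewrite Ea Eb subUset !sub1set !imset_f.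
rewrite Dx Dx'; case: H => E; case: H' => E'; try by rewrite E E'.
- by case: out; exists s, s'.
- by case: out; exists s', s.
Qed.

Lemma coll_inj x y x' y' : y \in enb A2 x -> y' \in enb A2 x' -> coll x = coll x' -> coll y = coll y' -> x = x' /\ y = y'.
Proof.
move=> yx yx' Ex Ey; split; first exact: coll_inj1 yx yx' Ex Ey.
by apply: (@coll_inj1 y x y' x'); rewrite // enb_sym.
Qed.

Lemma Kan_within : within setT Kan.
Proof.
rewrite -coll_A2 => _ /(imEP A2_within)[x [y [xy xyA ->]]]; rewrite cards2 subsetT; split=> //.
suff -> : coll x != coll y by [].
apply/eqP => E; have yx : y \in enb A2 x by rewrite in_enb eq_sym xy.
have yx' : x \in enb A2 y by rewrite enb_sym.
by have [xy' _] := coll_inj yx yx' E (esym E); rewrite xy' eqxx in xy.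
Qed.

(** [Q] holds [None] and the vertices of the first round. It is independent because every edge of
    [Kan] has an end in the second round, where degrees are at most r. *)
Lemma Kan_rooted : rooted Kan set0 D.
Proof.
pose Q := [set o : KT | if o is Some (inr _) then false else true].
apply: (rooted_indep (Q := Q)) Kan_within _ _ => [e|w wQ].
  rewrite -coll_A2 => /imsetP[e' /(GA_new EFgr)[k ke] ->]; apply/subsetPn; exists (coll (inr k)); last by rewrite inE.
  exact: imset_f.
case: w wQ => [[w|k]|]; rewrite ?inE // => _; apply: leq_trans rD.
apply: (@leq_trans #|coll @: enb A2 (inr k)|); last first.
  by apply: leq_trans (leq_imset_card coll _) _; apply: GA_deg.
apply/subset_leq_card/subsetP => y; rewrite -coll_A2 => /(enb_imE_sub A2_within)[x [z [_ _ Ex -> zx]]].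
have [E|[s [s' [E _]]]] := @coll_eq (inr k) x Ex; last by [].
by apply: imset_f; rewrite E.
Qed.

Lemma A2_Kan : (forall x, r %| #|enb (GX a b) x|) ->
  (fabs EF D Kan -> absorbable EF D A2) /\ (fabs EF D A2 -> absorbable EF D Kan).
Proof.
move=> divX; apply: (link r_gt0 rD erefl adm dD _ (q := coll)) => //.
- by apply/set0Pn; exists [set u; v]; move: uv; rewrite in_enb => /andP[].
- exact: A2_within.
- exact: Kan_within.
- exact: coll_A2.
- apply: (GA_div EFgr EFreg uv aab aabI); rewrite A1X; exact: (GA_div EFgr EFreg uv ab ab_inj divX).
exact: coll_inj.
Qed.

Lemma inl_inj (T1 T2 : Type) : injective (inl : T1 -> T1 + T2). Proof. by move=> x y []. Qed.

(** [abs_gadget] twice, as A2 + A1 and A1 + X are decomposable. *)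
Lemma A2_X : absorbable EF D A2 -> absorbable EF D (GX a b).
Proof.
have W1in := GA_within EFgr uv ab ab_inj; have R1 : rooted A1 (inl @: setT) D by apply: rooted_le rD _; apply: GA_rooted.
have R2 : rooted A2 (inl @: setT) D by apply: rooted_le rD _; apply: GA_rooted.
have D2 := GA_dec EFgr uv aab aabI; rewrite A1X in D2.
move=> aA2; apply: (abs_gadget r_gt0 rD (@inl_inj _ _) (GX_within ab) W1in (GA_out EFgr (b := b)) R1 (GA_dec EFgr uv ab ab_inj)).
exact: (abs_gadget r_gt0 rD (@inl_inj _ _) W1in A2_within (GA_out EFgr (b := bb)) R2 D2 aA2).
Qed.

(** For decomposable X, the set A1 + X absorbs A2: alone it is a union of copies, one for each edge
    of X, and together with A2 it splits as (A2 + A1) + X. *)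
Lemma A2_free : dec EF (GX a b) -> (forall x, #|enb (GX a b) x| <= D) -> fabs EF D A2.
Proof.
move=> dX degX; set X := GX a b; have XS : within setT X := GX_within ab.
have R1 : rooted A1 (inl @: setT) D by apply: rooted_le rD _; apply: GA_rooted.
have R2 : rooted A2 (inl @: setT) D by apply: rooted_le rD _; apply: GA_rooted.
exists (#|S| + #|W1| + #|W2| + #|W2|) => V G Fb rG.
have weak M (f : finset_set_of__canonical__fintype_Finite V) : M + #|W2| <= #|S| + #|W1| + #|W2| + #|W2| -> #|f| <= #|W2| -> rich D G M (Fb :|: f).
  by move=> Mle cf; apply: (rich_sub (m := #|W2|) (N := f) rG).
have c2 : #|W1| <= #|W2| := leq_card _ (@inl_inj _ _).
have c1 : #|S| <= #|W1| := leq_card _ (@inl_inj _ _).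
have [||f0 [f0I f0F f0G]] := @place_free D _ _ X G Fb XS.
- exact: rooted_deg.
- by rewrite -[Fb]setU0; apply: weak; rewrite ?cards0 //; lia.
have [|f1 [f1I f10 f1F f1G]] := place (@inl_inj _ _) f0I (GA_within EFgr uv ab ab_inj) (GA_out EFgr (b := b)) R1 (G := G) (Fb := Fb).
  have c0 := imset_setT_card f0; apply: (weak #|W1|); last exact: leq_trans c0 (leq_trans c1 c2).
  by rewrite leq_add2r; apply: leq_trans (leq_addl _ _) (leq_addr _ _).
have [|f2 [f2I f21 f2F f2G]] := place (@inl_inj _ _) f1I A2_within (GA_out EFgr (b := bb)) R2 (G := G) (Fb := Fb).
  have c0 := imset_setT_card f1; apply: (weak #|W2|); last exact: leq_trans c0 c2.
  by rewrite leq_add2r leq_addl.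
have comp (U : finType) (g : U -> V) (W : finType) (f : W -> V) (i : U -> W) B : (forall x, f (i x) = g x) -> imE g B = imE f (imE i B).
  by move=> E; rewrite -imE_comp; apply: (@imE_eq _ _ _ _ setT) => [e _|x _]; rewrite ?subsetT //= E.
pose B := A1 :|: imE inl X; have Bw : within setT B by apply: dec_within EFgr (GA_dec EFgr uv ab ab_inj).
have dB : dec EF B := GA_dec EFgr uv ab ab_inj.
have E1 : imE f1 B = imE f1 A1 :|: imE f0 X by rewrite imEU -(comp _ f0 _ f1 inl X f10).
have F0n w : f2 (inl (inl w)) \notin Fb by rewrite f21 f10.
have F2n w : f2 w \notin Fb.
  case: w => [[s|k]|k]; [exact: F0n| |].
    by rewrite f21; move: (f1F (inr k)); rewrite in_setU negb_or; case: imsetP => [[s _ //]|_ /(_ isT)/andP[]].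
  by move: (f2F (inr k)); rewrite in_setU negb_or; case: imsetP => [[s _ //]|_ /(_ isT)/andP[]].
exists f2, (imE f1 B), (f2 @: setT); split; split=> //.
- by rewrite disjoints_subset; apply/subsetP => _ /imsetP[w _ ->]; rewrite in_setC.
- by apply: leq_trans (imset_setT_card _) (leq_addl _ _).
- apply: withinS (imE_within f1I Bw); apply/subsetP => _ /imsetP[w _ ->]; by rewrite -f21 imset_f.
- by rewrite E1 subUset f1G.
- rewrite (comp _ f1 _ f2 inl B f21) -setI_eq0 -imsetI ?setI_eq0; last by move=> x y _ _; apply: imset_inj.
  rewrite (_ : _ :&: _ = set0) ?imset0 //; apply/eqP; rewrite setI_eq0.
  apply: (dec_within_sub (Y := inl @: setT)); last exact: GA_out.
  by apply: imE_within Bw => x y [].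
- exact: dec_imE.
rewrite (comp _ f1 _ f2 inl B f21) -imEU; apply: dec_imE => //.
have inlI (T1 T2 : Type) : injective (inl : T1 -> T1 + T2) by move=> x y [].
have dis1 : [disjoint imE inl X & A1] by apply: dec_within_sub (imE_within (inlI _ _) XS) (GA_out EFgr (b := b)).
have dis2 : [disjoint imE inl (imE inl X) & A2].
  apply: dec_within_sub (imE_within (inlI _ _) _) (GA_out EFgr (b := bb)).
  by apply: within_sub Bw; apply: subsetUr.
rewrite imEU setUAC; apply: decU.
- rewrite -setI_eq0 setIUl setU_eq0 !setI_eq0 [X in _ && X]disjoint_sym dis2 andbT.
  rewrite -setI_eq0 /imE -imsetI; last by move=> x y _ _; apply/imset_inj/inlI.
  by rewrite setIC disjoint_setI0 // imset0.
- by rewrite setUC -A1X; exact: (GA_dec EFgr uv aab aabI).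
- by apply: dec_imE (inlI _ _) _; apply: dec_imE (inlI _ _) dX.
Qed.
End Canonical.

(** Both graphs have their edges indexed by I, hence share the same [Kan]. The chain runs from the
    first graph through its A2 to [Kan] and on to the A2 of the second graph, which has an absorber
    because the second graph is decomposable. *)
Lemma chain_absorbable (I S S' : finType) (a b : I -> S) (a' b' : I -> S') :
  (forall i, a i != b i) -> injective (fun i => [set a i; b i]) ->
  (forall i, a' i != b' i) -> injective (fun i => [set a' i; b' i]) ->
  (forall x, r %| #|enb (GX a b) x|) -> (forall x, r %| #|enb (GX a' b') x|) ->
  dec EF (GX a' b') -> (forall x, #|enb (GX a' b') x| <= D) -> absorbable EF D (GX a b).
Proof.
move=> ab abI ab' abI' divX divX' dX' degX'; apply: A2_X => //.
apply: (A2_Kan ab abI divX).1; apply: (abs_fabs r_gt0 rD); [|exact: (Kan_within ab' abI')|exact: (Kan_rooted ab' abI')].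
by apply: (A2_Kan ab' abI' divX').2; apply: A2_free.
Qed.
End Chain.

Lemma disjoint_copies (VF : finType) (EF : {set {set VF}}) (r p : nat) : within setT EF -> (forall w, #|enb EF w| = r) ->
  exists E : {set {set 'I_p * VF}}, [/\ within setT E, #|E| = p * #|EF|, dec EF E & forall x, #|enb E x| <= r].
Proof.
move=> EFgr EFreg; pose pr (j : 'I_p) (x : VF) := (j, x); have prI j : injective (pr j) by move=> x y [].
exists (\bigcup_j imE (pr j) EF); have dis i j e : e \in imE (pr i) EF -> e \in imE (pr j) EF -> i = j.
  case/imsetP=> e1 e1E ->; have [x [y [_ -> _ _ _]]] := edgeP EFgr e1E.
  case/imsetP=> e2 _ /setP/(_ (pr i x)); rewrite imset_f ?set21 // => /esym/imsetP[z _]; by case.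
have dE : dec EF (\bigcup_j imE (pr j) EF).
  apply: dec_bigcup => [|i _|i j _ _ ij]; [exact: index_enum_uniq|exact: dec_copy (prI i)|].
  rewrite -setI_eq0; apply/eqP/setP => e; rewrite in_setI in_set0; apply/negP => /andP[ei ej].
  by rewrite (dis _ _ _ ei ej) eqxx in ij.
split=> //; first exact: dec_within EFgr dE.
- rewrite -[p in RHS]card_ord -cardsT -cardsX -(card_in_imset (f := fun k : 'I_p * {set VF} => pr k.1 @: k.2) (D := setX setT EF)).
    apply: eq_card => e; apply/bigcupP/imsetP => [[j _ /imsetP[e' e'E ->]]|[[j e']]].
      by exists (j, e'); rewrite // in_setX in_setT.
    by rewrite in_setX => /andP[_ /= e'E] ->; exists j => //; apply: imset_f.
  move=> [i e] [j e']; rewrite !in_setX /= => /andP[_ eE] /andP[_ e'E] E.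
  have ij : i = j by apply: (dis i j (pr i @: e)); [apply: imset_f|rewrite E; apply: imset_f].
  by move: E; rewrite -ij => /(imset_inj (prI i))->.
case=> j x; rewrite -(EFreg x); apply: leq_trans (leq_imset_card (pr j) _); apply/subset_leq_card/subsetP => y.
rewrite enb_bigcup => /bigcupP[i _ /(enb_imE_sub EFgr)[s [t [_ _ [-> ->] -> ts]]]]; exact: imset_f.
Qed.

Theorem all_absorbable (VF : finType) (F : sgraph VF) (r d D : nat) : (forall w, #|enb (edges F) w| = r) -> 0 < r ->
  dF_admissible r F d -> d <= D -> r <= D -> 0 < #|VF| ->
  forall (S : finType) (H : {set {set S}}), within setT H -> (forall x, r %| #|enb H x|) -> #|edges F| %| #|H| ->
  absorbable (edges F) D H.
Proof.
move=> EFreg r_gt0 adm dD rD /card_gt0P[u _] S H HS divH /dvdnP[p cH].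
have /card_gt0P[v uv] : 0 < #|enb (edges F) u| by rewrite EFreg.
have EFgr := @edges_within _ F.
have E0w : within setT (E0 (edges F) u v) by apply: within_sub (subD1set _ _) EFgr.
have [al [be [albe albeI DE0]]] := orient E0w.
have [E [EW cE dE degE]] := disjoint_copies p EFgr EFreg.
have [a [b [ab abI DH]]] := orient HS.
have := orient EW; rewrite cE -cH => -[a' [b' [ab' abI' DE]]].
rewrite DH; apply: (chain_absorbable EFreg r_gt0 adm dD rD uv albe albeI DE0 ab abI ab' abI') => [x|x||x].
- by rewrite /GX -DH.
- by rewrite /GX -DE; exact: (dec_deg _ EFreg dE).
- by rewrite /GX -DE.
by rewrite /GX -DE; apply: leq_trans rD.
Qed.

(** * The absorbing structure *)

Lemma bounded_choice (P : nat -> nat -> Prop) : (forall k M M', M <= M' -> P k M -> P k M') ->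
  (forall k, exists M, P k M) -> forall n, exists M, forall k, k <= n -> P k M.
Proof.
move=> mono ex; elim=> [|n [M HM]]; first by have [M HM] := ex 0; exists M => k; rewrite leqn0 => /eqP->.
have [M' HM'] := ex n.+1; exists (maxn M M') => k; rewrite leq_eqVlt => /orP[/eqP->|kn].
  by apply: mono HM'; apply: leq_maxr.
by apply: mono (HM k kn); apply: leq_maxl.
Qed.

Section Structure.
Variables (VF : finType) (F : sgraph VF) (r d D : nat).
Local Notation EF := (edges F).
Hypothesis EFreg : forall w, #|enb EF w| = r.
Hypothesis r_gt0 : 0 < r.
Hypothesis adm : dF_admissible r F d.
Hypothesis dD : d <= D.
Hypothesis rD : r <= D.
Hypothesis VF0 : 0 < #|VF|.

(** For an r-regular F with at least one vertex, gcd(F) is r. *)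
Definition divisible_set (V : finType) (H : {set {set V}}) := (forall x, r %| #|enb H x|) /\ #|EF| %| #|H|.

Definition absorber (V : finType) (G : {set {set V}}) (U Fb : {set V}) (M : nat) (A : {set {set V}}) (N : {set V}) :=
  [/\ A \subset G, [disjoint N & Fb :|: U], #|N| <= M, within (U :|: N) A & forall e, e \in A -> ~~ (e \subset U)].

(** Up to renaming, there are finitely many graphs on at most m1 vertices, so a single M serves for
    all; they are moved to ordinals to make this finiteness available. *)
Lemma uniform_absorber m1 : exists M, forall (V : finType) (G H : {set {set V}}) (U Fb : {set V}), #|U| <= m1 ->
  within U H -> divisible_set H -> rich D G M Fb ->
  exists A N, absorber G U Fb M A N /\ (dec EF A /\ dec EF (A :|: H)).
Proof.
pose Q k (H : {set {set 'I_k}}) M := within setT H -> divisible_set H ->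
  forall (V : finType) (G : {set {set V}}) (phi : 'I_k -> V) (Fb : {set V}), injective phi -> rich D G M Fb ->
  exists A N, absorber G (phi @: setT) Fb M A N /\ (dec EF A /\ dec EF (A :|: imE phi H)).
have Qmono k H M M' : M <= M' -> @Q k H M -> @Q k H M'.
  move=> MM' HQ HS div V G phi Fb phiI rG.
  have [|A [N [[AG dN cN AN nA] dA]]] := HQ HS div V G phi Fb phiI.
    by apply: (rich_sub (m := 0) (N := set0) rG); rewrite ?setU0 ?cards0 ?addn0.
  by exists A, N; split=> //; split=> //; apply: leq_trans MM'.
have Qex k (H : {set {set 'I_k}}) : exists M, Q k H M.
  have [[HS [dH cH]]|nH] := EM (within setT H /\ divisible_set H); last by exists 0 => HS div; case: nH.
  have [M HM] := all_absorbable EFreg r_gt0 adm dD rD VF0 HS dH cH; exists M => _ _; exact: HM.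
have [|k|M HM] := @bounded_choice (fun k M => forall H, Q k H M) _ _ m1.
- by move=> k M M' MM' HQ H; apply: Qmono (HQ H).
- have [f Hf] := fin_all_exists (Qex k); exists (\max_H f H) => H; apply: Qmono (Hf H); exact: leq_bigmax.
exists M => V G H U Fb cU HU [dH cH] rG.
pose phi : 'I_#|U| -> V := enum_val; have phiI : injective phi by apply: enum_val_inj.
have phiU : phi @: setT = U.
  apply/setP => x; apply/imsetP/idP => [[i _ ->]|xU]; first exact: enum_valP.
  by exists (enum_rank_in xU x); rewrite // /phi enum_rankK_in.
pose H' := [set e : {set 'I_#|U|} | phi @: e \in H].
have DH : H = imE phi H'.
  apply/setP => e; apply/idP/imsetP => [eH|[e' + ->]]; last by rewrite inE.
  have [_ eU] := HU _ eH; have Ee : phi @: (phi @^-1: e) = e.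
    apply/setP => x; apply/imsetP/idP => [[i]|xe]; first by rewrite inE => ie ->.
    have /imsetP[i _ Ex] : x \in phi @: setT by rewrite phiU; apply: (subsetP eU).
    by exists i; rewrite ?inE -?Ex.
  by exists (phi @^-1: e); rewrite ?inE Ee.
have H'S : within setT H'.
  by move=> e'; rewrite inE => /HU[ce _]; split; [move: ce; rewrite card_imset|exact: subsetT].
have dvH' : divisible_set H'.
  split=> [i|]; last by move: cH; rewrite {1}DH imE_inj.
  by have := dH (phi i); rewrite {1}DH enb_imE // card_imset.
have [A [N [ab dA]]] := HM _ cU H' H'S dvH' V G phi Fb phiI rG.
by exists A, N; rewrite phiU -DH in ab dA *.
Qed.

(** Absorbers for all graphs on U are placed one after another on disjoint sets of new vertices.
    Given H, its own absorber takes it in and the others are decomposed alone. The constant counts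
    the sets of subsets of U. *)
Lemma absorbing_structure m1 : exists K, forall (V : finType) (G : {set {set V}}) (U Fb : {set V}), #|U| <= m1 ->
  rich D G K Fb ->
  exists A N, absorber G U Fb K A N /\ (dec EF A /\ forall H, within U H -> divisible_set H -> dec EF (A :|: H)).
Proof.
have [M HM] := uniform_absorber m1; exists ((2 ^ 2 ^ m1).+1 * M) => V G U Fb cU rG.
suff [A [N [ab [dA dAH]]]] : exists A N, absorber G U Fb (size (enum (powerset (powerset U))) * M) A N /\
    (dec EF A /\ forall H, H \in enum (powerset (powerset U)) -> within U H -> divisible_set H -> dec EF (A :|: H)).
  exists A, N; split; last first.
    split=> // H HU; apply: dAH (HU); rewrite mem_enum powersetE; apply/subsetP => e /HU[_]; by rewrite powersetE.
  case: ab => AG dN cN AN nA; split=> //; apply: leq_trans cN _; rewrite leq_mul2r -cardE !card_powerset.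
  by apply/orP; right; apply: leqW; rewrite leq_exp2l // leq_exp2l.
have : size (enum (powerset (powerset U))) <= 2 ^ 2 ^ m1.
  by rewrite -cardE !card_powerset leq_exp2l // leq_exp2l.
elim: (enum _) => [|H s IH] sz.
  exists set0, set0; split; last by split=> //; apply: dec0.
  by split=> [||||e]; rewrite ?sub0set ?cards0 ?inE // -?setI_eq0 ?set0I // => e; rewrite inE.
have [A [N [[AG dN cN AN nA] [dA dAH]]]] := IH (ltnW sz).
have [[HU dvH]|nH] := EM (within U H /\ divisible_set H); last first.
  exists A, N; split; first by split=> //; apply: leq_trans cN _; rewrite leq_mul2r leqnSn orbT.
  by split=> // H'; rewrite inE => /orP[/eqP-> HU dv|]; [case: nH|exact: dAH].
have [|A' [N' [[AG' dN' cN' AN' nA'] [dA' dAH']]]] := HM V G H U (Fb :|: N) cU HU dvH.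
  apply: (rich_sub (m := #|N|) (N := N) rG) => //; rewrite mulSn leq_add2l; apply: leq_trans cN _.
  by rewrite leq_mul2r ltnW ?orbT.
have AT : within setT A by apply: withinS AN; apply: subsetT.
have NN' : [disjoint N & N'] by rewrite disjoint_sym; apply: disjointWr dN'; rewrite -setUA subsetU // subsetUl orbT.
have dAA' : [disjoint A & A'].
  rewrite -setI_eq0; apply/eqP/setP => e; rewrite in_setI in_set0; apply/negP => /andP[eA eA'].
  have [_ e1] := AN e eA; have [_ e2] := AN' e eA'; case/negP: (nA e eA); apply/subsetP => x xe.
  have := subsetP e1 x xe; have := subsetP e2 x xe; rewrite !in_setU.
  case: (x \in U) => //= xN' xN; by move/setP/(_ x): (disjoint_setI0 NN'); rewrite in_setI xN xN' inE.
have outU (B B' : {set {set V}}) : (forall e, e \in B -> ~~ (e \subset U)) -> within U B' -> [disjoint B & B'].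
  move=> nB BU; rewrite -setI_eq0; apply/eqP/setP => e; rewrite in_setI in_set0; apply/negP => /andP[/nB/negP eB].
  by case/BU.
exists (A :|: A'), (N :|: N'); split; [split|split].
- by rewrite subUset AG.
- rewrite -setI_eq0 setIUl setU_eq0 !setI_eq0 dN /=; apply: disjointWr dN'; apply: setSU; exact: subsetUl.
- apply: leq_trans (leq_card_setU _ _) _; rewrite /= mulSn addnC; exact: leq_add.
- apply: withinU; [apply: withinS AN|apply: withinS AN']; rewrite ?setUS ?subsetUl ?subsetUr //.
- by move=> e /setUP[/nA|/nA'].
- exact: decU.
move=> H'; rewrite inE => /orP[/eqP->{H'} _ _|H's HU' dv'].
  rewrite -setUA; apply: decU => //; rewrite -setI_eq0 setIUr setU_eq0 !setI_eq0 dAA' /=; exact: outU HU.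
rewrite setUAC; apply: decU => //; last exact: dAH.
rewrite -setI_eq0 setIUl setU_eq0 !setI_eq0 dAA' /= disjoint_sym; exact: outU HU'.
Qed.
End Structure.

Local Open Scope ring_scope.

Lemma rich_min_degree (R : realType) (D K : nat) (V : finType) (G : {set {set V}}) (Fb : {set V}) (b : R) :
  0 <= b -> (forall x, #|~: enb G x|%:R <= b) -> #|Fb|%:R + D%:R * b + K%:R <= #|V|%:R -> rich D G K Fb.
Proof.
move=> b0 Hb HK X XD; pose Y := [set y in ~: Fb | X \subset enb G y].
have sub : ~: Y \subset Fb :|: \bigcup_(x in X) ~: enb G x.
  apply/subsetP => y; rewrite in_setC => yY; rewrite in_setU; case yF : (y \in Fb) => //=.
  have /subsetPn[x xX yx] : ~~ (X \subset enb G y).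
    by apply: contra yY => yX; apply/setIdP; rewrite in_setC yF.
  by apply/bigcupP; exists x => //; rewrite in_setC enb_sym.
have [->|[x0 x0X]] := set_0Vmem X.
  rewrite (_ : [set _ in _ | _] = ~: Fb); last by apply/setP => y; rewrite inE sub0set andbT.
  have Db0 : 0 <= D%:R * b by rewrite mulr_ge0.
  have : (#|Fb| + K <= #|V|)%N.
    rewrite -(ler_nat R) natrD; move: HK Db0; glra.
  rewrite -(cardsC Fb) leq_add2l //.
have cY : #|~: Y|%:R <= #|Fb|%:R + D%:R * b :> R.
  apply: le_trans (_ : #|Fb|%:R + \sum_(x in X) b <= _); last first.
    by rewrite lerD2l sumr_const -[leLHS]mulr_natl ler_wpM2r // ler_nat.
  apply: le_trans (_ : #|Fb|%:R + \sum_(x in X) (#|~: enb G x|)%:R <= _); last first.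
    by rewrite lerD2l; apply: ler_sum => x _; apply: Hb.
  rewrite -natr_sum -natrD ler_nat; apply: leq_trans (subset_leq_card sub) _.
  by apply: leq_trans (leq_card_setU _ _) _; rewrite leq_add2l; apply: card_bigcup_le.
rewrite -/Y -(ler_nat R); have : #|Y|%:R + #|~: Y|%:R = #|V|%:R :> R by rewrite -natrD cardsC.
move: HK cY; glra.
Qed.

(** The vortex is built first, in O. The absorber A for its last set U has its other vertices
    outside U1 and no edge inside U, so O minus A still contains every edge inside U1, as [iterate]
    requires. Removing A costs a vertex at most m1 + K edges, and leaves the degrees divisible
    because A is decomposable. *)
Theorem decomposition_core (R : realType) (VF : finType) (F : sgraph VF) (r d D : nat) (v0 : VF) (kinv eps : R) :
  (forall w, #|enb (edges F) w| = r) -> (0 < r)%N -> dF_admissible r F d -> (d <= D)%N -> (r <= D)%N ->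
  tileable (edges F) r v0 kinv -> 0 < kinv <= 1 -> 0 < eps <= kinv ->
  exists2 eta : R, 0 < eta & forall n1 : nat, exists n0 : nat, forall theta,
    good_theta r kinv theta -> 1 - theta <= D%:R^-1 -> approximable (edges F) eta (theta + eps / 2) n1 ->
  forall (V : finType) (O : {set {set V}}), within setT O -> (n0 <= #|V|)%N ->
    (forall x, (theta + 8 * eps) * #|V|%:R <= #|enb O x|%:R) -> divisible_set F r O -> dec (edges F) O.
Proof.
move=> EFreg r_gt0 adm dD rD tl k01 eps_range; have /andP[eps0 epsk] := eps_range; have /andP[k0 k1] := k01.
have EFgr := @edges_within _ F; have VF0 : (0 < #|VF|)%N by apply/card_gt0P; exists v0.
have eps1 : eps <= 1 := le_trans epsk k1.
have [N Ne] := large_nat 8 eps0; have {}Ne : 8 / eps <= N%:R by rewrite ler_pdivrMr // mulrC Ne.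
have N8 : 8 <= N%:R :> R by apply: le_trans Ne; rewrite ler_pdivlMr // ler_piMr.
have N2 : (2 < N)%N by rewrite -(ler_nat R); apply: le_trans N8; rewrite ler_nat.
have N0 : 0 < N%:R :> R by apply: lt_le_trans N8.
have [eta eta0 Heta] := iterate EFgr EFreg r_gt0 tl k01 eps_range Ne.
exists eta => // n1; have [n2 Hn2] := Heta n1.
have [m1 Hm1] := @vortex_exists R N eps N2 eps0 n2.
have [K HK] := absorbing_structure EFreg r_gt0 adm dD rD VF0 m1.
have g0 : 0 < eps / (2 * N%:R) by rewrite divr_gt0 // mulr_gt0.
have [na Hna] := large_nat (m1%:R + K%:R) g0; have [nb Hnb] := large_nat K%:R eps0.
exists (maxn m1.+1 (maxn na nb)) => theta gth thD apx V O OV; rewrite !geq_max => /andP[nm /andP[nna nnb]] degO [dvO cO].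
set n := #|V| in nm nna nnb degO *.
have n0 : 0 < n%:R :> R by rewrite ltr0n; apply: leq_ltn_trans nm.
have [th1 _ thr] := gth.
have th0 : 0 <= theta.
  have : r%:R^-1 <= 1 :> R by rewrite invf_le1 ?ltr0n // ler1n.
  move: thr; glra.
have /card_gt0P[x0 _] : (0 < #|V|)%N by apply: leq_ltn_trans nm.
have degn x : #|enb O x|%:R <= n%:R :> R by rewrite ler_nat max_card.
have th8 : theta + 8 * eps <= 1.
  by have := le_trans (degO x0) (degn x0); rewrite ger_pMl.
have [||x _|s [vs cs]] := Hm1 V O setT (theta + 6 * eps).
- move: th0 eps0 th8; clear; move=> *; apply/andP; split; lra.
- by rewrite cardsT; apply: ltnW.
- rewrite setIT cardsT; apply: le_trans (degO x); rewrite ler_wpM2r ?ler0n //.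
  move: eps0; glra.
case: s vs cs => [|U1 s] vs cs; first by move: cs; rewrite /= cardsT -/n leqNgt nm.
have /= [[_ _ _ cU1] [_ _ vs1]] := vs; rewrite cardsT in cU1.
have UU1 : last U1 s \subset U1 by apply: vortex_last vs1.
set U := last U1 s in UU1 cs.
(* As 1 - theta <= 1/D, the surplus of 8 eps in the density leaves D vertices at least 8 eps |V|
   common neighbours, and U1 takes at most eps/4 |V| of them. *)
have rO : rich D O K U1.
  apply: (@rich_min_degree R _ _ _ _ _ ((1 - theta - 8 * eps) * n%:R)) => [|x|].
    by rewrite mulr_ge0 //; move: th8; glra.
    have : #|enb O x|%:R + #|~: enb O x|%:R = n%:R :> R by rewrite -natrD cardsC.
    move: (degO x); glra.
  have D0 : 1 <= D%:R :> R by rewrite ler1n; apply: leq_trans rD.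
  have c1 : #|U1|%:R <= eps / 4 * n%:R :> R.
    have H1 : N%:R * #|U1|%:R <= 2 * n%:R :> R by rewrite -!natrM ler_nat.
    have H2 : 8 <= eps * N%:R by move: Ne; rewrite ler_pdivrMr // mulrC.
    rewrite -(ler_pM2l N0); apply: le_trans H1 _.
    apply: le_trans (_ : 8 / 4 * n%:R <= _); first by rewrite ler_wpM2r ?ler0n //; lra.
    rewrite (_ : N%:R * _ = (eps * N%:R) / 4 * n%:R); last by ring.
    by rewrite ler_wpM2r ?ler0n //; move: H2; glra.
  have c2 : D%:R * ((1 - theta - 8 * eps) * n%:R) <= n%:R - 8 * eps * n%:R.
    rewrite mulrA (_ : n%:R - _ = (1 - 8 * eps) * n%:R); last by ring.
    rewrite ler_wpM2r ?ler0n //.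
    have : D%:R * (1 - theta) <= 1.
      by rewrite mulrC -ler_pdivlMr ?div1r //; apply: lt_le_trans D0.
    have : 8 * eps <= D%:R * (8 * eps) by rewrite ler_peMl // mulr_ge0 // ltW.
    rewrite !mulrBr; clear; lra.
  have := Hnb _ nnb; have : 0 < eps * n%:R by rewrite mulr_gt0.
  move: c1 c2; rewrite -/n; clear; move=> *; lra.
have [A [Nw [[AO dN cN AN nA] [dA dAH]]]] := HK V O U U1 cs rO.
have enbA x : #|enb A x|%:R <= eps / (2 * N%:R) * n%:R :> R.
  apply: le_trans (Hna _ nna); rewrite -natrD ler_nat; apply: leq_trans (_ : #|U :|: Nw| <= _)%N.
    by apply/subset_leq_card/subsetP => y; rewrite in_enb => /andP[_ /AN[_ /subsetP]]; apply; rewrite set22.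
  by apply: leq_trans (leq_card_setU _ _) (leq_add cs cN).
have EO : eind O setT = O by apply/setP => e; rewrite inE subsetT andbT.
have dvC x : (r %| #|enb (O :\: A) x|)%N.
  rewrite enbD cardsD -enbI (setIidPr AO) dvdn_sub ?dvO //; exact: (dec_deg x EFreg dA).
have C1 : O :\: A \subset eind O setT by rewrite EO subsetDl.
have C2 : eind O (head set0 (U1 :: s)) \subset O :\: A.
  apply/subsetP => e /=; rewrite inE => /andP[eO eU1]; rewrite in_setD eO andbT; apply/negP => eA.
  have [_ eUN] := AN e eA; have /subsetPn[x xe xU] := nA e eA.
  have xN : x \in Nw by move: (subsetP eUN x xe); rewrite in_setU (negPf xU).
  by move/setP/(_ x): (disjoint_setI0 dN); rewrite in_setI xN in_setU (subsetP eU1) // inE.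
have C3 x : x \in [set: V] -> #|enb (eind O setT) x :\: enb (O :\: A) x|%:R <= eps / (2 * N%:R) * #|[set: V]|%:R :> R.
  move=> _; rewrite EO cardsT -/n; apply: le_trans (enbA x); rewrite ler_nat; apply: subset_leq_card.
  by apply/subsetP => y; rewrite enbD !in_setD negb_and negbK => /andP[/orP[//|/negP]].
have [P [PC dP LP]] := Hn2 theta gth apx V O setT (U1 :: s) (O :\: A) OV vs C1 C2 C3 dvC.
rewrite -/U /= in LP.
set L := (O :\: A) :\: P in LP.
have LU : within U L.
  move=> e /(subsetP LP); rewrite inE => /andP[eO eU]; by split=> //; have [] := OV e eO.
have PO : P \subset O := subset_trans PC (subsetDl _ _).
have dAP : [disjoint A & P].
  rewrite -setI_eq0; apply/eqP/setP => e; rewrite in_setI in_set0; apply/negP => /andP[eA /(subsetP PC)].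
  by rewrite in_setD eA.
have DO : O = P :|: (A :|: L).
  apply/setP => e; rewrite !in_setU !in_setD; case eP : (e \in P) => /=; first exact: (subsetP PO).
  by case eA : (e \in A) => //=; apply: (subsetP AO).
have dPAL : [disjoint P & A :|: L].
  rewrite -setI_eq0 setIUr setU_eq0 !setI_eq0 disjoint_sym dAP /= -setI_eq0 /L; apply/eqP/setP => e.
  by rewrite in_setI in_setD in_set0; case: (e \in P).
have dAL : [disjoint A & L].
  by rewrite -setI_eq0 /L; apply/eqP/setP => e; rewrite in_setI !in_setD in_set0; case: (e \in A); rewrite ?andbF.
rewrite DO; apply: decU => //; apply: dAH => //; split=> [x|].
  rewrite /L enbD cardsD -enbI (setIidPr PC) dvdn_sub ?dvC //; exact: (dec_deg x EFreg dP).
move: cO; rewrite {1}DO cardsU disjoint_setI0 // cards0 subn0 cardsU [A :&: L]disjoint_setI0 // cards0 subn0.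
by rewrite dvdn_addr ?(dec_card dP) // dvdn_addr ?(dec_card dA).
Qed.

Local Close Scope ring_scope.

(** * The threshold *)

Lemma bigmin_nat_le (V : finType) (f : V -> nat) (a : nat) (x : V) : \big[minn/a]_(y : V) f y <= f x.
Proof.
have: x \in index_enum V by rewrite mem_index_enum.
elim: (index_enum V) => // y s IH; rewrite inE big_cons => /orP[/eqP->|/IH]; first exact: geq_minl.
by apply: leq_trans; apply: geq_minr.
Qed.

Lemma gcd_graph_dvd (V : finType) (G : sgraph V) x : gcd_graph G %| deg G x.
Proof. by rewrite /gcd_graph (bigD1 x) //=; exact: dvdn_gcdl. Qed.

Lemma dvd_gcd_graph (V : finType) (G : sgraph V) n : (forall x, n %| deg G x) -> n %| gcd_graph G.
Proof. by move=> H; apply: (big_ind (fun m => n %| m)) => [|a b na nb|x _] //; rewrite ?dvdn0 // dvdn_gcd na. Qed.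

(* If every neighbourhood is a clique, adjacency-or-equality is an equivalence whose classes are the components. *)
Lemma locally_complete (V : finType) (F : sgraph V) (r : nat) (v0 : V) : regular r F ->
  (forall v a b, F v a -> F v b -> a != b -> F a b) -> disjoint_cliques r.+1 F.
Proof.
move=> Freg loc; pose R x y := (x == y) || F x y.
have Rsym x y : R x y = R y x by rewrite /R eq_sym adj_sym.
have Rtr x y z : R x y -> R y z -> R x z.
  rewrite /R => /orP[/eqP->//|xy] /orP[/eqP<-|yz]; first by rewrite xy orbT.
  by have [//|xz /=] := eqVneq x z; apply: (loc y) => //; rewrite adj_sym.
pose cl x := [set y | R x y].
have clE x y : (cl x == cl y) = R x y.
  apply/eqP/idP => [E|xy]; first by have : y \in cl x by [rewrite E inE /R eqxx]; rewrite inE.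
  apply/setP => z; rewrite !inE; apply/idP/idP; first by apply: Rtr; rewrite Rsym.
  exact: Rtr.
have ccl x : #|cl x| = r.+1.
  have -> : cl x = x |: nbhd F x by apply/setP => y; rewrite !inE eq_sym.
  by rewrite cardsU1 inE adj_irr -(Freg x).
pose C := [set cl x | x : V]; have clC x : cl x \in C by apply: imset_f.
pose f x : 'I_#|C| * 'I_r.+1 := (enum_rank_in (clC v0) (cl x), inord (index x (enum (cl x)))).
pose g (p : 'I_#|C| * 'I_r.+1) : V := nth v0 (enum (enum_val p.1)) p.2.
have memcl x : x \in enum (cl x) by rewrite mem_enum inE /R eqxx.
have idx x : index x (enum (cl x)) < r.+1 by rewrite -(ccl x) cardE index_mem.
have fK : cancel f g by move=> x; rewrite /g /f /= enum_rankK_in // inordK // nth_index.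
have gK : cancel g f.
  move=> [i j]; have /imsetP[x _ Ex] := enum_valP i; rewrite /g /f /= Ex; set y := nth _ _ _.
  have jlt : j < size (enum (cl x)) by rewrite -cardE ccl.
  have ycl : y \in cl x by rewrite -mem_enum; apply: mem_nth.
  have Ey : cl y = cl x by apply/eqP; rewrite clE Rsym; move: ycl; rewrite inE.
  rewrite Ey; congr (_, _); first by rewrite -Ex enum_valK_in.
  by apply/val_inj; rewrite /= inordK /y index_uniq ?enum_uniq.
exists #|C|, f; split; first by exists g.
move=> x y; rewrite /= /cliques_rel /= (can_in_eq (enum_rankK_in _)) // clE.
case Rxy : (R x y); last by move: Rxy; rewrite /R; case: (F x y); rewrite ?orbT.
have Exy : cl x = cl y by apply/eqP; rewrite clE.
have -> : (inord (index x (enum (cl x))) == inord (index y (enum (cl y))) :> 'I_r.+1) = (x == y).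
  apply/eqP/eqP => [/(congr1 val)/=|-> //]; rewrite !inordK // -Exy.
  by move/(congr1 (nth v0 (enum (cl x)))); rewrite !nth_index // Exy.
by move: Rxy; rewrite /R; have [->|] := eqVneq x y; rewrite ?adj_irr.
Qed.

Section Threshold.
Variables (R : realType) (VF : finType) (F : sgraph VF) (r : nat).
Local Notation EF := (edges F).
Hypothesis EFreg : forall w, #|enb EF w| = r.
Hypothesis r_gt0 : 0 < r.
Local Open Scope ring_scope.

(** If F is not a union of cliques, some vertex v0 has two nonadjacent neighbours, and
    [nonclique_tiling] allows k = r - 1 instead of r. The threshold has k + 1 because 1 - theta <=
    theta / k amounts to theta >= 1 - 1/(k+1). *)
Lemma tileable_exists (v : VF) : regular r F ->
  exists (v0 : VF) (k : nat), [/\ (0 < k)%N, tileable EF r v0 (k%:R^-1 : R), (r <= k.+1)%N &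
    k.+1 = if `[< disjoint_cliques r.+1 F >] then r.+1 else r].
Proof.
move=> Freg; case: asboolP => [_|nd].
  exists v, r; split=> // e e0; exists 0%N => V E S _ rS dS; apply: clique_tiling; rewrite ?EFreg // => x xS.
  rewrite -(ler_nat R) natrM -ler_pdivlMr ?ltr0n // [leRHS]mulrC; apply: le_trans (dS x xS) _.
  by rewrite ler_wpM2r ?ler0n // gerBl ltW.
have [v0 [a [b [va vb ab nab]]]] : exists v a b, [/\ F v a, F v b, a != b & ~~ F a b].
  apply: contrapT => H; apply: nd; apply: (locally_complete v Freg) => x a b xa xb ab; apply: contrapT => /negP nab.
  by apply: H; exists x, a, b.
have aN : a \in enb EF v0 by rewrite enb_edges inE.
have bN : b \in enb EF v0 by rewrite enb_edges inE.
have r2 : (1 < r)%N.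
  have <- : #|[set a; b]%SET| = 2%N by rewrite cards2 ab.
  by rewrite -(EFreg v0); apply/subset_leq_card; rewrite subUset !sub1set aN.
have Er : r = r.-1.+1 by rewrite prednK // ltnW.
exists v0, r.-1; split; rewrite -?Er //; first by rewrite -ltnS -Er.
move=> e e0.
have q0 : (0 < r.-1)%N by rewrite -ltnS -Er.
have cN : #|enb EF v0| = r.-1.+1 by rewrite EFreg.
have nN : b \notin enb EF a by rewrite enb_edges inE.
have [d0 Hd0] := nonclique_tiling q0 cN aN bN ab nN e0.
by exists d0 => V E S dS rS; apply: Hd0 => //; rewrite -Er.
Qed.

(** If the upper limit is below t, then from some n1 on the infima are too, and each is undercut by
    an admissible density below t. The graph on X is moved to the subtype of X, since [delta_approx]
    concerns graphs on all vertices of a type. *)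
Lemma approximable_delta (eta t : R) : (delta_approx eta F < t%:E)%E -> exists n1, approximable EF eta t n1.
Proof.
move=> /ereal_inf_lt[_ /= [A [n1 _ An1] <-]] supA; exists n1 => V E X XE nX degE.
have [X0|[x0 x0X]] := set_0Vmem X.
  have -> : E = finset.set0.
    apply/setP => e; rewrite inE; apply/negP => eE; have [x [_ [_ _ xX _ _]]] := edgeP XE eE.
    by move: xX; rewrite X0 inE.
  by exists finset.set0; rewrite sub0set setD0 cards0 X0 cards0 expr0n mulr0; split=> //; apply: dec0.
have /ereal_inf_lt[_ /= [de Hde <-]] : (delta_approx_n eta F #|X| < t%:E)%E.
  apply: le_lt_trans supA; apply: ereal_sup_ubound; exists #|X| => //; exact: An1.
rewrite lte_fin => det.
pose V' := {x | x \in X}; pose j : V' -> V := val; have jI : injective j by apply: val_inj.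
pose E' := [set e : {set V'} | (j @: e)%SET \in E].
have jX : (j @: setT)%SET = X.
  apply/setP => x; apply/imsetP/idP => [[y _ ->]|xX]; first exact: (valP y).
  by exists (Sub x xX); rewrite // /j SubK.
have DE : E = imE j E'.
  apply/setP => e; apply/idP/imsetP => [eE|[e' + ->]]; last by rewrite inE.
  have [x [y [_ De xX yX _]]] := edgeP XE eE.
  by exists [set Sub x xX; Sub y yX : V']%SET; rewrite ?inE imset_set2 /j !SubK -?De.
have E'w : within setT E'.
  by move=> e'; rewrite inE => /XE[ce _]; split; [move: ce; rewrite card_imset|exact: subsetT].
have cV' : #|{: V'}| = #|X| by rewrite card_sig; apply: eq_card.
have [|P [tP copyP cP]] := Hde V' (sg E') cV'.
  have degX : t * #|X|%:R <= #|X|%:R :> R.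
    apply: le_trans (degE x0 x0X) _; rewrite ler_nat; apply/subset_leq_card/subsetP => y.
    by rewrite in_enb => /andP[_ /XE[_ /subsetP]]; apply; rewrite set22.
  have dt : de * #|X|%:R <= t * #|X|%:R by rewrite ler_wpM2r ?ler0n // ltW.
  rewrite /mindeg; apply: (big_ind (fun m : nat => de * #|X|%:R <= m%:R)) => [|m m' Hm Hm'|x _].
  + by rewrite cV'; apply: le_trans degX.
  + by rewrite /minn; case: ifP.
  rewrite /deg -enb_edges edges_sg //; apply: le_trans dt _; apply: le_trans (degE (j x) (valP x)) _.
  by rewrite {1}DE enb_imE // card_imset.
have dP : dec EF (finset.cover P).
  by apply: trivIset_dec tP _ => B /copyP[f [fI _ ->]]; exists f.
have cPE : finset.cover P \subset E'.
  apply/subsetP => e /bigcupP[B /copyP[f [fI fh ->]]] /imsetP[e0 /edgesP[x [y [xy ->]]] ->].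
  by rewrite imset_set2 -[E']edges_sg // in_edges; apply: fh.
exists (imE j (finset.cover P)); split; first by rewrite DE; apply: imES.
- exact: dec_imE.
rewrite {1}DE; have -> : imE j E' :\: imE j (finset.cover P) = imE j (E' :\: finset.cover P).
  apply/setP => e; rewrite in_setD; apply/andP/imsetP => [[+ /imsetP[e' e'E De]]|[e']].
    by rewrite De => nP; exists e' => //; rewrite in_setD e'E andbT; apply: contra nP => ?; apply: imset_f.
  rewrite in_setD => /andP[nP eE] ->; split; last exact: imset_f.
  by apply: contra nP => /imsetP[e2 e2P /(imset_inj jI)->].
by rewrite imE_inj //; move: cP; rewrite edges_sg // cV'.
Qed.

Lemma dF_admissible_dF (v : VF) : regular r F -> dF_admissible r F (dF r F).
Proof.
move=> Freg; have VF0 : (0 < #|VF|)%N by apply/card_gt0P; exists v.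
suff [] : (dF_admissible r F (dF r F) /\ forall d', dF_admissible r F d' -> (dF r F <= d')%N) by [].
apply: (@xgetPex _ 0%N [set d | dF_admissible r F d /\ forall d', dF_admissible r F d' -> (d <= d')%N]%classic).
have ex : exists d, `[< dF_admissible r F d >].
  by have [d Hd] := dF_admissible_ex Freg r_gt0 VF0; exists d; apply/asboolP.
by case: (ex_minnP ex) => d /asboolP Hd dmin; exists d; split=> // d' /asboolP/dmin.
Qed.
End Threshold.

Local Open Scope ring_scope.

Lemma threshold_ge (R : realType) (eta : R) (VF : finType) (F : sgraph VF) (r k : nat) :
  k = (if `[< disjoint_cliques r.+1 F >] then r.+1 else r) ->
  [/\ (delta_approx eta F <= threshold eta r F)%E, ((1 - k%:R^-1)%R%:E <= threshold eta r F)%E &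
     dF r F != 0%N -> ((1 - (dF r F)%:R^-1)%R%:E <= threshold eta r F)%E].
Proof.
move=> ->; rewrite /threshold; set m := Order.max (delta_approx _ _) _; set c := (1 - (dF r F)%:R^-1)%R%:E.
have H : (m <= (if dF r F == 0%N then m else Order.max m c))%E by case: ifP => _; rewrite // le_max lexx.
split; [apply: le_trans H; rewrite /m le_max lexx //|apply: le_trans H; rewrite /m le_max lexx orbT //|].
by move/negPf->; rewrite le_max lexx orbT.
Qed.

Lemma inv_succ (R : realFieldType) (x : R) : 0 < x -> (x + 1)^-1 = x^-1 * (1 - (x + 1)^-1).
Proof. by move=> x0; field; rewrite !lt0r_neq0 // addr_gt0. Qed.

Theorem theorem11p1 (R : realType) (r : nat) (VF : finType) (F : sgraph VF)
    (r_ge1 : (1 <= r)%N) (F_regular : regular r F) (eps : R)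
    (eps_gt0 : (0 < eps)%R) :
  exists (n0 : nat) (eta : R), (0 < eta)%R /\
    forall (V : finType) (G : sgraph V),
      (n0 <= #|V|)%N ->
      divisible F G ->
      ((threshold eta r F + eps%:E) * (#|V|%:R)%:E <= ((mindeg G)%:R)%:E)%E ->
      has_decomposition F G.
Proof.
have EFreg w : #|enb (edges F) w| = r by rewrite enb_edges; apply: F_regular.
have [/card_gt0P[v _]|VF0] := boolP (0 < #|VF|)%N; last first.
  (* Without vertices F has no edges, so divisibility forces G to have none, and the empty partition
     will do. *)
  exists 0%N, 1; split=> // V G _ /andP[cG _] _.
  have F0 : edges F = finset.set0.
    apply/setP => e; rewrite [RHS]inE; apply/negP => /edgesP[x _]; case/negP: VF0; apply/card_gt0P; by exists x.
  move: cG; rewrite F0 cards0 dvd0n cards_eq0 => /eqP G0.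
  by exists finset.set0; rewrite G0; split=> [|A]; rewrite ?partition_set0 // inE.
have F0 : edges F != finset.set0.
  have /card_gt0P[w] : (0 < #|enb (edges F) v|)%N by rewrite EFreg.
  by rewrite in_enb => /andP[_ vw]; apply/set0Pn; exists [set v; w]%SET.
have [v0 [k [k0 tl rk Dk]]] := @tileable_exists R VF F r EFreg r_ge1 v F_regular.
have adm := dF_admissible_dF r_ge1 v F_regular; pose D := maxn (dF r F) r.
have k1 : 1 <= k%:R :> R by rewrite ler1n.
have kp : 0 < k%:R :> R by rewrite ltr0n.
have ki : 0 < (k%:R^-1 : R) <= 1 by rewrite invr_gt0 kp invf_le1.
(* Eight times e is the surplus of density spent in [decomposition_core]; the bound by 1/k is what
   the tilings ask for. *)
pose e := Num.min (eps / 8) k%:R^-1.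
have e0 : 0 < e by rewrite lt_min divr_gt0 //; case/andP: ki.
have ek : 0 < e <= k%:R^-1 by rewrite e0 ge_min lexx orbT.
have e8 : 8 * e <= eps by rewrite mulrC -ler_pdivlMr // ge_min lexx.
(* [eta] is fixed here, before the value of the threshold that it determines is examined. *)
have [eta eta0 core] := decomposition_core EFreg r_ge1 adm (leq_maxl _ r) (leq_maxr (dF r F) _) tl ki ek.
have [Tdelta Tk Td] := threshold_ge eta Dk.
(* The threshold is at least 1 - 1/(k+1), so it is not -oo. If it is +oo or exceeds 1, no graph with
   a vertex meets the degree condition. *)
case ET : (threshold eta r F) => [t||]; last by move: Tk; rewrite ET.
  2: exists 1%N, eta; split=> // V G n1 _; rewrite ET /= addye // gt0_mulye ?lte_fin ?ltr0n // leye_eq //.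
have deg_min V G x : (mindeg G <= #|enb (edges G) x :> {set V}|)%N.
  by rewrite enb_edges; exact: bigmin_nat_le.
have [t1|t1] := leP t 1; last first.
  exists 1%N, eta; split=> // V G n1 _; rewrite ET -EFinD -EFinM lee_fin => degG.
  have /card_gt0P[x _] := n1; have xn : (mindeg G <= #|V|)%N := leq_trans (deg_min V G x) (max_card _).
  have n0 : 0 < #|V|%:R :> R by rewrite ltr0n.
  have xn' : (mindeg G)%:R <= #|V|%:R :> R by rewrite ler_nat.
  have := le_trans degG xn'; rewrite ger_pMl // => H; move: t1 eps_gt0 H; clear; move=> *; lra.
rewrite ET lee_fin in Tk; rewrite ET in Tdelta.
have [n1 apx] : exists n1, approximable (edges F) eta (t + e / 2) n1.
  apply: approximable_delta => //; apply: le_lt_trans Tdelta _; rewrite lte_fin ltrDl divr_gt0 //.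
have [n0 Hn0] := core n1; exists (maxn n0 1), eta; split=> // V G; rewrite geq_max => /andP[nn0 nV] /andP[cG gG].
rewrite ET -EFinD -EFinM lee_fin => degG.
have kS0 : 0 < k.+1%:R :> R by rewrite ltr0n.
have rR : 0 < r%:R :> R by rewrite ltr0n.
have tk : 1 - t <= k.+1%:R^-1 by rewrite lerBlDl -lerBlDr.
have tr : 1 - t <= r%:R^-1.
  by apply: le_trans tk _; rewrite lef_pV2 ?posrE // ler_nat.
apply/(has_decP G F0); apply: (Hn0 t) => //.
- split=> //; have Hk : (k.+1%:R^-1 : R) = k%:R^-1 * (1 - k.+1%:R^-1).
    by rewrite -[k.+1%:R]natr1; apply: inv_succ.
  have Hi : k%:R^-1 * (1 - k.+1%:R^-1) <= k%:R^-1 * t by rewrite ler_pM2l ?invr_gt0.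
  by apply: le_trans tk _; rewrite Hk.
(* For D = r this is [tr]; otherwise D is [dF], which is then positive, and the term 1 - 1/dF of the
   threshold gives the bound. *)
- rewrite /D /maxn; case: ifP => // dr; have d0 : dF r F != 0%N by rewrite -lt0n; apply: leq_trans r_ge1 _; rewrite leqNgt dr.
  by have := Td d0; rewrite ET lee_fin lerBlDr -lerBlDl.
- exact: edges_within.
- move=> x; apply: le_trans (_ : (mindeg G)%:R <= _); last by rewrite ler_nat; apply: deg_min.
  apply: le_trans degG; rewrite ler_wpM2r ?ler0n //; move: e8; clear; move=> *; lra.
split=> // x; rewrite enb_edges; apply: dvdn_trans (dvdn_trans _ gG) (gcd_graph_dvd G x).
by apply: dvd_gcd_graph => y; rewrite F_regular.
Qed.
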